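(* Let $E^L_n$ be the expected total fringe size of a simple two-dimensional lattice path chosen uniformly at random among the $4^n$ paths of length $n$. Then, as $n\to\infty$, \[ E^L_n=\frac43 n+\frac13\log_4 n+\frac{5+3\gamma-11\log2}{18\log2}+\delta(\log_4 n)+O\Big(\frac{\log n}{n}\Big), \] where $\delta$ is the $1$-periodic function of mean zero with Fourier series \[ \delta(x)=\sum_{k\ne0}\frac{2}{3\sqrt\pi\,\log2}\,\Gamma\Big(\frac{3+\chi_k}{2}\Big)\big(2\zeta(\chi_k-1)+\zeta(\chi_k+1)\big)e^{2k\pi ix}. \]
   Context: A simple two-dimensional lattice path is a finite nonempty word over the steps $\{\uparrow,\rightarrow,\downarrow,\leftarrow\}$; its length $|\ell|$ is the number of steps. The reduction $\Phi_L(\ell)$ of a path $\ell$ of length $\ge2$: first, if the first step of $\ell$ is vertical, the entire path is rotated by $90^\circ$ clockwise; then, if the last step is horizontal, this last step alone is rotated by $90^\circ$ clockwise. The resulting path decomposes uniquely as $H_1V_1\cdots H_kV_k$ ($k\ge1$) with each $H_i$ a nonempty maximal run of horizontal steps and each $V_i$ a nonempty maximal run of vertical steps. Each block $H_iV_i$ is replaced by $\nearrow$, $\searrow$, $\swarrow$, $\nwarrow$ according as ($H_i$ starts with $\rightarrow$, $V_i$ with $\uparrow$), ($\rightarrow$, $\downarrow$), ($\leftarrow$, $\downarrow$), ($\leftarrow$, $\uparrow$); the diagonal path is then rotated by $45^\circ$ clockwise, giving $\Phi_L(\ell)$ of length $k$. The compactification degree $\mathrm{cdeg}(\ell)$ is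 the number $m\ge0$ such that $\Phi_L^m(\ell)$ is a single step. The size of the $r$th fringe of $\ell$ is $|\Phi_L^r(\ell)|$ if $\mathrm{cdeg}(\ell)\ge r$, and $0$ otherwise; $E^L_{n;r}$ is its expectation over uniformly random paths of length $n$, and $E^L_n=\sum_{r\ge0}E^L_{n;r}$. Here $\gamma$ is the Euler–Mascheroni constant, $\zeta$ the Riemann zeta function, $\Gamma$ the Gamma function, and $\chi_k=\frac{2\pi ik}{\log2}$. *)

(* Defs.v *)
From HB Require Import structures.
From mathcomp Require Import all_boot all_order all_algebra.
From mathcomp Require Import all_classical all_reals all_analysis.
From mathcomp.real_closed Require Import complex.

Set Implicit Arguments.
Unset Strict Implicit.
Unset Printing Implicit Defensive.

Import Order.TTheory GRing.Theory Num.Theory.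
Import numFieldTopology.Exports numFieldNormedType.Exports.

Inductive step := Up | Right | Down | Left.

Definition step_to_ord (s : step) : 'I_4 :=
  match s with Up => inord 0 | Right => inord 1 | Down => inord 2 | Left => inord 3 end.
Definition ord_to_step (o : 'I_4) : step :=
  match val o with 0 => Up | 1 => Right | 2 => Down | _ => Left end.
Lemma step_to_ordK : cancel step_to_ord ord_to_step.
Proof. by case; rewrite /ord_to_step /= inordK. Qed.

HB.instance Definition _ := Equality.copy step (can_type step_to_ordK).
HB.instance Definition _ := Choice.copy step (can_type step_to_ordK).
HB.instance Definition _ := Countable.copy step (can_type step_to_ordK).
HB.instance Definition _ := Finite.copy step (can_type step_to_ordK).

Definition horizontal (s : step) : bool :=
  match s with Right | Left => true | _ => false end.

Definition rot_cw (s : step) : step :=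
  match s with Up => Right | Right => Down | Down => Left | Left => Up end.

Definition normalize (l : seq step) : seq step :=
  let l1 := if l is s :: _ then (if horizontal s then l else map rot_cw l) else l in
  if l1 is s :: t then
    (if horizontal (last s t) then rcons (belast s t) (rot_cw (last s t)) else l1)
  else l1.

(* a block H V, with H starting with h and V starting with v, becomes a
   diagonal step, which is then rotated by 45 degrees clockwise:
   NE -> Right, SE -> Down, SW -> Left, NW -> Up *)
Definition block_step (h v : step) : step :=
  match h, v with
  | Right, Up => Right
  | Right, Down => Down
  | Left, Down => Left
  | Left, Up => Up
  | _, _ => Right (* unreachable: h horizontal, v vertical *)
  end.

(* scan of H_1 V_1 ... H_k V_k : the state is [Some h] while reading a
   horizontal run starting with h, and [None] while reading a vertical run *)
Fixpoint blocks (st : option step) (l : seq step) : seq step :=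
  match l with
  | [::] => [::]
  | s :: l' =>
      match st with
      | Some h => if horizontal s then blocks st l' else block_step h s :: blocks None l'
      | None => if horizontal s then blocks (Some s) l' else blocks None l'
      end
  end.

(* the reduction Phi_L (only meaningful for paths of length >= 2; it is the
   identity on shorter paths, where it is never used) *)
Definition PhiL (l : seq step) : seq step :=
  if (2 <= size l)%N then blocks None (normalize l) else l.

(* compactification degree: the m such that Phi_L^m(l) is a single step
   (the search range [0, size l) always contains it for nonempty l) *)
Definition cdeg (l : seq step) : nat :=
  find (fun r => size (iter r PhiL l) == 1%N) (iota 0 (size l)).

Definition fringe (r : nat) (l : seq step) : nat :=
  if (r <= cdeg l)%N then size (iter r PhiL l) else 0%N.

(* total fringe size  sum_{r >= 0} fringe r l; the terms with r > cdeg l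
   vanish and cdeg l <= size l, so the sum is finite *)
Definition total_fringe (l : seq step) : nat :=
  (\sum_(r < (size l).+1) fringe r l)%N.

Local Open Scope ring_scope.
Local Open Scope classical_set_scope.

Definition ELr (R : realType) (n r : nat) : R :=
  (\sum_(l : n.-tuple step) (fringe r l)%:R) / (4%:R ^+ n).

Definition EL (R : realType) (n : nat) : R :=
  (\sum_(l : n.-tuple step) (total_fringe l)%:R) / (4%:R ^+ n).

Local Open Scope complex_scope.

Definition euler_gamma (R : realType) : R :=
  limn (fun n : nat => \sum_(1 <= k < n.+1) (k%:R : R)^-1 - ln (n%:R : R)).

Definition climn (R : realType) (u : nat -> R[i]) : R[i] :=
  lim ((fun n => (u n : (R[i])^o)) @ \oo).

Definition cexp (R : realType) (z : R[i]) : R[i] :=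
  (expR (@complex.Re R z))%:C * ((cos (@complex.Im R z)) +i* (sin (@complex.Im R z))).

Definition cpow_nat (R : realType) (a : nat) (z : R[i]) : R[i] :=
  cexp (z * (ln (a%:R : R))%:C).

(* Euler's Gamma function (Gauss' limit formula, valid on C \ {0,-1,-2,...}) *)
Definition Gamma (R : realType) (z : R[i]) : R[i] :=
  climn (fun m : nat =>
    cpow_nat m z * (m`!)%:R / \prod_(j < m.+1) (z + j%:R)).

(* Riemann zeta function, via Hasse's globally convergent series
   zeta(s) = 1/(s-1) sum_{n>=0} 1/(n+1) sum_{k=0}^n (-1)^k C(n,k) (k+1)^(1-s),
   valid for every complex s <> 1 *)
Definition zeta (R : realType) (s : R[i]) : R[i] :=
  (s - 1)^-1 *
  climn (fun N : nat =>
    \sum_(n < N) ((n.+1)%:R)^-1 *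
      \sum_(k < n.+1) ((-1) ^+ k * ('C(n, k))%:R * cpow_nat k.+1 (1 - s))).

Definition chi (R : realType) (k : int) : R[i] :=
  0 +i* (2 * pi * k%:~R / ln (2 : R)).

Definition delta_term (R : realType) (k : int) (x : R) : R[i] :=
  (2 / (3 * Num.sqrt pi * ln (2 : R)))%:C
  * Gamma ((3 + chi R k) / 2)
  * (2 * zeta (chi R k - 1) + zeta (chi R k + 1))
  * cexp (0 +i* (2 * k%:~R * pi * x)).

(* delta(x) = sum_{k <> 0} delta_term k x  (absolutely convergent) *)
Definition delta (R : realType) (x : R) : R[i] :=
  climn (fun K : nat => \sum_(1 <= k < K.+1)
          (delta_term (k%:Z) x + delta_term (- (k%:Z)) x)).

Definition log4 (R : realType) (x : R) : R := ln x / ln 4.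

(* Main.v *)
(* Write alpha n = 3 E_n - 4 n + 1. One reduction maps a uniform path of length n + 2 to a uniform path
   of random length X./2 + 1, where X is binomial (n, 1/2); hence alpha satisfies a recursion that
   averages alpha at about n/4, and concentration of X gives
     alpha n = log4 n + f (log4 n) + O(1/n)
   with f 1-periodic and with second differences O(h^2).

   The Fourier coefficients of f come from the generating function A(v) = \sum_n alpha_n v^n. Put
   v = 1/cosh^2 x and D(x) = x^2 A(v). The recursion becomes D(x) = g(x) + D(2 x) with an explicit g,
   so D is a sum of dilates of g. The Mellin transform of g at chi is
   Gamma(chi + 2) (zeta(chi + 1) + 2 zeta(chi - 1)), by integration by parts and Hasse's series, while
   an Abelian estimate identifies D(x), for x -> 0, with f convolved with the density e^(w - e^w),
   whose Fourier transform contributes Gamma(1 + chi/2). Legendre duplication simplifies the quotient,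
   and Fejer's theorem recovers f from its coefficients. *)

Require Import Defs.
From HB Require Import structures.
From mathcomp Require Import all_boot all_order all_algebra.
From mathcomp Require Import all_classical all_reals all_analysis.
From mathcomp.real_closed Require Import complex.
From mathcomp Require Import ring lra zify.

Set Implicit Arguments.
Unset Strict Implicit.
Unset Printing Implicit Defensive.

Import Order.TTheory GRing.Theory Num.Theory.
Import numFieldTopology.Exports numFieldNormedType.Exports.
Local Open Scope ring_scope.

(** Two independent descriptions of f meet. The recursion yields f with a rate, so the generating
    function serves only in the Abelian direction, to average an f that is already known. The
    coefficients thus found identify f because its second differences are O(h^2): the coefficients
    are then O(k^-2), and the symmetric partial sums converge to f at every point, which is what the
    limit defining delta asks for. At the frequencies chi one has e^(chi ln 2) = 1, so the dilates
    of g, integrated over one period, unfold into a single integral over the line. That integral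
    does not converge absolutely: in the logarithmic variable g tends to 1 at -oo, a trace of the
    term log4 n. Truncation at multiples of ln 2, where the phase is exactly 1, leaves the boundary
    term 1/chi, and it cancels against the transform of the linear drift. Euler's integral is
    handled at arguments with positive integer real part. The point (3 + chi)/2 has real part 3/2;
    it is reached through Gauss products and the duplication formula. *)

Ltac lra_neq0 := repeat (apply/andP; split); try done; apply/eqP => ?; lra.

(** * Null sequences *)

Section Null.
Variable R : realType.
Implicit Types (u v e : nat -> R) (l c : R).

Definition null e := forall eps : R, 0 < eps -> exists N : nat, forall n, (N <= n)%N -> `|e n| <= eps.

Lemma null_le e e' : null e' -> (exists N : nat, forall n, (N <= n)%N -> `|e n| <= e' n) -> null e.
Proof.
move=> H [N HN] eps e0; have [M HM] := H _ e0; exists (maxn N M) => n.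
rewrite geq_max => /andP[Nn Mn]; apply: le_trans (HN _ Nn) _.
by apply: le_trans (HM _ Mn); rewrite ler_norm.
Qed.

Lemma null_le0 e e' : null e' -> (forall n, `|e n| <= e' n) -> null e.
Proof. by move=> H H'; apply: (null_le H); exists 0%N. Qed.

Lemma eq_null e e' : null e -> (forall n, e' n = e n) -> null e'.
Proof. by move=> H E eps /H[N HN]; exists N => n; rewrite E; apply: HN. Qed.

Lemma nullD e e' : null e -> null e' -> null (fun n => e n + e' n).
Proof.
move=> H H' eps e0; have e2 : 0 < eps / 2 by rewrite divr_gt0.
have [N HN] := H _ e2; have [M HM] := H' _ e2; exists (maxn N M) => n.
rewrite geq_max => /andP[/HN h1 /HM h2].
by apply: le_trans (ler_normD _ _) _; rewrite [eps]splitr lerD.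
Qed.

Lemma nullZ c e : null e -> null (fun n => c * e n).
Proof.
move=> H eps e0.
have c0 : 0 < `|c| + 1 by have := normr_ge0 c; lra.
have [N HN] := H _ (divr_gt0 e0 c0); exists N => n /HN h.
rewrite normrM; apply: le_trans (ler_wpM2l (normr_ge0 c) h) _.
rewrite mulrCA; apply: ler_piMr; first exact: ltW.
by rewrite ler_pdivrMr //; lra.
Qed.

Lemma nullN e : null e -> null (fun n => - e n).
Proof. by move=> H; apply: (eq_null (nullZ (-1) H)) => n; rewrite mulN1r. Qed.

Lemma nullB e e' : null e -> null e' -> null (fun n => e n - e' n).
Proof. by move=> H H'; apply: nullD => //; apply: nullN. Qed.

Lemma null0 : null (fun=> 0).
Proof. by move=> eps e0; exists 0%N => n _; rewrite normr0 ltW. Qed.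

Lemma null_inv : null (fun n => n.+1%:R^-1).
Proof.
move=> eps e0; exists (Num.truncn eps^-1) => n nN.
rewrite ger0_norm ?invr_ge0 //.
have e1 : 0 < eps^-1 by rewrite invr_gt0.
have /andP[_ h] := truncn_itv (ltW e1).
rewrite -[eps]invrK lef_pV2 ?posrE //.
by apply: le_trans (ltW h) _; rewrite ler_nat; lia.
Qed.

Lemma null_shift e k : null (fun n => e (n + k)%N) <-> null e.
Proof.
split=> H eps /H[N HN]; last by exists N => n nN; apply: HN; lia.
by exists (N + k)%N => n nN; have := HN (n - k)%N; rewrite subnK; [apply; lia|lia].
Qed.

Lemma null_sub e (a : nat -> nat) : (forall n, (n <= a n)%N) -> null e -> null (fun n => e (a n)).
Proof. by move=> H He eps /He[N HN]; exists N => n nN; apply: HN; apply: leq_trans (H n). Qed.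

Lemma nullM e e' : null e -> null e' -> null (fun n => e n * e' n).
Proof.
move=> H H' eps e0; have [N HN] := H _ ltr01; have [M HM] := H' _ e0.
exists (maxn N M) => n; rewrite geq_max => /andP[/HN h1 /HM h2].
by rewrite normrM -[eps]mul1r ler_pM.
Qed.

Lemma null_uniq c e : null e -> (forall n, `|c| <= e n) -> c = 0.
Proof.
move=> H Hc; apply/normr0_eq0/eqP; rewrite eq_le normr_ge0 andbT.
apply/ler_addgt0Pr => eps e0; rewrite add0r; have [N HN] := H _ e0.
apply: le_trans (Hc N) _; apply: le_trans (ler_norm _) _; exact: HN.
Qed.

Lemma null_ge a b e : null e -> (exists N : nat, forall n, (N <= n)%N -> a <= b + e n) -> a <= b.
Proof.
move=> H [M HM]; apply/ler_addgt0Pr => eps e0; have [N HN] := H _ e0.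
apply: le_trans (HM _ (leq_maxl M N)) _; rewrite lerD2l.
by apply: le_trans (ler_norm _) _; apply: HN; apply: leq_maxr.
Qed.

Lemma null_expn (q : R) : 0 <= q < 1 -> null (fun n => q ^+ n).
Proof.
move=> /andP[q0 q1] eps e0.
have : `|q| < 1 by rewrite ger0_norm.
move=> /cvg_expr/cvgrPdist_le /(_ _ e0)[N _ HN]; exists N => n nN.
by have := HN n nN; rewrite sub0r normrN.
Qed.

Definition tends u l := null (fun n => u n - l).

Lemma tends_uniq u l l' : tends u l -> tends u l' -> l = l'.
Proof.
move=> H H'; apply/eqP; rewrite -subr_eq0; apply/eqP.
have := nullB H' H; rewrite /null => K; apply: null_uniq (_ : null (fun n => `|(u n - l') - (u n - l)|)) _.
  by move=> eps /K[N HN]; exists N => n /HN; rewrite normr_id.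
by move=> n; rewrite le_eqVlt; apply/orP; left; apply/eqP; congr (`|_|); ring.
Qed.

Lemma tends_limn u l : tends u l -> limn u = l.
Proof.
move=> H; apply/cvg_lim => //; apply/cvgrPdist_le => eps /H[N HN].
by exists N => // n /HN; rewrite distrC.
Qed.

Lemma cvg_tends u : cvgn u -> tends u (limn u).
Proof.
move=> /cvgrPdist_le H eps /H[N _ HN]; exists N => n nN.
by rewrite distrC; apply: HN.
Qed.

Lemma tendsD u v l c : tends u l -> tends v c -> tends (fun n => u n + v n) (l + c).
Proof. by move=> H H'; apply: (eq_null (nullD H H')) => n; ring. Qed.

Lemma tendsN u l : tends u l -> tends (fun n => - u n) (- l).
Proof. by move=> H; apply: (eq_null (nullN H)) => n; ring. Qed.

Lemma tendsB u v l c : tends u l -> tends v c -> tends (fun n => u n - v n) (l - c).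
Proof. by move=> H H'; apply: tendsD => //; apply: tendsN. Qed.

Lemma tendsZ a u l : tends u l -> tends (fun n => a * u n) (a * l).
Proof. by move=> H; apply: (eq_null (nullZ a H)) => n; ring. Qed.

Lemma tends_cst l : tends (fun=> l) l.
Proof. by apply: (eq_null null0) => n; rewrite subrr. Qed.

Lemma eq_tends u v l : tends u l -> (forall n, v n = u n) -> tends v l.
Proof. by move=> H E; apply: (eq_null H) => n; rewrite E. Qed.

Lemma tends_null u v l : tends u l -> null (fun n => v n - u n) -> tends v l.
Proof. by move=> H H'; apply: (eq_null (nullD H H')) => n; ring. Qed.

Lemma tends_le u l b : tends u l -> (exists N : nat, forall n, (N <= n)%N -> u n <= b) -> l <= b.
Proof.
move=> H [N HN]; apply: (@null_ge _ _ _ (nullN H)); exists N => n /HN; lra.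
Qed.

Lemma tends_ge u l b : tends u l -> (exists N : nat, forall n, (N <= n)%N -> b <= u n) -> b <= l.
Proof.
move=> H [N HN]; apply: (@null_ge _ _ _ H); exists N => n /HN; lra.
Qed.

Lemma tends_norm u l : tends u l -> tends (fun n => `|u n|) `|l|.
Proof.
move=> H eps /H[N HN]; exists N => n /HN; apply: le_trans; exact: ler_dist_dist.
Qed.

Lemma tends_norm_le u l b : tends u l -> (exists N : nat, forall n, (N <= n)%N -> `|u n| <= b) -> `|l| <= b.
Proof. by move=> H K; apply: tends_le (tends_norm H) K. Qed.

Lemma tends_shift u l k : tends (fun n => u (n + k)%N) l <-> tends u l.
Proof. exact: (null_shift (fun n => u n - l)). Qed.

Lemma nondecreasing_tends u b : (forall n, u n <= u n.+1) -> (forall n, u n <= b) ->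
  exists2 l, tends u l & forall n, u n <= l.
Proof.
move=> Hm Hb.
have hm : {homo u : n m / (n <= m)%N >-> n <= m}.
  by apply/nondecreasing_seqP.
have cv : cvgn u.
  by apply: nondecreasing_is_cvgn => //; exists b => _ [n _ <-].
by exists (limn u); [exact: cvg_tends|move=> n; apply: nondecreasing_cvgn_le].
Qed.

Lemma geometric_tends u a : (forall n, `|u n.+1 - u n| <= a / 4 ^+ n) ->
  exists2 l, tends u l & `|l - u 0%N| <= 2 * a.
Proof.
move=> H.
have a0 : 0 <= a by have := le_trans (normr_ge0 _) (H 0%N); rewrite expr0 divr1.
have q0 n : 0 <= a / 4 ^+ n by rewrite divr_ge0 // exprn_ge0.
have qS n : a / 4 ^+ n.+1 = a / 4 ^+ n / 4 by rewrite exprS invfM; ring.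
have Hb n : `|u n - u 0%N| <= 2 * a - 2 * (a / 4 ^+ n).
  elim: n => [|n IH]; first by rewrite expr0 divr1 !subrr normr0.
  have -> : u n.+1 - u 0%N = (u n.+1 - u n) + (u n - u 0%N) by ring.
  apply: le_trans (ler_normD _ _) _; rewrite qS.
  by move: (H n) (q0 n) IH; set p := a / 4 ^+ n; lra.
(* The correction adds [3/2 * (a / 4 ^+ n)] to each increment, which dominates [|u n.+1 - u n|]; the
   corrected sequence is monotone and has the same limit. *)
have [||l hl _] := @nondecreasing_tends (fun n => u n - 2 * (a / 4 ^+ n)) (u 0%N + 2 * a).
- move=> n; rewrite qS; move: (H n) (q0 n); rewrite ler_norml.
  by set p := a / 4 ^+ n; lra.
- move=> n; move: (Hb n) (q0 n); rewrite ler_norml.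
  by set p := a / 4 ^+ n; lra.
have K : null (fun n => 2 * a * (4^-1) ^+ n) by apply/nullZ/null_expn; lra.
have hu : tends u l by apply: (tends_null hl); apply: (eq_null K) => n; rewrite exprVn; ring.
exists l => //; apply: (tends_norm_le (tendsB hu (tends_cst (u 0%N)))).
by exists 0%N => n _; move: (Hb n) (q0 n); lra.
Qed.
End Null.

(** * The recursion for the expected fringe size *)

Lemma size_normalize l : size (normalize l) = size l.
Proof.
rewrite /normalize; case: l => [|s t] //=.
case: (horizontal s) => /=; case: ifP => _ //=; rewrite ?size_rcons ?size_belast ?size_map //.
Qed.

Lemma size_blocks l : (size (blocks None l) <= (size l)./2)%N /\
  forall h, (size (blocks (Some h) l) <= (size l).+1./2)%N.
Proof.
elim: l => [|s l [IH1 IH2]] //=; split.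
  by case: (horizontal s); [exact: IH2|rewrite uphalf_half; lia].
move=> h; case: (horizontal s) => /=.
  by have := IH2 h; rewrite /= !uphalf_half; lia.
by rewrite ltnS.
Qed.

Definition vlast (s : step) (t : seq step) := ~~ horizontal (last s t).


Lemma blocks_Some_gt0 h s t : vlast s t -> (0 < size (blocks (Some h) (s :: t)))%N.
Proof.
rewrite /vlast; elim: t s => [|s' t IH] s /=.
  by case: (horizontal s).
by case: (horizontal s) => //= H; apply: IH.
Qed.

Lemma normalize_shape s t : t != [::] -> exists s' t', [/\ normalize (s :: t) = s' :: t',
  horizontal s', t' != [::] & vlast s' t'].
Proof.
move=> tn0.
have [s1 [t1 [E1 h1 n1]]] : exists s1 t1, [/\ (if horizontal s then s :: t else map rot_cw (s :: t)) = s1 :: t1,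
   horizontal s1 & t1 != [::]].
  case hs: (horizontal s); first by exists s, t.
  exists (rot_cw s), (map rot_cw t); split => //; first by case: s hs.
  by case: t tn0.
rewrite /normalize E1 /vlast.
case hl: (horizontal (last s1 t1)); last by exists s1, t1; rewrite hl.
case: t1 n1 {E1} hl => // a t1 _ hl.
exists s1, (rcons (belast a t1) (rot_cw (last a t1))); split => //.
  by case: (belast _ _).
by rewrite last_rcons; move: hl => /=; case: (last a t1).
Qed.

Lemma size_PhiL l : (2 <= size l)%N -> (0 < size (PhiL l) <= (size l)./2)%N.
Proof.
move=> l2; rewrite /PhiL l2.
apply/andP; split; last by rewrite -(size_normalize l); case: (size_blocks (normalize l)).
case: l l2 => // s [|s' t] // _.
have [|s1 [[|a t1] [-> h1 // _ vl]]] := @normalize_shape s (s' :: t); first by [].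
by rewrite /= h1; apply: blocks_Some_gt0.
Qed.

Lemma iter_PhiL_size1 l : (0 < size l)%N -> (exists2 r, (r < size l)%N & size (iter r PhiL l) == 1%N).
Proof.
elim: {l}(size l) {-2}l (leqnn (size l)) => [|n IH] l; first by case: (size l).
move=> ln l0; have [l2|l1] := leqP 2 (size l); last first.
  by exists 0%N => //=; case: (size l) l0 l1 => [|[]].
have /andP[p0 ph] := size_PhiL l2.
have hl : (size (PhiL l) < size l)%N.
  by apply: leq_ltn_trans ph _; rewrite ltn_half_double -addnn; lia.
have [||r rl re] := IH (PhiL l) => //; first lia.
by exists r.+1; [lia|rewrite iterSr].
Qed.

Lemma cdegE l m : (m < size l)%N -> size (iter m PhiL l) = 1%N ->
  (forall r, (r < m)%N -> size (iter r PhiL l) != 1%N) -> cdeg l = m.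
Proof.
move=> ml e1 ne; rewrite /cdeg; apply/eqP; rewrite eqn_leq; apply/andP; split.
  rewrite leqNgt; apply/negP => /(before_find 0%N).
  by rewrite nth_iota // add0n e1.
rewrite leqNgt; apply/negP => H.
set p := (X in find X _) in H.
have hp : has p (iota 0 (size l)) by rewrite has_find size_iota; lia.
by have := nth_find 0%N hp; rewrite nth_iota ?add0n; [apply/negP/ne|lia].
Qed.

Lemma cdeg_spec l : (0 < size l)%N -> [/\ (cdeg l < size l)%N, size (iter (cdeg l) PhiL l) = 1%N &
  forall r, (r < cdeg l)%N -> size (iter r PhiL l) != 1%N].
Proof.
move=> l0; have [r rl re] := iter_PhiL_size1 l0.
have ex : exists r, (r < size l)%N && (size (iter r PhiL l) == 1%N) by exists r; rewrite rl.
case: (ex_minnP ex) => m /andP[ml /eqP me] mmin.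
have ne : forall r, (r < m)%N -> size (iter r PhiL l) != 1%N.
  move=> r' rm; apply/negP => H.
  by have := mmin r'; rewrite H andbT [(m <= r')%N]leqNgt rm => /(_ (ltn_trans rm ml)).
by rewrite (cdegE ml me ne).
Qed.

Lemma cdeg_PhiL l : (2 <= size l)%N -> cdeg l = (cdeg (PhiL l)).+1.
Proof.
move=> l2; have /andP[p0 ph] := size_PhiL l2.
have [cl ce cn] := cdeg_spec p0.
apply: cdegE.
- apply: (leq_ltn_trans cl); apply: leq_ltn_trans ph _; rewrite ltn_half_double -addnn; lia.
- by rewrite iterSr.
- case=> [|r] rc; first by rewrite /=; lia.
  by rewrite iterSr; apply: cn.
Qed.

Lemma total_fringeE l : (0 < size l)%N ->
  total_fringe l = (\sum_(r < (cdeg l).+1) size (iter r PhiL l))%N.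
Proof.
move=> l0; have [cl _ _] := cdeg_spec l0.
rewrite /total_fringe (big_ord_widen (size l).+1 (fun r => size (iter r PhiL l))); last lia.
rewrite [RHS]big_mkcond; apply: eq_bigr => i _ /=; rewrite /fringe ltnS //.
Qed.

Lemma total_fringe_size1 l : size l = 1%N -> total_fringe l = 1%N.
Proof.
move=> l1; rewrite total_fringeE ?l1 //.
have -> : cdeg l = 0%N by apply: cdegE; rewrite ?l1.
by rewrite big_ord1 /= l1.
Qed.

(** Fringe [r + 1] of a path is fringe [r] of its reduction and the degree drops by one; only fringe
    0, the path itself, is left over. *)
Lemma total_fringe_PhiL l : (2 <= size l)%N ->
  total_fringe l = (size l + total_fringe (PhiL l))%N.
Proof.
move=> l2; have /andP[p0 _] := size_PhiL l2.
rewrite !total_fringeE //; last lia.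
rewrite cdeg_PhiL // big_ord_recl /=; congr addn.
by apply: eq_bigr => i _; rewrite -iterSr /=.
Qed.

Section PathSums.
Variable R : realType.
Implicit Types (phi : seq step -> R) (psi : nat -> R).

(** Summation letter by letter: conditioning on the first step matches the left-to-right scan
    [blocks]. *)
Fixpoint sumseq (n : nat) phi : R :=
  if n is m.+1 then \sum_(s : step) sumseq m (fun l => phi (s :: l)) else phi [::].

(** Expectation of [psi X] for [X] binomial (m, 1/2), unfolded one trial at a time. *)
Fixpoint bmean (m : nat) psi : R :=
  if m is m'.+1 then (bmean m' psi + bmean m' (fun x => psi x.+1)) / 2 else psi 0%N.

Lemma bmeanS m psi : bmean m.+1 psi = (bmean m psi + bmean m (fun x => psi x.+1)) / 2.
Proof. by []. Qed.

Lemma sum_step (F : step -> R) : \sum_(s : step) F s = F Up + F Right + F Down + F Left.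
Proof.
have K : cancel ord_to_step step_to_ord.
  by case=> [[|[|[|[|//]]]] h]; apply/val_inj; rewrite /= inordK.
rewrite (reindex ord_to_step) /=; last first.
  by exists step_to_ord => ? _; rewrite (K, step_to_ordK).
by rewrite 4!big_ord_recl big_ord0 addr0 /= !addrA.
Qed.

Lemma sum_tuple_sumseq n phi : \sum_(l : n.-tuple step) phi l = sumseq n phi.
Proof.
elim: n phi => [|n IH] phi /=.
  by rewrite (big_pred1 [tuple]) // => l; apply/esym/eqP; rewrite tuple0.
rewrite -[RHS](eq_bigr _ (fun s _ => IH (fun l => phi (s :: l)))).
rewrite pair_big /= (reindex (fun p : step * n.-tuple step => [tuple of p.1 :: p.2])) /=.
  by apply: eq_bigr => -[].
exists (fun t => (thead t, [tuple of behead t])) => [[s t] _ | t _] /=.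
  by congr pair; apply/val_inj.
by rewrite -tuple_eta.
Qed.

Lemma eq_sumseq n phi phi' : (forall l, size l = n -> phi l = phi' l) -> sumseq n phi = sumseq n phi'.
Proof.
elim: n phi phi' => [|n IH] phi phi' H /=; first exact: H.
by apply: eq_bigr => s _; apply: IH => l ln; apply: H; rewrite /= ln.
Qed.

Lemma sumseq_map_rot n phi : sumseq n (fun l => phi (map rot_cw l)) = sumseq n phi.
Proof.
elim: n phi => [|n IH] phi //=.
by rewrite !sum_step /= !(IH (fun l => phi (_ :: l))); ring.
Qed.

(** The second half of [normalize] as a structural recursion, so that it commutes with splitting off
    the first letter of a path with at least two steps. *)
Fixpoint fixlast (l : seq step) : seq step :=
  match l with
  | [::] => [::]
  | s :: l' => if l' is [::] then [:: if horizontal s then rot_cw s else s]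
               else s :: fixlast l'
  end.

Lemma fixlastE s t : fixlast (s :: t) =
  if horizontal (last s t) then rcons (belast s t) (rot_cw (last s t)) else s :: t.
Proof.
elim: t s => [|s' t IH] s; first by rewrite /=; case: (horizontal s).
rewrite [fixlast _]/= -/(fixlast (s' :: t)) IH /=.
by case: (horizontal _).
Qed.

(** Rotation maps the paths with a vertical start bijectively onto those with a horizontal start, so
    each of the latter counts twice; its first letter merely sets the state of the scan. *)
Lemma sumseq_PhiL n phi :
  sumseq n.+2 (fun l => phi (PhiL l)) =
  2 * (sumseq n.+1 (fun t => phi (blocks (Some Right) (fixlast t))) +
       sumseq n.+1 (fun t => phi (blocks (Some Left) (fixlast t)))).
Proof.
pose G l := phi (blocks None (fixlast l)).
have E : sumseq n.+2 (fun l => phi (PhiL l)) =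
    sumseq n.+2 (fun l => G (if l is s :: _ then if horizontal s then l else map rot_cw l else l)).
  apply: eq_sumseq => l ln; rewrite /PhiL ln /= /G /normalize.
  case: l ln => [|s t] //= _; case: (horizontal s) => /=; first by rewrite -fixlastE.
  by rewrite -fixlastE.
rewrite E.
have GE h : horizontal h -> sumseq n.+1 (fun t => G (h :: t)) =
    sumseq n.+1 (fun t => phi (blocks (Some h) (fixlast t))).
  move=> hh; apply: eq_sumseq => t; case: t => // s t _.
  by rewrite /G [fixlast (h :: _)]/= -/(fixlast (s :: t)) /= hh.
rewrite -(GE Right) // -(GE Left) //.
rewrite [LHS]/= -/sumseq.
have -> (F : step -> R) : \sum_(s : step) F s = F Up + F Right + F Down + F Left by exact: sum_step.
rewrite -/(sumseq n.+1 (fun l => G (Right :: l))) -/(sumseq n.+1 (fun l => G (Left :: l))).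
rewrite -/(sumseq n.+1 (fun l => G (Right :: map rot_cw l))) -/(sumseq n.+1 (fun l => G (Left :: map rot_cw l))).
rewrite (sumseq_map_rot n.+1 (fun l => G (Right :: l))).
by rewrite (sumseq_map_rot n.+1 (fun l => G (Left :: l))); ring.
Qed.

Definition mean_len (k : nat) phi : R := sumseq k phi / 4 ^+ k.

Lemma bmeanZ m a psi : bmean m (fun x => a * psi x) = a * bmean m psi.
Proof. by elim: m psi => [|m IH] psi //=; rewrite !IH; field. Qed.

Lemma bmeanD m psi psi' : bmean m (fun x => psi x + psi' x) = bmean m psi + bmean m psi'.
Proof. by elim: m psi psi' => [|m IH] psi psi' //=; rewrite !IH; field. Qed.

Lemma eq_bmean m psi psi' : psi =1 psi' -> bmean m psi = bmean m psi'.
Proof. by move=> /funext ->. Qed.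

(** Here [x] counts the switches between horizontal and vertical letters. As [fixlast] makes the
    last letter vertical, [x] is even when the scan starts in a vertical run and odd when it starts
    in a horizontal one. The scan then emits [x./2], respectively [uphalf x], blocks, and their
    directions are uniform. *)
Definition evens phi (x : nat) : R := if odd x then 0 else mean_len x./2 phi.
Definition odds phi (x : nat) : R := if odd x then mean_len (uphalf x) phi else 0.

Lemma odds_evens phi x : odds phi x.+1 = 4^-1 * \sum_(s : step) evens (fun l => phi (s :: l)) x.
Proof.
rewrite /odds /evens /=; case: (odd x) => /=; first by rewrite big1 ?mulr0.
by rewrite /mean_len /= -mulr_suml exprS invfM; ring.
Qed.

Lemma evens_odds phi x : evens phi x.+1 = odds phi x.
Proof. by rewrite /odds /evens /=; case: (odd x). Qed.

(** The first letter continues the current run or switches, with two choices each, so the two sums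
    obey the recursion of [bmean]; they are proved together because a switch exchanges them. A
    switch to a vertical run emits a uniform step, since the first letters of the two runs are
    independent ([odds_evens]). *)
Lemma sumseq_blocks n phi :
  sumseq n.+1 (fun t => phi (blocks None (fixlast t))) = 2 ^+ (n + n).+3 * bmean n.+1 (evens phi) /\
  sumseq n.+1 (fun t => phi (blocks (Some Right) (fixlast t))) +
  sumseq n.+1 (fun t => phi (blocks (Some Left) (fixlast t))) =
    2 ^+ (n + n).+4 * bmean n.+1 (odds phi).
Proof.
elim: n phi => [|n IH] phi.
  rewrite /= !sum_step /= /evens /odds /mean_len /= sum_step; split; by field.
have stepN : sumseq n.+2 (fun t => phi (blocks None (fixlast t))) =
   2 * sumseq n.+1 (fun t => phi (blocks None (fixlast t))) +
   (sumseq n.+1 (fun t => phi (blocks (Some Right) (fixlast t))) +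
    sumseq n.+1 (fun t => phi (blocks (Some Left) (fixlast t)))).
  rewrite -[LHS]/(\sum_(s : step) \sum_(s0 : step)
    sumseq n (fun l => phi (blocks None (fixlast [:: s, s0 & l])))) sum_step.
  have X s : \sum_(s0 : step) sumseq n (fun l => phi (blocks None (fixlast [:: s, s0 & l]))) =
     sumseq n.+1 (fun t => phi (if horizontal s then blocks (Some s) (fixlast t) else blocks None (fixlast t))).
    apply: eq_bigr => s0 _; apply: eq_sumseq => l _ /=.
    by case: (horizontal s); case: l.
  by rewrite !X; cbv beta iota delta [horizontal block_step]; ring.
have stepS : sumseq n.+2 (fun t => phi (blocks (Some Right) (fixlast t))) +
   sumseq n.+2 (fun t => phi (blocks (Some Left) (fixlast t))) =
   2 * (sumseq n.+1 (fun t => phi (blocks (Some Right) (fixlast t))) +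
    sumseq n.+1 (fun t => phi (blocks (Some Left) (fixlast t)))) +
   \sum_(s : step) sumseq n.+1 (fun t => phi (s :: blocks None (fixlast t))).
  have X h s : \sum_(s0 : step) sumseq n (fun l => phi (blocks (Some h) (fixlast [:: s, s0 & l]))) =
     sumseq n.+1 (fun t => phi (if horizontal s then blocks (Some h) (fixlast t)
        else block_step h s :: blocks None (fixlast t))).
    apply: eq_bigr => s0 _; apply: eq_sumseq => l _ /=.
    by case: (horizontal s); case: l.
  have U h : sumseq n.+2 (fun t => phi (blocks (Some h) (fixlast t))) =
      2 * sumseq n.+1 (fun t => phi (blocks (Some h) (fixlast t))) +
      sumseq n.+1 (fun t => phi (block_step h Up :: blocks None (fixlast t))) +
      sumseq n.+1 (fun t => phi (block_step h Down :: blocks None (fixlast t))).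
    rewrite -[LHS]/(\sum_(s : step) \sum_(s0 : step)
      sumseq n (fun l => phi (blocks (Some h) (fixlast [:: s, s0 & l])))) sum_step.
    by rewrite !X; cbv beta iota delta [horizontal]; ring.
  by rewrite !U sum_step; cbv beta iota delta [block_step]; ring.
have [IHN IHS] := IH phi.
split.
  rewrite stepN IHN IHS (bmeanS n.+1).
  have -> : bmean n.+1 (fun x => evens phi x.+1) = bmean n.+1 (odds phi).
    by apply: eq_bmean => x; rewrite evens_odds.
  by rewrite !addnS addSn !exprS; field.
rewrite stepS IHS.
have -> : \sum_(s : step) sumseq n.+1 (fun t => phi (s :: blocks None (fixlast t))) =
   2 ^+ (n + n).+3 * \sum_(s : step) bmean n.+1 (evens (fun l => phi (s :: l))).
  by rewrite mulr_sumr; apply: eq_bigr => s _; have [-> _] := IH (fun l => phi (s :: l)).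
have -> : \sum_(s : step) bmean n.+1 (evens (fun l => phi (s :: l))) =
   4 * bmean n.+1 (fun x => odds phi x.+1).
  rewrite -bmeanZ.
  have -> : bmean n.+1 (fun x => 4 * odds phi x.+1) =
     bmean n.+1 (fun x => \sum_(s : step) evens (fun l => phi (s :: l)) x).
    by apply: eq_bmean => x; rewrite odds_evens; field.
  rewrite sum_step.
  by rewrite -!bmeanD; apply: eq_bmean => x; rewrite sum_step.
by rewrite (bmeanS n.+1) !addnS addSn !exprS; field.
Qed.

(** One of the [n + 1] trials absorbs the parity constraint: of [x] and [x + 1] exactly one is odd,
    and either way it gives [x./2 + 1] blocks. *)
Lemma mean_PhiL n phi :
  mean_len n.+2 (fun l => phi (PhiL l)) = bmean n (fun x => mean_len (x./2).+1 phi).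
Proof.
rewrite /mean_len sumseq_PhiL (sumseq_blocks n phi).2 (bmeanS n).
have -> : bmean n (fun x => mean_len (x./2).+1 phi) =
   bmean n (odds phi) + bmean n (fun x => odds phi x.+1).
  rewrite -bmeanD; apply: eq_bmean => x; rewrite /odds /= uphalf_half.
  by case: (odd x); rewrite ?addr0 ?add0r.
have -> : (4 : R) ^+ n.+2 = 2 ^+ (n + n).+4.
  have -> : (n + n).+4 = (2 * n.+2)%N by lia.
  by rewrite exprM; congr (_ ^+ _); ring.
rewrite -/(mean_len _ _) [2 ^+ (n+n).+4]exprS; field.
by rewrite expf_neq0.
Qed.

Lemma mean_lenD n phi phi' : mean_len n (fun l => phi l + phi' l) = mean_len n phi + mean_len n phi'.
Proof.
rewrite /mean_len -mulrDl; congr (_ / _).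
elim: n phi phi' => [|n IH] phi phi' //=.
by rewrite -big_split; apply: eq_bigr => s _; rewrite IH.
Qed.

Lemma mean_len_cst n (a : R) : mean_len n (fun=> a) = a.
Proof.
rewrite /mean_len; elim: n => [|n IH] /=; first by rewrite expr0 divr1.
rewrite sum_step exprS; move: IH; set y := sumseq _ _ => IH.
have -> : y = a * 4 ^+ n by rewrite -IH mulfVK // expf_neq0.
by field; rewrite expf_neq0.
Qed.

Lemma EL_mean n : EL R n = mean_len n (fun l => (total_fringe l)%:R).
Proof. by rewrite /EL /mean_len -sum_tuple_sumseq. Qed.

Lemma EL1 : EL R 1 = 1.
Proof.
rewrite EL_mean -[RHS](mean_len_cst 1 1) /mean_len; congr (_ / _).
by apply: eq_sumseq => l l1; rewrite total_fringe_size1.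
Qed.

Lemma EL_rec n : EL R n.+2 = n.+2%:R + bmean n (fun x => EL R (x./2).+1).
Proof.
rewrite EL_mean.
have -> : mean_len n.+2 (fun l => (total_fringe l)%:R) =
   mean_len n.+2 (fun l => n.+2%:R + (total_fringe (PhiL l))%:R).
  rewrite /mean_len; congr (_ / _); apply: eq_sumseq => l ln.
  by rewrite total_fringe_PhiL ln // natrD.
rewrite (mean_lenD _ (fun=> n.+2%:R)) mean_len_cst (mean_PhiL n (fun l => (total_fringe l)%:R)).
by congr (_ + _); apply: eq_bmean => x; rewrite EL_mean.
Qed.
End PathSums.

(** * Binomial means *)

Section Increments.
Variable R : realType.
Implicit Types (phi psi : nat -> R).

Lemma bmean_le m psi psi' : (forall x, (x <= m)%N -> psi x <= psi' x) -> bmean m psi <= bmean m psi'.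
Proof.
elim: m psi psi' => [|m IH] psi psi' H; first exact: H.
rewrite !bmeanS ler_pM2r ?invr_gt0 ?ltr0n // lerD //; apply: IH => x xm; apply: H; lia.
Qed.

Lemma bmean_cst m (a : R) : bmean m (fun=> a) = a.
Proof. by elim: m => [|m IH] //=; rewrite IH; field. Qed.

Lemma bmeanB m psi psi' : bmean m (fun x => psi x - psi' x) = bmean m psi - bmean m psi'.
Proof. by elim: m psi psi' => [|m IH] psi psi' //=; rewrite !IH; field. Qed.

Lemma bmean_norm m psi psi' : (forall x, (x <= m)%N -> `|psi x| <= psi' x) -> `|bmean m psi| <= bmean m psi'.
Proof.
move=> H; rewrite ler_norml; apply/andP; split.
  rewrite -mulN1r -bmeanZ; apply: bmean_le => x /H; rewrite ler_norml mulN1r; by case/andP.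
by apply: bmean_le => x /H; rewrite ler_norml; case/andP.
Qed.

(** The absorption identity x C(m+1, x) = (m+1) C(m, x-1), averaged. *)
Lemma bmean_absorb m psi :
  bmean m.+1 (fun x => x%:R * psi x) = m.+1%:R / 2 * bmean m (fun x => psi x.+1).
Proof.
elim: m psi => [|m IH] psi; first by rewrite /=; field.
rewrite bmeanS IH.
have -> : bmean m.+1 (fun x => x.+1%:R * psi x.+1) =
   bmean m.+1 (fun x => x%:R * psi x.+1) + bmean m.+1 (fun x => psi x.+1).
  by rewrite -bmeanD; apply: eq_bmean => x; rewrite -natr1; ring.
by rewrite (IH (fun x => psi x.+1)) [bmean m.+1 _]bmeanS -!natr1; field.

Qed.

Lemma bmean_id m : bmean m (fun x => x%:R) = m%:R / 2 :> R.
Proof.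
case: m => [|m] /=; first by rewrite mul0r.
have := bmean_absorb m (fun=> 1); rewrite bmean_cst mulr1 => <-.
by apply: (@eq_bmean _ m.+1) => x; rewrite mulr1.
Qed.

Lemma bmean_sqr m : bmean m (fun x => x%:R ^+ 2) = m%:R * (m%:R + 1) / 4 :> R.
Proof.
case: m => [|m]; first by rewrite /= expr0n /= !mul0r.
rewrite (eq_bmean _ (psi' := fun x => x%:R * x%:R)); last by move=> x; rewrite expr2.
rewrite bmean_absorb (eq_bmean _ (psi' := fun x => x%:R + 1)); last by move=> x; rewrite -natr1.
by rewrite bmeanD bmean_id bmean_cst -(natr1 m); field.

Qed.

Lemma bmean_inv1 m : bmean m (fun x => x.+1%:R^-1) <= 2 / m.+1%:R :> R.
Proof.
have := bmean_absorb m (fun x => x%:R^-1).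
have : bmean m.+1 (fun x => x%:R * x%:R^-1) <= 1 :> R.
  rewrite -[leRHS](bmean_cst m.+1 1); apply: bmean_le => -[|x] _; first by rewrite mul0r.
  by rewrite divff // pnatr_eq0.
move=> H E; rewrite E in H.
by rewrite ler_pdivlMr ?ltr0n //; lra.
Qed.

(** Three absorptions turn E 1/(X+3) into E (Y-1)(Y-2) with [m + 3] trials, up to the value Y = 0,
    where the inequality comes from; the polynomial moment is explicit. The bound is shaped for the
    induction of [dalpha_bound]. *)
Lemma bmean_inv3 m : (0 < m)%N -> bmean m (fun x => (x%:R + 3)^-1) <= 2 / (m%:R + 4) :> R.
Proof.
move=> m0.
have E1 := bmean_absorb m (fun x => (x%:R + 2)^-1).
have E2 := bmean_absorb m.+1 (fun x => (x%:R - 1) / (x%:R + 1)).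
have E3 := bmean_absorb m.+2 (fun x => (x%:R - 1) * (x%:R - 2) / x%:R).
have F1 : bmean m (fun x => (x%:R + 3)^-1) = bmean m (fun x => (x.+1%:R + 2)^-1) :> R.
  by apply: eq_bmean => x; rewrite -natr1; congr (_^-1); ring.
have F2 : bmean m.+1 (fun x => x%:R / (x%:R + 2)) = bmean m.+1 (fun x => (x.+1%:R - 1) / (x.+1%:R + 1)) :> R.
  by apply: eq_bmean => x; rewrite -natr1; congr (_ / _); ring.
have F3 : bmean m.+2 (fun x => x%:R * ((x%:R - 1) / (x%:R + 1))) =
   bmean m.+2 (fun x => (x.+1%:R - 1) * (x.+1%:R - 2) / x.+1%:R) :> R.
  apply: eq_bmean => x; rewrite -natr1 mulrA; congr (_ / _); ring.
have F4 : bmean m.+3 (fun x => x%:R * ((x%:R - 1) * (x%:R - 2) / x%:R)) <=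
   bmean m.+3 (fun x => x%:R ^+ 2 - 3 * x%:R + 2) :> R.
  apply: bmean_le => -[|x] _; first by rewrite mul0r; lra.
  by rewrite mulrC mulfVK ?pnatr_eq0 //; lra.
rewrite -F3 in E3; rewrite -F2 in E2; rewrite -F1 in E1.
move: F4; rewrite E3 E2 E1 bmeanD bmeanB bmean_sqr bmeanZ bmean_id bmean_cst -(natr1 m.+2) -(natr1 m.+1) -(natr1 m).
set B := bmean m _ => F4.
have M1 : 1 <= m%:R :> R by rewrite ler1n.
rewrite ler_pdivlMr; last by lra.
have P0 : 0 < (m%:R + 1) * (m%:R + 2) * (m%:R + 3) :> R by rewrite !mulr_gt0 //; lra.
rewrite -(ler_pM2r P0).
have : B * ((m%:R + 1) * (m%:R + 2) * (m%:R + 3)) <= 2 * (m%:R ^+ 2 + m%:R + 2). by lra.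
move=> /(@ler_wpM2r _ (m%:R + 4)) => /(_ ltac:(lra)).
by nra.
Qed.

(** Four absorptions, as in [bmean_inv3], reduce the mean to E (Y-2)(Y-3) with [m + 4] trials, up to
    Y = 0. The shifts 5 and 11/2 are those at which the induction of [ddalpha_bound] closes. *)
Lemma bmean_inv34 m : (1 < m)%N ->
  bmean m (fun x => ((x%:R + 3) * (x%:R + 4))^-1) <= 4 / ((m%:R + 5) * (m%:R + 11 / 2)) :> R.
Proof.
move=> m0.
have E1 := bmean_absorb m (fun x => ((x%:R + 2) * (x%:R + 3))^-1).
have E2 := bmean_absorb m.+1 (fun x => (x%:R - 1) / ((x%:R + 1) * (x%:R + 2))).
have E3 := bmean_absorb m.+2 (fun x => (x%:R - 1) * (x%:R - 2) / (x%:R * (x%:R + 1))).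
have E4 := bmean_absorb m.+3 (fun x => (x%:R - 1) * (x%:R - 2) * (x%:R - 3) / ((x%:R - 1) * x%:R)).
have F1 : bmean m (fun x => ((x%:R + 3) * (x%:R + 4))^-1) = bmean m (fun x => ((x.+1%:R + 2) * (x.+1%:R + 3))^-1) :> R.
  by apply: eq_bmean => x; rewrite -natr1; congr (_^-1); ring.
have F2 : bmean m.+1 (fun x => x%:R * ((x%:R + 2) * (x%:R + 3))^-1) =
    bmean m.+1 (fun x => (x.+1%:R - 1) / ((x.+1%:R + 1) * (x.+1%:R + 2))) :> R.
  by apply: eq_bmean => x; rewrite -natr1; congr (_ / _); ring.
have F3 : bmean m.+2 (fun x => x%:R * ((x%:R - 1) / ((x%:R + 1) * (x%:R + 2)))) =
   bmean m.+2 (fun x => (x.+1%:R - 1) * (x.+1%:R - 2) / (x.+1%:R * (x.+1%:R + 1))) :> R.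
  by apply: eq_bmean => x; rewrite -natr1 mulrA; congr (_ / _); ring.
have F4 : bmean m.+3 (fun x => x%:R * ((x%:R - 1) * (x%:R - 2) / (x%:R * (x%:R + 1)))) =
   bmean m.+3 (fun x => (x.+1%:R - 1) * (x.+1%:R - 2) * (x.+1%:R - 3) / ((x.+1%:R - 1) * x.+1%:R)) :> R.
  by apply: eq_bmean => x; rewrite -natr1 mulrA; congr (_ / _); ring.
have F5 : bmean m.+4 (fun x => x%:R * ((x%:R - 1) * (x%:R - 2) * (x%:R - 3) / ((x%:R - 1) * x%:R))) <=
   bmean m.+4 (fun x => x%:R ^+ 2 - 5 * x%:R + 6) :> R.
  apply: bmean_le => -[|[|x]] _; first by rewrite mul0r; lra.
    by rewrite subrr !(mul0r, mulr0); lra.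
  rewrite -(natr1 x.+1) -(natr1 x) le_eqVlt; apply/orP; left; apply/eqP; field.
  by apply/andP; split; apply/eqP; have := ler0n R x; lra.
rewrite -F4 in E4; rewrite -F3 in E3; rewrite -F2 in E2; rewrite -F1 in E1.
move: F5; rewrite E4 E3 E2 E1 bmeanD bmeanB bmean_sqr bmeanZ bmean_id bmean_cst -(natr1 m.+3) -(natr1 m.+2) -(natr1 m.+1) -(natr1 m).
set B := bmean m _ => F5.
have M1 : 2 <= m%:R :> R by rewrite ler_nat.
rewrite ler_pdivlMr; last by nra.
pose P : R := (m%:R + 1) * (m%:R + 2) * (m%:R + 3) * (m%:R + 4).
have P0 : 0 < P by rewrite /P !mulr_gt0 //; lra.
rewrite -(ler_pM2r P0).
have : B * P <= 4 * (m%:R ^+ 2 - m%:R + 4) by rewrite /P; lra.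
move=> /(@ler_wpM2r _ ((m%:R + 5) * (m%:R + 11 / 2))) => /(_ ltac:(nra)).
rewrite /P; nra.
Qed.
End Increments.

(** * Decay of the first and second differences of the normalised sequence *)

Section Alpha.
Variable R : realType.
Implicit Types (phi psi : nat -> R).

(* The normalisation that kills the linear term: alpha n = log4 n + f (log4 n) + O(1/n) with f periodic. *)
Definition alpha (n : nat) : R := 3 * EL R n - 4 * n%:R + 1.

(* Differencing twice in the number of trials turns x./2 into its increment with a factor 1/4; this
   is what makes the differences of alpha contract. *)
Lemma bmean_half_incr m phi :
  bmean m.+2 (fun x => phi x./2) - bmean m.+1 (fun x => phi x./2) =
  bmean m (fun x => phi (x./2).+1 - phi x./2) / 4.
Proof.
by rewrite !bmeanS bmeanB /=; field.
Qed.

Lemma bmean_half m : bmean m.+1 (fun x => (x./2).+1%:R) = m%:R / 4 + 1 :> R.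
Proof.
elim: m => [|m IH]; first by rewrite /= mul0r add0r; field.
have := bmean_half_incr m (fun k => k.+1%:R); rewrite IH.
rewrite [X in _ = X / 4](eq_bmean _ (psi' := fun=> 1)); last by move=> x; rewrite /= -(natr1 (x ./2).+1) addrAC subrr add0r.
rewrite bmean_cst -natr1; lra.
Qed.

Lemma alpha1 : alpha 1 = 0.
Proof. by rewrite /alpha EL1; ring. Qed.

Lemma alpha2 : alpha 2 = 2.
Proof. by rewrite /alpha EL_rec /= EL1; ring. Qed.

Lemma alpha_rec n : alpha n.+3 = 1 + bmean n.+1 (fun x => alpha (x./2).+1).
Proof.
rewrite /alpha EL_rec bmeanD bmeanB !bmeanZ bmean_cst bmean_half.
by rewrite -(natr1 n.+2) -(natr1 n.+1) -(natr1 n); field.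
Qed.

Definition dalpha n : R := alpha n.+1 - alpha n.
Definition ddalpha n : R := dalpha n.+1 - dalpha n.

Lemma dalpha_rec n : dalpha n.+3 = bmean n (fun x => dalpha (x./2).+1) / 4.
Proof.
rewrite /dalpha !alpha_rec opprD addrACA subrr add0r.
exact: (bmean_half_incr n (fun k => alpha k.+1)).
Qed.

Lemma ddalpha_rec n : ddalpha n.+4 = bmean n (fun x => ddalpha (x./2).+1) / 16.
Proof.
rewrite /ddalpha !dalpha_rec -mulrBl (bmean_half_incr n (fun k => dalpha k.+1)).
rewrite -mulrA -invfM; congr (_ / _); ring.
Qed.

Lemma half_bounds (x : nat) : (x%:R - 1 <= 2 * x./2%:R :> R) && (2 * x./2%:R <= x%:R :> R).
Proof.
have : (x <= 2 * x./2 + 1 /\ 2 * x./2 <= x)%N by lia.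
rewrite -!(ler_nat R) natrD natrM; lra.
Qed.

(** The induction keeps the same constant: C/(x./2 + 2) is at most 2C/(x + 3), its mean is at most
    4C/(n + 4), and the factor 1/4 of the recursion gives C/(n + 4), the claim at index [n + 3]. The
    indices below 4 fix [C]. *)
Lemma dalpha_bound : exists2 C : R, 0 <= C & forall n, (0 < n)%N -> `|dalpha n| <= C / (n%:R + 1).
Proof.
have [C C0 Cb] : exists2 C : R, 0 <= C & forall n, (0 < n < 4)%N -> `|dalpha n| <= C / (n%:R + 1).
  have [n1 n2 n3] : [/\ 0 <= `|dalpha 1|, 0 <= `|dalpha 2| & 0 <= `|dalpha 3|] by [].
  exists (2 * `|dalpha 1| + 3 * `|dalpha 2| + 4 * `|dalpha 3|); first by lra.
  by case=> [|[|[|[|//]]]] // _; rewrite ler_pdivlMr; lra.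
exists C => // n; elim/ltn_ind: n => n IH n0.
have [n4|n4] := leqP 4 n; last by apply: Cb; rewrite n0.
case: n n4 IH {n0} => [|[|[|n]]] // n4 IH.
rewrite dalpha_rec normrM (ger0_norm (x := 4^-1)) //.
have : `|bmean n (fun x => dalpha (x./2).+1)| <= bmean n (fun x => (2 * C) * (x%:R + 3)^-1).
  apply: bmean_norm => x xn; apply: le_trans (IH _ _ _) _ => //; first by lia.
  have /andP[h1 h2] := half_bounds x.
  have x0 := ler0n R x.
  rewrite -natr1 ler_pdivrMr; last by have := ler0n R x./2; lra.
  rewrite mulrAC ler_pdivlMr; last lra.
  have : x%:R + 3 <= 2 * (x./2%:R + 1 + 1) :> R by lra.
  by move/(ler_wpM2l C0); lra.
rewrite bmeanZ => H.
have n0 : (0 < n)%N by lia.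
have := ler_wpM2l (_ : 0 <= 2 * C) (bmean_inv3 R n0) => /(_ ltac:(lra)) H2.
rewrite -(natr1 n.+2) -(natr1 n.+1) -(natr1 n).
have -> : C / (n%:R + 1 + 1 + 1 + 1) = 2 * C * (2 / (n%:R + 4)) / 4.
  by field; have := ler0n R n => ?; lra_neq0.
by rewrite ler_pM2r ?invr_gt0 //; apply: le_trans H H2.
Qed.

(** The induction runs on the bound C/((n + 1)(n + 3/2)), which reproduces itself: since x./2 >= (x
    - 1)/2, its value at x./2 + 1 is at most 4C/((x + 3)(x + 4)), and [bmean_inv34] with the factor
    1/16 gives C/((n + 5)(n + 11/2)), the claim at index [n + 4]. *)
Lemma ddalpha_bound : exists2 C : R, 0 <= C & forall n, (0 < n)%N -> `|ddalpha n| <= C / (n%:R * (n%:R + 1)).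
Proof.
have [C C0 Cb] : exists2 C : R, 0 <= C &
    forall n, (n < 6)%N -> `|ddalpha n| <= C / ((n%:R + 1) * (n%:R + 3 / 2)).
  exists (\sum_(i < 6) (`|ddalpha i| * ((i%:R + 1) * (i%:R + 3 / 2)))).
    by apply: sumr_ge0 => i _; rewrite mulr_ge0 // mulr_ge0 //; have := ler0n R i; lra.
  move=> n n6.
  rewrite ler_pdivlMr; last by rewrite mulr_gt0 //; have := ler0n R n; lra.
  rewrite (bigD1 (Ordinal n6)) //= lerDl; apply: sumr_ge0 => i _.
  by rewrite mulr_ge0 // mulr_ge0 //; have := ler0n R i; lra.
suff H n : (0 < n)%N -> `|ddalpha n| <= C / ((n%:R + 1) * (n%:R + 3 / 2)).
  exists C => // n n0; apply: le_trans (H _ n0) _.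
  have n1 : 1 <= n%:R :> R by rewrite ler1n.
  apply: ler_wpM2l => //; rewrite lef_pV2 ?posrE; nra.
elim/ltn_ind: n => n IH n0.
have [n6|n6] := leqP 6 n; last exact: Cb.
case: n n6 IH {n0} => [|[|[|[|n]]]] // n6 IH.
rewrite ddalpha_rec normrM (ger0_norm (x := 16^-1)) //.
have : `|bmean n (fun x => ddalpha (x./2).+1)| <= bmean n (fun x => (4 * C) * ((x%:R + 3) * (x%:R + 4))^-1).
  apply: bmean_norm => x xn; apply: le_trans (IH _ _ _) _ => //; first by lia.
  have /andP[h1 h2] := half_bounds x.
  have x0 := ler0n R x; have hx0 := ler0n R x./2.
  rewrite -natr1 ler_pdivrMr; last by rewrite mulr_gt0 //; lra.
  rewrite mulrAC ler_pdivlMr; last by rewrite mulr_gt0 //; lra.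
  rewrite [4 * C]mulrC -!mulrA ler_wpM2l //.
  have : (x%:R + 3) * (x%:R + 4) <= (2 * (x./2%:R + 1 + 1)) * (2 * (x./2%:R + 1 + 3 / 2)) :> R.
    by apply: ler_pM; lra.
  by lra.
rewrite bmeanZ => H.
have n1 : (1 < n)%N by lia.
have := ler_wpM2l (_ : 0 <= 4 * C) (bmean_inv34 R n1) => /(_ ltac:(lra)) H2.
rewrite -(natr1 n.+3) -(natr1 n.+2) -(natr1 n.+1) -(natr1 n).
have -> : C / ((n%:R + 1 + 1 + 1 + 1 + 1) * (n%:R + 1 + 1 + 1 + 1 + 3 / 2)) =
   4 * C * (4 / ((n%:R + 5) * (n%:R + 11 / 2))) / 16.
  by field; have := ler0n R n => ?; lra_neq0.
by rewrite ler_pM2r ?invr_gt0 //; apply: le_trans H H2.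
Qed.
End Alpha.

(** * Taylor expansion of the sequence and its behaviour under multiplication by 4 *)

Section Taylor.
Variable R : realType.
Local Notation alpha := (@alpha R).
Local Notation dalpha := (@dalpha R).

Lemma dalpha_diff : exists2 C : R, 0 <= C & forall m n, (0 < m)%N -> (m <= n)%N ->
  `|dalpha n - dalpha m| <= C * (m%:R^-1 - n%:R^-1).
Proof.
have [C C0 HC] := @ddalpha_bound R; exists C => // m n m0 mn.
rewrite -(subnKC mn); elim: (n - m)%N => [|p IH]; first by rewrite addn0 !subrr normr0 mulr0.
have E : dalpha (m + p.+1)%N - dalpha m = ddalpha R (m + p)%N + (dalpha (m + p)%N - dalpha m).
  by rewrite /ddalpha addnS; ring.
rewrite E; apply: le_trans (ler_normD _ _) _.
have p0 : (0 < m + p)%N by lia.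
have := HC _ p0; move: IH.
have mp : 1 <= (m + p)%:R :> R by rewrite ler1n.
have -> : (m + p.+1)%:R = (m + p)%:R + 1 :> R by rewrite addnS -natr1.
have -> : C / ((m + p)%:R * ((m + p)%:R + 1)) = C * ((m + p)%:R^-1 - ((m + p)%:R + 1)^-1).
  by field; lra_neq0.
lra.
Qed.

(** Summing [dalpha_diff] between [n] and [k] gives |k - n| |1/n - 1/k|. The exact denominator
    [n k], valid also for [k] far from [n], allows the remainder to be averaged over all values of a
    binomial variable. *)
Lemma alpha_taylor : exists2 C : R, 0 <= C & forall k n, (0 < k)%N -> (0 < n)%N ->
  `|alpha k - alpha n - (k%:R - n%:R) * dalpha n| <= C * (k%:R - n%:R) ^+ 2 / (n%:R * k%:R).
Proof.
have [C C0 HC] := dalpha_diff; exists C => // k n k0 n0.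
have k1 : 1 <= k%:R :> R by rewrite ler1n.
have n1 : 1 <= n%:R :> R by rewrite ler1n.
have inv_diff (a b : R) : 1 <= a -> 1 <= b -> a^-1 - b^-1 = (b - a) / (a * b).
  by move=> a1 b1; field; lra_neq0.
have [nk|kn] := leqP n k.
  have Hp q : (n + q <= k)%N ->
     `|alpha (n + q)%N - alpha n - q%:R * dalpha n| <= q%:R * (C * (n%:R^-1 - k%:R^-1)).
    elim: q => [|q IH] qk; first by rewrite addn0 subrr !mul0r subr0 normr0.
    have -> : alpha (n + q.+1)%N - alpha n - q.+1%:R * dalpha n =
        (dalpha (n + q)%N - dalpha n) + (alpha (n + q)%N - alpha n - q%:R * dalpha n).
      by rewrite /dalpha addnS -natr1; ring.
    apply: le_trans (ler_normD _ _) _; rewrite -(natr1 q) mulrDl mul1r addrC.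
    apply: lerD; first by apply: IH; lia.
    apply: le_trans (HC _ _ _ (leq_addr _ _)) _ => //.
    apply: ler_wpM2l => //; apply: lerB => //.
    by rewrite lef_pV2 ?posrE ?ltr0n ?ler_nat; lia.
  have := Hp (k - n)%N; rewrite subnKC // leqnn natrB // => /(_ isT) /le_trans; apply.
  by rewrite inv_diff // expr2 le_eqVlt; apply/orP; left; apply/eqP; ring.
have Hp q : (k + q <= n)%N ->
   `|alpha (k + q)%N - alpha k - q%:R * dalpha n| <= q%:R * (C * (k%:R^-1 - n%:R^-1)).
  elim: q => [|q IH] qk; first by rewrite addn0 subrr !mul0r subr0 normr0.
  have -> : alpha (k + q.+1)%N - alpha k - q.+1%:R * dalpha n =
      (dalpha (k + q)%N - dalpha n) + (alpha (k + q)%N - alpha k - q%:R * dalpha n).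
    by rewrite /dalpha addnS -natr1; ring.
  apply: le_trans (ler_normD _ _) _; rewrite -(natr1 q) mulrDl mul1r addrC.
  apply: lerD; first by apply: IH; lia.
  rewrite distrC; apply: le_trans (HC _ _ _ _) _; [lia|lia|].
  apply: ler_wpM2l => //; apply: lerB => //.
  by rewrite lef_pV2 ?posrE ?ltr0n ?ler_nat; lia.
have := Hp (n - k)%N; rewrite subnKC ?(ltnW kn) // leqnn natrB ?(ltnW kn) // => /(_ isT).
have -> : alpha n - alpha k - (n%:R - k%:R) * dalpha n =
    - (alpha k - alpha n - (k%:R - n%:R) * dalpha n) by ring.
rewrite normrN => /le_trans; apply.
by rewrite inv_diff // expr2 le_eqVlt; apply/orP; left; apply/eqP; field; lra_neq0.
Qed.

(** Taylor expansion at [n] under the recursion: the mean of [(x./2).+1] differs from [n] by at most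
    1, so the linear term is O(1/n), and the quadratic remainder is a variance of order n over a
    product of order n^2. The range [i <= 3] is that of the last base-4 digit in [floor4S]. *)
Lemma alpha_scale : exists2 C : R, 0 <= C & forall n i, (0 < n)%N -> (i <= 3)%N ->
  `|alpha (4 * n + i)%N - 1 - alpha n| <= C / n%:R.
Proof.
have [C C0 HC] := alpha_taylor; have [D D0 HD] := @dalpha_bound R.
exists (D + 9 * C); first lra.
move=> n i n0 i3.
have n1 : 1 <= n%:R :> R by rewrite ler1n.
have [m Em] : exists m, (4 * n + i = m.+3)%N by exists (4 * n + i - 3)%N; lia.
have EmR : 4 * n%:R + i%:R = m%:R + 3 :> R by rewrite -natrM -!natrD Em; congr (_%:R); lia.
have [i0R i3R] : (0 <= i%:R :> R) /\ (i%:R <= 3 :> R) by rewrite ler0n ler_nat.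
pose k (x : nat) := (x./2).+1.
rewrite Em alpha_rec (_ : 1 + _ - 1 - alpha n = bmean m.+1 (fun x => alpha (k x)) - alpha n); last by ring.
have E : bmean m.+1 (fun x => alpha (k x)) - alpha n =
   bmean m.+1 (fun x => alpha (k x) - alpha n - ((k x)%:R - n%:R) * dalpha n) +
   (m%:R / 4 + 1 - n%:R) * dalpha n.
  rewrite bmeanB bmeanB bmean_cst.
  have -> : bmean m.+1 (fun x => ((k x)%:R - n%:R) * dalpha n) = (m%:R / 4 + 1 - n%:R) * dalpha n.
    rewrite -(bmean_half R m) -(bmean_cst m.+1 n%:R) -bmeanB mulrC -bmeanZ.
    by apply: eq_bmean => x; rewrite bmean_cst mulrC.
  by ring.
rewrite E; apply: le_trans (ler_normD _ _) _; rewrite addrC [(D + _) / _]mulrDl; apply: lerD.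
  rewrite normrM; have := HD _ n0.
  have h1 : `|m%:R / 4 + 1 - n%:R| <= 1 :> R by rewrite ler_norml; lra.
  move=> h2; apply: le_trans (ler_pM _ _ h1 h2) _ => //; rewrite mul1r.
  apply: ler_wpM2l => //; rewrite lef_pV2 ?posrE; lra.
(* Polynomial division by [x + 1] leaves a linear part with known mean and a multiple of 1/(x + 1),
   bounded by [bmean_inv1]; their contributions of order [m] cancel. The 8 absorbs the rounding in
   [x./2] and the offset between [m] and [4 n]. *)
have HX : bmean m.+1 (fun x => (((x%:R - m.+1%:R / 2) ^+ 2 + 8) / (x%:R + 1))) <= 9 :> R.
  have M0 := ler0n R m.
  have EX x : ((x%:R - m.+1%:R / 2) ^+ 2 + 8) / (x%:R + 1) =
     x%:R - (m%:R + 2) + ((m%:R + 3) ^+ 2 / 4 + 8) * x.+1%:R^-1 :> R.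
    rewrite -(natr1 m) -(natr1 x); have := ler0n R x => ?; field; lra_neq0.
  rewrite (eq_bmean _ EX) bmeanD bmeanB bmean_id bmean_cst bmeanZ.
  have := bmean_inv1 R m.+1; rewrite -(natr1 m.+1) -(natr1 m).
  have c0 : 0 <= (m%:R + 3) ^+ 2 / 4 + 8 :> R by rewrite addr_ge0 // divr_ge0 // sqr_ge0.
  move/(ler_wpM2l c0) => H; apply: le_trans (lerD (lexx _) H) _.
  have -> : (m%:R + 1) / 2 - (m%:R + 2) + ((m%:R + 3) ^+ 2 / 4 + 8) * (2 / (m%:R + 1 + 1)) =
     ((m%:R + 1) / 2 * (m%:R + 2) - (m%:R + 2) ^+ 2 + (m%:R + 3) ^+ 2 / 2 + 16) / (m%:R + 2) :> R.
    by field; lra_neq0.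
  by rewrite ler_pdivrMr; nra.
apply: (@le_trans _ _ (bmean m.+1 (fun x => C / n%:R * (((x%:R - m.+1%:R / 2) ^+ 2 + 8) / (x%:R + 1))))).
  apply: bmean_norm => x xm; apply: le_trans (HC _ _ _ n0) _ => //.
  have /andP[h1 h2] := half_bounds R x.
  have x0 := ler0n R x.
  have kE : (k x)%:R = x./2%:R + 1 :> R by rewrite /k -natr1.
  have k0 : (x%:R + 1) / 2 <= (k x)%:R :> R by rewrite kE; lra.
  have -> : C * ((k x)%:R - n%:R) ^+ 2 / (n%:R * (k x)%:R) = C / n%:R * (((k x)%:R - n%:R) ^+ 2 / (k x)%:R).
    by field; lra_neq0.
  apply: ler_wpM2l; first by rewrite divr_ge0 //; lra.
  have h3 : ((k x)%:R - n%:R) ^+ 2 <= ((x%:R - m.+1%:R / 2) ^+ 2 + 8) / 2 :> R.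
    set q : R := x%:R - _.
    have : `|(k x)%:R - n%:R| <= `|q| / 2 + 5 / 4 :> R.
      have -> : (k x)%:R - n%:R = q / 2 + ((k x)%:R - n%:R - q / 2) by ring.
      apply: le_trans (ler_normD _ _) _; rewrite normrM (ger0_norm (x := 2^-1)) // lerD2l.
      by rewrite ler_norml /q kE -natr1; lra.
    move=> H; rewrite -real_normK ?num_real // -[q ^+ 2]real_normK ?num_real //.
    have : `|(k x)%:R - n%:R| ^+ 2 <= (`|q| / 2 + 5 / 4) ^+ 2 :> R by rewrite lerXn2r ?nnegrE // addr_ge0 ?divr_ge0.
    by have := sqr_ge0 (`|q| / 2 - 5 / 4); lra.
  apply: le_trans (ler_pM _ _ h3 (_ : _ <= ((x%:R + 1) / 2)^-1)) _; rewrite ?sqr_ge0 ?invr_ge0 ?ler0n //.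
    by rewrite lef_pV2 ?posrE //; lra.
  by rewrite le_eqVlt; apply/orP; left; apply/eqP; field; lra_neq0.
rewrite bmeanZ; apply: le_trans (ler_wpM2l _ HX) _; first by rewrite divr_ge0 //; lra.
by rewrite le_eqVlt; apply/orP; left; apply/eqP; ring.
Qed.
End Taylor.

(** * The periodic limit *)

Section PeriodicLimit.
Variable R : realType.
Implicit Types (x y h : R).

Definition pow4 y : R := expR (y * ln 4).

Lemma ln4_gt0 : 0 < ln 4 :> R.
Proof. by rewrite ln_gt0 //; lra. Qed.

Lemma pow4_gt0 y : 0 < pow4 y. Proof. exact: expR_gt0. Qed.

Lemma pow4D x y : pow4 (x + y) = pow4 x * pow4 y.
Proof. by rewrite /pow4 mulrDl expRD. Qed.

Lemma pow4_1 : pow4 1 = 4.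
Proof. by rewrite /pow4 mul1r lnK // posrE; lra. Qed.

Lemma pow4_0 : pow4 0 = 1.
Proof. by rewrite /pow4 mul0r expR0. Qed.

Lemma pow4N y : pow4 (- y) = (pow4 y)^-1.
Proof. by rewrite /pow4 mulNr expRN. Qed.

Lemma pow4_nat (j : nat) : pow4 j%:R = 4 ^+ j.
Proof.
elim: j => [|j IH]; first exact: pow4_0.
by rewrite -natr1 pow4D IH pow4_1 exprS mulrC.
Qed.

Lemma ler_pow4 x y : x <= y -> pow4 x <= pow4 y.
Proof. by move=> xy; rewrite /pow4 ler_expR ler_wpM2r // ltW // ln4_gt0. Qed.

Lemma pow4_ge1 y : 0 <= y -> 1 <= pow4 y.
Proof. by move=> /ler_pow4; rewrite pow4_0. Qed.

Lemma pow4_log4 (n : nat) : (0 < n)%N -> pow4 (log4 (n%:R : R)) = n%:R.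
Proof. by move=> n0; rewrite /pow4 /log4 mulfVK ?gt_eqF ?ln4_gt0 // lnK // posrE ltr0n. Qed.

Definition floor4 y : nat := Num.truncn (pow4 y).

Lemma floor4P y : 0 <= y -> [/\ (0 < floor4 y)%N, (floor4 y)%:R <= pow4 y & pow4 y < (floor4 y)%:R + 1].
Proof.
move=> y0; have /andP[h1 h2] := truncn_itv (ltW (pow4_gt0 y)).
rewrite -natr1 in h2; split => //.
rewrite lt0n; apply/eqP => E; move: h2; rewrite -/(floor4 y) E.
have := pow4_ge1 y0; lra.
Qed.

Lemma floor4_log4 (n : nat) : (0 < n)%N -> floor4 (log4 (n%:R : R)) = n.
Proof. by move=> n0; rewrite /floor4 pow4_log4 //; apply: truncn_def; rewrite lexx ltr_nat ltnSn. Qed.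

Lemma floor4S y : 0 <= y -> exists2 i, (i <= 3)%N & floor4 (y + 1) = (4 * floor4 y + i)%N.
Proof.
move=> y0; have [p1 p2 p3] := floor4P y0.
have y1 : 0 <= y + 1 by lra.
have [q1 q2 q3] := floor4P y1.
have E : pow4 (y + 1) = 4 * pow4 y by rewrite pow4D pow4_1 mulrC.
rewrite E in q2 q3.
have h1 : (4 * floor4 y < (floor4 (y + 1)%R).+1)%N.
  by rewrite -(ltr_nat R) natrM -natr1; lra.
have h2 : (floor4 (y + 1)%R < 4 * (floor4 y).+1)%N.
  by rewrite -(ltr_nat R) natrM -natr1; lra.
by exists (floor4 (y + 1)%R - 4 * floor4 y)%N; lia.
Qed.

Definition osc y : R := alpha R (floor4 y) - y.

Lemma osc_step : exists2 K : R, 0 <= K & forall y, 0 <= y -> `|osc (y + 1) - osc y| <= K / pow4 y.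
Proof.
have [C C0 HC] := @alpha_scale R; exists (2 * C); first lra.
move=> y y0; have [p1 p2 p3] := floor4P y0.
have [i i3 E] := floor4S y0.
have -> : osc (y + 1) - osc y = alpha R (4 * floor4 y + i)%N - 1 - alpha R (floor4 y).
  by rewrite /osc E; ring.
apply: le_trans (HC _ _ p1 i3) _.
have f1 : 1 <= (floor4 y)%:R :> R by rewrite ler1n.
rewrite ler_pdivrMr; last lra.
rewrite mulrAC ler_pdivlMr ?pow4_gt0 //.
have : pow4 y <= 2 * (floor4 y)%:R by lra.
by move/(ler_wpM2l C0); lra.
Qed.

(* f y is the limit of osc (y + j), which is Cauchy by osc_step. *)
Lemma periodic_limit : exists f : R -> R, (forall x, f (x + 1) = f x) /\
  exists2 K : R, 0 <= K & forall y, 0 <= y -> `|f y - osc y| <= K / pow4 y.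
Proof.
have [K K0 HK] := osc_step.
have H0 y : 0 <= y -> exists2 l, tends (fun j => osc (y + j%:R)) l & `|l - osc y| <= 2 * (K / pow4 y).
  move=> y0.
  have [|l h1 h2] := @geometric_tends R (fun j => osc (y + j%:R)) (K / pow4 y); last first.
    by exists l => //; move: h2; rewrite addr0.
  move=> j; rewrite -natr1 addrA.
  have yj : 0 <= y + j%:R by rewrite addr_ge0.
  apply: le_trans (HK _ yj) _; rewrite pow4D pow4_nat invfM mulrA.
  exact: lexx.
have H x : exists l, tends (fun j => osc (x + j%:R)) l.
  pose k := Num.truncn `|x|.
  have xk : 0 <= x + k.+1%:R.
    have /andP[_ h2] := truncn_itv (normr_ge0 x).
    by have := ler_norm (- x); rewrite normrN /k; lra.
  have [l hl _] := H0 _ xk; exists l; apply/(tends_shift _ _ k.+1).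
  by apply: (eq_tends hl) => n; rewrite natrD addrA addrAC.
pose f x := projT1 (cid (H x)).
have Hf x : tends (fun j => osc (x + j%:R)) (f x) by rewrite /f; case: cid.
exists f; split.
  move=> x; apply: (tends_uniq (Hf _)).
  apply: (eq_tends ((tends_shift _ _ 1).2 (Hf x))) => n.
  by rewrite natrD -addrA [1 + _]addrC.
exists (2 * K); first lra.
move=> y y0; have [l hl bl] := H0 _ y0.
by rewrite (tends_uniq (Hf y) hl); apply: le_trans bl _; rewrite mulrA.
Qed.

Lemma expR_m1_le (u : R) : 0 <= u -> expR u - 1 <= u * expR u.
Proof.
move=> u0; have := expR_ge1Dx (- u); rewrite expRN => h.
have e0 := expR_gt0 u.
have := ler_wpM2r (ltW e0) h; rewrite mulVf ?gt_eqF //; lra.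
Qed.

Lemma pow4_m1_le h : 0 <= h <= 1 -> pow4 h - 1 <= 4 * ln 4 * h.
Proof.
move=> /andP[h0 h1]; have l0 := ln4_gt0.
have u0 : 0 <= h * ln 4 by rewrite mulr_ge0 // ltW.
apply: le_trans (expR_m1_le u0) _.
have := ler_pow4 h1; rewrite pow4_1 {1}/pow4.
by move/(ler_wpM2l u0); lra.
Qed.

Lemma pow4_second h : 0 <= h <= 1 -> 0 <= pow4 h - 2 + pow4 (- h) <= 16 * (ln 4) ^+ 2 * h ^+ 2.
Proof.
move=> hh; have /andP[h0 h1] := hh.
have E : pow4 h - 2 + pow4 (- h) = (pow4 h - 1) ^+ 2 / pow4 h.
  by rewrite pow4N; field; rewrite gt_eqF ?pow4_gt0.
have p1 := pow4_ge1 h0.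
rewrite E divr_ge0 ?sqr_ge0 ?(le_trans _ p1) //=.
have b := pow4_m1_le hh.
have b0 : 0 <= pow4 h - 1 by lra.
have : (pow4 h - 1) ^+ 2 <= (4 * ln 4 * h) ^+ 2 by rewrite lerXn2r ?nnegrE // (le_trans b0).
have -> : (4 * ln 4 * h) ^+ 2 = 16 * ln 4 ^+ 2 * h ^+ 2 by ring.
move=> bb; apply: le_trans bb; rewrite ler_pdivrMr; last by lra.
by rewrite ler_peMr ?sqr_ge0.
Qed.
End PeriodicLimit.

(** * Regularity of the periodic limit *)

Section PeriodicRegularity.
Variable R : realType.
Implicit Types (x y h : R).

(** An inequality between values of a periodic function may be tested after a shift by [j]; the
    discretisation errors there are O(4^-j) and disappear in the limit. *)
Lemma limit_pow4 x (a b c : R) :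
  (forall j : nat, 0 <= x + j%:R -> a <= b + c / pow4 (x + j%:R)) -> a <= b.
Proof.
move=> H; have K : null (fun j : nat => c / pow4 x * (4^-1) ^+ j) by apply/nullZ/null_expn; lra.
apply: (null_ge K); exists (Num.truncn `|x|).+1 => j hj.
have xj : 0 <= x + j%:R.
  have /andP[_ h2] := truncn_itv (normr_ge0 x).
  have : (Num.truncn `|x|).+1%:R <= j%:R :> R by rewrite ler_nat.
  by have := ler_norm (- x); rewrite normrN; lra.
apply: le_trans (H _ xj) _; rewrite pow4D pow4_nat exprVn invfM mulrA.
exact: lexx.
Qed.

Lemma periodD (f : R -> R) : (forall x, f (x + 1) = f x) -> forall x (j : nat), f (x + j%:R) = f x.
Proof.
move=> H x; elim=> [|j IH]; first by rewrite addr0.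
by rewrite -natr1 addrA H.
Qed.

Lemma period_int (f : R -> R) : (forall x, f (x + 1) = f x) -> forall x (k : int), f (x + k%:~R) = f x.
Proof.
move=> H x [n|n]; first exact: periodD.
by rewrite NegzE -[RHS](periodD H _ n.+1) mulrNz -pmulrn -(periodD H _ n.+1) addrNK periodD.
Qed.

Lemma alpha_lip : exists2 D : R, 0 <= D & forall m n, (0 < m)%N -> (m <= n)%N ->
  `|alpha R n - alpha R m| <= D * (n%:R - m%:R) / m%:R.
Proof.
have [D D0 HD] := @dalpha_bound R; exists D => // m n m0 mn.
rewrite -(subnKC mn); elim: (n - m)%N => [|p IH].
  by rewrite addn0 !subrr normr0 mulr0 mul0r.
have -> : alpha R (m + p.+1)%N - alpha R m = dalpha R (m + p)%N + (alpha R (m + p)%N - alpha R m).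
  by rewrite /dalpha addnS; ring.
apply: le_trans (ler_normD _ _) _.
have m1 : 1 <= m%:R :> R by rewrite ler1n.
have h : `|dalpha R (m + p)%N| <= D / m%:R.
  apply: le_trans (HD _ _) _; first lia.
  apply: ler_wpM2l => //; rewrite natrD lef_pV2 ?posrE; have := ler0n R p; lra.
have -> : D * ((m + p.+1)%:R - m%:R) / m%:R = D / m%:R + D * ((m + p)%:R - m%:R) / m%:R.
  by rewrite addnS -natr1; ring.
exact: lerD.
Qed.

Section Regularity.
Variables (f : R -> R) (K : R).
Hypothesis f1 : forall x, f (x + 1) = f x.
Hypothesis K0 : 0 <= K.
Hypothesis fK : forall y, 0 <= y -> `|f y - osc y| <= K / pow4 y.

(** [osc] jumps with the floor, but at height [y] the jumps are O(4^-y). Only the Lipschitz part,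
    [alpha_lip] between two floors, survives [limit_pow4]. *)
Lemma lipschitz_unit : exists2 L : R, 0 <= L & forall x h, 0 <= h <= 1 -> `|f (x + h) - f x| <= L * h.
Proof.
have [D D0 HD] := alpha_lip.
have l0 := @ln4_gt0 R.
have c0 : 0 <= 8 * ln 4 * D by rewrite !mulr_ge0 // ltW.
exists (8 * ln 4 * D + 1); first lra.
move=> x h /andP[h0 h1]; apply: (@limit_pow4 x _ _ (2 * D + 2 * K)) => j.
set y := x + j%:R => y0.
have -> : f (x + h) - f x = f (y + h) - f y.
  by rewrite /y -(periodD f1 (x + h) j) -(periodD f1 x j) addrAC.
have yh : 0 <= y + h by lra.
have [p1 p2 p3] := floor4P y0; have [q1 q2 q3] := floor4P yh.
have P0 := pow4_gt0 y.
have P1 := pow4_ge1 y0.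
have mm : (floor4 y <= floor4 (y + h)%R)%N.
  have := ler_pow4 (_ : y <= y + h) => /(_ ltac:(lra)) hh.
  by rewrite -ltnS -(ltr_nat R) -natr1; lra.
have b1 := fK y0; have b2 := fK yh; have b3 := HD _ _ p1 mm.
have b4 : K / pow4 (y + h) <= K / pow4 y.
  by apply: ler_wpM2l => //; rewrite lef_pV2 ?posrE ?pow4_gt0 //; apply: ler_pow4; lra.
have b5 : D * ((floor4 (y + h)%R)%:R - (floor4 y)%:R) / (floor4 y)%:R <= 8 * ln 4 * D * h + 2 * D / pow4 y.
  have m1 : 1 <= (floor4 y)%:R :> R by rewrite ler1n.
  have e1 : pow4 (y + h) <= pow4 y * (1 + 4 * ln 4 * h).
    rewrite pow4D; apply: ler_wpM2l; first exact: ltW.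
    by have := @pow4_m1_le R h; rewrite h0 h1 => /(_ isT); lra.
  rewrite ler_pdivrMr; last lra.
  have -> : (8 * ln 4 * D * h + 2 * D / pow4 y) * (floor4 y)%:R =
     D * ((4 * ln 4 * h + (pow4 y)^-1) * (2 * (floor4 y)%:R)) by ring.
  apply: ler_wpM2l => //.
  have s0 : 0 <= 4 * ln 4 * h + (pow4 y)^-1 by rewrite addr_ge0 ?invr_ge0 ?(ltW P0) // !mulr_ge0 // ltW.
  have s1 : pow4 y <= 2 * (floor4 y)%:R by lra.
  have := ler_wpM2l s0 s1; apply: le_trans.
  rewrite mulrDl mulVf ?gt_eqF //; lra.
have -> : f (y + h) - f y = (f (y + h) - osc (y + h)) - (f y - osc y) +
   (alpha R (floor4 (y + h)%R) - alpha R (floor4 y)) - h by rewrite /osc; ring.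
apply: le_trans (ler_normB _ _) _.
apply: le_trans (lerD (ler_normD _ _) (lexx _)) _.
apply: le_trans (lerD (lerD (ler_normB _ _) (lexx _)) (lexx _)) _.
rewrite (ger0_norm h0).
have -> : (8 * ln 4 * D + 1) * h + (2 * D + 2 * K) / pow4 y =
  8 * ln 4 * D * h + 2 * D / pow4 y + K / pow4 y + K / pow4 y + h by ring.
lra.
Qed.

Lemma period_bdd : exists2 M : R, 0 <= M & forall x, `|f x| <= M.
Proof.
have [L L0 HL] := lipschitz_unit; exists (`|f 0| + L); first by rewrite addr_ge0.
move=> x; have := floor_itv x.
rewrite intrD => /andP[h1 h2].
set k := Num.floor x in h1 h2.
have -> : f x = f (0 + (x - k%:~R)).
  by rewrite add0r -(period_int f1 (x - k%:~R) k); congr f; ring.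
have hh : 0 <= x - k%:~R <= 1 by lra.
have h := HL 0 _ hh.
rewrite -[f (0 + _)](subrK (f 0)); apply: le_trans (ler_normD _ _) _.
rewrite addrC lerD2l; apply: le_trans h _.
by rewrite ler_piMr //; lra.
Qed.

Lemma period_lipschitz : exists2 L : R, 0 <= L & forall x y, `|f x - f y| <= L * `|x - y|.
Proof.
have [L L0 HL] := lipschitz_unit; have [M M0 HM] := period_bdd.
exists (L + 2 * M); first lra.
move=> x y; wlog xy : x y / y <= x.
  move=> H; have [/H //|/ltW/H] := leP y x.
  by rewrite distrC [`|y - x|]distrC.
have h0 : 0 <= x - y by lra.
rewrite (ger0_norm h0); have [h1|h1] := leP (x - y) 1.
  have := HL y (x - y); rewrite h0 h1 => /(_ isT); rewrite (_ : y + (x - y) = x); [move=> h|by ring].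
  by apply: le_trans h _; rewrite mulrDl lerDl mulr_ge0 // mulr_ge0.
apply: le_trans (ler_normB _ _) _; apply: le_trans (lerD (HM x) (HM y)) _.
have h2 : M <= M * (x - y) by rewrite ler_peMr // ltW.
have : 0 <= L * (x - y) by rewrite mulr_ge0.
by lra.
Qed.

Lemma quad_quot_bound (C P Z m m' t s : R) : 0 <= C -> 1 <= P -> 0 <= Z -> 1 <= s -> P / 2 <= m -> P / s <= m' ->
  t <= P ^+ 2 * Z + 2 -> C * t / (m * m') <= C * (2 * s * Z + 4 * s / P).
Proof.
move=> C0 P1 Z0 s1 h1 h2 h3.
have P2 : 0 < P / s by apply: divr_gt0; lra.
have mm : 0 < m * m' by apply: mulr_gt0; lra.
rewrite -mulrA ler_wpM2l // ler_pdivrMr //; apply: le_trans h3 _.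
have u : (P / 2) * (P / s) <= m * m' by apply: ler_pM => //; lra.
have v : 0 <= 2 * s * Z + 4 * s / P.
  by apply: addr_ge0; [apply: mulr_ge0; lra|apply: divr_ge0; lra].
apply: le_trans (ler_wpM2l v u).
have -> : (2 * s * Z + 4 * s / P) * (P / 2 * (P / s)) = P ^+ 2 * Z + 2 * P by field; lra_neq0.
by lra.
Qed.

Lemma floor_sqr_bound (P a Z d : R) : 1 <= P -> 1 <= a -> (a - 1) ^+ 2 <= Z / 2 -> `|d| <= P * (a - 1) + 1 ->
  d ^+ 2 <= P ^+ 2 * Z + 2.
Proof.
move=> P1 a1 aZ dP.
have w : 0 <= P * (a - 1) by apply: mulr_ge0; lra.
have u2 : d ^+ 2 <= (P * (a - 1) + 1) ^+ 2.
  by rewrite -real_normK ?num_real // lerXn2r ?nnegrE //; lra.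
apply: le_trans u2 _; have := ler_wpM2l (sqr_ge0 P) aZ.
by have := sqr_ge0 (P * (a - 1) - 1); lra.
Qed.

Lemma lin_quot_bound (D P Z m q d : R) : 0 <= D -> 1 <= P -> 0 <= Z -> P / 2 <= m + 1 ->
  `|q| <= P * (Z / 2) + 2 -> `|d| <= D / (m + 1) -> `|q * d| <= D * (Z + 4 / P).
Proof.
move=> D0 P1 Z0 Pm hq hd.
rewrite normrM mulrC; apply: le_trans (ler_pM (normr_ge0 _) (normr_ge0 _) hd hq) _.
rewrite -mulrA ler_wpM2l // mulrC ler_pdivrMr; last lra.
have v : 0 <= Z + 4 / P by apply: addr_ge0 => //; apply: divr_ge0; lra.
apply: le_trans (ler_wpM2l v Pm).
by have -> : (Z + 4 / P) * (P / 2) = P * (Z / 2) + 2 by field; lra_neq0.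
Qed.

(** With P = 4^y, expand [alpha] at the floor [m] of P towards the floors of P 4^h and P 4^-h. The
    linear term carries m1 - 2m + m2, which is P (4^h - 2 + 4^-h) = O(P h^2) up to rounding, times
    [dalpha] = O(1/P); the quadratic remainders are O(h^2). All rounding errors are O(1/P) and
    vanish by [limit_pow4]. *)
Lemma second_unit : exists2 S : R, 0 <= S & forall x h, 0 <= h <= 1 -> `|f (x + h) - 2 * f x + f (x - h)| <= S * h ^+ 2.
Proof.
have [C C0 HC] := @alpha_taylor R; have [D D0 HD] := @dalpha_bound R.
have l0 := @ln4_gt0 R.
pose Q : R := 32 * ln 4 ^+ 2.
have Q0 : 0 <= Q by rewrite /Q mulr_ge0 // sqr_ge0.
exists (20 * C * Q + D * Q); first by apply: addr_ge0; [apply: mulr_ge0 => //; exact: mulr_ge0|exact: mulr_ge0].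
move=> x h hh; have /andP[h0 h1] := hh.
(* Starting from [x - 1] keeps [y - h] nonnegative as well, since [y = y0 + 1] and [h <= 1]; the
   price is the factor 4 between the powers at [y] and at [y0]. *)
apply: (@limit_pow4 (x - 1) _ _ (40 * C + 4 * D + 20 * K)) => j; set y0 := x - 1 + j%:R => y00.
set y := y0 + 1.
have yE : y = x + j%:R by rewrite /y /y0; ring.
have -> : f (x + h) - 2 * f x + f (x - h) = f (y + h) - 2 * f y + f (y - h).
  rewrite yE -(periodD f1 (x + h) j) -(periodD f1 x j) -(periodD f1 (x - h) j).
  by congr (f _ - _ + f _); ring.
have ya : 0 <= y by rewrite /y; lra.
have yb : 0 <= y + h by lra.
have yc : 0 <= y - h by rewrite /y; lra.
have [p1 p2 p3] := floor4P ya; have [q1 q2 q3] := floor4P yb; have [r1 r2 r3] := floor4P yc.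
have PE : pow4 y = 4 * pow4 y0 by rewrite /y pow4D pow4_1 mulrC.
have P1 := pow4_ge1 ya.
set P := pow4 y in P1 PE p2 p3.
pose a := pow4 h; pose b := pow4 (- h).
have E1 : pow4 (y + h) = P * a by rewrite pow4D.
have E2 : pow4 (y - h) = P * b by rewrite pow4D.
have ab : a * b = 1 by rewrite /a /b -pow4D subrr pow4_0.
have a1 : 1 <= a by apply: pow4_ge1.
have b0 : 0 < b by apply: pow4_gt0.
have b1 : b <= 1 by rewrite -(mulr1 b) -ab mulrA -{1}(mul1r b); nra.
have b4 : 1 / 4 <= b.
  have : pow4 (- (1 : R)) <= b by apply: ler_pow4; lra.
  by rewrite pow4N pow4_1; lra.
have ah : (a - 1) ^+ 2 <= Q * h ^+ 2 / 2.
  have := pow4_m1_le hh; rewrite -/a => u.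
  have : (a - 1) ^+ 2 <= (4 * ln 4 * h) ^+ 2.
    by rewrite lerXn2r ?nnegrE //; lra.
  by rewrite /Q; lra.
have /andP[s0 s1] := pow4_second hh; rewrite -/a -/b in s0 s1.
rewrite E1 in q2 q3; rewrite E2 in r2 r3.
set m := floor4 y in p1 p2 p3 *; set m1 := floor4 (y + h) in q1 q2 q3 *.
set m2 := floor4 (y - h) in r1 r2 r3 *.
have m_1 : 1 <= m%:R :> R by rewrite ler1n.
have m1_1 : 1 <= m1%:R :> R by rewrite ler1n.
have m2_1 : 1 <= m2%:R :> R by rewrite ler1n.
pose Z := Q * h ^+ 2.
have Z0 : 0 <= Z by rewrite /Z mulr_ge0 // sqr_ge0.
have w1 : P * (1 - b) <= P * (a - 1).
  by apply: ler_wpM2l; [move: P1; clear -f1 K0 fK; lra|move: s0; clear -f1 K0 fK; lra].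
have w2 : 0 <= P * (1 - b) by apply: mulr_ge0; [move: P1; clear -f1 K0 fK; lra|move: b1; clear -f1 K0 fK; lra].
have w3 : P * (a - 2 + b) <= P * (Z / 2).
  by apply: ler_wpM2l; [move: P1; clear -f1 K0 fK; lra|move: s1; rewrite /Z /Q; clear -f1 K0 fK; lra].
have w4 : 0 <= P * (a - 2 + b) by apply: mulr_ge0; [move: P1; clear -f1 K0 fK; lra|move: s0; clear -f1 K0 fK; lra].
have w5 : 0 <= P * (a - 1) by exact: le_trans w2 w1.
have t1 : (m1%:R - m%:R) ^+ 2 <= P ^+ 2 * Z + 2 :> R.
  apply: (floor_sqr_bound P1 a1 ah); rewrite ler_norml; move: p2 p3 q2 q3 w5; clear -f1 K0 fK; lra.
have t2 : (m2%:R - m%:R) ^+ 2 <= P ^+ 2 * Z + 2 :> R.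
  apply: (floor_sqr_bound P1 a1 ah); rewrite ler_norml; move: p2 p3 r2 r3 w1 w2; clear -f1 K0 fK; lra.
have t3 : `|m1%:R - 2 * m%:R + m2%:R| <= P * (Z / 2) + 2 :> R.
  rewrite ler_norml; move: p2 p3 q2 q3 r2 r3 w3 w4; clear -f1 K0 fK; lra.
have P2m : P / 2 <= m%:R by move: p3 m_1; clear -f1 K0 fK; lra.
have P2m1 : P / 2 <= m1%:R.
  have : P <= P * a by rewrite ler_peMr //; move: P1; clear -f1 K0 fK; lra.
  by move: q3 m1_1; clear -f1 K0 fK; lra.
have P8m2 : P / 8 <= m2%:R.
  have : P * (1 / 4) <= P * b by apply: ler_wpM2l => //; move: P1; clear -f1 K0 fK; lra.
  by move: r3 m2_1; clear -f1 K0 fK; lra.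
have B1 := quad_quot_bound C0 P1 Z0 (_ : 1 <= 2) P2m P2m1 t1.
have B2 := quad_quot_bound C0 P1 Z0 (_ : 1 <= 8) P2m P8m2 t2.
have B3 : `|(m1%:R - 2 * m%:R + m2%:R) * dalpha R m| <= D * (Z + 4 / P).
  by apply: (lin_quot_bound D0 P1 Z0 _ t3 (HD _ p1)); move: P2m; clear -f1 K0 fK; lra.
have [G1 G2] := (HC _ _ q1 p1, HC _ _ r1 p1).
have F1 := fK ya; have F2 := fK yb; have F3 := fK yc.
have F2' : K / pow4 (y + h) <= K / P.
  apply: ler_wpM2l => //; rewrite lef_pV2 ?posrE ?pow4_gt0 //.
  by apply: ler_pow4; move: h0; clear -f1 K0 fK; lra.
have F3' : K / pow4 (y - h) <= 4 * (K / P).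
  have -> : 4 * (K / P) = K / (P / 4) by field; move: P1; clear -f1 K0 fK => ?; lra_neq0.
  apply: ler_wpM2l => //; rewrite lef_pV2 ?posrE ?pow4_gt0 // ?divr_gt0 // ?pow4_gt0 //.
  by rewrite E2 ler_wpM2l //; move: P1 b4; clear -f1 K0 fK; lra.
have -> : f (y + h) - 2 * f y + f (y - h) =
  (f (y + h) - osc (y + h)) - 2 * (f y - osc y) + (f (y - h) - osc (y - h)) +
  (alpha R m1 - alpha R m - (m1%:R - m%:R) * dalpha R m) +
  (alpha R m2 - alpha R m - (m2%:R - m%:R) * dalpha R m) +
  (m1%:R - 2 * m%:R + m2%:R) * dalpha R m by rewrite /osc -/m -/m1 -/m2; ring.
have -> : (20 * C * Q + D * Q) * h ^+ 2 + (40 * C + 4 * D + 20 * K) / pow4 y0 =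
   C * (20 * Z) + D * Z + (160 * C + 16 * D + 80 * K) / P.
  by rewrite /Z PE; field; lra_neq0.
have {B1} B1 := le_trans G1 (B1 ltac:(clear -f1 K0 fK; lra)).
have {B2} B2 := le_trans G2 (B2 ltac:(clear -f1 K0 fK; lra)).
have {F2 F2'} F2 := le_trans F2 F2'; have {F3 F3'} F3 := le_trans F3 F3'.
rewrite -/P in F1.
have k0 : 0 <= K / P by rewrite divr_ge0 //; move: P1; clear -f1 K0 fK; lra.
have k1 : 0 <= C / P by rewrite divr_ge0 //; move: P1; clear -f1 K0 fK; lra.
have k2 : 0 <= D / P by rewrite divr_ge0 //; move: P1; clear -f1 K0 fK; lra.
apply: le_trans (ler_normD _ _) _; apply: le_trans (lerD (ler_normD _ _) B3) _.
apply: le_trans (lerD (lerD (ler_normD _ _) B2) (lexx _)) _.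
apply: le_trans (lerD (lerD (lerD (ler_normD _ _) B1) (lexx _)) (lexx _)) _.
apply: le_trans (lerD (lerD (lerD (lerD (ler_normB _ _) F3) (lexx _)) (lexx _)) (lexx _)) _.
rewrite normrM (ger0_norm (x := 2)) //.
have -> : C * (2 * 2 * Z + 4 * 2 / P) = C * (4 * Z) + 8 * (C / P) by ring.
have -> : C * (2 * 8 * Z + 4 * 8 / P) = C * (16 * Z) + 32 * (C / P) by ring.
have -> : D * (Z + 4 / P) = D * Z + 4 * (D / P) by ring.
have -> : (160 * C + 16 * D + 80 * K) / P = 160 * (C / P) + 16 * (D / P) + 80 * (K / P) by ring.
have -> : C * (20 * Z) = C * (4 * Z) + C * (16 * Z) by ring.
move: F1 F2 k0 k1 k2; clear -f1 K0 fK; lra.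
Qed.

Lemma period_second : exists2 S : R, 0 <= S & forall x h, `|f (x + h) - 2 * f x + f (x - h)| <= S * h ^+ 2.
Proof.
have [S S0 HS] := second_unit; have [M M0 HM] := period_bdd.
exists (S + 4 * M); first lra.
move=> x h; wlog h0 : h / 0 <= h.
  move=> H; have [/H //|/ltW h0] := leP 0 h.
  have := H (- h); rewrite oppr_ge0 opprK sqrrN => /(_ h0).
  by rewrite (_ : f (x - h) - 2 * f x + f (x + h) = f (x + h) - 2 * f x + f (x - h)); last ring.
have [h1|h1] := leP h 1.
  have := HS x h; rewrite h0 h1 => /(_ isT) /le_trans; apply.
  by rewrite ler_wpM2r ?sqr_ge0 //; lra.
have h2 : 1 <= h ^+ 2 by rewrite expr2; nra.
have := ler_wpM2l M0 h2; rewrite mulr1 => h3.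
have h4 : 0 <= S * h ^+ 2 by rewrite mulr_ge0 // sqr_ge0.
move: (HM (x + h)) (HM x) (HM (x - h)); rewrite !ler_norml => /andP[? ?] /andP[? ?] /andP[? ?].
lra.
Qed.

End Regularity.
End PeriodicRegularity.

(** * Calculus on the real line *)

Section Calculus.
Variable R : realType.
Implicit Types (f g P Q : R -> R) (a b c x y : R).
Local Open Scope classical_set_scope.

Definition dv f x (d : R) : Prop := is_derive x (1 : R) f d.

Lemma dv_eq f x d d' : dv f x d -> d = d' -> dv f x d'.
Proof. by move=> ? <-. Qed.

Lemma eq_dv f g x d : dv f x d -> f =1 g -> dv g x d.
Proof. by move=> H /funext <-. Qed.

Lemma dv_cst c x : dv (fun=> c) x 0.
Proof. exact: is_derive_cst. Qed.

Lemma dv_id x : dv (fun y => y) x 1.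
Proof. exact: is_derive_id. Qed.

Lemma dvD f g x d e : dv f x d -> dv g x e -> dv (fun y => f y + g y) x (d + e).
Proof. by move=> hf hg; apply: is_deriveD. Qed.

Lemma dvN f x d : dv f x d -> dv (fun y => - f y) x (- d).
Proof. by move=> hf; apply: is_deriveN. Qed.

Lemma dvB f g x d e : dv f x d -> dv g x e -> dv (fun y => f y - g y) x (d - e).
Proof. by move=> hf hg; apply: is_deriveB. Qed.

Lemma dvM f g x d e : dv f x d -> dv g x e -> dv (fun y => f y * g y) x (d * g x + f x * e).
Proof.
move=> hf hg; apply: (dv_eq (is_deriveM hf hg)).
by rewrite /GRing.scale /= addrC [g x * d]mulrC.
Qed.

Lemma dvZ c f x d : dv f x d -> dv (fun y => c * f y) x (c * d).
Proof. by move=> hf; apply: (dv_eq (dvM (dv_cst c x) hf)); rewrite mul0r add0r. Qed.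

Lemma dv_comp f g x d e : dv f (g x) d -> dv g x e -> dv (fun y => f (g y)) x (d * e).
Proof. by move=> hf hg; apply: is_derive1_comp. Qed.

Lemma dv_exp f x d : dv f x d -> dv (fun y => expR (f y)) x (expR (f x) * d).
Proof. by apply: dv_comp; apply: is_derive_expR. Qed.

Lemma dv_sin f x d : dv f x d -> dv (fun y => sin (f y)) x (cos (f x) * d).
Proof. by apply: dv_comp; apply: is_derive_sin. Qed.

Lemma dv_cos f x d : dv f x d -> dv (fun y => cos (f y)) x (- sin (f x) * d).
Proof. by apply: dv_comp; apply: is_derive_cos. Qed.

Lemma dv_ln f x d : 0 < f x -> dv f x d -> dv (fun y => ln (f y)) x ((f x)^-1 * d).
Proof. by move=> f0; apply: dv_comp; apply: is_derive1_ln. Qed.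

Lemma dv_inv f x d : f x != 0 -> dv f x d -> dv (fun y => (f y)^-1) x (- (f x) ^- 2 * d).
Proof. by move=> f0 hf; apply: is_deriveV. Qed.

Lemma dv_continuous f x d : dv f x d -> {for x, continuous f}.
Proof. by move=> [h _]; apply/differentiable_continuous/derivable1_diffP. Qed.

Lemma dv_ctn f f' : (forall x, dv f x (f' x)) -> continuous f.
Proof. by move=> H x; apply: dv_continuous (H x). Qed.

Lemma MVT_dv f f' a b : a <= b -> (forall x, a <= x <= b -> dv f x (f' x)) ->
  exists2 c, a <= c <= b & f b - f a = f' c * (b - a).
Proof.
move=> ab H; have [||c hc E] := @MVT_segment R f f' a b ab.
- by move=> x; rewrite in_itv /= => /andP[h1 h2]; apply: H; rewrite !ltW.
- apply: derivable_within_continuous => x; rewrite in_itv /= => hx.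
  by have [] := H _ hx.
- by exists c => //; move: hc; rewrite in_itv.
Qed.

Lemma dv_ge0_le f f' a b : a <= b -> (forall x, a <= x <= b -> dv f x (f' x)) ->
  (forall x, a <= x <= b -> 0 <= f' x) -> f a <= f b.
Proof.
move=> ab H h0; have [c hc E] := MVT_dv ab H.
by rewrite -subr_ge0 E mulr_ge0 ?h0 // subr_ge0.
Qed.

Lemma dv_eq_itv f g h a b : a <= b -> (forall x, a <= x <= b -> dv f x (h x)) ->
  (forall x, a <= x <= b -> dv g x (h x)) -> f b - f a = g b - g a.
Proof.
move=> ab Hf Hg.
have H x : a <= x <= b -> dv (fun y => f y - g y) x ((fun=> 0) x).
  by move=> hx; apply: (dv_eq (dvB (Hf _ hx) (Hg _ hx))); rewrite subrr.
have [c _] := MVT_dv ab H; rewrite mul0r; lra.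
Qed.

Lemma ctnD f g : continuous f -> continuous g -> continuous (fun x => f x + g x).
Proof. by move=> hf hg x; apply: cvgD; [exact: hf|exact: hg]. Qed.

Lemma ctnM f g : continuous f -> continuous g -> continuous (fun x => f x * g x).
Proof. by move=> hf hg x; apply: cvgM; [exact: hf|exact: hg]. Qed.

Lemma ctn_cst c : continuous (fun _ : R => c).
Proof. by move=> x; apply: cvg_cst. Qed.

Lemma ctnZ c f : continuous f -> continuous (fun x => c * f x).
Proof. by apply: ctnM; apply: ctn_cst. Qed.

Lemma ctnN f : continuous f -> continuous (fun x => - f x).
Proof. by move=> hf x; apply: cvgN; exact: hf. Qed.

Lemma ctnB f g : continuous f -> continuous g -> continuous (fun x => f x - g x).
Proof. by move=> hf hg; apply: ctnD => //; apply: ctnN. Qed.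

Lemma ctn_comp f g : continuous f -> continuous g -> continuous (fun x => f (g x)).
Proof. by move=> hf hg x; apply: (@continuous_comp _ _ _ g f); [exact: hg|exact: hf]. Qed.

Lemma ctn_norm f : continuous f -> continuous (fun x => `|f x|).
Proof. by move=> hf x; apply: cvg_norm; exact: hf. Qed.

Lemma ctn_lipschitz f (L : R) : (forall x y, `|f x - f y| <= L * `|x - y|) -> continuous f.
Proof.
move=> H x; apply/cvgrPdist_le => e e0.
have L0 : 0 <= L by have := H 1 0; rewrite subr0 normr1 mulr1; apply: le_trans.
near=> y; apply: le_trans (H _ _) _.
have : `|x - y| <= e / (L + 1).
  by near: y; apply: cvgr_dist_le => //; rewrite divr_gt0 //; lra.
move=> h; apply: le_trans (ler_wpM2l L0 h) _.
rewrite mulrCA; apply: ler_piMr; first exact: ltW.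
by rewrite ler_pdivrMr; lra.
Unshelve. all: by end_near. Qed.

Lemma local_primitive f a : continuous f -> exists P, forall x, a < x -> dv P x (f x).
Proof.
move=> cf; exists (fun x => \int[@lebesgue_measure R]_(t in [set` `[a, x]]) (f t))%R => x ax.
have xu : x < x + 1 by lra.
have fi : (@lebesgue_measure R).-integrable `[a, x + 1] (EFin \o f).
  by apply: continuous_compact_integrable; [exact: segment_compact|exact: continuous_subspaceT].
have [h1 h2] := continuous_FTC1_closed xu fi ax (cf x).
apply: DeriveDef; [exact: h1|rewrite -derive1E; exact: h2].
Qed.

(** Primitives on half-lines reaching further and further to the left, all normalised to vanish at
    0, agree where both are defined; [Q (k x) x] picks one defined around [x]. *)
Lemma primitive f : continuous f -> exists P, forall x, dv P x (f x).
Proof.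
move=> cf.
have H (n : nat) : exists P, P 0 = 0 /\ forall x, - n.+1%:R < x -> dv P x (f x).
  have [P HP] := local_primitive (- n.+1%:R) cf.
  exists (fun x => P x - P 0); rewrite subrr; split=> // x hx.
  by apply: (dv_eq (dvB (HP _ hx) (dv_cst _ _))); rewrite subr0.
pose Q n := projT1 (cid (H n)).
have Q0 n : Q n 0 = 0 by rewrite /Q; case: cid => P [].
have QD n x : - n.+1%:R < x -> dv (Q n) x (f x) by rewrite /Q; case: cid => P /= [_ HP]; exact: HP.
have QE n m x : (n <= m)%N -> - n.+1%:R < x -> Q n x = Q m x.
  move=> nm hx; have nmR : n.+1%:R <= m.+1%:R :> R by rewrite ler_nat.
  have n1 : 1 <= n.+1%:R :> R by rewrite ler1n.
  have [x0|x0] := leP 0 x.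
    have := @dv_eq_itv (Q n) (Q m) f 0 x x0; rewrite !Q0 !subr0; apply.
      by move=> y /andP[y0 _]; apply: QD; lra.
    by move=> y /andP[y0 _]; apply: QD; lra.
  have := @dv_eq_itv (Q n) (Q m) f x 0 (ltW x0); rewrite !Q0 !sub0r => E.
  apply: oppr_inj; apply: E.
    by move=> y /andP[y0 _]; apply: QD; lra.
  by move=> y /andP[y0 _]; apply: QD; lra.
pose k x := Num.truncn `|x|.
have kP x : - (k x).+1%:R < x.
  have /andP[_ h2] := truncn_itv (normr_ge0 x).
  by have := ler_norm (- x); rewrite normrN /k; lra.
exists (fun x => Q (k x) x) => x.
apply: (@near_eq_is_derive _ _ _ (Q (k x).+2)); last first.
  by apply: QD; have := kP x; rewrite -!natr1; lra.
near=> y.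
have xy : `|x - y| < 1 by near: y; apply: cvgr_dist_lt => //; exact: cvg_id.
have kxy : (k y <= (k x).+2)%N.
  have /andP[h1 _] := truncn_itv (normr_ge0 y).
  have /andP[_ h2] := truncn_itv (normr_ge0 x).
  rewrite -ltnS -(ltr_nat R) -!natr1; rewrite -!natr1 -/(k x) in h2; rewrite -/(k y) in h1.
  have : `|y| <= `|x| + `|x - y|.
    have -> : y = x - (x - y) by ring.
    by apply: le_trans (ler_normB _ _) _; rewrite (_ : x - (x - (x - y)) = x - y) //; ring.
  by lra.
by apply/esym/QE.
Unshelve. all: by end_near. Qed.

(* Any antiderivative; on a function without one [get] returns a junk value. *)
Definition prim f : R -> R := get [set P | forall x, dv P x (f x)].

Lemma prim_dv f x : continuous f -> dv (prim f) x (f x).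
Proof. by move=> /primitive [P HP]; apply: (@getI _ [set P | forall x, dv P x (f x)] P HP). Qed.

Definition intg f a b := prim f b - prim f a.

Lemma intg_FTC f P a b : continuous f -> (forall x, dv P x (f x)) -> intg f a b = P b - P a.
Proof.
move=> cf HP; rewrite /intg.
have [ab|/ltW ab] := leP a b.
  by apply: (dv_eq_itv ab) => x _; [exact: prim_dv|exact: HP].
have E : prim f a - prim f b = P a - P b.
  by apply: (dv_eq_itv ab) => x _; [exact: prim_dv|exact: HP].
lra.
Qed.

Lemma intg_chasles f a b c : intg f a b + intg f b c = intg f a c.
Proof. by rewrite /intg; ring. Qed.

Lemma intg_refl f a : intg f a a = 0.
Proof. by rewrite /intg subrr. Qed.

Lemma eq_intg f g a b : f =1 g -> intg f a b = intg g a b.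
Proof. by move=> /funext ->. Qed.

Lemma intgD f g a b : continuous f -> continuous g ->
  intg (fun x => f x + g x) a b = intg f a b + intg g a b.
Proof.
move=> cf cg; rewrite (@intg_FTC _ (fun x => prim f x + prim g x)); first by rewrite /intg; ring.
  exact: ctnD.
by move=> x; apply: dvD; apply: prim_dv.
Qed.

Lemma intgZ c f a b : continuous f -> intg (fun x => c * f x) a b = c * intg f a b.
Proof.
move=> cf; rewrite (@intg_FTC _ (fun x => c * prim f x)); first by rewrite /intg; ring.
  exact: ctnZ.
by move=> x; apply: dvZ; apply: prim_dv.
Qed.

Lemma intgN f a b : continuous f -> intg (fun x => - f x) a b = - intg f a b.
Proof.
by move=> cf; rewrite -mulN1r -intgZ //; apply: eq_intg => x; rewrite mulN1r.
Qed.

Lemma intgB f g a b : continuous f -> continuous g ->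
  intg (fun x => f x - g x) a b = intg f a b - intg g a b.
Proof. by move=> cf cg; rewrite intgD ?intgN //; apply: ctnN. Qed.

Lemma intg_cst c a b : intg (fun=> c) a b = c * (b - a).
Proof.
rewrite (@intg_FTC _ (fun x => c * x)); first by ring.
  exact: ctn_cst.
by move=> x; apply: (dv_eq (dvZ c (dv_id x))); rewrite mulr1.
Qed.

Lemma intg_shift f c a b : continuous f -> intg (fun x => f (x + c)) a b = intg f (a + c) (b + c).
Proof.
move=> cf; have H x : dv (fun x => x + c) x 1.
  by apply: (dv_eq (dvD (dv_id x) (dv_cst c x))); rewrite addr0.
rewrite (@intg_FTC _ (fun x => prim f (x + c))) //.
  by apply: ctn_comp => //; apply: dv_ctn H.
move=> x; apply: (dv_eq (@dv_comp (prim f) (fun x => x + c) x _ _ (prim_dv _ cf) (H x))); exact: mulr1.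
Qed.

Lemma intg_scale f c d a b : continuous f -> intg (fun x => c * f (c * x + d)) a b = intg f (c * a + d) (c * b + d).
Proof.
move=> cf; have H x : dv (fun x => c * x + d) x c.
  by apply: (dv_eq (dvD (dvZ c (dv_id x)) (dv_cst d x))); rewrite addr0 mulr1.
rewrite (@intg_FTC _ (fun x => prim f (c * x + d))) //.
  by apply: ctnZ; apply: ctn_comp => //; apply: dv_ctn H.
move=> x; apply: (dv_eq (@dv_comp (prim f) (fun x => c * x + d) x _ _ (prim_dv _ cf) (H x))); exact: mulrC.
Qed.

Lemma le_intg f g a b : a <= b -> continuous f -> continuous g ->
  (forall x, a <= x <= b -> f x <= g x) -> intg f a b <= intg g a b.
Proof.
move=> ab cf cg H; rewrite -subr_ge0 -intgB // /intg subr_ge0.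
have ch : continuous (fun x => g x - f x) by apply: ctnB.
apply: (@dv_ge0_le _ (fun x => g x - f x)) => //.
  by move=> x _; apply: prim_dv.
by move=> x /H; rewrite subr_ge0.
Qed.

Lemma intg_ge0 f a b : a <= b -> continuous f -> (forall x, a <= x <= b -> 0 <= f x) -> 0 <= intg f a b.
Proof.
move=> ab cf H; rewrite -(mul0r (b - a)) -(intg_cst 0 a b).
by apply: le_intg => //; apply: ctn_cst.
Qed.

Lemma norm_intg f g a b : a <= b -> continuous f -> continuous g ->
  (forall x, a <= x <= b -> `|f x| <= g x) -> `|intg f a b| <= intg g a b.
Proof.
move=> ab cf cg H; rewrite ler_norml -intgN //; apply/andP; split.
  apply: le_intg => //; first exact: ctnN.
  by move=> x /H; rewrite ler_norml => /andP[].
by apply: le_intg => // x /H; rewrite ler_norml => /andP[].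
Qed.
End Calculus.

(** * Complex-valued functions of a real variable *)

Section ComplexCalculus.
Variable R : realType.
Implicit Types (f g P : R -> R[i]) (z w : R[i]) (a b x y : R).
Local Open Scope classical_set_scope.
Local Open Scope complex_scope.
Local Notation Re := (@complex.Re R).
Local Notation Im := (@complex.Im R).

(** The l^1 norm of the plane: submultiplicative, and valued in [R], whereas the norm of [R[i]]
    takes its values in [R[i]]. *)
Definition n1 z : R := `|Re z| + `|Im z|.

Lemma ReM z w : Re (z * w) = Re z * Re w - Im z * Im w.
Proof. by case: z; case: w. Qed.
Lemma ImM z w : Im (z * w) = Re z * Im w + Im z * Re w.
Proof. by case: z; case: w. Qed.
Lemma ReD z w : Re (z + w) = Re z + Re w.
Proof. by case: z; case: w. Qed.
Lemma ImD z w : Im (z + w) = Im z + Im w.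
Proof. by case: z; case: w. Qed.
Lemma ReN z : Re (- z) = - Re z.
Proof. by case: z. Qed.
Lemma ImN z : Im (- z) = - Im z.
Proof. by case: z. Qed.

Lemma complexP z w : Re z = Re w -> Im z = Im w -> z = w.
Proof. by case: z => a b; case: w => c d /= -> ->. Qed.

Lemma n1_ge0 z : 0 <= n1 z.
Proof. by rewrite addr_ge0. Qed.

Lemma n1_0 : n1 0 = 0.
Proof. by rewrite /n1 /= normr0 addr0. Qed.

Lemma n1_eq0 z : n1 z = 0 -> z = 0.
Proof.
move=> /eqP; rewrite paddr_eq0 // !normr_eq0 => /andP[/eqP h1 /eqP h2].
exact: complexP.
Qed.

Lemma n1D z w : n1 (z + w) <= n1 z + n1 w.
Proof.
rewrite /n1 ReD ImD addrACA; apply: lerD; exact: ler_normD.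
Qed.

Lemma n1N z : n1 (- z) = n1 z.
Proof. by rewrite /n1 ReN ImN !normrN. Qed.

Lemma n1B z w : n1 (z - w) <= n1 z + n1 w.
Proof. by apply: le_trans (n1D _ _) _; rewrite n1N. Qed.

Lemma n1_dist z w : n1 (z - w) = n1 (w - z).
Proof. by rewrite -n1N opprB. Qed.

Lemma n1M z w : n1 (z * w) <= n1 z * n1 w.
Proof.
rewrite /n1 ReM ImM mulrDl !mulrDr -!normrM.
apply: le_trans (lerD (ler_normB _ _) (ler_normD _ _)) _.
lra.
Qed.

Lemma n1_real (r : R) : n1 r%:C = `|r|.
Proof. by rewrite /n1 /= normr0 addr0. Qed.

Lemma n1_realM (r : R) z : n1 (r%:C * z) = `|r| * n1 z.
Proof. by rewrite /n1 ReM ImM /= !mul0r subr0 addr0 !normrM mulrDr. Qed.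

Lemma realCM (r s : R) : (r * s)%:C = r%:C * s%:C.
Proof. exact: rmorphM. Qed.

Lemma realCD (r s : R) : (r + s)%:C = r%:C + s%:C.
Proof. exact: rmorphD. Qed.

Lemma realC_nat n : (n%:R : R)%:C = n%:R.
Proof. exact: rmorph_nat. Qed.

Lemma cexpD z w : cexp (z + w) = cexp z * cexp w.
Proof.
by apply: complexP; rewrite /cexp !(ReM, ImM) /= ReD ImD expRD ?cosD ?sinD; ring.
Qed.

Lemma cexp_real (r : R) : cexp r%:C = (expR r)%:C.
Proof. by apply: complexP; rewrite /cexp !(ReM, ImM) /= ?cos0 ?sin0; ring. Qed.

Lemma cexp0 : cexp (0 : R[i]) = 1.
Proof. by rewrite (cexp_real 0) expR0. Qed.

Lemma cexpN z : cexp z * cexp (- z) = 1.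
Proof. by rewrite -cexpD subrr cexp0. Qed.

Lemma cexp_neq0 z : cexp z != 0.
Proof. by apply/eqP => E; have := cexpN z; rewrite E mul0r => /esym/eqP; rewrite oner_eq0. Qed.

Lemma n1_cexp z : n1 (cexp z) <= 2 * expR (Re z).
Proof.
rewrite /cexp n1_realM ger0_norm ?expR_ge0 // mulrC ler_wpM2r ?expR_ge0 //.
by have := cos_max (Im z); have := sin_max (Im z); rewrite /n1 /=; lra.
Qed.

Definition cdv f x (d : R[i]) := dv (fun y => Re (f y)) x (Re d) /\ dv (fun y => Im (f y)) x (Im d).
Definition ccn f := continuous (fun y => Re (f y)) /\ continuous (fun y => Im (f y)).

Lemma cdv_eq f x d d' : cdv f x d -> d = d' -> cdv f x d'.
Proof. by move=> ? <-. Qed.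

Lemma eq_cdv f g x d : cdv f x d -> f =1 g -> cdv g x d.
Proof. by move=> H /funext <-. Qed.

Lemma cdv_cst z x : cdv (fun=> z) x 0.
Proof. by split; apply: dv_cst. Qed.

Lemma cdv_real (u : R -> R) x (d : R) : dv u x d -> cdv (fun y => (u y)%:C) x d%:C.
Proof. by move=> h; split => //=; apply: dv_cst. Qed.

Lemma cdvD f g x d e : cdv f x d -> cdv g x e -> cdv (fun y => f y + g y) x (d + e).
Proof.
move=> [h1 h2] [h3 h4]; split.
  by rewrite ReD; apply: (eq_dv (dvD h1 h3)) => y; rewrite ReD.
by rewrite ImD; apply: (eq_dv (dvD h2 h4)) => y; rewrite ImD.
Qed.

Lemma cdvM f g x d e : cdv f x d -> cdv g x e -> cdv (fun y => f y * g y) x (d * g x + f x * e).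
Proof.
move=> [h1 h2] [h3 h4]; split.
  apply: (eq_dv (dv_eq (dvB (dvM h1 h3) (dvM h2 h4)) _)) => [|y]; last by rewrite ReM.
  by rewrite ReD !ReM; ring.
apply: (eq_dv (dv_eq (dvD (dvM h1 h4) (dvM h2 h3)) _)) => [|y]; last by rewrite ImM.
by rewrite ImD !ImM; ring.
Qed.

Lemma cdvZ z f x d : cdv f x d -> cdv (fun y => z * f y) x (z * d).
Proof. by move=> h; apply: (cdv_eq (cdvM (cdv_cst z x) h)); rewrite mul0r add0r. Qed.

Lemma cdv_cexp z x : cdv (fun y => cexp (z * y%:C)) x (z * cexp (z * x%:C)).
Proof.
have E y : cexp (z * y%:C) =
   (expR (Re z * y) * cos (Im z * y)) +i* (expR (Re z * y) * sin (Im z * y)).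
  by rewrite /cexp ReM ImM /= !mulr0 subr0 add0r; apply: complexP; rewrite !(ReM, ImM) /=; ring.
have hR : dv (fun y => Re z * y) x (Re z) by apply: (dv_eq (dvZ _ (dv_id x))); rewrite mulr1.
have hI : dv (fun y => Im z * y) x (Im z) by apply: (dv_eq (dvZ _ (dv_id x))); rewrite mulr1.
split.
  apply: (eq_dv (dv_eq (dvM (dv_exp hR) (dv_cos hI)) _)) => [|y]; last by rewrite E.
  by rewrite E ReM /=; ring.
apply: (eq_dv (dv_eq (dvM (dv_exp hR) (dv_sin hI)) _)) => [|y]; last by rewrite E.
by rewrite E ImM /=; ring.
Qed.

Lemma cdv_ccn f f' : (forall x, cdv f x (f' x)) -> ccn f.
Proof.
by move=> H; split; [apply: (@dv_ctn _ _ (fun x => Re (f' x)))|apply: (@dv_ctn _ _ (fun x => Im (f' x)))];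
  move=> x; have [] := H x.
Qed.

Lemma eq_ctn (u v : R -> R) : continuous u -> u =1 v -> continuous v.
Proof. by move=> H /funext <-. Qed.

Lemma eq_ccn f g : ccn f -> f =1 g -> ccn g.
Proof. by move=> H /funext <-. Qed.

Lemma ccn_cst z : ccn (fun=> z).
Proof. by split; apply: ctn_cst. Qed.

Lemma ccn_real (u : R -> R) : continuous u -> ccn (fun y => (u y)%:C).
Proof. by move=> h; split => //=; apply: ctn_cst. Qed.

Lemma ccnD f g : ccn f -> ccn g -> ccn (fun y => f y + g y).
Proof.
move=> [h1 h2] [h3 h4]; split.
  by apply: (eq_ctn (ctnD h1 h3)) => y; rewrite ReD.
by apply: (eq_ctn (ctnD h2 h4)) => y; rewrite ImD.
Qed.

Lemma ccnM f g : ccn f -> ccn g -> ccn (fun y => f y * g y).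
Proof.
move=> [h1 h2] [h3 h4]; split.
  by apply: (eq_ctn (ctnB (ctnM h1 h3) (ctnM h2 h4))) => y; rewrite ReM.
by apply: (eq_ctn (ctnD (ctnM h1 h4) (ctnM h2 h3))) => y; rewrite ImM.
Qed.

Lemma ccnZ z f : ccn f -> ccn (fun y => z * f y).
Proof. by apply: ccnM; apply: ccn_cst. Qed.

Lemma ccn_comp f (u : R -> R) : ccn f -> continuous u -> ccn (fun y => f (u y)).
Proof.
by move=> [h1 h2] h; split; [apply: (ctn_comp h1 h)|apply: (ctn_comp h2 h)].
Qed.

Lemma ccn_cexp z : ccn (fun y => cexp (z * y%:C)).
Proof. exact: cdv_ccn (fun x => cdv_cexp z x). Qed.

Definition cintg f a b : R[i] := intg (fun y => Re (f y)) a b +i* intg (fun y => Im (f y)) a b.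

Lemma eq_cintg f g a b : f =1 g -> cintg f a b = cintg g a b.
Proof. by move=> /funext ->. Qed.

Lemma cintg_FTC f P a b : ccn f -> (forall x, cdv P x (f x)) -> cintg f a b = P b - P a.
Proof.
move=> [h1 h2] H; apply: complexP; rewrite /= ?(ReD, ImD) ?(ReN, ImN).
  by apply: (@intg_FTC _ _ (fun y => Re (P y))) => // x; have [] := H x.
by apply: (@intg_FTC _ _ (fun y => Im (P y))) => // x; have [] := H x.
Qed.

Lemma cintg_chasles f a b c : cintg f a b + cintg f b c = cintg f a c.
Proof. by apply: complexP; rewrite ?(ReD, ImD) /= intg_chasles. Qed.

Lemma cintg_refl f a : cintg f a a = 0.
Proof. by apply: complexP; rewrite /= intg_refl. Qed.

Lemma cintgD f g a b : ccn f -> ccn g -> cintg (fun y => f y + g y) a b = cintg f a b + cintg g a b.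
Proof.
move=> [h1 h2] [h3 h4]; apply: complexP; rewrite ?(ReD, ImD) /= -intgD //; apply: eq_intg => y.
  by rewrite ReD.
by rewrite ImD.
Qed.

Lemma cintgZ z f a b : ccn f -> cintg (fun y => z * f y) a b = z * cintg f a b.
Proof.
move=> [h1 h2]; apply: complexP; rewrite ?(ReM, ImM) /= -!intgZ //.
  rewrite -intgB; try exact: ctnZ.
  by apply: eq_intg => y; rewrite ReM.
rewrite -intgD; try exact: ctnZ.
by apply: eq_intg => y; rewrite ImM.
Qed.

Lemma cintgN f a b : ccn f -> cintg (fun y => - f y) a b = - cintg f a b.
Proof. by move=> h; rewrite -mulN1r -cintgZ //; apply: eq_cintg => y; rewrite mulN1r. Qed.

Lemma cintgB f g a b : ccn f -> ccn g -> cintg (fun y => f y - g y) a b = cintg f a b - cintg g a b.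
Proof.
move=> h1 h2; rewrite -cintgN // -cintgD //.
by apply: (eq_ccn (ccnZ (-1) h2)) => y; rewrite mulN1r.
Qed.

Lemma cintg_cst z a b : cintg (fun=> z) a b = z * (b - a)%:C.
Proof. by apply: complexP; rewrite ?(ReM, ImM) /= intg_cst; ring. Qed.

Lemma cintg_shift f c a b : ccn f -> cintg (fun y => f (y + c)) a b = cintg f (a + c) (b + c).
Proof.
by move=> [h1 h2]; rewrite /cintg (intg_shift _ _ _ h1) (intg_shift _ _ _ h2).
Qed.

Lemma cintg_scale f (c d : R) a b : ccn f ->
  cintg (fun y => c%:C * f (c * y + d)) a b = cintg f (c * a + d) (c * b + d).
Proof.
move=> [h1 h2]; rewrite /cintg -(intg_scale c d a b h1) -(intg_scale c d a b h2).
by congr (_ +i* _); apply: eq_intg => y; rewrite ?(ReM, ImM) /=; ring.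
Qed.

Lemma cintg_real (u : R -> R) a b : cintg (fun y => (u y)%:C) a b = (intg u a b)%:C.
Proof. by apply: complexP; rewrite //= intg_cst mul0r. Qed.

Lemma n1_cintg f (u : R -> R) a b : a <= b -> ccn f -> continuous u ->
  (forall x, a <= x <= b -> n1 (f x) <= u x) -> n1 (cintg f a b) <= intg u a b.
Proof.
move=> ab [h1 h2] cu H; rewrite /n1 /=.
have k1 := ctn_norm h1; have k2 := ctn_norm h2.
apply: (@le_trans _ _ (intg (fun y => `|Re (f y)| + `|Im (f y)|) a b)).
  by rewrite intgD //; apply: lerD; apply: norm_intg.
by apply: le_intg => //; apply: ctnD.
Qed.

Lemma n1_cintg_le f (M : R) a b : a <= b -> ccn f ->
  (forall x, a <= x <= b -> n1 (f x) <= M) -> n1 (cintg f a b) <= M * (b - a).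
Proof. by move=> ab cf H; rewrite -intg_cst; apply: n1_cintg => //; apply: ctn_cst. Qed.
End ComplexCalculus.

(** * Limits of complex sequences *)

Section ComplexLimits.
Variable R : realType.
Implicit Types (u v : nat -> R[i]) (z w l : R[i]).
Local Open Scope classical_set_scope.
Local Open Scope complex_scope.
Local Notation Re := (@complex.Re R).
Local Notation Im := (@complex.Im R).

Definition ctends u l := null (fun n => n1 (u n - l)).

Lemma eq_ctends u v l : ctends u l -> (forall n, v n = u n) -> ctends v l.
Proof. by move=> H E; apply: (eq_null H) => n; rewrite E. Qed.

Lemma ctends_cst l : ctends (fun=> l) l.
Proof. by apply: (eq_null (@null0 R)) => n; rewrite subrr n1_0. Qed.

Lemma ctendsD u v l w : ctends u l -> ctends v w -> ctends (fun n => u n + v n) (l + w).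
Proof.
move=> H H'; apply: (null_le0 (nullD H H')) => n; rewrite ger0_norm ?n1_ge0 //.
have -> : u n + v n - (l + w) = (u n - l) + (v n - w) by ring.
exact: n1D.
Qed.

Lemma ctendsM u v l w : ctends u l -> ctends v w -> ctends (fun n => u n * v n) (l * w).
Proof.
move=> H H'.
have K := nullD (nullM H H') (nullD (nullZ (n1 w) H) (nullZ (n1 l) H')).
apply: (null_le0 K) => n; rewrite ger0_norm ?n1_ge0 //.
have -> : u n * v n - l * w = (u n - l) * (v n - w) + (w * (u n - l) + l * (v n - w)) by ring.
apply: le_trans (n1D _ _) _; apply: lerD; first exact: n1M.
by apply: le_trans (n1D _ _) _; apply: lerD; exact: n1M.
Qed.

Lemma ctendsZ z u l : ctends u l -> ctends (fun n => z * u n) (z * l).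
Proof. exact: ctendsM (ctends_cst z). Qed.

Lemma ctendsN u l : ctends u l -> ctends (fun n => - u n) (- l).
Proof. by move=> H; apply: (eq_null H) => n; rewrite -n1N; congr n1; ring. Qed.

Lemma ctendsB u v l w : ctends u l -> ctends v w -> ctends (fun n => u n - v n) (l - w).
Proof. by move=> H H'; apply: ctendsD => //; apply: ctendsN. Qed.

Lemma ctends_uniq u l w : ctends u l -> ctends u w -> l = w.
Proof.
move=> H H'; apply/eqP; rewrite -subr_eq0; apply/eqP/n1_eq0.
apply: (null_uniq (nullD H' H)) => n; rewrite ger0_norm ?n1_ge0 //.
have -> : l - w = (u n - w) - (u n - l) by ring.
exact: n1B.
Qed.

Lemma ctends_null u v l : ctends u l -> null (fun n => n1 (v n - u n)) -> ctends v l.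
Proof.
move=> H H'; apply: (null_le0 (nullD H H')) => n; rewrite ger0_norm ?n1_ge0 //.
have -> : v n - l = (u n - l) + (v n - u n) by ring.
exact: n1D.
Qed.

Lemma ctends_sub u l (a : nat -> nat) : (forall n, (n <= a n)%N) -> ctends u l -> ctends (fun n => u (a n)) l.
Proof. exact: null_sub. Qed.

Lemma ctends_real (u : nat -> R) (l : R) : tends u l -> ctends (fun n => (u n)%:C) l%:C.
Proof.
move=> H; apply: (null_le0 (e' := fun n => `|u n - l|)) => [|n].
  by move=> e /H[N HN]; exists N => n /HN; rewrite normr_id.
by rewrite -rmorphB n1_real ger0_norm.
Qed.

Lemma ctends_shift u l k : ctends (fun n => u (n + k)%N) l <-> ctends u l.
Proof. exact: (null_shift (fun n => n1 (u n - l))). Qed.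

Lemma n1_inv z : z != 0 -> n1 z^-1 <= 2 / n1 z.
Proof.
move=> z0; case: z z0 => a b z0.
have n0 : 0 < n1 (a +i* b).
  by rewrite lt_neqAle n1_ge0 andbT eq_sym; apply/eqP => /n1_eq0/eqP; apply/negP.
have d0 : 0 < a ^+ 2 + b ^+ 2.
  rewrite lt_neqAle addr_ge0 ?sqr_ge0 // andbT eq_sym paddr_eq0 ?sqr_ge0 // !sqrf_eq0.
  by apply/negP => /andP[/eqP ha /eqP hb]; move: z0; rewrite ha hb eqxx.
rewrite /GRing.inv /= /n1 /= normrN !normrM !normfV (ger0_norm (ltW d0)) -mulrDl.
rewrite ler_pdivlMr // mulrAC ler_pdivrMr //.
rewrite -(real_normK (num_real a)) -(real_normK (num_real b)).
have := sqr_ge0 (`|a| - `|b|); lra.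
Qed.

Lemma ctends_inv u l : l != 0 -> ctends u l -> ctends (fun n => (u n)^-1) l^-1.
Proof.
move=> l0 H.
have n0 : 0 < n1 l by rewrite lt_neqAle n1_ge0 andbT eq_sym; apply/eqP => /n1_eq0/eqP; apply/negP.
have K := nullZ (8 / n1 l ^+ 2) H; apply: (null_le K).
have [N HN] := H _ (divr_gt0 n0 (ltac:(lra) : 0 < 2 :> R)); exists N => n /HN.
rewrite !ger0_norm ?n1_ge0 // => h.
have hu : n1 l / 2 <= n1 (u n).
  have : n1 l <= n1 (u n) + n1 (u n - l).
    have -> : l = u n - (u n - l) by ring.
    by apply: le_trans (n1B _ _) _; rewrite (_ : u n - (u n - (u n - l)) = u n - l) //; ring.
  lra.
have u0 : u n != 0 by apply/eqP => E; move: hu; rewrite E n1_0; lra.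
have -> : (u n)^-1 - l^-1 = - (u n - l) * (u n)^-1 * l^-1 by field; rewrite ?u0 ?l0 ?u0.
apply: le_trans (n1M _ _) _; apply: le_trans (ler_wpM2r (n1_ge0 _) (n1M _ _)) _.
rewrite n1N; have i1 := n1_inv u0; have i2 := n1_inv l0.
have i3 : 2 / n1 (u n) <= 4 / n1 l.
  rewrite ler_pdivrMr; last lra.
  by rewrite mulrAC ler_pdivlMr //; lra.
rewrite -mulrA mulrC; apply: ler_wpM2r; first exact: n1_ge0.
apply: le_trans (ler_pM (n1_ge0 _) (n1_ge0 _) (le_trans i1 i3) i2) _.
by rewrite le_eqVlt; apply/orP; left; apply/eqP; field; rewrite gt_eqF.
Qed.

Lemma norm_le_n1 z : `|z| <= (n1 z)%:C.
Proof.
case: z => a b; rewrite normc_def /n1 /= lecR.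
rewrite -[leRHS]ger0_norm ?addr_ge0 // -sqrtr_sqr ler_wsqrtr //.
rewrite sqrrD !real_normK ?num_real //.
have : 0 <= `|a| * `|b| by rewrite mulr_ge0.
lra.
Qed.

Lemma climnE u l : ctends u l -> climn u = l.
Proof.
move=> H.
have K : (fun n : nat => (u n : R[i]^o)) @ \oo --> (l : R[i]^o); last first.
  exact: (@cvg_lim _ (@norm_hausdorff _ _) _ _ _ _ _ K).
apply/(@cvgrPdist_le R[i] R[i]^o) => -[e e'] e0.
(* The radius is itself complex; its positivity in the partial order of [R[i]] forces it to be
   real. *)
have [/eqP e'0 e1] : (e' == 0) /\ 0 < e.
  by move: e0; rewrite ltcE /= => /andP[/eqP -> ->].
have [N HN] := H _ e1; exists N => // n nN /=.
rewrite distrC; apply: le_trans (norm_le_n1 _) _.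
by rewrite e'0 lecR; have := HN _ nN; rewrite ger0_norm ?n1_ge0.
Qed.
End ComplexLimits.

(** * Improper integrals over the line *)

Section Improper.
Variable R : realType.
Implicit Types (f g P : R -> R[i]) (z w l : R[i]) (a b c x y : R).
Local Open Scope complex_scope.
Local Notation Re := (@complex.Re R).
Local Notation Im := (@complex.Im R).

Definition impr f l := forall eps : R, 0 < eps -> exists A : R, forall a b, a <= - A -> A <= b ->
  n1 (cintg f a b - l) <= eps.
Definition vanish P := forall eps : R, 0 < eps -> exists A : R, forall x, A <= `|x| -> n1 (P x) <= eps.

Lemma eq_impr f g l : impr f l -> f =1 g -> impr g l.
Proof. by move=> H /funext <-. Qed.

Lemma imprD f g l w : ccn f -> ccn g -> impr f l -> impr g w -> impr (fun x => f x + g x) (l + w).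
Proof.
move=> cf cg H H' e e0; have e2 : 0 < e / 2 by rewrite divr_gt0.
have [A HA] := H _ e2; have [B HB] := H' _ e2; exists (Num.max A B) => a b ha hb.
have [h1 h2] : A <= Num.max A B /\ B <= Num.max A B by rewrite !le_max !lexx orbT.
rewrite cintgD //.
have -> : cintg f a b + cintg g a b - (l + w) = (cintg f a b - l) + (cintg g a b - w) by ring.
apply: le_trans (n1D _ _) _; rewrite [e]splitr; apply: lerD; [apply: HA|apply: HB]; lra.
Qed.

Lemma imprZ z f l : ccn f -> impr f l -> impr (fun x => z * f x) (z * l).
Proof.
move=> cf H e e0.
have z0 : 0 < n1 z + 1 by have := n1_ge0 z; lra.
have [A HA] := H _ (divr_gt0 e0 z0); exists A => a b ha hb; rewrite cintgZ // -mulrBr.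
apply: le_trans (n1M _ _) _; apply: le_trans (ler_wpM2l (n1_ge0 z) (HA _ _ ha hb)) _.
rewrite mulrCA; apply: ler_piMr; first exact: ltW.
by rewrite ler_pdivrMr //; lra.
Qed.

Lemma imprB f g l w : ccn f -> ccn g -> impr f l -> impr g w -> impr (fun x => f x - g x) (l - w).
Proof.
move=> cf cg H H'; have := imprD cf (ccnZ (-1) cg) H (imprZ (-1) cg H').
by rewrite mulN1r => K; apply: (eq_impr K) => x; rewrite mulN1r.
Qed.

Lemma impr_uniq f l w : impr f l -> impr f w -> l = w.
Proof.
move=> H H'; apply/eqP; rewrite -subr_eq0; apply/eqP/n1_eq0/eqP.
rewrite eq_le n1_ge0 andbT; apply/ler_addgt0Pr => e e0; rewrite add0r.
have e2 : 0 < e / 2 by rewrite divr_gt0.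
have [A HA] := H _ e2; have [B HB] := H' _ e2.
pose M := Num.max A B.
have [h1 h2] : A <= M /\ B <= M by rewrite !le_max !lexx orbT.
have k1 := HA (- M) M ltac:(lra) h1; have k2 := HB (- M) M ltac:(lra) h2.
have -> : l - w = (cintg f (- M) M - w) - (cintg f (- M) M - l) by ring.
apply: le_trans (n1B _ _) _; lra.
Qed.

Lemma impr_shift f c l : ccn f -> impr f l -> impr (fun x => f (x + c)) l.
Proof.
move=> cf H e /H[A HA]; exists (A + `|c|) => a b ha hb.
rewrite cintg_shift //; apply: HA; have := ler_norm c; have := ler_norm (- c); rewrite normrN; lra.
Qed.

Lemma impr_FTC f P : ccn f -> (forall x, cdv P x (f x)) -> vanish P -> impr f 0.
Proof.
move=> cf HP H e e0; have e2 : 0 < e / 2 by rewrite divr_gt0.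
have [A HA] := H _ e2; exists (Num.max A 0) => a b ha hb.
have [h1 h2] : A <= Num.max A 0 /\ 0 <= Num.max A 0 by rewrite !le_max !lexx orbT.
rewrite subr0 (cintg_FTC _ _ cf HP) [e]splitr; apply: le_trans (n1B _ _) _; apply: lerD; apply: HA.
  by rewrite ger0_norm; lra.
by rewrite ler0_norm; lra.
Qed.

Lemma impr_ctends f l c : 0 < c -> impr f l -> ctends (fun n => cintg f (- (c * n%:R)) (c * n%:R)) l.
Proof.
move=> c0 H e /H[A HA]; exists (Num.truncn (`|A| / c)).+1 => n hn.
rewrite ger0_norm ?n1_ge0 //.
have q0 : 0 <= `|A| / c by rewrite divr_ge0 // ltW.
have /andP[_ h] := truncn_itv q0.
have hA : A <= c * n%:R.
  apply: le_trans (ler_norm A) _; rewrite mulrC -ler_pdivrMr //.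
  by apply: le_trans (ltW h) _; rewrite ler_nat.
by apply: HA => //; rewrite lerN2.
Qed.

(* The density c t e^{-ct} dt/t in the logarithmic variable t = e^x; all improper integrals below
   converge by comparison with it. *)
Definition dexp c x : R := expR x * expR (- (c * expR x)).

Lemma dexp_ge0 c x : 0 <= dexp c x.
Proof. by rewrite mulr_ge0 ?expR_ge0. Qed.

Lemma expR_poly (k : nat) c : 0 < c -> exists2 K : R, 0 <= K & forall t, 0 <= t -> t ^+ k * expR (- (c * t)) <= K.
Proof.
move=> c0; case: k => [|k].
  by exists 1 => // t t0; rewrite expr0 mul1r -expR0 ler_expR oppr_le0 mulr_ge0 // ltW.
have k0 : 0 < k.+1%:R :> R by rewrite ltr0n.
exists ((k.+1%:R / c) ^+ k.+1); first by rewrite exprn_ge0 // divr_ge0 // ltW.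
move=> t t0; rewrite expRN ler_pdivrMr ?expR_gt0 //.
have -> : c * t = k.+1%:R * (c * t / k.+1%:R) by field; rewrite gt_eqF.
rewrite expRM_natl.
have u0 : 0 <= c * t / k.+1%:R by rewrite divr_ge0 // mulr_ge0 // ltW.
have h := expR_ge1Dx (c * t / k.+1%:R).
have -> : (k.+1%:R / c) ^+ k.+1 * expR (c * t / k.+1%:R) ^+ k.+1 =
  (k.+1%:R / c * expR (c * t / k.+1%:R)) ^+ k.+1 by rewrite -exprMn.
apply: lerXn2r; rewrite ?nnegrE //.
  by rewrite mulr_ge0 ?expR_ge0 // divr_ge0 // ltW.
have kc : 0 <= k.+1%:R / c by rewrite divr_ge0 // ltW.
have h2 : c * t / k.+1%:R <= expR (c * t / k.+1%:R) by apply: le_trans h; rewrite lerDr.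
apply: le_trans (ler_wpM2l kc h2).
by rewrite le_eqVlt; apply/orP; left; apply/eqP; field; rewrite !gt_eqF.
Qed.

Lemma dexp_bound c : 0 < c -> exists2 K : R, 0 <= K & forall x, dexp c x <= K * expR (- `|x|).
Proof.
move=> c0; have [K K0 HK] := expR_poly 2 c0; exists (K + 1); first lra.
move=> x; have ex := expR_gt0 x; rewrite /dexp.
have [x0|x0] := leP 0 x.
  rewrite (ger0_norm x0) [expR (- x)]expRN ler_pdivlMr //.
  have := HK _ (ltW ex); rewrite expr2; lra.
rewrite (ltr0_norm x0) opprK mulrC ler_pM2r //.
have : expR (- (c * expR x)) <= 1 by rewrite -expR0 ler_expR oppr_le0 mulr_ge0 // ltW.
lra.
Qed.

Lemma dexp_vanish P c (C : R) : 0 < c -> (forall x, n1 (P x) <= C * dexp c x) -> vanish P.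
Proof.
move=> c0 H e e0; have [K K0 HK] := dexp_bound c0.
have q0 : 0 < (`|C| * K + 1) / e by rewrite divr_gt0 //; have : 0 <= `|C| * K by [rewrite mulr_ge0]; lra.
exists (ln ((`|C| * K + 1) / e)) => x hx.
apply: le_trans (H x) _.
have h1 : C * dexp c x <= `|C| * K * expR (- `|x|).
  rewrite -mulrA; apply: le_trans (ler_wpM2r (dexp_ge0 c x) (ler_norm C)) _.
  exact: ler_wpM2l.
apply: le_trans h1 _; rewrite expRN ler_pdivrMr ?expR_gt0 //.
have h2 : (`|C| * K + 1) / e <= expR `|x| by rewrite -[leLHS]lnK // ler_expR.
rewrite ler_pdivrMr // in h2; rewrite mulrC; lra.
Qed.

Lemma dexp_dv c x : c != 0 -> dv (fun y => - c^-1 * expR (- (c * expR y))) x (dexp c x).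
Proof.
move=> c0; have h := dv_exp (dvN (dvZ c (dv_exp (dv_id x)))).
by apply: (dv_eq (dvZ (- c^-1) h)); rewrite /dexp; field.
Qed.

Lemma ctn_dexp c : continuous (dexp c).
Proof.
by apply: (@dv_ctn _ _ (fun x => expR x * 1 * expR (- (c * expR x)) +
   expR x * (expR (- (c * expR x)) * - (c * (expR x * 1))))) => x;
   apply: dvM; [apply: dv_exp; apply: dv_id|apply: dv_exp; apply: dvN; apply: dvZ; apply: dv_exp; apply: dv_id].
Qed.

Lemma intg_dexp c a b : 0 < c -> intg (dexp c) a b = (expR (- (c * expR a)) - expR (- (c * expR b))) / c.
Proof.
move=> c0; rewrite (@intg_FTC _ _ _ _ _ (@ctn_dexp c) (fun x => dexp_dv x (lt0r_neq0 c0))).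
by field; rewrite gt_eqF.
Qed.

Lemma intg_dexp_le c a b : 0 < c -> intg (dexp c) a b <= c^-1.
Proof.
move=> c0; rewrite intg_dexp // ler_pdivrMr // mulVf ?gt_eqF //.
have : expR (- (c * expR a)) <= 1 by rewrite -expR0 ler_expR oppr_le0 mulr_ge0 // ?expR_ge0 ltW.
have := expR_gt0 (- (c * expR b)); lra.
Qed.

Lemma expR_N_le x : 0 <= x -> 1 - expR (- x) <= x.
Proof. by move=> x0; have := expR_ge1Dx (- x); lra. Qed.

Lemma dexp_tail c A a b : 0 < c -> a <= b -> (b <= - A \/ A <= a) ->
  intg (dexp c) a b <= (1 + c^-2) * expR (- A).
Proof.
move=> c0 ab h; have eA := expR_gt0 A; have eA' := expR_gt0 (- A).
have ic : 0 < c^-2 by rewrite invr_gt0 exprn_gt0.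
rewrite intg_dexp // ler_pdivrMr //; case: h => h.
  have : expR b <= expR (- A) by rewrite ler_expR.
  have := @expR_N_le (c * expR b) (mulr_ge0 (ltW c0) (expR_ge0 _)).
  have : expR (- (c * expR a)) <= 1 by rewrite -expR0 ler_expR oppr_le0 mulr_ge0 // ?expR_ge0 ltW.
  move=> h1 h2 /(ler_wpM2l (ltW c0)) h3.
  have : 0 <= c^-2 * expR (- A) * c by rewrite !mulr_ge0 // ltW.
  by lra.
have e1 : expR (- (c * expR a)) <= expR (- (c * expR A)) by rewrite ler_expR lerN2 ler_pM2l // ler_expR.
have e2 := expR_gt0 (- (c * expR b)).
have e3 : expR (- (c * expR A)) <= c^-1 * expR (- A).
  rewrite !expRN -invfM lef_pV2 ?posrE ?expR_gt0 ?mulr_gt0 //.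
  have := expR_ge1Dx (c * expR A); lra.
have -> : (1 + c^-2) * expR (- A) * c = c * expR (- A) + c^-1 * expR (- A) by field; rewrite gt_eqF.
have : 0 < c * expR (- A) by rewrite mulr_gt0.
by lra.
Qed.

(** Adding the majorant makes the real and imaginary parts nonnegative, so their integrals over
    [[-n, n]] are monotone and bounded; [tail] then frees the two ends from each other. *)
Lemma impr_exists f c (C : R) : 0 < c -> 0 <= C -> ccn f -> (forall x, n1 (f x) <= C * dexp c x) ->
  exists2 l, impr f l & n1 l <= 2 * (C / c).
Proof.
move=> c0 C0 cf H.
have tail (A a b a' b' : R) : a <= - A -> a' <= - A -> A <= b -> A <= b' ->
  n1 (cintg f a b - cintg f a' b') <= 2 * (C * ((1 + c^-2) * expR (- A))).
  move=> h1 h2 h3 h4.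
  have part x y : (Num.max x y <= - A \/ A <= Num.min x y) -> n1 (cintg f x y) <= C * ((1 + c^-2) * expR (- A)).
    wlog xy : x y / x <= y.
      move=> K h; have [xy|/ltW yx] := leP x y; first exact: K.
      have -> : cintg f x y = - cintg f y x.
        by apply/eqP; rewrite -addr_eq0 cintg_chasles cintg_refl.
      by rewrite n1N; apply: K => //; rewrite maxC minC.
    rewrite (max_idPr xy) (min_idPl xy) => h.
    have q : n1 (cintg f x y) <= intg (fun t => C * dexp c t) x y.
      by apply: n1_cintg => //; apply: ctnZ; exact: ctn_dexp.
    apply: le_trans q _.
    rewrite intgZ; last exact: ctn_dexp.
    by apply: ler_wpM2l => //; apply: dexp_tail.
  have -> : cintg f a b - cintg f a' b' = cintg f a a' + cintg f b' b.
    rewrite -(cintg_chasles f a a' b) -(cintg_chasles f a' b' b); ring.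
  apply: le_trans (n1D _ _) _; rewrite mulrDl mul1r; apply: lerD; apply: part.
    by left; rewrite ge_max h1 h2.
  by right; rewrite le_min h3 h4.
have lim1 (u : R -> R) : continuous u -> (forall x, `|u x| <= C * dexp c x) ->
  exists2 l, tends (fun n => intg u (- n%:R) n%:R) l & `|l| <= C / c.
  move=> cu hu.
  have cd := ctnZ (c := C) (@ctn_dexp c).
  have bnd n : intg (fun x => C * dexp c x) (- n%:R) n%:R <= C / c.
    rewrite intgZ; last exact: ctn_dexp.
    by apply: ler_wpM2l => //; apply: intg_dexp_le.
  have nn n : - n%:R <= n%:R :> R by have := ler0n R n; lra.
  have mono (v : R -> R) : continuous v -> (forall x, 0 <= v x) ->
     forall n, intg v (- n%:R) n%:R <= intg v (- n.+1%:R) n.+1%:R.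
    move=> cv v0 n; rewrite -(intg_chasles v (- n.+1%:R) (- n%:R)) -(intg_chasles v (- n%:R) n%:R n.+1%:R).
    have : 0 <= intg v (- n.+1%:R) (- n%:R) by apply: intg_ge0 => //; rewrite lerN2 ler_nat.
    have : 0 <= intg v n%:R n.+1%:R by apply: intg_ge0 => //; rewrite ler_nat.
    by lra.
  have pos x : 0 <= u x + C * dexp c x by have := hu x; rewrite ler_norml => /andP[? _]; lra.
  have bu n : `|intg u (- n%:R) n%:R| <= C / c.
    by apply: le_trans (bnd n); apply: norm_intg.
  have [||l1 hl1 _] := @nondecreasing_tends R (fun n => intg (fun x => u x + C * dexp c x) (- n%:R) n%:R) (2 * (C / c)).
  - by apply: mono => //; apply: ctnD.
  - by move=> n; rewrite intgD //; have := bu n; rewrite ler_norml => /andP[_]; have := bnd n; lra.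
  have [||l2 hl2 _] := @nondecreasing_tends R (fun n => intg (fun x => C * dexp c x) (- n%:R) n%:R) (C / c).
  - by apply: mono => // x; rewrite mulr_ge0 ?dexp_ge0.
  - exact: bnd.
  have hl : tends (fun n => intg u (- n%:R) n%:R) (l1 - l2).
    by apply: (eq_tends (tendsB hl1 hl2)) => n; rewrite intgD //; ring.
  by exists (l1 - l2) => //; apply: (tends_norm_le hl); exists 0%N => n _.
have [c1 c2] := cf.
have Re_n1 x : `|Re (f x)| <= C * dexp c x by apply: le_trans (H x); rewrite /n1 lerDl.
have Im_n1 x : `|Im (f x)| <= C * dexp c x by apply: le_trans (H x); rewrite /n1 lerDr.
have [lr h1 b1] := lim1 _ c1 Re_n1.
have [li h2 b2] := lim1 _ c2 Im_n1.
have hl : ctends (fun n => cintg f (- n%:R) n%:R) (lr +i* li).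
  have K := nullD h1 h2; move=> e e0.
  have e2 : 0 < e / 2 by rewrite divr_gt0.
  have [N HN] := h1 _ e2; have [M HM] := h2 _ e2; exists (maxn N M) => n.
  rewrite geq_max => /andP[/HN k1 /HM k2].
  by rewrite ger0_norm ?n1_ge0 // /n1 /= [e]splitr lerD.
exists (lr +i* li); last by rewrite /n1 /= mulrDl mul1r lerD.
move=> e e0.
pose D : R := 2 * (C * (1 + c^-2)) + 1.
have D0 : 0 < D.
  rewrite /D; have : 0 <= C * (1 + c^-2) by rewrite mulr_ge0 // addr_ge0 // invr_ge0 exprn_ge0 // ltW.
  by lra.
have e2 : 0 < e / 2 by rewrite divr_gt0.
have q0 : 0 < D / (e / 2) by rewrite divr_gt0.
exists (ln (D / (e / 2))) => a b ha hb.
set A := ln _ in ha hb.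
have [N HN] := hl _ e2.
pose n := maxn N (Num.truncn `|A|).+1.
have hn : A <= n%:R.
  have /andP[_ h] := truncn_itv (normr_ge0 A).
  apply: le_trans (ler_norm A) _; apply: le_trans (ltW h) _.
  by rewrite ler_nat leq_maxr.
have := HN n (leq_maxl _ _); rewrite ger0_norm ?n1_ge0 // => k1.
have hn' : - n%:R <= - A by rewrite lerN2.
have k2 := @tail A a b (- n%:R) n%:R ha hn' hb hn.
have -> : cintg f a b - (lr +i* li) = (cintg f a b - cintg f (- n%:R) n%:R) + (cintg f (- n%:R) n%:R - (lr +i* li)) by ring.
apply: le_trans (n1D _ _) _; rewrite [e]splitr; apply: lerD => //.
apply: le_trans k2 _.
have -> : expR (- A) = (e / 2) / D by rewrite expRN /A lnK // invfM invrK mulrC.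
have -> : 2 * (C * ((1 + c^-2) * (e / 2 / D))) = (2 * (C * (1 + c^-2))) / D * (e / 2) by ring.
rewrite -[leRHS]mul1r ler_wpM2r ?(ltW e2) // ler_pdivrMr // mul1r /D; lra.
Qed.
End Improper.

(** * The Gamma function *)

Section GammaIntegral.
Variable R : realType.
Implicit Types (z w l : R[i]) (a b c x y t : R).
Local Open Scope complex_scope.
Local Notation Re := (@complex.Re R).
Local Notation Im := (@complex.Im R).

Lemma impr_le (f : R -> R[i]) (u : R -> R) l (r : R) : ccn f -> continuous u ->
  (forall x, n1 (f x) <= u x) -> impr f l -> impr (fun x => (u x)%:C) r%:C -> n1 l <= r.
Proof.
move=> cf cu H hf hu; apply/ler_addgt0Pr => e e0.
have e2 : 0 < e / 2 by rewrite divr_gt0.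
have [A HA] := hf _ e2; have [B HB] := hu _ e2.
pose M := Num.max (Num.max A B) 0.
have [h1 h2 h3] : [/\ A <= M, B <= M & 0 <= M] by rewrite !le_max !lexx !orbT.
have k1 := HA (- M) M (_ : _ <= - A) h1; have k2 := HB (- M) M (_ : _ <= - B) h2.
have {}k1 := k1 ltac:(lra); have {}k2 := k2 ltac:(lra).
have k3 : n1 (cintg f (- M) M) <= intg u (- M) M by apply: n1_cintg => //; lra.
rewrite cintg_real -rmorphB n1_real ler_norml in k2; move/andP: k2 => [_ k2].
have -> : l = cintg f (- M) M - (cintg f (- M) M - l) by ring.
apply: le_trans (n1B _ _) _; lra.
Qed.

Lemma impr_real_comb (u v : R -> R) (r s c d : R) : continuous u -> continuous v ->
  impr (fun x => (u x)%:C) r%:C -> impr (fun x => (v x)%:C) s%:C ->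
  impr (fun x => (c * u x + d * v x)%:C) (c * r + d * s)%:C.
Proof.
move=> cu cv hu hv; have ku := ccn_real cu; have kv := ccn_real cv.
have := imprD (ccnZ c%:C ku) (ccnZ d%:C kv) (imprZ c%:C ku hu) (imprZ d%:C kv hv).
rewrite -!realCM -realCD => H; apply: (eq_impr H) => x.
by rewrite realCD !realCM.
Qed.

Definition gker z x : R[i] := cexp (z * x%:C) * (expR (- expR x))%:C.

Lemma gker_cdv z x : cdv (gker z) x (z * gker z x - gker (z + 1) x).
Proof.
have h := cdv_real (dv_exp (dvN (dv_exp (dv_id x)))).
apply: (cdv_eq (cdvM (cdv_cexp z x) h)); rewrite /gker mulrDl cexpD mul1r cexp_real.
by rewrite mulr1 -mulrN !realCM rmorphN /=; ring.
Qed.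

Lemma gker_ccn z : ccn (gker z).
Proof. exact: cdv_ccn (gker_cdv z). Qed.

(** A positive integer real part turns the modulus of e^(z x) into a power of e^x, which half of the
    exponential absorbs. The arguments 1 + chi/2, 2 + chi and the positive integers are of this
    kind. *)
Lemma gker_dexp z (k : nat) : Re z = k.+1%:R -> exists2 C : R, 0 <= C & forall x, n1 (gker z x) <= C * dexp (1 / 2) x.
Proof.
move=> hz; have [|K K0 HK] := @expR_poly R k (1 / 2); first lra.
exists (2 * K); first lra.
move=> x; rewrite /gker mulrC n1_realM ger0_norm ?expR_ge0 //.
have := n1_cexp (z * x%:C); rewrite ReM /= mulr0 subr0 hz => h.
apply: le_trans (ler_wpM2l (expR_ge0 _) h) _; rewrite /dexp.
have := HK (expR x) (expR_ge0 _).
rewrite expRM_natl exprS.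
have -> : expR (- expR x) = expR (- (1 / 2 * expR x)) * expR (- (1 / 2 * expR x)).
  by rewrite -expRD; congr expR; field.
set p := expR (- (1 / 2 * expR x)).
have p0 : 0 <= expR x * p by rewrite mulr_ge0 ?expR_ge0.
by move/(ler_wpM2r p0) => ?; lra.
Qed.

(* Euler's integral for Gamma in the logarithmic variable. *)
Definition Gint z : R[i] := xget 0 [set l | impr (gker z) l]%classic.

Lemma Gint_impr z (k : nat) : Re z = k.+1%:R -> impr (gker z) (Gint z).
Proof.
move=> hz; have [C C0 HC] := gker_dexp hz.
have [|l hl _] := impr_exists (_ : 0 < 1 / 2) C0 (gker_ccn z) HC; first lra.
by rewrite /Gint; case: xgetP => [l' -> //|/(_ l)].
Qed.

Lemma Gint_eq z l : impr (gker z) l -> Gint z = l.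
Proof.
move=> hl; rewrite /Gint; case: xgetP => [l' _ h|/(_ l)//].
exact: impr_uniq h hl.
Qed.

Lemma gker_vanish z (k : nat) : Re z = k.+1%:R -> vanish (gker z).
Proof.
move=> hz; have [C C0 HC] := gker_dexp hz.
by apply: (dexp_vanish _ HC); lra.
Qed.

Lemma Gint_rec z (k : nat) : Re z = k.+1%:R -> Gint (z + 1) = z * Gint z.
Proof.
move=> hz; have hz1 : Re (z + 1) = k.+2%:R by rewrite ReD hz /= natr1.
have h1 := imprZ z (gker_ccn z) (Gint_impr hz); have h2 := Gint_impr hz1.
have h3 := imprB (ccnZ z (gker_ccn z)) (gker_ccn (z + 1)) h1 h2.
have h4 : impr (fun x => z * gker z x - gker (z + 1) x) 0.
  apply: (@impr_FTC _ _ (gker z)); last exact: gker_vanish hz.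
    have := ccnD (ccnZ z (gker_ccn z)) (ccnZ (-1) (gker_ccn (z + 1))) => h.
    by apply: (eq_ccn h) => x; rewrite mulN1r.
  exact: gker_cdv.
by have /eqP := impr_uniq h3 h4; rewrite subr_eq0 => /eqP.
Qed.

Lemma gker_nat (n : nat) x : gker n.+1%:R x = (expR x ^+ n.+1 * expR (- expR x))%:C.
Proof.
by rewrite /gker -realC_nat -realCM cexp_real -realCM expRM_natl.
Qed.

Lemma Gint1 : Gint 1 = 1.
Proof.
apply: Gint_eq => e e0; exists (ln (2 / e)) => a b; set A := ln _ => ha hb.
have E : gker 1 =1 (fun x => (dexp 1 x)%:C).
  by move=> x; rewrite (gker_nat 0) expr1 /dexp mul1r.
rewrite (eq_cintg _ _ E) cintg_real -(rmorph1 (real_complex R)) -rmorphB n1_real.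
rewrite intg_dexp // divr1 !mul1r.
have h1 : expR a <= expR (- A) by rewrite ler_expR.
have h2 : expR (- expR b) <= expR (- A).
  rewrite expRN [leRHS]expRN lef_pV2 ?posrE ?expR_gt0 //.
  have : expR A <= expR b by rewrite ler_expR.
  have := expR_ge1Dx (expR b); lra.
have h3 := expR_N_le (expR_ge0 a).
have h4 : expR (- expR a) <= 1 by rewrite -expR0 ler_expR oppr_le0 expR_ge0.
have h5 := expR_gt0 (- expR b).
have h6 : expR (- A) = e / 2 by rewrite expRN /A lnK ?posrE ?divr_gt0 // invf_div.
rewrite ler_norml; lra.
Qed.

Lemma Gint_nat (n : nat) : Gint n.+1%:R = n`!%:R.
Proof.
elim: n => [|n IH]; first exact: Gint1.
rewrite -natr1 (@Gint_rec _ n); first by rewrite IH factS natrM.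
by rewrite -realC_nat.
Qed.

Lemma Gint_prod z (k m : nat) : Re z = k.+1%:R -> Gint (z + m%:R) = \prod_(j < m) (z + j%:R) * Gint z.
Proof.
move=> hz; elim: m => [|m IH]; first by rewrite addr0 big_ord0 mul1r.
rewrite big_ord_recr /= -natr1 addrA (@Gint_rec _ (k + m)%N); first by rewrite IH; ring.
by rewrite ReD hz -realC_nat /= -natrD addSn.
Qed.

Lemma lipschitz1 (f f' : R -> R) : (forall x, dv f x (f' x)) -> (forall x, `|f' x| <= 1) ->
  forall x, `|f x - f 0| <= `|x|.
Proof.
move=> H b x; have [x0|/ltW x0] := leP 0 x.
  have [c _ ->] := MVT_dv x0 (fun y _ => H y).
  by rewrite subr0 normrM ler_piMl.
have [c _] := MVT_dv x0 (fun y _ => H y); rewrite distrC => ->.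
by rewrite sub0r normrM normrN ler_piMl.
Qed.

Lemma norm_sin_le x : `|sin x| <= `|x|.
Proof.
have := @lipschitz1 sin cos (fun y => is_derive_sin y) (@cos_max R) x.
by rewrite sin0 subr0.
Qed.

Lemma norm_cosB1_le x : `|cos x - 1| <= `|x|.
Proof.
have := @lipschitz1 cos (fun y => - sin y) (fun y => is_derive_cos y) _ x.
by rewrite cos0; apply => y; rewrite normrN; apply: sin_max.
Qed.

(** For w = e^t >= 1/2 one has |t| <= 2 |w - 1| and the phase is Lipschitz; for smaller w, |w - 1|
    >= 1/2 and boundedness suffices. Expressed in w, the estimate integrates against a Gamma density
    through its first two moments. *)
Lemma cexpB1_bound z (k : nat) : Re z = k.+1%:R -> (k <= 1)%N -> exists2 B : R, 0 <= B & forall t,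
  n1 (cexp (z * t%:C) - 1) <= B * ((expR t - 1) ^+ 2 + `|expR t - 1|).
Proof.
move=> hz k1; exists (4 * `|Im z| + 10); first by have := normr_ge0 (Im z); lra.
move=> t; set w := expR t; set th := Im z * t.
have w0 : 0 < w by apply: expR_gt0.
have E : cexp (z * t%:C) = (w ^+ k.+1 * cos th) +i* (w ^+ k.+1 * sin th).
  rewrite /cexp ReM ImM /= !mulr0 subr0 add0r hz expRM_natl.
  by apply: complexP; rewrite !(ReM, ImM) /= -/w -/th; ring.
have hc := cos_max th; have hs := sin_max th.
have q0 := normr_ge0 (w - 1).
have A1 : `|cos th - 1| + `|sin th| <= (4 * `|Im z| + 6) * `|w - 1|.
  have [w2|w2] := leP (1 / 2) w.
    have ht : `|t| <= 2 * `|w - 1|.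
      have h1 := expR_ge1Dx t; have h2 := expR_ge1Dx (- t); rewrite -/w in h1.
      rewrite expRN -/w in h2.
      have h3 : 1 - t <= w^-1 by lra.
      have : (1 - t) * w <= 1 by rewrite -ler_pdivlMr // mul1r.
      move=> h4; rewrite ler_norml.
      have := ler_norm (w - 1); have := ler_norm (- (w - 1)); rewrite normrN.
      have [t0|t0] := leP 0 t; first by lra.
      have h5 : (- t) * (1 / 2) <= (- t) * w by apply: ler_wpM2l; lra.
      by lra.
    have hth : `|th| <= 2 * `|Im z| * `|w - 1|.
      by rewrite /th normrM; have := ler_wpM2l (normr_ge0 (Im z)) ht; lra.
    have := norm_sin_le th; have := norm_cosB1_le th.
    have : 0 <= `|Im z| * `|w - 1| by rewrite mulr_ge0.
    by lra.
  have h1 : 1 / 2 <= `|w - 1|.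
    by have := ler_norm (- (w - 1)); rewrite normrN; lra.
  have h2 : `|cos th - 1| <= 2.
    by apply: le_trans (ler_normB _ _) _; rewrite normr1; lra.
  have : 0 <= `|Im z| * `|w - 1| by rewrite mulr_ge0.
  by lra.
have A2 : `|w ^+ k.+1 - 1| <= (w - 1) ^+ 2 + 2 * `|w - 1|.
  have := sqr_ge0 (w - 1).
  case: k k1 {hz E} => [|[|//]] _ s0; first by rewrite expr1; lra.
  have -> : w ^+ 2 - 1 = (w - 1) ^+ 2 + 2 * (w - 1) by ring.
  apply: le_trans (ler_normD _ _) _; rewrite ger0_norm // normrM.
  by rewrite (ger0_norm (x := 2)).
rewrite E /n1 /=.
have -> : w ^+ k.+1 * cos th - 1 = (w ^+ k.+1 - 1) * cos th + (cos th - 1) by ring.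
have -> : w ^+ k.+1 * sin th - 0 = (w ^+ k.+1 - 1) * sin th + sin th by ring.
have B1 : `|(w ^+ k.+1 - 1) * cos th + (cos th - 1)| <= `|w ^+ k.+1 - 1| + `|cos th - 1|.
  by apply: le_trans (ler_normD _ _) _; rewrite lerD2r normrM ler_piMr.
have B2 : `|(w ^+ k.+1 - 1) * sin th + sin th| <= `|w ^+ k.+1 - 1| + `|sin th|.
  by apply: le_trans (ler_normD _ _) _; rewrite lerD2r normrM ler_piMr.
have s0 := sqr_ge0 (w - 1).
have C1 : 0 <= `|Im z| * (w - 1) ^+ 2 by rewrite mulr_ge0.
lra.
Qed.

Definition gauss_prod z (m : nat) : R[i] := cpow_nat m z * m`!%:R / \prod_(j < m.+1) (z + j%:R).

Lemma gker_shiftE z (m : nat) x : (0 < m)%N ->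
  gker (z + m.+1%:R) x * cexp (- (z * (ln m%:R)%:C)) - gker m.+1%:R x =
  (expR x ^+ m.+1 * expR (- expR x))%:C * (cexp (z * (x - ln m%:R)%:C) - 1).
Proof.
move=> m0; rewrite mulrBr mulr1 -gker_nat; congr (_ - _).
rewrite /gker mulrDl cexpD rmorphB mulrBr [cexp (_ - _)]cexpD; ring.
Qed.

(** A law of large numbers: under the Gamma density of order [m + 1], the variable w = e^x/m
    satisfies E (w - 1)^2 = (m + 2)/m^2, so the mean of w^z is close to 1. The parameter [d] is free
    and is balanced against [m] in [gauss_prod_tends]. *)
Lemma gint_dist z (k m : nat) (B d : R) : Re z = k.+1%:R -> (0 < m)%N -> 0 <= B -> 0 < d ->
  (forall t, n1 (cexp (z * t%:C) - 1) <= B * ((expR t - 1) ^+ 2 + `|expR t - 1|)) ->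
  n1 (Gint (z + m.+1%:R) * cexp (- (z * (ln m%:R)%:C)) / m`!%:R - 1) <=
    B * ((1 + (2 * d)^-1) * (3 / m%:R) + d / 2).
Proof.
move=> hz m0 B0 d0 HB.
have m1 : 1 <= m%:R :> R by rewrite ler1n.
have f0 : 0 < m`!%:R :> R by rewrite ltr0n fact_gt0.
have hz' : Re (z + m.+1%:R) = (k + m.+1).+1%:R by rewrite ReD hz -realC_nat /= -natrD addSn.
set cm := cexp (- _).
pose h x := cm * gker (z + m.+1%:R) x - gker m.+1%:R x.
have nk (n : nat) : Re n.+1%:R = n.+1%:R by rewrite -realC_nat.
have ch : ccn h.
  have := ccnD (ccnZ cm (gker_ccn (z + m.+1%:R))) (ccnZ (-1) (gker_ccn m.+1%:R)) => H.
  by apply: (eq_ccn H) => x; rewrite mulN1r.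
have hi : impr h (cm * Gint (z + m.+1%:R) - m`!%:R).
  rewrite -(Gint_nat m); apply: imprB; [exact: ccnZ (gker_ccn _)|exact: gker_ccn| |].
  - by apply: imprZ; [exact: gker_ccn|exact: Gint_impr hz'].
  - exact: Gint_impr (nk m).
pose e (n : nat) x := expR x ^+ n.+1 * expR (- expR x).
pose q : R := B * (1 + (2 * d)^-1).
pose u x := q / m%:R ^+ 2 * e m.+2 x + 1 * (- (2 * q / m%:R) * e m.+1 x + (q + B * d / 2) * e m x).
have ce n : continuous (e n).
  have [c1 _] := gker_ccn n.+1%:R; apply: (eq_ctn c1) => x.
  by rewrite gker_nat.
have cu2 : continuous (fun x => - (2 * q / m%:R) * e m.+1 x + (q + B * d / 2) * e m x).
  by apply: ctnD; exact: ctnZ.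
have cu : continuous u by apply: ctnD; exact: ctnZ.
have ie n : impr (fun x => (e n x)%:C) (n`!%:R : R)%:C.
  rewrite realC_nat -(Gint_nat n); apply: (eq_impr (Gint_impr (nk n))) => x.
  exact: gker_nat.
pose r : R := q / m%:R ^+ 2 * (m.+2)`!%:R + 1 * (- (2 * q / m%:R) * (m.+1)`!%:R + (q + B * d / 2) * m`!%:R).
have iu : impr (fun x => (u x)%:C) r%:C.
  have h2 := impr_real_comb (- (2 * q / m%:R)) (q + B * d / 2) (ce m.+1) (ce m) (ie m.+1) (ie m).
  exact: impr_real_comb (q / m%:R ^+ 2) 1 (ce m.+2) cu2 (ie m.+2) h2.
have hu x : n1 (h x) <= u x.
  rewrite /h mulrC gker_shiftE // n1_realM ger0_norm; last by rewrite mulr_ge0 ?expR_ge0 // exprn_ge0 ?expR_ge0.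
  have E : expR (x - ln m%:R) = expR x / m%:R by rewrite expRD expRN lnK // posrE; lra.
  have := HB (x - ln m%:R); rewrite E; set w := expR x / m%:R => hw.
  have e0 : 0 <= e m x by rewrite mulr_ge0 ?expR_ge0 // exprn_ge0 ?expR_ge0.
  (* The arithmetic-geometric inequality replaces the first absolute moment by the second moment,
     which is explicit. *)
  have hd : `|w - 1| <= (w - 1) ^+ 2 * (2 * d)^-1 + d / 2.
    rewrite -(real_normK (num_real (w - 1))); set a := `|w - 1|.
    have -> : a ^+ 2 * (2 * d)^-1 + d / 2 = a + (a - d) ^+ 2 / (2 * d) by field; rewrite gt_eqF.
    by rewrite lerDl divr_ge0 ?sqr_ge0 // mulr_ge0 // ltW.
  have hq : B * ((w - 1) ^+ 2 + `|w - 1|) <= q * (w - 1) ^+ 2 + B * d / 2.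
    have := ler_wpM2l B0 hd; rewrite /q; lra.
  apply: le_trans (ler_wpM2l e0 (le_trans hw hq)) _.
  rewrite /u /e !exprS /w le_eqVlt; apply/orP; left; apply/eqP.
  by field; rewrite gt_eqF //; lra.
have := impr_le ch cu hu hi iu.
have fC : (m`!%:R : R[i]) != 0 by rewrite -realC_nat; apply/eqP => -[/eqP]; rewrite gt_eqF.
have -> : Gint (z + m.+1%:R) * cm / m`!%:R - 1 = (m`!%:R^-1 : R)%:C * (cm * Gint (z + m.+1%:R) - m`!%:R).
  by rewrite rmorphV ?unitfE ?gt_eqF //= realC_nat; field.
have fi : 0 <= m`!%:R^-1 :> R by rewrite invr_ge0 ltW.
move=> H; rewrite n1_realM (ger0_norm fi).
apply: le_trans (ler_wpM2l fi H) _.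
have -> : m`!%:R^-1 * r = q * ((m%:R + 2) / m%:R ^+ 2) + B * d / 2.
  rewrite /r !factS !natrM -(natr1 m.+1) -(natr1 m); field.
  by rewrite !gt_eqF //; lra.
rewrite mulrDr !mulrA lerD2r /q -!mulrA ler_wpM2l // ler_wpM2l //.
  by rewrite addr_ge0 // invr_ge0 mulr_ge0 // ltW.
by rewrite expr2 invfM mulrA ler_pM2r ?invr_gt0 ?ler_pdivrMr //; lra.
Qed.

(** The functional equation gives [Gint z = gauss_prod z m * (1 + eps m)], and [gint_dist] sends
    [eps] to 0. This links the Gauss limit that defines [Gamma] with Euler's integral. *)
Lemma gauss_prod_tends z (k : nat) : Re z = k.+1%:R -> (k <= 1)%N ->
  ctends (gauss_prod z) (Gint z) /\ Gint z != 0.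
Proof.
move=> hz k1; have [B B0 HB] := cexpB1_bound hz k1.
pose eps m := Gint (z + m.+1%:R) * cexp (- (z * (ln m%:R)%:C)) / m`!%:R - 1.
have Hn : null (fun m => n1 (eps m)).
  move=> e e0; pose d := e / (B + 1).
  have d0 : 0 < d by rewrite divr_gt0 //; lra.
  have K := nullZ (B * (1 + (2 * d)^-1) * 6) (@null_inv R).
  have [N HN] := K _ (divr_gt0 e0 (ltac:(lra) : 0 < 2 :> R)); exists N.+1 => m mN.
  have m0 : (0 < m)%N by lia.
  rewrite ger0_norm ?n1_ge0 //; apply: le_trans (gint_dist hz m0 B0 d0 HB) _.
  rewrite mulrDr [e]splitr; apply: lerD.
    have := HN m (ltnW mN); apply: le_trans; apply: le_trans (ler_norm _).
    have c0 : 0 <= B * (1 + (2 * d)^-1) by rewrite mulr_ge0 // addr_ge0 // invr_ge0 mulr_ge0 // ltW.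
    have m1 : 1 <= m%:R :> R by rewrite ler1n.
    have h6 : 3 / m%:R <= 6 / m.+1%:R :> R.
      rewrite -(natr1 m) ler_pdivrMr; last lra.
      by rewrite mulrAC ler_pdivlMr; lra.
    rewrite [leRHS](_ : _ = B * (1 + (2 * d)^-1) * (6 / m.+1%:R)); last by ring.
    rewrite [leLHS](_ : _ = B * (1 + (2 * d)^-1) * (3 / m%:R)); last by ring.
    exact: ler_wpM2l.
  rewrite mulrA ler_pM2r ?invr_gt0 // /d mulrA ler_pdivrMr; last lra.
  by have := ltW e0; lra.
have prod0 m : \prod_(j < m) (z + j%:R) != 0.
  apply/prodf_neq0 => j _; apply/eqP => E.
  have : Re (z + j%:R) = 0 by rewrite E.
  by rewrite ReD hz -realC_nat /= -natrD => /eqP; rewrite pnatr_eq0.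
have fC m : (m`!%:R : R[i]) != 0.
  by rewrite -realC_nat; apply/eqP => -[/eqP]; rewrite pnatr_eq0 eqn0Ngt fact_gt0.
have g0 m : gauss_prod z m != 0.
  apply: mulf_neq0; last by rewrite invr_neq0.
  by apply: mulf_neq0; [exact: cexp_neq0|exact: fC].
have E m : Gint z = gauss_prod z m * (1 + eps m).
  rewrite /eps addrC subrK (Gint_prod _ hz) /gauss_prod /cpow_nat.
  have := cexpN (z * (ln m%:R)%:C).
  set c1 := cexp _; set c2 := cexp _ => cc.
  transitivity (Gint z * (c1 * c2)); first by rewrite cc mulr1.
  by field; rewrite fC prod0.
have bnd : exists N, forall m, (N <= m)%N -> n1 (gauss_prod z m) <= 2 * n1 (Gint z).
  have [N HN] := Hn (1 / 2) ltac:(lra); exists N => m /HN.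
  rewrite ger0_norm ?n1_ge0 // => h.
  have : n1 (gauss_prod z m) <= n1 (Gint z) + n1 (gauss_prod z m) * n1 (eps m).
    have -> : gauss_prod z m = Gint z - gauss_prod z m * eps m by rewrite (E m); ring.
    apply: le_trans (n1B _ _) _; rewrite lerD2l.
    rewrite (_ : Gint z - gauss_prod z m * eps m = gauss_prod z m); first exact: n1M.
    by rewrite (E m); ring.
  have := ler_wpM2l (n1_ge0 (gauss_prod z m)) h; lra.
split.
  have K := nullZ (2 * n1 (Gint z)) Hn; apply: (null_le K).
  have [N HN] := bnd; exists N => m /HN h; rewrite ger0_norm ?n1_ge0 //.
  have -> : gauss_prod z m - Gint z = - (gauss_prod z m * eps m) by rewrite (E m); ring.
  rewrite n1N; apply: le_trans (n1M _ _) _; apply: ler_wpM2r => //; exact: n1_ge0.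
(* A zero of [Gint] would force a Gauss product to vanish, and none of them does. *)
apply/eqP => G0; have [N HN] := bnd.
have := HN N (leqnn N); rewrite G0 n1_0 mulr0 => h.
by have /eqP := g0 N; apply; apply: n1_eq0; apply/eqP; rewrite eq_le h n1_ge0.
Qed.
End GammaIntegral.

(** * Wallis' limit and Legendre duplication *)

Section Duplication.
Variable R : realType.
Implicit Types (z w l : R[i]) (x y : R).
Local Open Scope complex_scope.
Local Notation Re := (@complex.Re R).
Local Notation Im := (@complex.Im R).

Lemma dvX (f : R -> R) x d n : dv f x d -> dv (fun y => f y ^+ n.+1) x (n.+1%:R * f x ^+ n * d).
Proof.
move=> h; elim: n => [|n IH].
  by apply: (eq_dv (dv_eq h _)) => [|y]; rewrite ?expr1 // expr0 !mul1r.
apply: (eq_dv (dv_eq (dvM h IH) _)) => [|y]; last by rewrite [RHS]exprS.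
by rewrite -(natr1 n.+1) [f x ^+ n.+1]exprS; ring.
Qed.

Definition cosint (n : nat) : R := intg (fun x => cos x ^+ n) 0 (pi / 2).

Lemma ctn_cosX n : continuous (fun x : R => cos x ^+ n).
Proof.
case: n => [|n]; first by apply: (eq_ctn (@ctn_cst R 1)) => x; rewrite expr0.
by apply: (@dv_ctn _ _ (fun x => n.+1%:R * cos x ^+ n * - sin x)) => x; apply: dvX; apply: is_derive_cos.
Qed.

Lemma cos_pihalf_ge0 x : 0 <= x <= pi / 2 -> 0 <= cos x.
Proof. by move=> /andP[h1 h2]; apply: cos_ge0_pihalf; rewrite h2 andbT; have := @pi_ge0 R; lra. Qed.

Lemma cosint_rec n : n.+2%:R * cosint n.+2 = n.+1%:R * cosint n.
Proof.
have cX := ctn_cosX.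
have H : intg (fun x : R => n.+2%:R * cos x ^+ n.+2 - n.+1%:R * cos x ^+ n) 0 (pi / 2) = 0.
  have cf : continuous (fun x : R => n.+2%:R * cos x ^+ n.+2 - n.+1%:R * cos x ^+ n).
    by apply: ctnB; apply: ctnZ.
  rewrite (@intg_FTC _ _ (fun x => cos x ^+ n.+1 * sin x) _ _ cf).
    by rewrite cos_pihalf sin0 exprS !(mul0r, mulr0) subrr.
  move=> x; have h1 := @dvX cos x _ n (is_derive_cos x).
  apply: (dv_eq (dvM h1 (is_derive_sin x))).
  have S : sin x * sin x = 1 - cos x * cos x by have := cos2Dsin2 x; rewrite !expr2; lra.
  have -> : n.+1%:R * cos x ^+ n * - sin x * sin x = - (n.+1%:R * cos x ^+ n) * (sin x * sin x) by ring.
  by rewrite S -(natr1 n.+1) !exprS; ring.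
rewrite intgB in H; [|exact: ctnZ|exact: ctnZ].
rewrite !intgZ // in H; rewrite /cosint; lra.
Qed.

Lemma pihalf_ge0 : 0 <= pi / 2 :> R.
Proof. by have := @pi_ge0 R; lra. Qed.

Lemma cosint_ge0 n : 0 <= cosint n.
Proof.
apply: intg_ge0; [exact: pihalf_ge0|exact: ctn_cosX|].
by move=> x /cos_pihalf_ge0 h; rewrite exprn_ge0.
Qed.

Lemma cosint_le n : cosint n.+1 <= cosint n.
Proof.
apply: le_intg; [exact: pihalf_ge0|exact: ctn_cosX|exact: ctn_cosX|].
by move=> x /cos_pihalf_ge0 h; rewrite exprS ler_piMl ?exprn_ge0 ?cos_le1.
Qed.

Lemma cosint0 : cosint 0 = pi / 2.
Proof.
by rewrite /cosint (@eq_intg _ _ (fun=> 1)) ?intg_cst ?mul1r ?subr0.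
Qed.

Lemma cosint1 : cosint 1 = 1.
Proof.
rewrite /cosint (@intg_FTC _ _ sin); first by rewrite sin_pihalf sin0 subr0.
  exact: ctn_cosX.
by move=> x; rewrite expr1; apply: is_derive_sin.
Qed.

Lemma cosint_prod n : n.+1%:R * (cosint n * cosint n.+1) = pi / 2.
Proof.
elim: n => [|n IH]; first by rewrite cosint0 cosint1 mulr1 mul1r.
rewrite -IH mulrCA cosint_rec; ring.
Qed.

Lemma cosint_odd m : cosint (2 * m).+1 = 4 ^+ m * (m`!%:R) ^+ 2 / ((2 * m).+1)`!%:R.
Proof.
elim: m => [|m IH]; first by rewrite muln0 cosint1 expr0 fact0 expr1n !mul1r invr1.
have E : (2 * m.+1)%N = (2 * m).+2 by lia.
rewrite E; have := cosint_rec (2 * m).+1; rewrite IH => H.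
have f0 : ((2 * m).+1)`!%:R != 0 :> R by rewrite pnatr_eq0 eqn0Ngt fact_gt0.
have -> : cosint (2 * m).+3 = (2 * m).+2%:R * (4 ^+ m * m`!%:R ^+ 2 / ((2 * m).+1)`!%:R) / (2 * m).+3%:R.
  by rewrite -H mulrC mulKf // pnatr_eq0.
have -> : ((2 * m).+3)`!%:R = (2 * m).+3%:R * ((2 * m).+2%:R * ((2 * m).+1)`!%:R) :> R by rewrite -!natrM.
have -> : (m.+1)`!%:R = m.+1%:R * m`!%:R :> R by rewrite -natrM.
rewrite [4 ^+ m.+1]exprS; set F := ((2 * m).+1)`!%:R in f0 *.
rewrite -(natr1 (2 * m).+2) -(natr1 (2 * m).+1) -(natr1 (2 * m)) -(natr1 m) natrM.
by have := ler0n R m => m0; field; rewrite f0 /=; lra_neq0.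
Qed.

(** The integrals decrease and (n + 1) [cosint n] [cosint n.+1] is pi/2 for every n, so the
    neighbours of index 2m + 1 enclose m times the square of [cosint] within O(1/m) of pi/4. *)
Lemma wallis : tends (fun m => Num.sqrt m%:R * cosint (2 * m).+1) (Num.sqrt pi / 2).
Proof.
have p0 := @pi_gt0 R.
have sp : Num.sqrt pi / 2 = Num.sqrt (pi / 4) :> R.
  rewrite sqrtrM ?ltW // sqrtrV //; congr (_ / _).
  have E4 : (4 : R) = 2 ^+ 2 by ring.
  by rewrite E4 sqrtr_sqr ger0_norm.
have s0 : 0 < Num.sqrt (pi / 4) :> R by rewrite sqrtr_gt0; lra.
have K := nullZ (pi / (4 * Num.sqrt (pi / 4))) (@null_inv R).
rewrite sp; apply: (null_le0 K) => m.
set c := cosint (2 * m).+1.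
have c0 : 0 <= c by apply: cosint_ge0.
have -> : Num.sqrt m%:R * c = Num.sqrt (m%:R * c ^+ 2).
  by rewrite sqrtrM ?ler0n // sqrtr_sqr ger0_norm.
set x := m%:R * c ^+ 2.
have x0 : 0 <= x by rewrite mulr_ge0 ?sqr_ge0.
have h1 := cosint_prod (2 * m).+1; have h2 := cosint_prod (2 * m).
have M0 := ler0n R m.
have E1 : (2 * m).+1%:R = 2 * m%:R + 1 :> R by rewrite -natr1 natrM.
have E2 : (2 * m).+2%:R = 2 * m%:R + 2 :> R by rewrite -natr1 E1; ring.
rewrite E2 -/c in h1; rewrite E1 -/c in h2.
have hx1 : pi / 2 <= (2 * m%:R + 2) * c ^+ 2.
  rewrite -h1 expr2; apply: ler_wpM2l; first by lra.
  by apply: ler_wpM2l => //; apply: cosint_le.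
have hx2 : (2 * m%:R + 1) * c ^+ 2 <= pi / 2.
  rewrite -h2 expr2; apply: ler_wpM2l; first by lra.
  by apply: ler_wpM2r => //; apply: cosint_le.
have cc := sqr_ge0 c.
have hd : `|x - pi / 4| <= pi / 4 / m.+1%:R.
  rewrite ler_pdivlMr ?ltr0n // -(natr1 m) -[X in _ * X]ger0_norm; last by lra.
  rewrite -normrM ler_norml /x; apply/andP; split.
    have : 0 <= m%:R * ((2 * m%:R + 2) * c ^+ 2 - pi / 2) by rewrite mulr_ge0 // subr_ge0.
    by lra.
  have : 0 <= m%:R * (pi / 2 - (2 * m%:R + 1) * c ^+ 2) by rewrite mulr_ge0 // subr_ge0.
  have : m%:R * c ^+ 2 <= pi / 4 by lra.
  by lra.
have hs : (Num.sqrt x - Num.sqrt (pi / 4)) * (Num.sqrt x + Num.sqrt (pi / 4)) = x - pi / 4.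
  by rewrite -subr_sqr !sqr_sqrtr //; lra.
have sx := sqrtr_ge0 x.
have : `|Num.sqrt x - Num.sqrt (pi / 4)| * Num.sqrt (pi / 4) <= pi / 4 / m.+1%:R.
  apply: le_trans hd; rewrite -hs normrM ler_wpM2l // ger0_norm; lra.
rewrite -ler_pdivlMr //= => /le_trans; apply; rewrite le_eqVlt; apply/orP; left; apply/eqP.
by field; apply/andP; split; rewrite gt_eqF //; lra.
Qed.

Lemma prod_double w m :
  \prod_(i < (2 * m)%N) (2 * w + i%:R) = 4 ^+ m * \prod_(j < m) ((w + j%:R) * (w + 1 / 2 + j%:R)) :> R[i].
Proof.
elim: m => [|m IH]; first by rewrite muln0 !big_ord0 expr0 mulr1.
have -> : (2 * m.+1)%N = (2 * m).+2 by lia.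
by rewrite !big_ord_recr /= IH exprS -(natr1 (2 * m)) natrM; field.
Qed.

Lemma tends_cexp_half z : Re z = 2 ->
  ctends (fun m : nat => cexp (z * (ln (m.+1%:R / (2 * m.+1).+1%:R))%:C)) (cexp (- (z * (ln 2)%:C))).
Proof.
move=> hz; have [B B0 HB] := @cexpB1_bound R z 1 hz isT.
set c := cexp (- _).
have K := nullZ (n1 c * (B * 2)) (@null_inv R); apply: (null_le0 K) => m.
rewrite ger0_norm ?n1_ge0 //.
have M0 := ler0n R m.
have p1 : 0 < m.+1%:R :> R by rewrite ltr0n.
have p2 : 0 < (2 * m.+1).+1%:R :> R by rewrite ltr0n.
pose q : R := m.+1%:R / (2 * m.+1).+1%:R * 2.
have q0 : 0 < q by rewrite mulr_gt0 // divr_gt0.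
have E : ln (m.+1%:R / (2 * m.+1).+1%:R) = - ln 2 + ln q.
  have -> : ln q = ln (m.+1%:R / (2 * m.+1).+1%:R) + ln 2 by rewrite /q [LHS]lnM // posrE ?divr_gt0.
  by ring.
rewrite E rmorphD mulrDr cexpD rmorphN mulrN -/c.
have -> : c * cexp (z * (ln q)%:C) - c = c * (cexp (z * (ln q)%:C) - 1) by ring.
apply: le_trans (n1M _ _) _; rewrite -mulrA; apply: ler_wpM2l; first exact: n1_ge0.
apply: le_trans (HB _) _; rewrite lnK ?posrE // -mulrA; apply: ler_wpM2l => //.
have hq : `|q - 1| <= m.+1%:R^-1.
  have -> : q - 1 = - (2 * m.+1).+1%:R^-1.
    by rewrite /q -(natr1 (2 * m.+1)) natrM -(natr1 m); field; lra_neq0.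
  rewrite normrN ger0_norm; last by rewrite invr_ge0 ltW.
  by rewrite lef_pV2 ?posrE // ler_nat; lia.
have hq1 : `|q - 1| <= 1.
  by apply: le_trans hq _; rewrite -[leRHS]invr1 lef_pV2 ?posrE // ler1n.
rewrite -(real_normK (num_real (q - 1))) expr2.
have := ler_pM (normr_ge0 _) (normr_ge0 _) hq1 (lexx `|q - 1|).
move: hq; rewrite /=; set r := m.+1%:R^-1; set n := `|q - 1|; clear => h1 h2; lra.
Qed.

(** At [w + 1/2] the real part is 3/2, outside the scope of [gauss_prod_tends]. The Gauss products
    at [w], [w + 1/2] and [2 w] satisfy an exact relation, and as [Gint w] is nonzero the limit at
    [w + 1/2] follows from the other two. *)
Lemma gauss_prod_duplication w : Re w = 1 ->
  exists2 L, ctends (gauss_prod (w + 1 / 2)) L &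
    L * Gint w = 2 * (Num.sqrt pi)%:C * cexp (- (2 * w * (ln 2)%:C)) * Gint (2 * w).
Proof.
move=> hw.
have hw2 : Re (2 * w) = 2 by rewrite -(realC_nat R 2) ReM /= hw; ring.
have [h1 n0] := @gauss_prod_tends R w 0 hw isT.
have [h2 _] := @gauss_prod_tends R (2 * w) 1 hw2 isT.
have hr (j : nat) : w + j%:R != 0.
  apply/eqP => E; have : Re (w + j%:R) = 0 by rewrite E.
  by rewrite ReD hw -realC_nat /= => /eqP; rewrite addrC natr1 pnatr_eq0.
have hr2 (j : nat) : w + 1 / 2 + j%:R != 0.
  apply/eqP => E; have : Re (w + 1 / 2 + j%:R) = 0 by rewrite E.
  rewrite !ReD hw -realC_nat.
  have -> : (1 / 2 : R[i]) = (1 / 2 : R)%:C by rewrite rmorphM rmorphV ?unitfE //= ?rmorph1 ?realC_nat.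
  by rewrite /= => E2; have := ler0n R j; lra.
(* With M = m + 1, the Gauss product of index 2M + 1 at [2 w] has 2M + 2 factors, which
   [prod_double] splits evenly. The factorials left over form [cosint (2 * M).+1], whose limit is
   [wallis]; starting at M = 1 avoids ln 0. *)
pose rho (m : nat) : R[i] := cexp (2 * w * (ln (m.+1%:R / (2 * m.+1).+1%:R))%:C) *
  (4 * (Num.sqrt m.+1%:R * cosint (2 * m.+1).+1))%:C.
have E m : gauss_prod w m.+1 * gauss_prod (w + 1 / 2) m.+1 = rho m * gauss_prod (2 * w) (2 * m.+1).+1.
  rewrite /gauss_prod /rho /cpow_nat; set M := m.+1.
  have M0 : 0 < M%:R :> R by rewrite ltr0n.
  have N0 : 0 < (2 * M).+1%:R :> R by rewrite ltr0n.
  have -> : \prod_(j < (2 * M).+2) (2 * w + j%:R) = 4 ^+ M.+1 *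
     ((\prod_(j < M.+1) (w + j%:R)) * (\prod_(j < M.+1) (w + 1 / 2 + j%:R))).
    by rewrite -big_split /= -prod_double mulnS.
  rewrite lnM ?posrE ?invr_gt0 // lnV ?posrE //.
  have sq : (Num.sqrt (M%:R : R))%:C = @cexp R (1 / 2 * (ln (M%:R : R))%:C).
    transitivity (@cexp R (1 / 2 * ln M%:R : R)%:C); last first.
      congr cexp; rewrite rmorphM; congr (_ * _).
      by rewrite rmorphM rmorphV ?unitfE //= ?rmorph1 ?realC_nat.
    rewrite cexp_real; congr (_%:C); apply/eqP.
    rewrite -(eqrXn2 (n := 2)) ?sqrtr_ge0 ?expR_ge0 // sqr_sqrtr ?ltW // -expRM_natl.
    by rewrite mulrA mulrC (_ : ln _ * (2%:R * (1 / 2)) = ln M%:R) ?lnK ?posrE //; field.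
  have -> : @cexp R ((w + 1 / 2) * (ln (M%:R : R))%:C) = cexp (w * (ln (M%:R : R))%:C) * (Num.sqrt (M%:R : R))%:C.
    by rewrite sq -cexpD; congr cexp; ring.
  have -> : @cexp R (2 * w * (ln (M%:R : R) - ln ((2 * M).+1%:R : R))%:C) =
     cexp (w * (ln (M%:R : R))%:C) * cexp (w * (ln (M%:R : R))%:C) * cexp (- (2 * w * (ln ((2 * M).+1%:R : R))%:C)).
    by rewrite -!cexpD rmorphB; congr cexp; ring.
  have := cexpN (2 * w * (ln (2 * M).+1%:R)%:C).
  set c1 := cexp (w * _); set c2 := cexp (2 * w * _); set c3 := cexp (- _) => cc.
  rewrite cosint_odd !realCM (rmorphV _ (_ : _ \is a GRing.unit)); last first.
    by rewrite unitfE pnatr_eq0 eqn0Ngt fact_gt0.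
  rewrite !rmorphXn /= !realC_nat.
  have f0 : (((2 * M).+1)`!%:R : R[i]) != 0 by rewrite -realC_nat; apply/eqP => -[/eqP]; rewrite pnatr_eq0 eqn0Ngt fact_gt0.
  have P1 : \prod_(j < M.+1) (w + j%:R) != 0 by apply/prodf_neq0 => j _.
  have P2 : \prod_(j < M.+1) (w + 1 / 2 + j%:R) != 0 by apply/prodf_neq0 => j _.
  have k0 : (4 : R[i]) ^+ M.+1 != 0 by rewrite expf_neq0 // pnatr_eq0.
  set p1 := \prod_(j < M.+1) (w + j%:R) in P1 *.
  set p2 := \prod_(j < M.+1) (w + 1 / 2 + j%:R) in P2 *.
  rewrite (_ : c1 * c1 * c3 * (4 * ((Num.sqrt M%:R)%:C * (4 ^+ M * M`!%:R ^+ 2 / ((2 * M).+1)`!%:R))) *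
    (c2 * ((2 * M).+1)`!%:R / (4 ^+ M.+1 * (p1 * p2))) =
    (c2 * c3) * (c1 * c1 * (4 * ((Num.sqrt M%:R)%:C * (4 ^+ M * M`!%:R ^+ 2 / ((2 * M).+1)`!%:R))) *
    (((2 * M).+1)`!%:R / (4 ^+ M.+1 * (p1 * p2))))); last by ring.
  rewrite cc mul1r [4 ^+ M.+1]exprS; field.
  by rewrite P1 P2 f0 expf_neq0 // pnatr_eq0.
have T1 : ctends (fun m => gauss_prod w m.+1) (Gint w).
  by apply: (ctends_sub (a := fun m => m.+1)) h1.
have T2 : ctends (fun m => gauss_prod (2 * w) (2 * m.+1).+1) (Gint (2 * w)).
  by apply: (ctends_sub (a := fun m => (2 * m.+1).+1)) h2 => n; lia.
have T3 : ctends rho (cexp (- (2 * w * (ln 2)%:C)) * (4 * (Num.sqrt pi / 2))%:C).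
  apply: ctendsM; first exact: tends_cexp_half.
  apply: ctends_real; apply: tendsZ.
  by have := (tends_shift _ _ 1).2 wallis => h; apply: (eq_tends h) => n; rewrite addn1.
have T4 := ctendsM (ctendsM T3 T2) (ctends_inv n0 T1).
exists (cexp (- (2 * w * (ln 2)%:C)) * (4 * (Num.sqrt pi / 2))%:C * Gint (2 * w) / Gint w).
  apply/(ctends_shift _ _ 1); apply: (eq_ctends T4) => m; rewrite addn1 -E mulrAC mulfV ?mul1r //.
  rewrite /gauss_prod; apply: mulf_neq0; last by rewrite invr_neq0 //; apply/prodf_neq0 => j _.
  apply: mulf_neq0; first exact: cexp_neq0.
  by rewrite -realC_nat; apply/eqP => -[/eqP]; rewrite pnatr_eq0 eqn0Ngt fact_gt0.
rewrite mulfVK // (_ : 4 * (Num.sqrt pi / 2) = 2 * Num.sqrt pi); last by field.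
by rewrite realCM realC_nat; ring.
Qed.
End Duplication.

(** * Hasse's series *)

Section Bernoulli.
Variable R : realType.
Implicit Types (x y t : R) (N i n : nat).

Lemma dv_uniq (f : R -> R) x d e : dv f x d -> dv f x e -> d = e.
Proof. by move=> [_ <-] [_ <-]. Qed.

Lemma dvXn (f : R -> R) x d n : f x != 0 -> dv f x d -> dv (fun y => f y ^+ n) x (n%:R * f x ^+ n / f x * d).
Proof.
move=> f0 h; case: n => [|n].
  by rewrite !mul0r; apply: (eq_dv (dv_cst 1 x)) => y; rewrite expr0.
by apply: (dv_eq (dvX n h)); rewrite [f x ^+ n.+1]exprS; field.
Qed.

Definition expN x : R := expR (- expR x).
Definition expC x : R := 1 - expN x.

Lemma expN_gt0 x : 0 < expN x. Proof. exact: expR_gt0. Qed.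

Lemma expN_lt1 x : expN x < 1.
Proof. by rewrite /expN -expR0 ltr_expR oppr_lt0 expR_gt0. Qed.

Lemma expC_gt0 x : 0 < expC x.
Proof. by rewrite subr_gt0 expN_lt1. Qed.

Lemma expC_lt1 x : expC x < 1.
Proof. by rewrite /expC; have := expN_gt0 x; lra. Qed.

Lemma expC_le x : expC x <= expR x.
Proof. by apply: expR_N_le; exact: expR_ge0. Qed.

Lemma expN_dv x : dv expN x (- (expR x * expN x)).
Proof.
by apply: (dv_eq (dv_exp (dvN (dv_exp (dv_id x))))); rewrite /expN; ring.
Qed.

Lemma expC_dv x : dv expC x (expR x * expN x).
Proof. by apply: (dv_eq (dvB (dv_cst 1 x) (expN_dv x))); ring. Qed.

Lemma expR_dv x : dv (fun y => expR y) x (expR x).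
Proof. exact: is_derive_expR. Qed.

(** Remainder of the series t = -ln(1 - u) = \sum u^(n+1)/(n+1) at u = 1 - e^-t. Its derivative is
    just u^N, from which the bounds below follow by monotonicity. *)
Definition logrem N t : R := t - \sum_(n < N) (1 - expR (- t)) ^+ n.+1 / n.+1%:R.

Lemma dv_sum N (f : nat -> R -> R) (d : nat -> R) x : (forall n, dv (f n) x (d n)) ->
  dv (fun y => \sum_(n < N) f n y) x (\sum_(n < N) d n).
Proof.
move=> H; elim: N => [|N IH].
  by rewrite big_ord0; apply: (eq_dv (dv_cst 0 x)) => y; rewrite big_ord0.
by rewrite big_ord_recr; apply: (eq_dv (dvD IH (H N))) => y; rewrite big_ord_recr.
Qed.

Lemma compl_exp_dv t : dv (fun t => 1 - expR (- t)) t (expR (- t)).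
Proof.
by apply: (dv_eq (dvB (dv_cst 1 t) (dv_exp (dvN (dv_id t))))); ring.
Qed.

Lemma logrem_dv N t : dv (logrem N) t ((1 - expR (- t)) ^+ N).
Proof.
set u := 1 - expR (- t).
have H n : dv (fun t => (1 - expR (- t)) ^+ n.+1 / n.+1%:R) t (u ^+ n * expR (- t)).
  apply: (eq_dv (dv_eq (dvZ n.+1%:R^-1 (dvX n (compl_exp_dv t))) _)) => [|y]; last exact: mulrC.
  by rewrite -/u !mulrA mulVf ?mul1r // pnatr_eq0.
apply: (dv_eq (dvB (dv_id t) (dv_sum N H))).
have E : expR (- t) = 1 - u by rewrite /u; ring.
rewrite E; elim: N => [|N IH]; first by rewrite big_ord0 expr0 subr0.
by rewrite big_ord_recr /= opprD addrA IH exprS; ring.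
Qed.

Lemma compl_exp_ge0 t : 0 <= t -> 0 <= 1 - expR (- t).
Proof. by move=> t0; rewrite subr_ge0 -expR0 ler_expR oppr_le0. Qed.

Lemma logrem0 N : logrem N 0 = 0.
Proof. by rewrite /logrem oppr0 expR0 subrr big1 ?subr0 // => i _; rewrite expr0n mul0r. Qed.

Lemma logrem_ge0 N t : 0 <= t -> 0 <= logrem N t.
Proof.
move=> t0; rewrite -(logrem0 N); apply: (dv_ge0_le t0 (fun x _ => logrem_dv N x)) => x /andP[x0 _].
by rewrite exprn_ge0 // compl_exp_ge0.
Qed.

Lemma logrem_le N t : 0 <= t -> logrem N t <= (1 - expR (- t)) ^+ N * t.
Proof.
move=> t0; case: N => [|N]; first by rewrite /logrem big_ord0 expr0 mul1r subr0.
have H x : dv (fun t => (1 - expR (- t)) ^+ N.+1 * t - logrem N.+1 t) x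
   (N.+1%:R * (1 - expR (- x)) ^+ N * expR (- x) * x).
  apply: (dv_eq (dvB (dvM (dvX N (compl_exp_dv x)) (dv_id x)) (logrem_dv N.+1 x))); ring.
have := dv_ge0_le t0 (fun x _ => H x); rewrite mulr0 logrem0 subr0 subr_ge0; apply.
by move=> x /andP[x0 _]; rewrite !mulr_ge0 ?expR_ge0 // exprn_ge0 // compl_exp_ge0.
Qed.

Lemma logrem_le2 N t : 0 <= t -> expR (- t) * logrem N t <= (1 - expR (- t)) ^+ N.+1 / N.+1%:R.
Proof.
move=> t0.
have H x : dv (fun t => N.+1%:R^-1 * (1 - expR (- t)) ^+ N.+1 - expR (- t) * logrem N t) x
   (expR (- x) * logrem N x).
  apply: (dv_eq (dvB (dvZ N.+1%:R^-1 (dvX N (compl_exp_dv x))) (dvM (dv_exp (dvN (dv_id x))) (logrem_dv N x)))).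
  by field; rewrite addrC natr1 pnatr_eq0.
have := dv_ge0_le t0 (fun x _ => H x).
rewrite logrem0 mulr0 oppr0 expR0 subrr expr0n mulr0 addr0 subr_ge0 => K.
by rewrite [leRHS]mulrC; apply: K => x /andP[x0 _]; rewrite mulr_ge0 ?expR_ge0 // logrem_ge0.
Qed.

(* Remainder after N terms of the expansion T/(e^T - 1) = \sum_n e^{-T} (1 - e^{-T})^n / (n + 1),
   T = e^x, whose Mellin transform termwise is Hasse's series. *)
Definition brem N x : R := expN x * logrem N (expR x) / expC x.

Lemma brem_dv N x : dv (brem N) x (expR x * (expN x * expC x ^+ N - brem N x) / expC x).
Proof.
have u0 : expC x != 0 by rewrite gt_eqF // expC_gt0.
have hg : dv (fun y => logrem N (expR y)) x (expC x ^+ N * expR x).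
  exact: (dv_comp (logrem_dv N (expR x)) (expR_dv x)).
apply: (dv_eq (dvM (dvM (expN_dv x) hg) (dv_inv u0 (expC_dv x)))).
rewrite /brem; have -> : expN x = 1 - expC x by rewrite /expC; ring.
by field.
Qed.

Lemma brem_ge0 N x : 0 <= brem N x.
Proof.
by rewrite /brem divr_ge0 ?(ltW (expC_gt0 x)) // mulr_ge0 ?(ltW (expN_gt0 x)) // logrem_ge0 ?expR_ge0.
Qed.

Lemma brem_le N x : brem N.+1 x <= expN x * expR x * expC x ^+ N.
Proof.
rewrite /brem ler_pdivrMr ?expC_gt0 // -!mulrA ler_wpM2l ?(ltW (expN_gt0 x)) //.
by apply: le_trans (logrem_le _ (expR_ge0 x)) _; rewrite -/(expC x) mulrC exprSr.
Qed.

Lemma brem_le2 N x : brem N x <= expC x ^+ N / N.+1%:R.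
Proof.
rewrite /brem ler_pdivrMr ?expC_gt0 //.
by apply: le_trans (logrem_le2 N (expR_ge0 x)) _; rewrite -/(expC x) exprSr mulrAC.
Qed.

Lemma bremE N x : brem 0 x = brem N x + \sum_(n < N) expN x * expC x ^+ n / n.+1%:R.
Proof.
have u0 : expC x != 0 by rewrite gt_eqF // expC_gt0.
rewrite /brem /logrem big_ord0 subr0 -/(expC x) mulrBr mulrBl -addrA -[LHS]addr0; congr (_ + _).
apply/esym/eqP; rewrite addrC subr_eq0; apply/eqP.
rewrite mulr_sumr mulr_suml; apply: eq_bigr => n _.
by rewrite exprSr; field; rewrite u0 addrC natr1 pnatr_eq0.
Qed.

Local Open Scope ring_scope.

(* T^i times the i-th T-derivative of brem N, where T = expR x, is
   T^i (A(u) e^{-T} u^N + B(u) brem N) / u^i with u = 1 - e^{-T}. *)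
Fixpoint bpoly N i : {poly R} * {poly R} :=
  if i is j.+1 then
    let AB := bpoly N j in
    ('X * (AB.1^`() * (1 - 'X) - AB.1) + (N%:R - j%:R)%:P * (1 - 'X) * AB.1 + AB.2,
     'X * (1 - 'X) * AB.2^`() - AB.2 - (j%:R)%:P * (1 - 'X) * AB.2)
  else (0, 1).

Definition bder N i x : R := expR x ^+ i *
  (((bpoly N i).1).[expC x] * expN x * expC x ^+ N + ((bpoly N i).2).[expC x] * brem N x) / expC x ^+ i.

Lemma bder0 N x : bder N 0 x = brem N x.
Proof. by rewrite /bder /= !expr0 divr1 mul1r horner0 !mul0r add0r hornerC mul1r. Qed.

Lemma horner_dv (p : {poly R}) (f : R -> R) x d : dv f x d -> dv (fun y => p.[f y]) x ((p^`()).[f x] * d).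
Proof. by move=> h; apply: (@dv_comp _ (fun y => p.[y])) => //; apply: is_derive_poly. Qed.

Lemma bder_dv N i x : dv (bder N i) x (i%:R * bder N i x + bder N i.+1 x).
Proof.
have u0 : expC x != 0 by rewrite gt_eqF // expC_gt0.
have t0 : expR x != 0 by rewrite gt_eqF // expR_gt0.
set A := (bpoly N i).1; set B := (bpoly N i).2.
have hA := horner_dv A (expC_dv x); have hB := horner_dv B (expC_dv x).
have h1 := dvD (dvM (dvM hA (expN_dv x)) (dvXn N u0 (expC_dv x))) (dvM hB (brem_dv N x)).
have ui : expC x ^+ i != 0 by rewrite expf_neq0.
have h2 := dvM (dvM (dvXn i t0 (expR_dv x)) h1) (@dv_inv _ (fun y => expC y ^+ i) x _ ui (dvXn i u0 (expC_dv x))).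
apply: (dv_eq h2); rewrite /bder /= -/A -/B.
rewrite !(hornerD, hornerN, hornerM, hornerX, hornerC).
have -> : expN x = 1 - expC x by rewrite /expC; ring.
rewrite !exprS.
set a := A.[_]; set a' := (A^`()).[_]; set b := B.[_]; set b' := (B^`()).[_].
set u := expC x in u0 ui *; set t := expR x in t0 *; set r := brem N x.
set ut := u ^+ i in ui *; set un := u ^+ N; set tt := t ^+ i.
by field; rewrite u0 ui t0.
Qed.

Lemma expNX_dv (m : nat) x : dv (fun y => expN y ^+ m) x (- (m%:R * expR x * expN x ^+ m)).
Proof.
have n0 : expN x != 0 by rewrite gt_eqF // expN_gt0.
by apply: (dv_eq (dvXn m n0 (expN_dv x))); field.
Qed.

(** This is T^i times the i-th T-derivative of e^(-m T), with T = e^x. As d/dx = T d/dT, it obeys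
    the same rule of differentiation as [bder]. *)
Definition expder i (m : nat) x : R := (- (m%:R * expR x)) ^+ i * expN x ^+ m.

Lemma expder_dv i m x : dv (expder i m) x (i%:R * expder i m x + expder i.+1 m x).
Proof.
have h : dv (fun y => - (m%:R * expR y)) x (- (m%:R * expR x)) by apply: dvN; apply: dvZ; exact: expR_dv.
case: i => [|i].
  rewrite mul0r add0r /expder expr1.
  apply: (eq_dv (dv_eq (expNX_dv m x) _)) => [|y]; last by rewrite expr0 mul1r.
  by ring.
apply: (dv_eq (dvM (dvX i h) (expNX_dv m x))); rewrite /expder !exprS; ring.
Qed.

Definition hasse_der i N x : R :=
  \sum_(n < N) n.+1%:R^-1 * \sum_(k < n.+1) (-1) ^+ k * 'C(n, k)%:R * expder i k.+1 x.

Lemma hasse_der_dv i N x : dv (hasse_der i N) x (i%:R * hasse_der i N x + hasse_der i.+1 N x).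
Proof.
have H n : dv (fun y => n.+1%:R^-1 * \sum_(k < n.+1) (-1) ^+ k * 'C(n, k)%:R * expder i k.+1 y) x
   (n.+1%:R^-1 * \sum_(k < n.+1) (-1) ^+ k * 'C(n, k)%:R * (i%:R * expder i k.+1 x + expder i.+1 k.+1 x)).
  by apply: dvZ; apply: (@dv_sum n.+1 (fun k y => (-1) ^+ k * 'C(n, k)%:R * expder i k.+1 y)
      (fun k => (-1) ^+ k * 'C(n, k)%:R * (i%:R * expder i k.+1 x + expder i.+1 k.+1 x))) => k; apply: dvZ; exact: expder_dv.
apply: (dv_eq (dv_sum N H)).
rewrite /hasse_der mulr_sumr -big_split /=; apply: eq_bigr => n _.
rewrite mulrCA -mulrDr; congr (_ * _).
rewrite mulr_sumr -big_split /=; apply: eq_bigr => k _; ring.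
Qed.

Lemma hasse_der0 N x : hasse_der 0 N x = \sum_(n < N) expN x * expC x ^+ n / n.+1%:R.
Proof.
apply: eq_bigr => n _; rewrite [RHS]mulrC; congr (_ * _).
rewrite /expC exprBn mulr_sumr; apply: eq_bigr => k _.
by rewrite expr1n /expder expr0 exprS -mulr_natr; ring.
Qed.

(** Differentiate the expansion [bremE] repeatedly: both sides follow the same rule, so uniqueness
    of the derivative and cancellation of the terms with factor [i] give the next order. *)
Lemma bderE i N x : bder 0 i x = bder N i x + hasse_der i N x.
Proof.
elim: i x => [|i IH] x; first by rewrite !bder0 hasse_der0 -bremE.
have h1 := bder_dv 0 i x.
have h2 := dvD (bder_dv N i x) (hasse_der_dv i N x).
have := dv_uniq h1 (eq_dv h2 (fun y => esym (IH y))).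
rewrite (IH x) mulrDr addrACA; exact: addrI.
Qed.

Lemma poly_bound01 (p : {poly R}) : exists2 C : R, 0 <= C & forall u, 0 <= u <= 1 -> `|p.[u]| <= C.
Proof.
exists (\sum_(i < size p) `|p`_i|); first by rewrite sumr_ge0.
move=> u /andP[u0 u1]; rewrite horner_coef; apply: le_trans (ler_norm_sum _ _ _) _.
apply: ler_sum => i _; rewrite normrM ler_piMr // ger0_norm ?exprn_ge0 //.
by rewrite exprn_ile1.
Qed.

(** Division by u^i costs i powers of u = 1 - e^-T and [brem_le] one more, hence the index
    [(N + i).+1] for a remaining factor u^N. *)
Lemma bder_bound N i : exists2 C : R, 0 <= C & forall x,
  `|bder (N + i).+1 i x| <= C * (expR x ^+ i * expN x * (1 + expR x) * expC x ^+ N).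
Proof.
have [a a0 Ha] := poly_bound01 (bpoly (N + i).+1 i).1.
have [b b0 Hb] := poly_bound01 (bpoly (N + i).+1 i).2.
exists (a + b); first by rewrite addr_ge0.
move=> x; have u0 := expC_gt0 x; have u1 := expC_lt1 x.
have uu : 0 <= expC x <= 1 by rewrite !ltW.
have t0 := expR_gt0 x; have e0 := expN_gt0 x.
rewrite /bder normrM normfV normrM (ger0_norm (_ : 0 <= expR x ^+ i)) ?exprn_ge0 ?(ltW t0) //.
rewrite (ger0_norm (_ : 0 <= expC x ^+ i)) ?exprn_ge0 ?(ltW u0) //.
rewrite ler_pdivrMr ?exprn_gt0 //.
have p1 : 0 <= expC x ^+ (N + i) by rewrite exprn_ge0 ?(ltW u0).
have h : `|((bpoly (N + i).+1 i).1).[expC x] * expN x * expC x ^+ (N + i).+1 +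
   ((bpoly (N + i).+1 i).2).[expC x] * brem (N + i).+1 x| <= (a + b) * (expN x * (1 + expR x) * expC x ^+ (N + i)).
  apply: le_trans (ler_normD _ _) _.
  rewrite [`|_ * expN x * _|]normrM [`|_ * expN x|]normrM [`|_ * brem _ _|]normrM.
  rewrite (ger0_norm (ltW e0)) (ger0_norm (brem_ge0 _ _)) (ger0_norm (_ : 0 <= expC x ^+ _)); last by rewrite exprn_ge0 ?(ltW u0).
  have k1 : `|((bpoly (N + i).+1 i).1).[expC x]| * expN x * expC x ^+ (N + i).+1 <= a * (expN x * (1 + expR x) * expC x ^+ (N + i)).
    rewrite -mulrA; apply: ler_pM => //; first by rewrite mulr_ge0 ?(ltW e0) // exprn_ge0 ?(ltW u0).
      exact: Ha.
    rewrite -mulrA ler_wpM2l ?(ltW e0) // exprS; apply: ler_wpM2r => //; lra.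
  have k2 : `|((bpoly (N + i).+1 i).2).[expC x]| * brem (N + i).+1 x <= b * (expN x * (1 + expR x) * expC x ^+ (N + i)).
    apply: ler_pM => //; [exact: brem_ge0|exact: Hb|].
    apply: le_trans (brem_le _ _) _; apply: ler_wpM2r => //.
    by apply: ler_wpM2l; [exact: ltW|lra].
  by rewrite mulrDl; apply: lerD.
have := ler_wpM2l (_ : 0 <= expR x ^+ i) h; rewrite exprn_ge0 ?(ltW t0) // => /(_ isT) K.
by apply: le_trans K _; rewrite le_eqVlt; apply/orP; left; apply/eqP; rewrite exprD; ring.
Qed.
End Bernoulli.

(** * Mellin transforms of the expansion and convergence of Hasse's series *)

Section HasseMellin.
Variable R : realType.
Implicit Types (z w l : R[i]) (x y t : R) (N i n : nat).
Local Open Scope complex_scope.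
Local Notation Re := (@complex.Re R).
Local Notation Im := (@complex.Im R).

Definition hasse_sum (e : R[i]) (N : nat) : R[i] :=
  \sum_(n < N) ((n.+1)%:R)^-1 * \sum_(k < n.+1) ((-1) ^+ k * ('C(n, k))%:R * cpow_nat k.+1 e).

Lemma ccn_sum N (f : nat -> R -> R[i]) : (forall n, ccn (f n)) -> ccn (fun x => \sum_(n < N) f n x).
Proof.
move=> H; elim: N => [|N IH]; first by apply: (eq_ccn (ccn_cst 0)) => x; rewrite big_ord0.
by apply: (eq_ccn (ccnD IH (H N))) => x; rewrite big_ord_recr.
Qed.

Lemma impr0 : impr (fun _ : R => 0) (0 : R[i]).
Proof. by move=> e e0; exists 0 => a b _ _; rewrite cintg_cst mul0r subrr n1_0 ltW. Qed.

Lemma impr_sum N (f : nat -> R -> R[i]) (l : nat -> R[i]) : (forall n, ccn (f n)) ->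
  (forall n, impr (f n) (l n)) -> impr (fun x => \sum_(n < N) f n x) (\sum_(n < N) l n).
Proof.
move=> cf H; elim: N => [|N IH].
  by rewrite big_ord0; apply: (eq_impr impr0) => x; rewrite big_ord0.
rewrite big_ord_recr; apply: (eq_impr (imprD (ccn_sum N cf) (cf N) IH (H N))) => x.
by rewrite big_ord_recr.
Qed.

Lemma cexp_natln (p m : nat) : (0 < m)%N -> cexp (p%:R * (ln (m%:R : R))%:C) = m%:R ^+ p.
Proof.
move=> m0; rewrite -(realC_nat R p) -realCM cexp_real expRM_natl lnK ?posrE ?ltr0n //.
by rewrite rmorphXn /= realC_nat.
Qed.

Lemma gker_scale z (m : nat) x : (0 < m)%N ->
  cexp (z * x%:C) * (expN x ^+ m)%:C = cexp (- (z * (ln (m%:R : R))%:C)) * gker z (x + ln m%:R).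
Proof.
move=> m0; rewrite /gker rmorphD mulrDr cexpD expRD lnK ?posrE ?ltr0n //.
have := cexpN (z * (ln (m%:R : R))%:C); set a := cexp _; set b := cexp (- _) => ab.
have -> : expN x ^+ m = expR (- (expR x * m%:R)).
  by rewrite /expN -expRM_natl; congr expR; ring.
rewrite -[LHS]mul1r -ab; ring.
Qed.

Lemma expder_cexp (w : R[i]) (p m : nat) x : ~~ odd p -> (0 < m)%N ->
  cexp ((w - p%:R) * x%:C) * (expder p m x)%:C =
  cpow_nat m (p%:R - w) * gker w (x + ln m%:R).
Proof.
move=> op m0; rewrite /expder exprNn -signr_odd (negbTE op) expr0 mul1r exprMn.
rewrite mulrBl cexpD !realCM.
have -> : (expR x ^+ p)%:C = cexp (p%:R * x%:C) by rewrite -(realC_nat R p) -realCM cexp_real expRM_natl.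
have := cexpN (p%:R * x%:C); set a := cexp (p%:R * _); set b := cexp (- _) => ab.
rewrite rmorphXn /= realC_nat /cpow_nat mulrBl cexpD cexp_natln //.
transitivity (m%:R ^+ p * (a * b) * (cexp (w * x%:C) * (expN x ^+ m)%:C)); first by ring.
by rewrite ab gker_scale //; ring.
Qed.

(** Translation by ln m shows that (m T)^p e^(-m T) has transform m^(p - w) times Euler's integral
    at [w], so the finite sum transforms into the partial sum of Hasse's series. Evenness of [p]
    removes the sign of (-m T)^p. *)
Lemma hasse_der_impr (w : R[i]) (k p N : nat) : Re w = k.+1%:R -> ~~ odd p ->
  ccn (fun x => cexp ((w - p%:R) * x%:C) * (hasse_der p N x)%:C) /\
  impr (fun x => cexp ((w - p%:R) * x%:C) * (hasse_der p N x)%:C) (hasse_sum (p%:R - w) N * Gint w).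
Proof.
move=> hw op.
pose f (n j : nat) x := (((-1) ^+ j * 'C(n, j)%:R) * cpow_nat j.+1 (p%:R - w)) * gker w (x + ln j.+1%:R).
have cg j : ccn (fun x => gker w (x + ln j.+1%:R)).
  apply: ccn_comp; first exact: gker_ccn.
  by apply: (@dv_ctn _ _ (fun=> 1 + 0)) => x; apply: dvD; [exact: dv_id|exact: dv_cst].
have cf n j : ccn (f n j) by apply: ccnZ.
have fi n j : impr (f n j) (((-1) ^+ j * 'C(n, j)%:R) * cpow_nat j.+1 (p%:R - w) * Gint w).
  by apply: imprZ => //; apply: impr_shift; [exact: gker_ccn|exact: Gint_impr hw].
pose g (n : nat) x := n.+1%:R^-1 * \sum_(j < n.+1) f n j x.
have cg' n : ccn (g n) by apply: (eq_ccn (ccnZ n.+1%:R^-1 (ccn_sum n.+1 (cf n)))).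
have gi n : impr (g n) (n.+1%:R^-1 * \sum_(j < n.+1) ((-1) ^+ j * 'C(n, j)%:R) * cpow_nat j.+1 (p%:R - w) * Gint w).
  by apply: (eq_impr (imprZ n.+1%:R^-1 (ccn_sum n.+1 (cf n)) (impr_sum n.+1 (cf n) (fi n)))).
have E x : cexp ((w - p%:R) * x%:C) * (hasse_der p N x)%:C = \sum_(n < N) g n x.
  rewrite /hasse_der rmorph_sum /= mulr_sumr; apply: eq_bigr => n _.
  rewrite realCM rmorphV ?unitfE ?pnatr_eq0 //= realC_nat mulrCA; congr (_ * _).
  rewrite rmorph_sum /= mulr_sumr; apply: eq_bigr => j _.
  rewrite realCM mulrCA (expder_cexp _ _ op) // realCM rmorphXn rmorphN rmorph1 /= realC_nat.
  by rewrite /f; ring.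
split; first by apply: (eq_ccn (ccn_sum N cg')) => x; rewrite E.
have := impr_sum N cg' gi => H; rewrite /hasse_sum mulr_suml.
rewrite (eq_bigr (fun n : 'I_N => n.+1%:R^-1 * \sum_(j < n.+1) (-1) ^+ j * 'C(n, j)%:R * cpow_nat j.+1 (p%:R - w) * Gint w)).
  by apply: (eq_impr H) => x; rewrite E.
by move=> n _; rewrite -mulrA mulr_suml.
Qed.

Lemma expR_dom (a : nat) : exists2 K : R, 0 <= K & forall x,
  expR x ^+ a.+1 * (1 + expR x) * expN x <= K * dexp (1 / 2) x.
Proof.
have h2 : 0 < 1 / 2 :> R by lra.
have [K K0 HK] := expR_poly a h2; have [L L0 HL] := expR_poly a.+1 h2.
exists (K + L); first lra.
move=> x; have k := HK _ (expR_ge0 x); have l := HL _ (expR_ge0 x).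
have -> : expN x = expR (- (1 / 2 * expR x)) * expR (- (1 / 2 * expR x)).
  by rewrite /expN -expRD; congr expR; field.
rewrite /dexp; set p := expR (- (1 / 2 * _)) in k l *.
have p0 : 0 <= expR x * p by rewrite mulr_ge0 ?expR_ge0.
have := ler_wpM2r p0 (lerD k l); rewrite exprS.
have -> : (expR x ^+ a * p + expR x * expR x ^+ a * p) * (expR x * p) =
  expR x * expR x ^+ a * (1 + expR x) * (p * p) by ring.
by [].
Qed.

Lemma expC_pow_le (a b : nat) x : (a <= b)%N -> expC x ^+ b <= expR x ^+ a.
Proof.
move=> ab; have u0 := expC_gt0 x; have u1 := expC_lt1 x.
apply: (@le_trans _ _ (expC x ^+ a)).
  by apply: ler_wiXn2l => //; rewrite ltW.
by apply: lerXn2r; rewrite ?nnegrE ?expR_ge0 ?(ltW u0) //; apply: expC_le.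
Qed.

(** For real part -2 the factor T^-2 is paid for by powers of 1 - e^-T <= T. With [i <= 4], the
    condition [8 <= M] leaves at least three of them. *)
Lemma bder_dexp (M i : nat) z : (8 <= M)%N -> (i <= 4)%N -> Re z = 0 \/ Re z = -2 ->
  exists2 C : R, 0 <= C & forall x, n1 (cexp (z * x%:C) * (bder M i x)%:C) <= C * dexp (1 / 2) x.
Proof.
move=> M8 i4 hz.
have [N [EM N3]] : exists N, M = (N + i).+1 /\ (3 <= N)%N by exists (M - i.+1)%N; lia.
rewrite EM; have [C C0 HC] := @bder_bound R N i; have [K K0 HK] := expR_dom i.
exists (2 * (C * K)); first by rewrite !mulr_ge0.
move=> x; rewrite mulrC n1_realM.
have := n1_cexp (z * x%:C); rewrite ReM /= mulr0 subr0 => hc.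
apply: le_trans (ler_wpM2l (normr_ge0 _) hc) _.
have t0 := expR_gt0 x; have e0 := expN_gt0 x.
have key : expC x ^+ N * expR (Re z * x) <= expR x.
  case: hz => ->.
    rewrite mul0r expR0 mulr1 -[leRHS]expr1; apply: expC_pow_le; lia.
  have -> : expR (-2 * x) = (expR x ^+ 2)^-1.
    by rewrite -expRM_natl -expRN mulNr.
  rewrite ler_pdivrMr ?exprn_gt0 // -exprS; exact: expC_pow_le.
have w0 : 0 <= expR x ^+ i * expN x * (1 + expR x).
  by rewrite !mulr_ge0 ?exprn_ge0 ?(ltW e0) ?(ltW t0) // addr_ge0 // ltW.
have h1 := ler_wpM2r (expR_ge0 (Re z * x)) (HC x).
have h2 := ler_wpM2l (mulr_ge0 C0 w0) key.
have h3 := ler_wpM2l C0 (HK x).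
have -> : `|bder (N + i).+1 i x| * (2 * expR (Re z * x)) = 2 * (`|bder (N + i).+1 i x| * expR (Re z * x)) by ring.
rewrite -!mulrA ler_pM2l // mulrA.
apply: le_trans h1 _; rewrite -[leRHS]mulrA; apply: le_trans h3.
apply: le_trans (le_trans _ h2) _; rewrite le_eqVlt; apply/orP; left; apply/eqP; rewrite ?exprS; ring.
Qed.

Lemma bder_cdv M i z x : cdv (fun y => cexp (z * y%:C) * (bder M i y)%:C) x
  ((z + i%:R) * (cexp (z * x%:C) * (bder M i x)%:C) + cexp (z * x%:C) * (bder M i.+1 x)%:C).
Proof.
apply: (cdv_eq (cdvM (cdv_cexp z x) (cdv_real (bder_dv M i x)))).
by rewrite realCD realCM realC_nat; ring.
Qed.

Lemma bder_ccn M i z : ccn (fun y => cexp (z * y%:C) * (bder M i y)%:C).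
Proof. exact: cdv_ccn (bder_cdv M i z). Qed.

(** Of the two bounds for [brem], one decays exponentially in T and the other as 1/(M + 1). Their
    geometric mean does both, at the rate (M + 1)^(-1/2), and is integrable uniformly in [M]. *)
Lemma bder_impr0 z : Re z = 0 \/ Re z = -2 -> exists2 C : R, 0 <= C & forall M, (8 <= M)%N ->
  exists2 l, impr (fun x => cexp (z * x%:C) * (bder M 0 x)%:C) l & n1 l <= C / Num.sqrt M.+1%:R.
Proof.
move=> hz.
have h4 : 0 < 1 / 4 :> R by lra.
have [K K0 HK] := @expR_poly R 2 (1 / 4) h4.
exists (16 * (K + 1)); first lra.
move=> M M8.
have EM : M = M.-1.+1 by rewrite prednK // (leq_trans _ M8).
have M5 : (5 <= M.-1 + M)%N by apply: leq_trans (leq_addl _ _); apply: leq_trans M8.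
have s0 : 0 < Num.sqrt M.+1%:R :> R by rewrite sqrtr_gt0 ltr0n.
have Q0 : 0 <= 2 * (K + 1) / Num.sqrt M.+1%:R by rewrite divr_ge0 ?(ltW s0) //; lra.
have bnd x : n1 (cexp (z * x%:C) * (bder M 0 x)%:C) <= 2 * (K + 1) / Num.sqrt M.+1%:R * dexp (1 / 4) x.
  rewrite bder0 mulrC n1_realM (ger0_norm (brem_ge0 _ _)).
  have := n1_cexp (z * x%:C); rewrite ReM /= mulr0 subr0 => hc.
  apply: le_trans (ler_wpM2l (brem_ge0 _ _) hc) _.
  have t0 := expR_gt0 x; have e0 := expN_gt0 x; have u0 := expC_gt0 x.
  set q := expR (- (1 / 4 * expR x)); have q0 : 0 < q by apply: expR_gt0.
  have q1 : q <= 1 by rewrite /q -expR0 ler_expR oppr_le0 mulr_ge0 // ltW.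
  have Eq : expN x = (q ^+ 2) ^+ 2.
    by rewrite /expN /q -exprM -expRM_natl; congr expR; field.
  have hb : brem M x <= expR x ^+ 3 * q ^+ 2 / Num.sqrt M.+1%:R.
    have b0 := brem_ge0 M x.
    have c0 : 0 <= expR x ^+ 3 * q ^+ 2 / Num.sqrt M.+1%:R.
      by rewrite divr_ge0 ?(ltW s0) // mulr_ge0 ?exprn_ge0 // ?(ltW t0) ?(ltW q0).
    have b1 : brem M x <= expN x * expR x * expC x ^+ M.-1 by rewrite {1}EM; exact: brem_le.
    have b2 := brem_le2 M x.
    rewrite -(@ler_pXn2r _ 2) ?nnegrE // expr2.
    apply: le_trans (ler_pM b0 b0 b1 b2) _.
    rewrite expr_div_n sqr_sqrtr ?ler0n // mulrA ler_pM2r ?invr_gt0 ?ltr0n //.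
    have h5 : expC x ^+ (M.-1 + M) <= expR x ^+ 5 by exact: expC_pow_le.
    have w0 : 0 <= expN x * expR x by rewrite mulr_ge0 ?(ltW e0) ?(ltW t0).
    have := ler_wpM2l w0 h5; rewrite exprD.
    have -> : expN x * expR x * expR x ^+ 5 = (expR x ^+ 3 * q ^+ 2) ^+ 2 by rewrite Eq; ring.
    by rewrite mulrA.
  have key : expR x ^+ 3 * q ^+ 2 * expR (Re z * x) <= (K + 1) * dexp (1 / 4) x.
    rewrite /dexp -/q; have hk := HK _ (ltW t0); rewrite -/q in hk.
    have w0 : 0 <= expR x * q by rewrite mulr_ge0 ?(ltW t0) ?(ltW q0).
    case: hz => ->.
      rewrite mul0r expR0 mulr1.
      have := ler_wpM2r w0 hk; rewrite exprS [q ^+ 2]expr2; lra.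
    have -> : expR (-2 * x) = (expR x ^+ 2)^-1 by rewrite -expRM_natl -expRN mulNr.
    have -> : expR x ^+ 3 * q ^+ 2 * (expR x ^+ 2)^-1 = expR x * q * q by field; rewrite gt_eqF.
    have K1 : q <= K + 1 by lra.
    by have := ler_wpM2l w0 K1; rewrite [_ * (K + 1)]mulrC mulrA.
  have := ler_wpM2r (expR_ge0 (Re z * x)) hb.
  have := ler_wpM2r (_ : 0 <= (Num.sqrt M.+1%:R)^-1) key; rewrite invr_ge0 (ltW s0) => /(_ isT).
  move=> h5 h6.
  have E : expR x ^+ 3 * q ^+ 2 / Num.sqrt M.+1%:R * expR (Re z * x) =
    expR x ^+ 3 * q ^+ 2 * expR (Re z * x) / Num.sqrt M.+1%:R by ring.
  rewrite E in h6; have := le_trans h6 h5.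
  set b := brem M x; set e := expR (Re z * x); move=> h7.
  have -> : b * (2 * e) = 2 * (b * e) by ring.
  have -> : 2 * (K + 1) / Num.sqrt M.+1%:R * dexp (1 / 4) x =
    2 * ((K + 1) * dexp (1 / 4) x / Num.sqrt M.+1%:R) by ring.
  by rewrite ler_pM2l.
have [l hl bl] := impr_exists h4 Q0 (bder_ccn M 0 z) bnd.
exists l => //; apply: le_trans bl _.
by rewrite le_eqVlt; apply/orP; left; apply/eqP; field; rewrite gt_eqF.
Qed.

(** Integration by parts multiplies the integral by -(z + p) when the order rises from p to p + 1,
    so the rate in [M] passes from order 0 to the higher ones. *)
Lemma bder_impr z (p : nat) : Re z = 0 \/ Re z = -2 -> (p <= 4)%N -> exists2 C : R, 0 <= C & forall M, (8 <= M)%N ->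
  exists2 l, impr (fun x => cexp (z * x%:C) * (bder M p x)%:C) l & n1 l <= C / Num.sqrt M.+1%:R.
Proof.
move=> hz; elim: p => [|p IH] p4; first exact: bder_impr0.
have [C C0 HC] := IH (ltnW p4).
exists (n1 (z + p%:R) * C); first by rewrite mulr_ge0 // n1_ge0.
move=> M M8; have [l hl bl] := HC _ M8.
have [D D0 HD] := bder_dexp M8 (ltnW p4) hz.
have hv : vanish (fun x => cexp (z * x%:C) * (bder M p x)%:C) by apply: (dexp_vanish _ HD); lra.
have cp := bder_ccn M p z; have cq := bder_ccn M p.+1 z.
have h0 := impr_FTC (ccnD (ccnZ (z + p%:R) cp) cq) (bder_cdv M p z) hv.
have h1 := imprB (ccnD (ccnZ (z + p%:R) cp) cq) (ccnZ (z + p%:R) cp) h0 (imprZ (z + p%:R) cp hl).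
exists (0 - (z + p%:R) * l).
  by apply: (eq_impr h1) => x; rewrite [X in X - _]addrC addrK.
rewrite sub0r n1N; apply: le_trans (n1M _ _) _; rewrite -mulrA.
by apply: ler_wpM2l => //; exact: n1_ge0.
Qed.

Lemma null_inv_sqrt (C : R) : null (fun M => C / Num.sqrt M.+1%:R).
Proof.
apply: nullZ => e e0; have [N HN] := @null_inv R _ (exprn_gt0 2 e0); exists N => n /HN.
rewrite !ger0_norm ?invr_ge0 ?sqrtr_ge0 // => h.
have s0 : 0 < Num.sqrt n.+1%:R :> R by rewrite sqrtr_gt0 ltr0n.
rewrite -(@ler_pXn2r _ 2) ?nnegrE ?invr_ge0 ?(ltW e0) ?(ltW s0) //.
by rewrite exprVn sqr_sqrtr.
Qed.

(** The full integral does not depend on [M], and the share of the remainder tends to 0; hence the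
    partial sums of Hasse's series converge, to the integral divided by [Gint w]. The orders 2 and 4
    yield the series for zeta at chi + 1 and chi - 1. *)
Lemma hasse_mellin (w : R[i]) (p : nat) : Re w = 2 -> p = 2%N \/ p = 4%N ->
  exists2 l, ctends (hasse_sum (p%:R - w)) l &
    impr (fun x => cexp ((w - p%:R) * x%:C) * (bder 0 p x)%:C) (l * Gint w).
Proof.
move=> hw hp.
have hz : Re (w - p%:R) = 0 \/ Re (w - p%:R) = -2.
  have -> : Re (w - p%:R) = 2 - p%:R by rewrite ReD ReN hw -(realC_nat R p).
  by case: hp => ->; [left; lra|right; lra].
have op : ~~ odd p by case: hp => ->.
have p4 : (p <= 4)%N by case: hp => ->.
have [_ G0] := @gauss_prod_tends R w 1 hw isT.
have [C C0 HC] := bder_impr hz p4.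
have tot M l : impr (fun x => cexp ((w - p%:R) * x%:C) * (bder M p x)%:C) l ->
  impr (fun x => cexp ((w - p%:R) * x%:C) * (bder 0 p x)%:C) (l + hasse_sum (p%:R - w) M * Gint w).
  move=> hl; have [c1 h1] := @hasse_der_impr w 1 p M hw op.
  apply: (eq_impr (imprD (bder_ccn M p _) c1 hl h1)) => x.
  by rewrite (bderE p M x) realCD mulrDr.
have [l8 hl8 _] := HC 8%N isT; have H8 := tot _ _ hl8; set L := l8 + _ in H8.
exists (L / Gint w); last by rewrite divfK.
have K := nullZ (n1 (Gint w)^-1) (null_inv_sqrt C); apply: (null_le K); exists 8%N => M M8.
have [l hl bl] := HC _ M8; have E := impr_uniq H8 (tot _ _ hl).
rewrite ger0_norm ?n1_ge0 // E.
have -> : hasse_sum (p%:R - w) M - (l + hasse_sum (p%:R - w) M * Gint w) / Gint w = - ((Gint w)^-1 * l).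
  by rewrite mulrDl mulfK // opprD addrC addrNK mulrC.
rewrite n1N; apply: le_trans (n1M _ _) _; apply: ler_wpM2l => //; exact: n1_ge0.
Qed.
End HasseMellin.

(** * The profile function and its Mellin transform *)

Section ProfileMellin.
Variable R : realType.
Implicit Types (z w l : R[i]) (x y t : R) (N i n J : nat).
Local Open Scope complex_scope.
Local Notation Re := (@complex.Re R).
Local Notation Im := (@complex.Im R).

Definition geo x : R := (expR (expR x) - 1)^-1.

Lemma expR2_ge x : expR x <= expR (expR x) - 1.
Proof. by have := expR_ge1Dx (expR x); lra. Qed.

Lemma expR2_gt0 x : 0 < expR (expR x) - 1.
Proof. exact: lt_le_trans (expR_gt0 x) (expR2_ge x). Qed.

Lemma geo_gt0 x : 0 < geo x.
Proof. by rewrite invr_gt0 expR2_gt0. Qed.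

Lemma geo_dv x : dv geo x (- (expR x * (geo x + geo x ^+ 2))).
Proof.
have h := expR2_gt0 x.
apply: (dv_eq (dv_inv (f := fun y => expR (expR y) - 1) _ (dvB (dv_exp (expR_dv x)) (dv_cst 1 x)))).
  by rewrite gt_eqF.
by rewrite /geo; field; rewrite gt_eqF.
Qed.

Lemma bder00 x : bder 0 0 x = expR x * geo x.
Proof.
rewrite bder0 /brem /logrem big_ord0 subr0 /expC /expN expRN /geo.
have := expR2_gt0 x; have := expR_gt0 (expR x); set E := expR (expR x) => E0 E1.
by field; rewrite gt_eqF //= gt_eqF.
Qed.

(** Up to alternating signs, [geo1], [geo2] and [geo3] are the first three T-derivatives of [geo] =
    1/(e^T - 1), written as polynomials in [geo]. *)
Definition geo1 x := geo x + geo x ^+ 2.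
Definition geo2 x := (1 + 2 * geo x) * geo1 x.
Definition geo3 x := 2 * geo1 x ^+ 2 + (1 + 2 * geo x) ^+ 2 * geo1 x.

Lemma geo1_dv x : dv geo1 x (- (expR x * geo2 x)).
Proof.
have h := geo_dv x; apply: (dv_eq (dvD h (dvM h h))).
by rewrite /geo2 /geo1; ring.
Qed.

Lemma geo2_dv x : dv geo2 x (- (expR x * geo3 x)).
Proof.
have h := geo_dv x; apply: (dv_eq (dvM (dvD (dv_cst 1 x) (dvZ 2 h)) (geo1_dv x))).
by rewrite /geo3 /geo2 /geo1; ring.
Qed.

Lemma bder_next i f d x : bder 0 i =1 f -> dv f x d -> bder 0 i.+1 x = d - i%:R * f x.
Proof.
move=> E h; have h1 := bder_dv (R := R) 0 i x.
by rewrite (dv_uniq h (eq_dv h1 E)) E addrC addKr.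
Qed.

Lemma bder01 x : bder 0 1 x = expR x * geo x - expR x ^+ 2 * geo1 x.
Proof.
rewrite (bder_next bder00 (dvM (expR_dv x) (geo_dv x))) mul0r subr0 /geo1; ring.
Qed.

Lemma expRX_dv n x : dv (fun y => expR y ^+ n) x (n%:R * expR x ^+ n).
Proof.
have t0 := expR_gt0 x; apply: (dv_eq (dvXn n _ (expR_dv x))); first by rewrite gt_eqF.
by field; rewrite gt_eqF.
Qed.

Lemma bder02 x : bder 0 2 x = - 2 * expR x ^+ 2 * geo1 x + expR x ^+ 3 * geo2 x.
Proof.
rewrite (bder_next bder01 (dvB (dvM (expR_dv x) (geo_dv x)) (dvM (expRX_dv 2 x) (geo1_dv x)))) /geo1; ring.
Qed.

Lemma bder03 x : bder 0 3 x = 3 * expR x ^+ 3 * geo2 x - expR x ^+ 4 * geo3 x.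
Proof.
rewrite (bder_next bder02 (dvD (dvM (dvZ (- 2) (expRX_dv 2 x)) (geo1_dv x)) (dvM (expRX_dv 3 x) (geo2_dv x)))); ring.
Qed.

(* With T = e^x and b = T/(e^T - 1), the derivatives of sker and pker are -T^2 b''(T) and
   T^4 b''''(T): integrating by parts reduces both to Hasse's series. *)
Definition sker x : R := expR x ^+ 2 * geo1 x.
Definition pker x : R := 6 - expR x ^+ 4 * geo3 x.

Lemma sker_dv x : dv sker x (- bder 0 2 x).
Proof.
apply: (dv_eq (dvM (expRX_dv 2 x) (geo1_dv x))); rewrite bder02; ring.
Qed.

Lemma pker_dv x : dv pker x (bder 0 4 x).
Proof.
have h0 := bder_dv (R := R) 0 0 x; have h1 := bder_dv (R := R) 0 1 x.
have h2 := bder_dv (R := R) 0 2 x; have h3 := bder_dv (R := R) 0 3 x.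
(* Repeated integration by parts of T^3 b'''' gives T^3 b''' - 3 T^2 b'' + 6 T b' - 6 b; the
   constant 6 makes it vanish at T = 0, where b = 1. *)
apply: (eq_dv (f := fun y => bder 0 3 y - 3 * bder 0 2 y + 6 * bder 0 1 y - 6 * bder 0 0 y + 6)).
  apply: (dv_eq (dvD (dvB (dvD (dvB h3 (dvZ 3 h2)) (dvZ 6 h1)) (dvZ 6 h0)) (dv_cst 6 x))); ring.
by move=> y; rewrite bder03 bder02 bder01 bder00 /pker; ring.
Qed.

Lemma bder00_bounds x : 1 - expR x <= bder 0 0 x <= 1.
Proof.
rewrite bder00 /geo; have h := expR2_ge x; have h0 := expR2_gt0 x.
rewrite ler_pdivlMr // ler_pdivrMr // mul1r h andbT.
have e0 := expR_gt0 (expR x); have t0 := expR_gt0 x.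
have : expR (expR x) * expR (- expR x) = 1 by rewrite -expRD subrr expR0.
have := expR_ge1Dx (- expR x); set E := expR (expR x) in h h0 e0 *; set q := expR (- _); set T := expR x in h t0 *.
move=> hq hE; have := ler_wpM2l (ltW e0) hq; rewrite hE; nra.
Qed.

Lemma sker_bder x : sker x = bder 0 0 x * (bder 0 0 x + expR x).
Proof. by rewrite bder00 /sker /geo1; ring. Qed.

Lemma sker_near0 x : `|sker x - 1| <= 3 * expR x.
Proof.
have /andP[h1 h2] := bder00_bounds x; have t0 := expR_gt0 x; rewrite sker_bder.
have b0 : 0 <= bder 0 0 x by rewrite bder00 mulr_ge0 ?(ltW t0) // (ltW (geo_gt0 x)).
move: (bder 0 0 x) (expR x) h1 h2 t0 b0 => b T h1 h2 t0 b0.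
by rewrite ler_norml; apply/andP; split; nra.
Qed.

Lemma geo_le x : 0 <= x -> geo x <= 1 /\ expR x ^+ 4 * geo x <= 256.
Proof.
move=> x0; have h := expR2_ge x; have h0 := expR2_gt0 x.
have t1 : 1 <= expR x by rewrite -expR0 ler_expR.
split; first by rewrite /geo -[leRHS]invr1 lef_pV2 ?posrE //; lra.
rewrite /geo ler_pdivrMr // .
have -> : expR (expR x) = expR (expR x / 4) ^+ 4 by rewrite -expRM_natl; congr expR; field.
have h4 := expR_ge1Dx (expR x / 4).
have p0 : 0 <= 1 + expR x / 4 by lra.
have h5 : (1 + expR x / 4) ^+ 4 <= expR (expR x / 4) ^+ 4.
  by apply: lerXn2r; rewrite ?nnegrE ?expR_ge0.
have h6 : 1 + (expR x / 4) ^+ 4 <= (1 + expR x / 4) ^+ 4.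
  have : 0 <= expR x / 4 by lra.
  move: (expR x / 4) => a a0.
  have -> : (1 + a) ^+ 4 = 1 + a ^+ 4 + (4 * a + 6 * a ^+ 2 + 4 * a ^+ 3) by ring.
  by rewrite lerDl !addr_ge0 // mulr_ge0 // exprn_ge0.
have -> : expR x ^+ 4 = 256 * (expR x / 4) ^+ 4 by field.
lra.
Qed.

Lemma sker_decay x : 0 <= x -> `|sker x| <= 512 * expR (- x).
Proof.
move=> x0; have [u1 u4] := geo_le x0; have u0 := geo_gt0 x.
have t1 : 1 <= expR x by rewrite -expR0 ler_expR.
rewrite expRN ler_pdivlMr ?expR_gt0 // /sker /geo1.
move: (expR x) (geo x) u1 u4 u0 t1 => T u u1 u4 u0 t1.
rewrite ger0_norm; last by rewrite mulr_ge0 // ?exprn_ge0 // ?addr_ge0 ?exprn_ge0 //; lra.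
have h1 : T ^+ 3 * (u * u) <= T ^+ 3 * u by rewrite ler_wpM2l ?exprn_ge0 //; nra.
have h2 : T ^+ 3 * u <= T ^+ 4 * u by rewrite ler_wpM2r // ?(ltW u0) //; apply: ler_weXn2l.
have -> : T ^+ 2 * (u + u ^+ 2) * T = T ^+ 3 * u + T ^+ 3 * (u * u) by ring.
lra.
Qed.

Lemma pker_decay x : 0 <= x -> `|pker x| <= 7000.
Proof.
move=> x0; have [u1 u4] := geo_le x0; have u0 := geo_gt0 x.
have t1 : 0 <= expR x ^+ 4 by rewrite exprn_ge0 // expR_ge0.
rewrite /pker.
have g30 : 0 <= geo3 x <= 26 * geo x.
  have -> : geo3 x = geo x + 7 * geo x ^+ 2 + 12 * geo x ^+ 3 + 6 * geo x ^+ 4 by rewrite /geo3 /geo1; ring.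
  move: (geo x) u1 u0 => u u1 u0.
  have up k : 0 <= u ^+ k.+1 <= u.
    by rewrite exprn_ge0 ?(ltW u0) // exprS ler_piMr ?(ltW u0) // exprn_ile1 // ltW.
  by move: (up 1%N) (up 2%N) (up 3%N) => /andP[? ?] /andP[? ?] /andP[? ?]; apply/andP; split; lra.
case/andP: g30 => g0 g3.
have h1 := ler_wpM2l t1 g3; have h2 := mulr_ge0 t1 g0.
rewrite ler_norml; apply/andP; split; lra.
Qed.

Lemma pker_near0 x : `|pker x| <= 50 * (expR x + expR x ^+ 3).
Proof.
have /andP[h1 h2] := bder00_bounds x; have t0 := expR_gt0 x.
have b0 : 0 <= bder 0 0 x by rewrite bder00 mulr_ge0 ?(ltW t0) // (ltW (geo_gt0 x)).
have -> : pker x = 6 * (1 - bder 0 0 x ^+ 4) - expR x * (12 * bder 0 0 x ^+ 3 + 7 * expR x * bder 0 0 x ^+ 2 + expR x ^+ 2 * bder 0 0 x).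
  by rewrite /pker bder00 /geo3 /geo1; ring.
move: (bder 0 0 x) (expR x) h1 h2 t0 b0 => b T h1 h2 t0 b0.
have b2 : 0 <= b ^+ 2 <= 1 by rewrite exprn_ge0 // exprn_ile1.
have b3 : 0 <= b ^+ 3 <= 1 by rewrite exprn_ge0 // exprn_ile1.
have b4 : 1 - 4 * T <= b ^+ 4 <= 1.
  rewrite exprn_ile1 // andbT.
  have E : 1 - b ^+ 4 = (1 - b) * (1 + b + b ^+ 2 + b ^+ 3) by ring.
  have : (1 - b) * (1 + b + b ^+ 2 + b ^+ 3) <= T * 4.
    by case/andP: b2 => ? ?; case/andP: b3 => ? ?; apply: ler_pM; lra.
  lra.
have : 0 <= T * (12 * b ^+ 3 + 7 * T * b ^+ 2 + T ^+ 2 * b) <= T * (12 + 7 * T + T ^+ 2).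
  case/andP: b2 => p2 q2; case/andP: b3 => p3 q3.
  have w1 := mulr_ge0 (ltW t0) p2; have w2 := ler_wpM2l (ltW t0) q2.
  have w3 := mulr_ge0 (sqr_ge0 T) b0; have w4 := ler_wpM2l (sqr_ge0 T) h2.
  have s1 : 0 <= 12 * b ^+ 3 + 7 * T * b ^+ 2 + T ^+ 2 * b by lra.
  have s2 : 12 * b ^+ 3 + 7 * T * b ^+ 2 + T ^+ 2 * b <= 12 + 7 * T + T ^+ 2 by lra.
  by rewrite (mulr_ge0 (ltW t0) s1) (ler_wpM2l (ltW t0) s2).
have -> : T * (12 + 7 * T + T ^+ 2) = 12 * T + 7 * T ^+ 2 + T ^+ 3 by ring.
have : 2 * T ^+ 2 <= T + T ^+ 3.
  have -> : T + T ^+ 3 = 2 * T ^+ 2 + T * (1 - T) ^+ 2 by ring.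
  by rewrite lerDl mulr_ge0 ?sqr_ge0 // ltW.
have : 0 <= T ^+ 3 by rewrite exprn_ge0 // ltW.
case/andP: b4 => p4 q4 c3 c2 /andP[p5 q5].
rewrite ler_norml; apply/andP; split; lra.
Qed.

(** The fourth derivative of b is bounded on the half-line. Five terms of the expansion are the
    number after which [bder_bound] applies at order 4 with no power of u remaining; these terms
    themselves are explicit exponentials. *)
Lemma bder04_bound : exists2 C : R, 0 <= C & forall x, `|bder 0 4 x| <= C * expR x ^+ 4.
Proof.
have [C C0 HC] := @bder_bound R 0 4.
pose D : R := \sum_(n < 5) n.+1%:R^-1 * \sum_(k < n.+1) 'C(n, k)%:R * k.+1%:R ^+ 4.
have D0 : 0 <= D.
  apply: sumr_ge0 => n _; apply: mulr_ge0; first by rewrite invr_ge0 ler0n.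
  by apply: sumr_ge0 => k _; apply: mulr_ge0; rewrite ?exprn_ge0 ?ler0n.
exists (C + D); first by rewrite addr_ge0.
move=> x; have t0 := expR_gt0 x; rewrite (bderE 4 5 x) mulrDl.
apply: le_trans (ler_normD _ _) _; apply: lerD.
  apply: le_trans (HC x) _; rewrite expr0 mulr1 -[in leRHS](mulr1 (expR x ^+ 4)) -mulrA.
  rewrite ler_wpM2l // ler_wpM2l ?exprn_ge0 ?(ltW t0) //.
  by have := ler_wpM2l (ltW (expN_gt0 x)) (expR_ge1Dx (expR x)); rewrite {2}/expN -expRD addNr expR0.
rewrite /hasse_der /D mulr_suml; apply: le_trans (ler_norm_sum _ _ _) _.
apply: ler_sum => n _; rewrite normrM ger0_norm ?invr_ge0 ?ler0n // -mulrA.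
rewrite ler_wpM2l ?invr_ge0 ?ler0n // mulr_suml; apply: le_trans (ler_norm_sum _ _ _) _.
apply: ler_sum => k _; rewrite normrM normrM normrX normrN1 expr1n mul1r normr_nat -mulrA.
rewrite ler_wpM2l ?ler0n // /expder normrM normrX normrN.
rewrite (ger0_norm (exprn_ge0 _ (ltW (expN_gt0 x)))) (ger0_norm (mulr_ge0 (ler0n _ _) (ltW t0))).
rewrite exprMn -[leRHS]mulr1 ler_wpM2l ?mulr_ge0 ?exprn_ge0 ?ler0n ?(ltW t0) //.
by rewrite exprn_ile1 ?(ltW (expN_gt0 x)) ?(ltW (expN_lt1 x)).
Qed.

Lemma expR_null (c : R) : null (fun J => expR (c - ln 2 * J%:R)).
Proof.
have h : 0 <= (1 / 2 : R) < 1 by apply/andP; split; lra.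
apply: (eq_null (nullZ (expR c) (null_expn h))) => J.
rewrite expRD [ln 2 * _]mulrC -mulrN expRM_natl expRN lnK ?posrE //.
by rewrite div1r.
Qed.

(** [pker_near0] gives only O(T), while [pker / T^2] must vanish at T = 0. By [bder04_bound] both
    (C/4) T^4 + pker and (C/4) T^4 - pker are nondecreasing, and they tend to 0 at -oo. *)
Lemma pker_bound : exists2 C : R, 0 <= C & forall x, `|pker x| <= C * expR x ^+ 4.
Proof.
have [C C0 HC] := bder04_bound; exists (C / 4); first by rewrite divr_ge0.
have pos (s : R) x : s = 1 \/ s = -1 -> 0 <= C / 4 * expR x ^+ 4 + s * pker x.
  move=> hs.
  pose f y : R := C / 4 * expR y ^+ 4 + s * pker y.
  have fd y : dv f y (C * expR y ^+ 4 + s * bder 0 4 y).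
    by apply: (dv_eq (dvD (dvZ (C / 4) (expRX_dv 4 y)) (dvZ s (pker_dv y)))); field.
  have fge y : 0 <= C * expR y ^+ 4 + s * bder 0 4 y.
    have := HC y; rewrite ler_norml => /andP[? ?]; case: hs => ->; lra.
  have e1 : null (fun J => expR (x - ln 2 * J%:R)) by exact: expR_null.
  have e3 : null (fun J => 50 * (expR (x - ln 2 * J%:R) + expR (x - ln 2 * J%:R) * (expR (x - ln 2 * J%:R) * expR (x - ln 2 * J%:R)))).
    by apply: nullZ; apply: nullD => //; apply: nullM => //; apply: nullM.
  apply: (null_ge e3); exists 0%N => J _.
  have l0 : 0 <= ln (2 : R) by rewrite ln_ge0 //; lra.
  have xle : x - ln 2 * J%:R <= x by rewrite gerBl mulr_ge0.
  have := dv_ge0_le xle (fun y _ => fd y) (fun y _ => fge y); rewrite -/(f x).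
  set y := x - _; move=> hle.
  have y4 : 0 <= C / 4 * expR y ^+ 4 by rewrite mulr_ge0 ?divr_ge0 ?exprn_ge0 ?expR_ge0.
  have := pker_near0 y; rewrite ler_norml => /andP[p q].
  have e : expR y ^+ 3 = expR y * (expR y * expR y) by ring.
  rewrite -e; move: hle; rewrite /f; case: hs => ->; lra.
move=> x; rewrite ler_norml.
have := pos 1 x (or_introl erefl); have := pos (-1) x (or_intror erefl).
by move=> ? ?; apply/andP; split; lra.
Qed.

(* s(T) + q(T/2) at T = e^x, where s(t) = t^2/sinh^2 t and q(t) = t^2/cosh^4 t. *)
Definition profile x : R :=
  4 * expR x ^+ 2 * expR (expR x) ^+ 2 *
  ((expR (expR x) ^+ 2 - 1) ^- 2 + (expR (expR x) + 1) ^- 4).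

(** With s(t) = t^2/sinh^2 t one has t^2/cosh^2 t = s(t) - s(2t), and 1/cosh^4 = (2/3)/cosh^2 -
    (1/6)(1/cosh^2)''. At t = T/2 the first part gives the weights 1/3 and 2/3, since [sker x] is
    s(T/2); the second derivative gives the bracket in [pker]. *)
Lemma profileE x : profile x = 1 / 3 * sker (x + ln 2) + 2 / 3 * sker x
  + 2 / 3 * (pker x / expR x ^+ 2 - 4 * (pker (x + ln 2) / expR (x + ln 2) ^+ 2)).
Proof.
rewrite /profile /sker /pker /geo3 /geo1 /geo expRD lnK ?posrE //.
have -> : expR (expR x * 2) = expR (expR x) ^+ 2 by rewrite -expRM_natl; congr expR; ring.
have := expR2_gt0 x; have := expR_gt0 x; move: (expR x) (expR (expR x)) => T E t0 E1.
have E2 : 0 < E ^+ 2 - 1 by nra.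
have E3 : 0 < E + 1 by lra.
by field; rewrite !gt_eqF.
Qed.
End ProfileMellin.

(** * The regularised integral of the profile *)

Section ProfileIntegrals.
Variable R : realType.
Implicit Types (z w l : R[i]) (x y t : R) (N i n J : nat).
Local Open Scope complex_scope.
Local Notation Re := (@complex.Re R).
Local Notation Im := (@complex.Im R).

Definition wprim x : R := - ln (1 + geo x) - expR x * geo x.

Lemma wprim_dv x : dv wprim x (sker x).
Proof.
have u0 := geo_gt0 x; have h : 0 < 1 + geo x by lra.
apply: (dv_eq (dvB (dvN (dv_ln (f := fun y => 1 + geo y) h (dvD (dv_cst 1 x) (geo_dv x)))) (dvM (expR_dv x) (geo_dv x)))).
by rewrite /sker /geo1; field; rewrite gt_eqF.
Qed.

Lemma wprim_decay x : 0 <= x -> `|wprim x| <= 512 * expR (- x).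
Proof.
move=> x0; have [u1 u4] := geo_le x0; have u0 := geo_gt0 x.
have t1 : 1 <= expR x by rewrite -expR0 ler_expR.
have l1 : ln (1 + geo x) <= geo x by apply: le_ln1Dx; lra.
have l0 : 0 <= ln (1 + geo x) by apply: ln_ge0; lra.
have tu : geo x <= expR x * geo x by rewrite ler_peMl // ltW.
have h : 2 * (expR x * geo x) <= 512 * expR (- x).
  rewrite expRN ler_pdivlMr ?expR_gt0 //.
  move: (expR x) (geo x) u4 u0 t1 => T u u4 u0 t1.
  have : T ^+ 2 * u <= T ^+ 4 * u by rewrite ler_wpM2r // ?(ltW u0) //; apply: ler_weXn2l.
  have -> : 2 * (T * u) * T = 2 * (T ^+ 2 * u) by ring.
  lra.
rewrite /wprim ler_norml; apply/andP; split; lra.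
Qed.

Lemma wprim_near0 x : expR x <= 1 / 2 -> `|wprim x - (x - 1)| <= 4 * expR x.
Proof.
move=> x0; have /andP[b1 b2] := bder00_bounds x; have u0 := geo_gt0 x; have t0 := expR_gt0 x.
have e0 := expR_gt0 (expR x); have e1 := expR2_gt0 x.
have E : wprim x = x - expR x - ln (bder 0 0 x) - bder 0 0 x.
  rewrite /wprim bder00 lnM ?posrE // expRK.
  have -> : 1 + geo x = expR (expR x) * geo x.
    by rewrite /geo; field; rewrite gt_eqF.
  by rewrite lnM ?posrE // expRK; ring.
move: (bder 0 0 x) E b1 b2 => b E b1 b2; rewrite E.
have b0 : 0 < b by lra.
have l1 : ln b <= 0 by rewrite -ln1 ler_ln ?posrE.
have l2 : - ln b <= 2 * expR x.
  rewrite -lnV ?posrE //; have := @le_ln1Dx R (b^-1 - 1); rewrite [1 + _]addrC subrK => h.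
  have bi : 0 < b^-1 by rewrite invr_gt0.
  apply: le_trans (h _) _; first lra.
  rewrite lerBlDr -div1r ler_pdivrMr //.
  by nra.
rewrite ler_norml; apply/andP; split; lra.
Qed.

Definition sgm x : R := (expR (expR x) + 1)^-1.

Lemma sgm_dv x : dv sgm x (- (expR x * (sgm x - sgm x ^+ 2))).
Proof.
have h := expR_gt0 (expR x).
apply: (dv_eq (dv_inv (f := fun y => expR (expR y) + 1) _ (dvD (dv_exp (expR_dv x)) (dv_cst 1 x)))).
  by rewrite gt_eqF // addr_gt0.
by rewrite /sgm; field; rewrite gt_eqF // addr_gt0.
Qed.

(* From 2/3 (pker/T^2 - 4 pker(2T)/(2T)^2) = -(1/6) t^2 (sech^2)''(t) at t = T/2. *)
Definition yprim x : R := (sgm x - sgm x ^+ 2) * (1 + expR x * (1 - 2 * sgm x)).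

Lemma yprim_dv x : dv yprim x (expR x ^+ 2 * (2 * (sgm x - sgm x ^+ 2) ^+ 2
  - (1 - 2 * sgm x) ^+ 2 * (sgm x - sgm x ^+ 2))).
Proof.
have h := sgm_dv x.
apply: (dv_eq (dvM (dvB h (dvXn 2 _ h)) (dvD (dv_cst 1 x) (dvM (expR_dv x) (dvB (dv_cst 1 x) (dvZ 2 h)))))).
  by rewrite invr_neq0 // gt_eqF // addr_gt0 ?expR_gt0.
by field; rewrite /sgm invr_neq0 // gt_eqF // addr_gt0 ?expR_gt0.
Qed.

Lemma sgm_bounds x : 0 < sgm x <= 1 / 2.
Proof.
have h : 1 < expR (expR x) by rewrite -expR0 ltr_expR expR_gt0.
apply/andP; split; first by rewrite invr_gt0; lra.
have h2 : 0 < expR (expR x) + 1 by lra.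
by rewrite /sgm -div1r ler_pdivrMr //; lra.
Qed.

Lemma yprim_decay x : 0 <= x -> `|yprim x| <= 512 * expR (- x).
Proof.
move=> x0; have [u1 u4] := geo_le x0; have u0 := geo_gt0 x.
have t1 : 1 <= expR x by rewrite -expR0 ler_expR.
have /andP[r0 r1] := sgm_bounds x.
have ru : sgm x <= geo x by rewrite lef_pV2 ?posrE ?expR2_gt0 // ?addr_gt0 ?expR_gt0 //; lra.
have h : 2 * (expR x * geo x) <= 512 * expR (- x).
  rewrite expRN ler_pdivlMr ?expR_gt0 //.
  move: (expR x) (geo x) u4 u0 t1 => T u u4 u0 t1.
  have : T ^+ 2 * u <= T ^+ 4 * u by rewrite ler_wpM2r // ?(ltW u0) //; apply: ler_weXn2l.
  have -> : 2 * (T * u) * T = 2 * (T ^+ 2 * u) by ring.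
  lra.
apply: le_trans h; rewrite /yprim; move: (expR x) (geo x) (sgm x) t1 ru r0 r1 => T u r t1 ru r0 r1.
have h1 : 0 <= r - r ^+ 2 <= u.
  have : r ^+ 2 = r * r by ring.
  move=> ->; have : 0 <= r * r <= r * 1 by rewrite mulr_ge0 ?ler_wpM2l //; lra.
  by move=> /andP[? ?]; apply/andP; split; lra.
have h2 : 0 <= 1 + T * (1 - 2 * r) <= 2 * T.
  have : 0 <= T * (1 - 2 * r) <= T * 1 by rewrite mulr_ge0 ?ler_wpM2l //; lra.
  by move=> /andP[? ?]; apply/andP; split; lra.
case/andP: h1 => a1 a2; case/andP: h2 => a3 a4.
rewrite ger0_norm ?mulr_ge0 //; apply: le_trans (ler_pM a1 a3 a2 a4) _.
by rewrite le_eqVlt; apply/orP; left; apply/eqP; ring.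
Qed.

Lemma yprim_near0 x : expR x <= 1 / 2 -> `|yprim x - 1 / 4| <= 4 * expR x.
Proof.
move=> x0; have /andP[b1 b2] := bder00_bounds x; have t0 := expR_gt0 x.
have /andP[r0 r1] := sgm_bounds x.
have e1 := expR2_gt0 x; have e0 := expR_gt0 (expR x).
have h : 1 / 2 - sgm x <= expR x.
  have b3 : expR (expR x) - 1 <= 2 * expR x.
    move: b1; rewrite bder00 /geo ler_pdivlMr // => b1.
    move: (expR x) (expR (expR x)) x0 t0 b1 e1 => T E x0 t0 b1 e1; nra.
  have -> : 1 / 2 - sgm x = (expR (expR x) - 1) / (2 * (expR (expR x) + 1)).
    by rewrite /sgm; field; rewrite gt_eqF // addr_gt0.
  rewrite ler_pdivrMr ?mulr_gt0 ?addr_gt0 //.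
  move: (expR x) (expR (expR x)) b3 t0 e0 => T E b3 t0 e0; nra.
rewrite /yprim; move: (expR x) (sgm x) t0 x0 r0 r1 h => T r t0 x0 r0 r1 h.
have h1 : 1 / 4 - T <= r - r ^+ 2 <= 1 / 4.
  have -> : r - r ^+ 2 = 1 / 4 - (1 / 2 - r) * (1 / 2 - r) by field.
  have : 0 <= (1 / 2 - r) * (1 / 2 - r) <= T * 1 by rewrite mulr_ge0 ?ler_pM //; lra.
  by move=> /andP[? ?]; apply/andP; split; lra.
have h2 : 0 <= T * (1 - 2 * r) <= T * 1 by rewrite mulr_ge0 ?ler_wpM2l //; lra.
case/andP: h1 => a1 a2; case/andP: h2 => a3 a4.
have h3 : 0 <= (r - r ^+ 2) * (T * (1 - 2 * r)) <= 1 / 4 * (T * 1).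
  have p0 : 0 <= r - r ^+ 2 by rewrite subr_ge0 expr2 ler_piMr //; lra.
  by rewrite mulr_ge0 // ler_pM.
case/andP: h3 => a5 a6.
rewrite mulrDr mulr1 ler_norml; apply/andP; split; lra.
Qed.

Definition profile_prim x : R := 1 / 3 * wprim (x + ln 2) + 2 / 3 * wprim x + 2 / 3 * yprim x.

Lemma dv_shift (f : R -> R) c x d : dv f (x + c) d -> dv (fun y => f (y + c)) x d.
Proof.
by move=> h; apply: (dv_eq (dv_comp (f := f) (g := fun y => y + c) h (dvD (dv_id x) (dv_cst c x)))); rewrite addr0 mulr1.
Qed.

Lemma profile_prim_dv x : dv profile_prim x (profile x).
Proof.
apply: (dv_eq (dvD (dvD (dvZ (1/3) (dv_shift (wprim_dv (x + ln 2)))) (dvZ (2/3) (wprim_dv x))) (dvZ (2/3) (yprim_dv x)))).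
rewrite /profile /sker /geo1 /geo /sgm expRD lnK ?posrE //.
have -> : expR (expR x * 2) = expR (expR x) ^+ 2 by rewrite -expRM_natl; congr expR; ring.
have := expR2_gt0 x; have := expR_gt0 x; move: (expR x) (expR (expR x)) => T E t0 E1.
have E2 : 0 < E ^+ 2 - 1 by nra.
have E3 : 0 < E + 1 by lra.
by field; rewrite !gt_eqF.
Qed.

Lemma profile_ctn : continuous (@profile R).
Proof.
have h x : 0 < expR (expR x) ^+ 2 - 1 :> R.
  have := expR2_gt0 x; have := expR_gt0 (expR x); move: (expR (expR x)) => E ? ?; nra.
have h2 x : 0 < expR (expR x) + 1 :> R by rewrite addr_gt0 ?expR_gt0.
have e x : expR (expR x) != 0 :> R by rewrite gt_eqF ?expR_gt0.
move=> x; have dE := dv_exp (expR_dv x).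
have d1 := dvXn (f := fun y => expR (expR y)) 2 (e x) dE.
have d2 := dvXn (f := fun y => expR (expR y) ^+ 2 - 1) 2 (lt0r_neq0 (h x)) (dvB d1 (dv_cst 1 x)).
have d3 := dvXn (f := fun y => expR (expR y) + 1) 4 (lt0r_neq0 (h2 x)) (dvD dE (dv_cst 1 x)).
have d4 := dv_inv (f := fun y => (expR (expR y) ^+ 2 - 1) ^+ 2) (expf_neq0 2 (lt0r_neq0 (h x))) d2.
have d5 := dv_inv (f := fun y => (expR (expR y) + 1) ^+ 4) (expf_neq0 4 (lt0r_neq0 (h2 x))) d3.
exact: (dv_continuous (dvM (dvM (dvZ 4 (expRX_dv 2 x)) d1) (dvD d4 d5))).
Qed.

Lemma ln2_gt0 : 0 < ln (2 : R).
Proof. by rewrite ln_gt0 //; lra. Qed.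

(** The primitive vanishes at +oo. At -oo [wprim] behaves as x - 1 and [yprim] tends to 1/4; the
    weights 1/3, 2/3 and 2/3 then give 1 - 1/6 = 5/6, and the shift by ln 2 contributes -ln 2/3. *)
Lemma profile_intg : tends (fun J => intg (@profile R) (- (ln 2 * J%:R)) (ln 2 * J%:R) - ln 2 * J%:R)
  (5 / 6 - ln 2 / 3).
Proof.
have l0 := ln2_gt0.
apply: (null_le (e' := fun J => 4000 * expR (ln 2 - ln 2 * J%:R))).
  by apply: nullZ; exact: expR_null.
exists 2%N => J J2.
have J2' : 2 <= J%:R :> R by rewrite (ler_nat R 2 J).
rewrite (intg_FTC _ _ profile_ctn profile_prim_dv) /profile_prim.
set a := ln 2 * J%:R.
have a0 : 2 * ln 2 <= a by rewrite mulrC ler_wpM2l // ltW.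
set q := expR (ln 2 - a).
have e1 : expR (- a) <= q by rewrite ler_expR; lra.
have e2 : expR (- (a + ln 2)) <= q by rewrite ler_expR; lra.
have q12 : q <= 1 / 2.
  have -> : 1 / 2 = expR (- ln 2) :> R by rewrite expRN lnK ?posrE // div1r.
  rewrite ler_expR; lra.
have A0 : 0 <= a by lra.
have A1 : 0 <= a + ln 2 by lra.
have W1 := wprim_decay A1; have W2 := wprim_decay A0; have Y2 := yprim_decay A0.
have W3 := wprim_near0 (le_trans e1 q12); have Y3 := yprim_near0 (le_trans e1 q12).
have W4 := @wprim_near0 (- a + ln 2); rewrite addrC -/q in W4; move: (W4 q12) => {}W4.
move: W1 W2 W3 W4 Y2 Y3; rewrite !ler_norml [- a + ln 2]addrC.
move: (wprim (a + ln 2)) (wprim a) (wprim (- a)) (wprim (ln 2 - a)) (yprim a) (yprim (- a)).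
move: (expR (- a)) (expR (- (a + ln 2))) q e1 e2 q12 => p r q e1 e2 q12 w1 w2 w3 w4 y2 y3.
clear - e1 e2.
move=> /andP[? ?] /andP[? ?] /andP[? ?] /andP[? ?] /andP[? ?] /andP[? ?].
by apply/andP; split; lra.
Qed.
End ProfileIntegrals.

(** * The Mellin transform of the profile on the imaginary axis *)

Section ProfileMellinTransform.
Variable R : realType.
Implicit Types (z w l : R[i]) (x y t : R) (N i n J : nat).
Local Open Scope complex_scope.
Local Notation Re := (@complex.Re R).
Local Notation Im := (@complex.Im R).

Lemma cdv_shift (f : R -> R[i]) c x d : cdv f (x + c) d -> cdv (fun y => f (y + c)) x d.
Proof. by case=> h1 h2; split; [exact: (dv_shift h1)|exact: (dv_shift h2)]. Qed.

Lemma ccn_shift (f : R -> R[i]) c : ccn f -> ccn (fun y => f (y + c)).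
Proof.
move=> h; apply: ccn_comp => //.
by apply: (@dv_ctn _ _ (fun=> 1 + 0)) => x; apply: dvD; [exact: dv_id|exact: dv_cst].
Qed.

Lemma cexp_per z x : cexp (z * (ln 2)%:C) = 1 -> cexp (z * (x + ln 2)%:C) = cexp (z * x%:C).
Proof. by move=> h; rewrite realCD mulrDr cexpD h mulr1. Qed.

Lemma cexp_perN z J : cexp (z * (ln 2)%:C) = 1 -> cexp (z * (- (ln 2 * J%:R))%:C) = 1.
Proof.
move=> h; elim: J => [|J IH]; first by rewrite mulr0 oppr0 mulr0 cexp0.
rewrite -(cexp_per _ h) -IH; congr (cexp (z * _%:C)).
by rewrite -(natr1 J); ring.
Qed.

Lemma n1_cexp_im z x (r : R) : n1 (cexp (z * x%:C) * r%:C) <= 2 * expR (Re z * x) * `|r|.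
Proof.
rewrite mulrC n1_realM mulrC; apply: ler_wpM2r => //.
by have := n1_cexp (z * x%:C); rewrite ReM /= mulr0 subr0.
Qed.

Lemma cdvB (f g : R -> R[i]) x d e : cdv f x d -> cdv g x e -> cdv (fun y => f y - g y) x (d - e).
Proof.
move=> hf hg; apply: (cdv_eq (eq_cdv (cdvD hf (cdvZ (- 1) hg)) _)) => [y|]; by rewrite mulN1r.
Qed.

Lemma minus_le (p c : R) : 0 <= c -> - (p + c) <= 0 - p.
Proof. by move=> ?; lra. Qed.

Lemma minus2_le (p c : R) : 0 <= p -> 0 <= c -> - 2 * (p + c) <= 0 - p.
Proof. by move=> ? ?; lra. Qed.

Lemma lin_realC (a b s t p q : R) : (a * s + b * t + b * (p - 4 * q))%:C =
  a%:C * s%:C + b%:C * t%:C + b%:C * (p%:C - 4 * q%:C).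
Proof.
by rewrite (realCD (a * s + b * t)) (realCD (a * s)) (realCM a) (realCM b t) (realCM b) (realCD p) rmorphN /=
  (realCM 4) (realC_nat R 4).
Qed.

Section Transform.
Variable z : R[i].
Hypotheses (z_im : Re z = 0) (z_neq0 : z != 0) (z_per : cexp (z * (ln 2)%:C) = 1).

Let A x := cexp (z * x%:C) * (sker x)%:C.
Let B x := cexp ((z - 2) * x%:C) * (pker x)%:C.
Let r2 x := cexp (z * x%:C) * (bder 0 2 x)%:C.
Let r4 x := cexp ((z - 2) * x%:C) * (bder 0 4 x)%:C.

Let Re_z2 : Re (z - 2) = - 2.
Proof. by rewrite ReD ReN z_im -(realC_nat R 2) /=; ring. Qed.

Let z2_neq0 : z - 2 != 0.
Proof. by apply/eqP => h; have := Re_z2; rewrite h => /=; lra. Qed.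

Let A_cdv x : cdv A x (z * A x - r2 x).
Proof.
apply: (cdv_eq (cdvM (cdv_cexp z x) (cdv_real (sker_dv x)))).
by rewrite /A /r2 rmorphN; ring.
Qed.

Let B_cdv x : cdv B x ((z - 2) * B x + r4 x).
Proof.
apply: (cdv_eq (cdvM (cdv_cexp (z - 2) x) (cdv_real (pker_dv x)))).
by rewrite /B /r4; ring.
Qed.

Let A_plus c : 0 <= c -> ctends (fun J => A (ln 2 * J%:R + c)) 0.
Proof.
move=> c0; have l0 := ln2_gt0 R; apply: (null_le0 (nullZ (2 * 512) (expR_null 0))) => J.
have x0 : 0 <= ln 2 * J%:R + c by rewrite addr_ge0 // mulr_ge0 // ltW.
rewrite ger0_norm ?n1_ge0 // subr0; apply: le_trans (n1_cexp_im _ _ _) _.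
rewrite z_im mul0r expR0 mulr1 -mulrA ler_wpM2l //; apply: le_trans (sker_decay x0) _.
apply: ler_wpM2l; [exact: ler0n|rewrite ler_expR; exact: minus_le].
Qed.

(** At multiples of ln 2 the phase e^(z x) equals 1, so the boundary term has a limit; along
    arbitrary x tending to -oo it would oscillate. *)
Let A_minus c : c = 0 \/ c = ln 2 -> ctends (fun J => A (- (ln 2 * J%:R) + c)) 1.
Proof.
move=> hc; have E J : A (- (ln 2 * J%:R) + c) = (sker (- (ln 2 * J%:R) + c))%:C.
  by rewrite /A; case: hc => ->; rewrite ?addr0 ?(cexp_per _ z_per) (cexp_perN _ z_per) mul1r.
apply: (eq_ctends _ E); apply: ctends_real.
apply: (null_le0 (nullZ 3 (expR_null c))) => J.
by rewrite [- _ + c]addrC; exact: sker_near0.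
Qed.

Let B_plus c : 0 <= c -> ctends (fun J => B (ln 2 * J%:R + c)) 0.
Proof.
move=> c0; have l0 := ln2_gt0 R; apply: (null_le0 (nullZ (2 * 7000) (expR_null 0))) => J.
have x0 : 0 <= ln 2 * J%:R + c by rewrite addr_ge0 // mulr_ge0 // ltW.
rewrite ger0_norm ?n1_ge0 // subr0; apply: le_trans (n1_cexp_im _ _ _) _.
have p0 : 0 <= ln (2 : R) * J%:R by apply: mulr_ge0 (ltW l0) (ler0n _ _).
have h1 : 2 * expR (Re (z - 2) * (ln 2 * J%:R + c)) <= 2 * expR (0 - ln 2 * J%:R).
  by apply: ler_wpM2l; [exact: ler0n|rewrite ler_expR Re_z2; exact: minus2_le].
have h2 : 0 <= 2 * expR (Re (z - 2) * (ln 2 * J%:R + c)) by rewrite mulr_ge0 ?expR_ge0.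
apply: le_trans (ler_pM h2 (normr_ge0 _) h1 (pker_decay x0)) _.
by rewrite mulrAC.
Qed.

Let B_minus c : ctends (fun J => B (- (ln 2 * J%:R) + c)) 0.
Proof.
have [C C0 HC] := @pker_bound R.
apply: (null_le0 (nullZ (2 * C) (nullM (expR_null c) (expR_null c)))) => J.
rewrite ger0_norm ?n1_ge0 // subr0; apply: le_trans (n1_cexp_im _ _ _) _.
rewrite Re_z2 [- _ + c]addrC; move: (c - _) => x.
have e : expR (- 2 * x) = (expR x ^+ 2)^-1 by rewrite -expRM_natl -expRN mulNr.
have := ler_wpM2l (_ : 0 <= 2 * expR (-2 * x)) (HC x); rewrite mulr_ge0 ?expR_ge0 // => /(_ isT) h.
apply: le_trans h _; rewrite e le_eqVlt; apply/orP; left; apply/eqP; field.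
by rewrite gt_eqF ?expR_gt0.
Qed.

(** Integration by parts in pointwise form: A = (A' + r2)/z and B = (B' - r4)/(z - 2), inserted in
    [profileE], split the integrand into the derivative of [prim] and the absolutely integrable
    [rest]. *)
Let prim x := z^-1 * ((1/3)%:C * A (x + ln 2) + (2/3)%:C * A x)
  + (2/3)%:C * (z - 2)^-1 * (B x - 4 * B (x + ln 2)).
Let rest x := z^-1 * ((1/3)%:C * r2 (x + ln 2) + (2/3)%:C * r2 x)
  - (2/3)%:C * (z - 2)^-1 * (r4 x - 4 * r4 (x + ln 2)).

Let f x := cexp (z * x%:C) * (profile x)%:C.

Let f_ccn : ccn f.
Proof. by apply: ccnM; [exact: ccn_cexp|apply: ccn_real; exact: profile_ctn]. Qed.

Let r2_ccn : ccn r2. Proof. exact: bder_ccn. Qed.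
Let r4_ccn : ccn r4. Proof. exact: bder_ccn. Qed.

Let ccn_comb (u v : R -> R[i]) a b c : ccn u -> ccn v ->
  ccn (fun x => c * (a * u x + b * v x)).
Proof. by move=> hu hv; apply: ccnZ; apply: ccnD; apply: ccnZ. Qed.

Let rest_ccn : ccn rest.
Proof.
have h1 := ccn_comb (1/3)%:C (2/3)%:C z^-1 (ccn_shift (ln 2) r2_ccn) r2_ccn.
have h2 := ccn_comb 1 (- 4) (- ((2/3)%:C * (z - 2)^-1)) r4_ccn (ccn_shift (ln 2) r4_ccn).
apply: (eq_ccn (ccnD h1 h2)) => x; rewrite /rest.
move: (r2 (x + ln 2)) (r2 x) (r4 (x + ln 2)) (r4 x) => *; ring.
Qed.

Let Bsplit x : cexp (z * x%:C) * (pker x / expR x ^+ 2)%:C = B x.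
Proof.
rewrite /B [(z - 2) * _]mulrBl cexpD -mulrA; congr (_ * _).
have -> : - (2 * x%:C) = (- (2 * x))%:C by rewrite -(realC_nat R 2) -realCM -rmorphN.
by rewrite cexp_real -realCM expRN expRM_natl mulrC.
Qed.

Let f_split x : cdv prim x (f x - rest x).
Proof.
have hA := A_cdv (x + ln 2); have hB := B_cdv (x + ln 2).
have h := cdvD (cdvZ z^-1 (cdvD (cdvZ (1/3)%:C (cdv_shift hA)) (cdvZ (2/3)%:C (A_cdv x))))
   (cdvZ ((2/3)%:C * (z - 2)^-1) (cdvB (B_cdv x) (cdvZ 4 (cdv_shift hB)))).
apply: (cdv_eq h) => {h hA hB}.
have E : f x = (1/3)%:C * A (x + ln 2) + (2/3)%:C * A x + (2/3)%:C * (B x - 4 * B (x + ln 2)).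
  rewrite -!Bsplit (cexp_per _ z_per) /A (cexp_per _ z_per) /f profileE lin_realC.
  by move: (cexp _) (sker _)%:C (sker _)%:C (_ / _)%:C (_ / _)%:C (1/3)%:C (2/3)%:C => *; ring.
rewrite E /rest; move: z_neq0 z2_neq0 (A (x + ln 2)) (A x) (B (x + ln 2)) (B x).
move: (r2 (x + ln 2)) (r2 x) (r4 (x + ln 2)) (r4 x) (1/3)%:C (2/3)%:C.
move=> a1 a2 a3 a4 a5 a6 z0 z2 a7 a8 a9 a10; field.
by rewrite z0 z2.
Qed.

(* The pole of the transform at z = 0 produces the term z^-1. *)
Lemma profile_mellin : exists l2 l4, [/\ ctends (hasse_sum (- z)) l2, ctends (hasse_sum (2 - z)) l4 &
  ctends (fun J => cintg (fun x => cexp (z * x%:C) * (profile x)%:C) (- (ln 2 * J%:R)) (ln 2 * J%:R) + z^-1)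
    ((l2 / z + 2 * l4 / (z - 2)) * Gint (2 + z))].
Proof.
have hw : Re (2 + z) = 2 by rewrite ReD z_im -(realC_nat R 2) /= addr0.
have [l2 H2 I2] := hasse_mellin hw (or_introl erefl).
have [l4 H4 I4] := hasse_mellin hw (or_intror erefl).
have E2 : 2%:R - (2 + z) = - z by ring.
have E4 : 4%:R - (2 + z) = 2 - z by ring.
have F2 : 2 + z - 2%:R = z by ring.
have F4 : 2 + z - 4%:R = z - 2 by ring.
rewrite E2 F2 in H2 I2; rewrite E4 F4 in H4 I4.
exists l2, l4; split=> //.
have l0 := ln2_gt0 R.
have D2 := imprD (ccnZ (1/3)%:C (ccn_shift (ln 2) r2_ccn)) (ccnZ (2/3)%:C r2_ccn)
  (imprZ (1/3)%:C (ccn_shift (ln 2) r2_ccn) (impr_shift (ln 2) r2_ccn I2)) (imprZ (2/3)%:C r2_ccn I2).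
have D4 := imprD r4_ccn (ccnZ (- 4) (ccn_shift (ln 2) r4_ccn)) I4
  (imprZ (- 4) (ccn_shift (ln 2) r4_ccn) (impr_shift (ln 2) r4_ccn I4)).
have c2 := ccnD (ccnZ (1/3)%:C (ccn_shift (ln 2) r2_ccn)) (ccnZ (2/3)%:C r2_ccn).
have c4 := ccnD r4_ccn (ccnZ (- 4) (ccn_shift (ln 2) r4_ccn)).
have D := imprD (ccnZ z^-1 c2) (ccnZ (- ((2/3)%:C * (z - 2)^-1)) c4)
   (imprZ z^-1 c2 D2) (imprZ (- ((2/3)%:C * (z - 2)^-1)) c4 D4).
(* Shifts leave the integrals over the line unchanged: the weights 1/3 + 2/3 = 1 and -(2/3)(1 - 4) =
   2 produce the coefficients 1 and 2 of the two zeta values. *)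
have G : impr rest ((l2 / z + 2 * l4 / (z - 2)) * Gint (2 + z)).
  set L := _ * Gint _; set L' := (X in impr _ X) in D.
  have <- : L' = L.
    rewrite /L' /L.
    have -> : (1 / 3)%:C = 1 / 3 :> R[i] by rewrite realCM rmorphV ?unitfE ?pnatr_eq0 //= !realC_nat.
    have -> : (2 / 3)%:C = 2 / 3 :> R[i] by rewrite realCM rmorphV ?unitfE ?pnatr_eq0 //= !realC_nat.
    by field; rewrite z_neq0 z2_neq0.
  apply: (eq_impr D) => x; rewrite /rest.
  move: (r2 (x + ln 2)) (r2 x) (r4 (x + ln 2)) (r4 x) => *; ring.
have K := impr_ctends l0 G.
have s13 : (1 / 3)%:C + (2 / 3)%:C = 1 :> R[i] by rewrite -realCD -[RHS](realC_nat R 1); congr (_%:C); field.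
have T J : cintg f (- (ln 2 * J%:R)) (ln 2 * J%:R) =
   prim (ln 2 * J%:R) - prim (- (ln 2 * J%:R)) + cintg rest (- (ln 2 * J%:R)) (ln 2 * J%:R).
  have cB := ccnD f_ccn (ccnZ (-1) rest_ccn).
  have h := cintg_FTC (- (ln 2 * J%:R)) (ln 2 * J%:R) cB (fun x => cdv_eq (f_split x) (_ : _ = f x + -1 * rest x)).
  rewrite -h; last by move=> x; ring.
  by rewrite (cintgD _ _ f_ccn (ccnZ (-1) rest_ccn)) (cintgZ _ _ _ rest_ccn); ring.
have P0 : ctends (fun J => prim (ln 2 * J%:R)) 0.
  have a0 := A_plus (lexx 0); have a1 := A_plus (ltW l0).
  have b0 := B_plus (lexx 0); have b1 := B_plus (ltW l0).
  have h := ctendsD (ctendsZ z^-1 (ctendsD (ctendsZ (1/3)%:C a1) (ctendsZ (2/3)%:C a0)))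
     (ctendsZ ((2/3)%:C * (z - 2)^-1) (ctendsB b0 (ctendsZ 4 b1))).
  rewrite !(mulr0, addr0, subr0) in h.
  by apply: (eq_ctends h) => J; rewrite /prim addr0.
have P1 : ctends (fun J => prim (- (ln 2 * J%:R))) z^-1.
  have a0 := A_minus (or_introl erefl); have a1 := A_minus (or_intror erefl).
  have b0 := B_minus 0; have b1 := B_minus (ln 2).
  have h := ctendsD (ctendsZ z^-1 (ctendsD (ctendsZ (1/3)%:C a1) (ctendsZ (2/3)%:C a0)))
     (ctendsZ ((2/3)%:C * (z - 2)^-1) (ctendsB b0 (ctendsZ 4 b1))).
  rewrite !(mulr0, mulr1, addr0, subr0) s13 mulr1 in h.
  by apply: (eq_ctends h) => J; rewrite /prim addr0.
have Q := ctendsD (ctendsD (ctendsB P0 P1) K) (ctends_cst z^-1).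
set L := (_ * Gint _) in Q *.
have EQ : 0 - z^-1 + L + z^-1 = L by ring.
rewrite EQ in Q; apply: (eq_ctends Q) => J.
by rewrite -/f T.
Qed.
End Transform.
End ProfileMellinTransform.

(** * The generating function and its functional equation *)

Section PowerSeries.
Variable R : realType.
Implicit Types (f g : nat -> R) (l v w C : R).

Definition sums f l := tends (fun N => \sum_(n < N) f n) l.

Lemma eq_sums f g l : sums f l -> f =1 g -> sums g l.
Proof. by move=> h E; apply: (eq_tends h) => N; apply: eq_bigr => n _; rewrite E. Qed.

Lemma sumsD f g l m : sums f l -> sums g m -> sums (fun n => f n + g n) (l + m).
Proof. by move=> hf hg; apply: (eq_tends (tendsD hf hg)) => N; rewrite big_split. Qed.

Lemma sumsZ C f l : sums f l -> sums (fun n => C * f n) (C * l).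
Proof. by move=> hf; apply: (eq_tends (tendsZ C hf)) => N; rewrite mulr_sumr. Qed.

Lemma sumsB f g l m : sums f l -> sums g m -> sums (fun n => f n - g n) (l - m).
Proof.
by move=> hf hg; rewrite -[- m]mulN1r; apply: (eq_sums (sumsD hf (sumsZ (-1) hg))) => n; rewrite mulN1r.
Qed.

Lemma sums_uniq f l m : sums f l -> sums f m -> l = m.
Proof. exact: tends_uniq. Qed.

Lemma sumsS f l a : sums f l -> sums (fun n => if n is m.+1 then f m else a) (a + l).
Proof.
move=> h; apply/(tends_shift _ _ 1).
by apply: (eq_tends (tendsD (tends_cst a) h)) => N; rewrite addn1 big_ord_recl.
Qed.

Lemma sums_null f l : sums f l -> null f.
Proof.
move=> h; have h1 := (tends_shift _ l 1).2 h.
by apply: (eq_null (nullB h1 h)) => n; rewrite addn1 big_ord_recr /=; ring.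
Qed.

Lemma sums_geometric v : 0 <= v < 1 -> sums (fun n => v ^+ n) (1 - v)^-1.
Proof.
move=> hv; case/andP: (hv) => v0 v1; have w0 : 1 - v != 0 by rewrite gt_eqF // subr_gt0.
apply: (null_le0 (nullZ (1 - v)^-1 (null_expn hv))) => N.
have E : (1 - v) * \sum_(n < N) v ^+ n = 1 - v ^+ N.
  elim: N => [|N IH]; first by rewrite big_ord0 expr0; ring.
  by rewrite big_ord_recr mulrDr IH /= exprS; ring.
have -> : \sum_(n < N) v ^+ n - (1 - v)^-1 = - ((1 - v)^-1 * v ^+ N).
  by apply: (mulfI w0); rewrite mulrBr E; field.
by rewrite normrN ger0_norm // mulr_ge0 ?exprn_ge0 // invr_ge0 subr_ge0 ltW.
Qed.

Lemma sum_lin_geometric v N : (1 - v) ^+ 2 * \sum_(n < N) n.+1%:R * v ^+ n =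
  1 - N.+1%:R * v ^+ N + N%:R * v ^+ N.+1.
Proof.
elim: N => [|N IH]; first by rewrite big_ord0 expr0; ring.
by rewrite big_ord_recr mulrDr IH /= -(natr1 N.+1) -(natr1 N) !exprS; ring.
Qed.

Lemma sums_exist v C f : 0 <= v < 1 -> 0 <= C -> (forall n, `|f n| <= C * (n.+1%:R * v ^+ n)) ->
  exists2 l, sums f l & `|l| <= C / (1 - v) ^+ 2.
Proof.
move=> hv C0 H; case/andP: (hv) => v0 v1; have w0 : 0 < (1 - v) ^+ 2 by rewrite exprn_gt0 // subr_gt0.
pose b n : R := C * (n.+1%:R * v ^+ n).
have b0 n : 0 <= b n by rewrite /b !mulr_ge0 ?exprn_ge0.
have bN N : \sum_(n < N) b n <= C / (1 - v) ^+ 2.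
  rewrite -mulr_sumr ler_wpM2l // -div1r ler_pdivlMr // mulrC sum_lin_geometric.
  have : N%:R * v ^+ N.+1 <= N.+1%:R * v ^+ N.
    by rewrite ler_pM ?exprn_ge0 ?ler_nat // exprS ler_piMl ?exprn_ge0 // ltW.
  lra.
have [lb hb _] : exists2 l, sums b l & forall N, \sum_(n < N) b n <= l.
  apply: nondecreasing_tends bN => N; by rewrite big_ord_recr /= lerDl.
have [lf hf _] : exists2 l, sums (fun n => f n + b n) l & forall N, \sum_(n < N) (f n + b n) <= l.
  apply: (@nondecreasing_tends _ _ (C / (1 - v) ^+ 2 + C / (1 - v) ^+ 2)) => N.
    by rewrite big_ord_recr /= lerDl; have := H N; rewrite ler_norml -/(b N) => /andP[? ?]; lra.
  rewrite big_split lerD // ; apply: le_trans (bN N); apply: ler_sum => n _.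
  exact: le_trans (ler_norm _) (H n).
exists (lf - lb); first by apply: (eq_sums (sumsB hf hb)) => n; rewrite addrK.
have h : sums f (lf - lb) by apply: (eq_sums (sumsB hf hb)) => n; rewrite addrK.
apply: (tends_norm_le h); exists 0%N => N _; apply: le_trans (bN N).
by apply: le_trans (ler_norm_sum _ _ _) _; apply: ler_sum => n _; exact: H.
Qed.

Lemma null_lin_expn v : 0 <= v < 1 -> null (fun n => n.+1%:R * v ^+ n).
Proof.
move=> hv; have [|l hl _] := @sums_exist v 1 (fun n => n.+1%:R * v ^+ n) hv ler01 _.
  by move=> n; case/andP: hv => v0 v1; rewrite mul1r ger0_norm // mulr_ge0 ?exprn_ge0.
exact: sums_null hl.
Qed.

Section Recurrence.
Local Notation alpha := (@alpha R).

Lemma alpha_lin : exists2 C : R, 0 <= C & forall n, `|alpha n.+1| <= C * n.+1%:R.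
Proof.
have [D D0 HD] := @alpha_lip R; exists D => // n.
have := HD 1%N n.+1 isT isT; rewrite alpha1 subr0 divr1 => h; apply: le_trans h _.
by rewrite ler_wpM2l // gerBl.
Qed.

Let psi (x : nat) : R := alpha (x./2).+1.

(** The recursion [alpha_rec] starts at index 3. At index 2 it would give 1 instead of 2, because
    the formula for the mean in [bmean_half] fails for zero trials; the indicator is the origin of
    the separate [v ^+ 2] below. *)
Lemma alpha_rec2 n : alpha n.+2 = 1 + bmean n psi + (n == 0%N)%:R.
Proof.
case: n => [|n]; first by rewrite alpha2 /= /psi alpha1; ring.
by rewrite alpha_rec addr0.
Qed.

(* \sum_m v^m E psi(Bin(m, 1/2)) is geometric in each value of psi, with ratio v/(2 - v). *)
Lemma alpha_series_eq v A B : 0 < v < 1 -> sums (fun n => alpha n.+1 * v ^+ n.+1) A ->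
  sums (fun n => alpha n.+1 * ((v / (2 - v)) ^+ 2) ^+ n.+1) B ->
  A = v ^+ 2 / (1 - v) + v ^+ 2 + 4 * B.
Proof.
case/andP=> v0 v1 hA hB; have hv : 0 <= v < 1 by rewrite ltW.
have [C C0 HC] := alpha_lin.
have d0 : 0 < 2 - v by lra.
set w := v / (2 - v); have w0 : 0 < w by rewrite divr_gt0.
have w1 : w < 1 by rewrite ltr_pdivrMr //; lra.
have hw : 0 <= w < 1 by rewrite ltW.
have bnd (k : nat) m : `|bmean m (fun x => psi (x + k)%N) * v ^+ m| <= C * k.+1%:R * (m.+1%:R * v ^+ m).
  rewrite normrM (ger0_norm (exprn_ge0 m (ltW v0))) mulrA ler_wpM2r ?exprn_ge0 ?(ltW v0) //.
  rewrite -[leRHS](bmean_cst m); apply: bmean_norm => x xm.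
  rewrite /psi; apply: le_trans (HC _) _; rewrite -mulrA ler_wpM2l // -natrM ler_nat.
  have h2 : ((x + k)./2 <= x + k)%N by rewrite -divn2 leq_div.
  by clear -xm h2; nia.
pose Phi k := xget 0 [set l | sums (fun m => bmean m (fun x => psi (x + k)%N) * v ^+ m) l]%classic.
have HPhi k : sums (fun m => bmean m (fun x => psi (x + k)%N) * v ^+ m) (Phi k) /\ `|Phi k| <= C * k.+1%:R / (1 - v) ^+ 2.
  have [l hl bl] := sums_exist hv (mulr_ge0 C0 (ler0n _ k.+1)) (bnd k).
  by rewrite /Phi; case: xgetP => [x _ hx|/(_ l)//]; rewrite (sums_uniq hx hl).
(* Conditioning on one trial gives Phi k = psi k + (v/2)(Phi k + Phi (k+1)); solving for Phi k
   produces the ratio w = (v/2)/(1 - v/2). *)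
have rec k : Phi k = psi k / (1 - v / 2) + w * Phi k.+1.
  have [h1 _] := HPhi k; have [h2 _] := HPhi k.+1.
  have h3 := sumsS (psi k) (sumsZ (v / 2) (sumsD h1 h2)).
  have E : Phi k = psi k + v / 2 * (Phi k + Phi k.+1).
    apply: (sums_uniq h1); apply: (eq_sums h3) => -[|m] /=; first by rewrite expr0 mulr1.
    have -> : bmean m (fun x => psi (x.+1 + k)%N) = bmean m (fun x => psi (x + k.+1)%N).
      by apply: eq_bmean => x; rewrite addnS.
    by rewrite exprS; field.
  have q : 1 - v / 2 != 0 by rewrite gt_eqF //; lra.
  apply: (mulfI q).
  have -> : (1 - v / 2) * (psi k / (1 - v / 2) + w * Phi k.+1) = psi k + v / 2 * Phi k.+1.
    by rewrite /w; field; rewrite gt_eqF.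
  by rewrite mulrBl mul1r {1}E; ring.
have iterE K : Phi 0%N = \sum_(k < K) psi k * w ^+ k / (1 - v / 2) + w ^+ K * Phi K.
  elim: K => [|K IH]; first by rewrite big_ord0 expr0; ring.
  by rewrite big_ord_recr /= {1}IH rec exprS; ring.
have hpsi : sums (fun k => psi k * w ^+ k / (1 - v / 2)) (Phi 0%N).
  apply: (null_le0 (nullZ (C / (1 - v) ^+ 2) (null_lin_expn hw))) => K.
  rewrite (iterE K) opprD addrA subrr sub0r normrN normrM (ger0_norm (exprn_ge0 K (ltW w0))).
  have [_ h] := HPhi K; apply: le_trans (ler_wpM2l (exprn_ge0 K (ltW w0)) h) _.
  by rewrite le_eqVlt; apply/orP; left; apply/eqP; ring.
have hpsi2 : tends (fun N => \sum_(k < (2 * N)%N) psi k * w ^+ k / (1 - v / 2)) (Phi 0%N).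
  by apply: (null_sub (a := fun N => (2 * N)%N) _ hpsi) => N; lia.
have q : 1 - v / 2 != 0 by rewrite gt_eqF //; lra.
(* [psi] depends on [x./2] only, so the terms of index 2n and 2n + 1 combine into the factor 1 + w
   and a power of w^2. *)
have pairE N : \sum_(k < (2 * N)%N) psi k * w ^+ k / (1 - v / 2) =
    (1 + w) / (w ^+ 2 * (1 - v / 2)) * \sum_(n < N) alpha n.+1 * (w ^+ 2) ^+ n.+1.
  elim: N => [|N IH]; first by rewrite muln0 !big_ord0 mulr0.
  rewrite [in RHS]big_ord_recr mulrDr -IH mulnS add2n !big_ord_recr /= -addrA; congr (_ + _).
  rewrite /psi !mul2n /= uphalf_double doubleK -mul2n -exprM mulnS exprS exprD mulnC exprM.
  have wn : w != 0 by rewrite gt_eqF.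
  have dn : 2 - v != 0 by rewrite gt_eqF.
  by field; rewrite wn dn.
have EP : Phi 0%N = (1 + w) / (w ^+ 2 * (1 - v / 2)) * B.
  by apply: (tends_uniq hpsi2); apply: (eq_tends (tendsZ _ hB)) => N; rewrite pairE.
have [h0 _] := HPhi 0%N.
have z0 : sums (fun=> 0) 0 by apply: (eq_tends (tends_cst 0)) => N; rewrite big1.
have h5 := sumsS (alpha 1 * v) (sumsZ (v ^+ 2) (sumsD (sumsD (sums_geometric hv) h0) (sumsS 1 z0))).
have -> : A = alpha 1 * v + v ^+ 2 * ((1 - v)^-1 + Phi 0%N + (1 + 0)).
  apply: (sums_uniq hA); apply: (eq_sums h5) => -[|n]; first by rewrite expr1.
  have -> : bmean n (fun x => psi (x + 0)%N) = bmean n psi by apply: eq_bmean => x; rewrite addn0.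
  have -> : v ^+ n.+2 = v ^+ 2 * v ^+ n by rewrite -exprD add2n.
  by rewrite alpha_rec2; case: n => [|n] /=; rewrite ?expr0; ring.
rewrite EP alpha1.
have wE : w = v / (2 - v) by [].
have v1' : 1 - v != 0 by rewrite gt_eqF //; lra.
have -> : (1 + w) / (w ^+ 2 * (1 - v / 2)) = 4 / v ^+ 2.
  by rewrite wE; field; rewrite !gt_eqF //; lra.
by field; rewrite v1' gt_eqF.
Qed.
End Recurrence.
End PowerSeries.

(** * The hyperbolic substitution and the dilation equation *)

Section FunctionalEquation.
Variable R : realType.
Implicit Types (x y : R).
Local Notation alpha := (@alpha R).

Definition th x : R := (expR (2 * x) - 1) / (expR (2 * x) + 1).
Definition sech2 x : R := 1 - th x ^+ 2.

Lemma th_den x : 0 < expR (2 * x) + 1 :> R.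
Proof. by rewrite addr_gt0 ?expR_gt0. Qed.

Lemma th_dv x : dv th x (sech2 x).
Proof.
have h := th_den x; have h0 : expR (2 * x) + 1 != 0 by rewrite gt_eqF.
have de := dv_exp (dvZ 2 (dv_id x)).
apply: (dv_eq (dvM (dvB de (dv_cst 1 x)) (dv_inv (f := fun y => expR (2 * y) + 1) h0 (dvD de (dv_cst 1 x))))).
by rewrite /sech2 /th; field.
Qed.

Lemma th0 : th 0 = 0.
Proof. by rewrite /th mulr0 expR0 subrr mul0r. Qed.

Lemma sech2E x : sech2 x = 4 * expR (2 * x) / (expR (2 * x) + 1) ^+ 2.
Proof. by rewrite /sech2 /th; field; rewrite gt_eqF // th_den. Qed.

Lemma sech2_gt0 x : 0 < sech2 x.
Proof. by rewrite sech2E divr_gt0 ?exprn_gt0 ?th_den // mulr_gt0 ?expR_gt0. Qed.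

Lemma th_ge0 x : 0 <= x -> 0 <= th x.
Proof.
by move=> x0; rewrite divr_ge0 ?(ltW (th_den x)) // subr_ge0 -expR0 ler_expR mulr_ge0.
Qed.

Lemma th_gt0 x : 0 < x -> 0 < th x.
Proof.
by move=> x0; rewrite divr_gt0 ?(th_den x) // subr_gt0 -expR0 ltr_expR mulr_gt0.
Qed.

Lemma sech2_lt1 x : 0 < x -> sech2 x < 1.
Proof. by move=> x0; rewrite /sech2 gtrBl exprn_gt0 // th_gt0. Qed.

Lemma th_le x : 0 <= x -> th x <= x.
Proof.
move=> x0; rewrite -subr_ge0.
have h y : dv (fun y => y - th y) y (th y ^+ 2).
  by apply: (dv_eq (dvB (dv_id y) (th_dv y))); rewrite /sech2; ring.
by have := dv_ge0_le x0 (fun y _ => h y) (fun y _ => sqr_ge0 (th y)); rewrite th0 subr0.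
Qed.

Lemma th_ge x : 0 <= x -> x * sech2 x <= th x.
Proof.
move=> x0; rewrite -subr_ge0.
have h y : dv (fun y => th y - y * sech2 y) y (2 * y * th y * sech2 y).
  apply: (dv_eq (dvB (th_dv y) (dvM (dv_id y) (dvB (dv_cst 1 y) (dvM (th_dv y) (th_dv y)))))).
  by rewrite /sech2; ring.
have p y : 0 <= y <= x -> 0 <= 2 * y * th y * sech2 y.
  by case/andP=> y0 _; exact: mulr_ge0 (mulr_ge0 (mulr_ge0 (ler0n _ 2) y0) (th_ge0 y0)) (ltW (sech2_gt0 y)).
by have := dv_ge0_le x0 (fun y _ => h y) p; rewrite th0 mul0r subr0.
Qed.

Lemma sech2_ge x : 0 <= x -> expR (- x ^+ 2) <= sech2 x.
Proof.
move=> x0; rewrite -[leRHS](lnK (sech2_gt0 x)) ler_expR lerNl.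
rewrite -subr_ge0 opprK.
have h y : dv (fun y => y * y + ln (sech2 y)) y (2 * (y - th y)).
  have hs : dv sech2 y (- (2 * th y * sech2 y)).
    by apply: (dv_eq (dvB (dv_cst 1 y) (dvM (th_dv y) (th_dv y)))); rewrite /sech2; ring.
  apply: (dv_eq (dvD (dvM (dv_id y) (dv_id y)) (dv_ln (sech2_gt0 y) hs))).
  by field; rewrite gt_eqF // sech2_gt0.
have p y : 0 <= y <= x -> 0 <= 2 * (y - th y).
  by case/andP=> y0 _; rewrite mulr_ge0 // subr_ge0 th_le.
have := dv_ge0_le x0 (fun y _ => h y) p.
by rewrite /sech2 th0 mul0r expr0n /= subr0 ln1 addr0 expr2.
Qed.

Definition aser (v : R) : R := xget 0 [set l | sums (fun n => alpha n.+1 * v ^+ n.+1) l]%classic.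

Lemma aserP : exists2 C : R, 0 <= C & forall v : R, 0 <= v < 1 ->
  sums (fun n => alpha n.+1 * v ^+ n.+1) (aser v) /\ `|aser v| <= C * v / (1 - v) ^+ 2.
Proof.
have [C C0 HC] := @alpha_lin R; exists C => // v hv; case/andP: (hv) => v0 v1.
have [|l hl bl] := sums_exist hv (mulr_ge0 C0 v0) (f := fun n => alpha n.+1 * v ^+ n.+1).
  move=> n; rewrite normrM (ger0_norm (exprn_ge0 n.+1 v0)).
  apply: le_trans (ler_wpM2r (exprn_ge0 n.+1 v0) (HC n)) _.
  by rewrite exprS le_eqVlt; apply/orP; left; apply/eqP; ring.
by rewrite /aser; case: xgetP => [x _ hx|/(_ l)//]; rewrite (sums_uniq hx hl).
Qed.

(* For v = sech^2 x one has v/(2 - v) = sech(2x), so the functional equation becomes a dilation. *)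
Definition dser x : R := x ^+ 2 * aser (sech2 x).

Lemma sech2_double x : sech2 (2 * x) = (sech2 x / (2 - sech2 x)) ^+ 2.
Proof.
rewrite !sech2E; have -> : expR (2 * (2 * x)) = expR (2 * x) ^+ 2 by rewrite -expRM_natl.
have := expR_gt0 (2 * x); move: (expR _) => E E0.
have h1 : 0 < E + 1 by lra.
have h2 : 0 < E ^+ 2 + 1 by nra.
by field; rewrite !gt_eqF //; nra.
Qed.

Lemma dser_double x : 0 < x -> dser x = profile (ln (2 * x)) + dser (2 * x).
Proof.
move=> x0; have [C _ HC] := aserP.
have hv : 0 <= sech2 x < 1 by rewrite (ltW (sech2_gt0 x)) sech2_lt1.
have x2 : 0 < 2 * x by rewrite mulr_gt0.
have hv2 : 0 <= sech2 (2 * x) < 1 by rewrite (ltW (sech2_gt0 _)) sech2_lt1.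
have [h1 _] := HC _ hv; have [h2 _] := HC _ hv2; rewrite /dser.
have hv' : 0 < sech2 x < 1 by rewrite sech2_gt0 sech2_lt1.
rewrite sech2_double in h2 *.
rewrite (alpha_series_eq hv' h1 h2) mulrDr; congr (_ + _); last by ring.
rewrite /profile lnK ?posrE // sech2E.
have e1 : 1 < expR (2 * x) by rewrite -[ltLHS]expR0 ltr_expR.
move: (expR (2 * x)) e1 => E e1.
have h3 : 0 < E + 1 by lra.
have h4 : 0 < E - 1 by lra.
have h5 : 0 < E ^+ 2 - 1 by nra.
have h6 : 0 < (E + 1) ^+ 2 - 4 * E by nra.
by field; rewrite !gt_eqF.
Qed.

Lemma dser_iter x N : 0 < x -> dser x = \sum_(r < N) profile (ln (2 ^+ r.+1 * x)) + dser (2 ^+ N * x).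
Proof.
move=> x0; elim: N => [|N IH]; first by rewrite big_ord0 expr0 mul1r add0r.
have xN : 0 < 2 ^+ N * x by rewrite mulr_gt0 // exprn_gt0.
by rewrite big_ord_recr IH (dser_double xN) mulrA -exprS addrA.
Qed.

(** Exponential decay of v = sech^2 x beats the factor x^2. For x >= 1 one has x^3 v <= 27/2 and (1
    - v)^2 >= 1/16, whence 216 = 16 * 27/2. *)
Lemma dser_decay : exists2 C : R, 0 <= C & forall x, 1 <= x -> `|dser x| <= C / x.
Proof.
have [C C0 HC] := aserP; exists (C * 216); first exact: mulr_ge0 C0 (ler0n _ _).
move=> x x1; have x0 : 0 < x by lra.
have hv : 0 <= sech2 x < 1 by rewrite (ltW (sech2_gt0 x)) sech2_lt1.
have [_ h] := HC _ hv; rewrite /dser normrM (ger0_norm (sqr_ge0 x)).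
apply: le_trans (ler_wpM2l (sqr_ge0 x) h) _.
have E3 : (1 + 2 * x / 3) ^+ 3 <= expR (2 * x).
  have -> : expR (2 * x) = expR (2 * x / 3) ^+ 3 by rewrite -expRM_natl; congr expR; field.
  apply: lerXn2r; rewrite ?nnegrE ?expR_ge0 //; last exact: expR_ge1Dx.
  by rewrite addr_ge0 // divr_ge0 // mulr_ge0 // ltW.
have xE : x ^+ 3 <= 27 / 8 * expR (2 * x).
  have : (2 * x / 3) ^+ 3 <= (1 + 2 * x / 3) ^+ 3.
    by apply: lerXn2r; rewrite ?nnegrE; lra.
  have -> : x ^+ 3 = 27 / 8 * (2 * x / 3) ^+ 3 by field.
  lra.
have Ebig : 3 <= expR (2 * x) by have := expR_ge1Dx (2 * x); lra.
have vle : sech2 x * expR (2 * x) <= 4.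
  rewrite sech2E; move: (expR (2 * x)) Ebig => E Eb.
  have E0 : 0 < (E + 1) ^+ 2 by nra.
  by rewrite mulrAC ler_pdivrMr //; nra.
have t2 : 1 / 2 <= th x by rewrite /th ler_pdivlMr ?th_den //; lra.
have v4 : 1 / 4 <= 1 - sech2 x by rewrite /sech2; nra.
have {}v4 : 1 / 16 <= (1 - sech2 x) ^+ 2 by nra.
have xv : x ^+ 3 * sech2 x <= 27 / 2.
  have s0 := ltW (sech2_gt0 x); have := ler_wpM2r s0 xE; nra.
rewrite ler_pdivlMr //.
have v0 : 0 < (1 - sech2 x) ^+ 2 by lra.
have -> : x ^+ 2 * (C * sech2 x / (1 - sech2 x) ^+ 2) * x = C * ((x ^+ 3 * sech2 x) / (1 - sech2 x) ^+ 2).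
  by field; rewrite gt_eqF //; case/andP: hv => _ ?; rewrite subr_gt0.
by rewrite ler_wpM2l // ler_pdivrMr //; lra.
Qed.
End FunctionalEquation.

(** * Abelian estimate *)

Section AbelEstimate.
Variable R : realType.
Implicit Types (x y v q : R).
Local Notation alpha := (@alpha R).

Definition harm (n : nat) : R := \sum_(k < n) k.+1%:R^-1.

Lemma harmS n : harm n.+1 = harm n + n.+1%:R^-1.
Proof. by rewrite /harm big_ord_recr. Qed.

Lemma ln_diff_bounds (n : nat) :
  n.+2%:R^-1 <= ln (n.+2%:R : R) - ln n.+1%:R <= n.+1%:R^-1.
Proof.
have a0 : 0 < n.+1%:R :> R by rewrite ltr0n.
have b0 : 0 < n.+2%:R :> R by rewrite ltr0n.
have E : (n.+2%:R : R) = n.+1%:R + 1 by rewrite -(natr1 n.+1).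
rewrite -ln_div ?posrE //; apply/andP; split.
  rewrite -[ln _]opprK -lnV ?posrE ?divr_gt0 // invf_div lerNr.
  have -> : (n.+1%:R / n.+2%:R : R) = 1 + - n.+2%:R^-1 by rewrite E; field; apply: lt0r_neq0; lra.
  by apply: le_ln1Dx; rewrite ltrNl opprK invf_lt1 // ltr1n.
have -> : (n.+2%:R / n.+1%:R : R) = 1 + n.+1%:R^-1 by rewrite E; field; rewrite gt_eqF.
by apply: le_ln1Dx; apply: lt_trans (_ : 0 < _); rewrite ?invr_gt0 //; lra.
Qed.

Lemma squeeze_tends (u p : nat -> R) : (forall m, 0 <= p m) ->
  (forall m, u m - p m + p m.+1 <= u m.+1 <= u m) ->
  exists2 l, tends u l & forall n, `|u n - l| <= p n.
Proof.
move=> p0 uS.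
have low m k : u m - p m + p (m + k)%N <= u (m + k)%N <= u m.
  elim: k => [|k /andP[h1 h2]]; first by rewrite addn0; apply/andP; split; lra.
  by rewrite addnS; have /andP[? ?] := uS (m + k)%N; apply/andP; split; lra.
have [l hl _] : exists2 l, tends (fun m => - u m) l & forall m, - u m <= l.
  apply: (@nondecreasing_tends _ _ (p 0%N - u 0%N)) => m; first by have /andP[? ?] := uS m; lra.
  by have /andP[h1 h2] := low 0%N m; rewrite add0n in h1; have := p0 m; lra.
exists (- l); first by apply: (eq_tends (tendsN hl)) => m; rewrite opprK.
move=> n; rewrite opprK.
have h : tends (fun m => u n - u (n + m)%N) (u n + l).
  have := (tends_shift _ _ n).2 hl => /(tendsD (tends_cst (u n))) h.
  by apply: (eq_tends h) => m; rewrite addnC.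
apply: (tends_norm_le h); exists 0%N => m _.
have /andP[h1 h2] := low n m; have := p0 (n + m)%N.
by move=> ?; rewrite ger0_norm; lra.
Qed.

Lemma harm_gamma n : `|harm n.+1 - ln n.+1%:R - euler_gamma R| <= n.+1%:R^-1.
Proof.
have [|m|l hl bl] := @squeeze_tends (fun n => harm n.+1 - ln n.+1%:R) (fun n => n.+1%:R^-1).
- by move=> m; rewrite invr_ge0.
- have := ln_diff_bounds m; rewrite (harmS m.+1).
  move: (harm m.+1) (ln _) (ln _) (m.+1%:R^-1) (m.+2%:R^-1) => h a b c d /andP[? ?].
  by apply/andP; split; lra.
suff -> : euler_gamma R = l by exact: bl.
apply: tends_limn; apply/(tends_shift _ _ 1); apply: (eq_tends hl) => m.
by rewrite addn1 big_add1 big_mkord.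
Qed.

(** At t = -ln(1 - v) the remainder is [logrem N t], already bounded for Hasse's series. *)
Lemma sums_log v : 0 <= v < 1 -> sums (fun n => v ^+ n.+1 / n.+1%:R) (- ln (1 - v)).
Proof.
move=> hv; case/andP: (hv) => v0 v1; have w0 : 0 < 1 - v by rewrite subr_gt0.
set t := - ln (1 - v); have t0 : 0 <= t by rewrite oppr_ge0 -ln1 ler_ln ?posrE //; lra.
have tE : 1 - expR (- t) = v by rewrite opprK lnK ?posrE //; ring.
apply: (null_le0 (nullZ t (null_expn hv))) => N.
have := logrem_ge0 N t0; have := logrem_le N t0; rewrite /logrem tE => h1 h2.
by rewrite ler0_norm; lra.
Qed.

Lemma harm_le n : 0 <= harm n <= n%:R.
Proof.
elim: n => [|n /andP[h1 h2]]; first by rewrite /harm big_ord0 lexx.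
have h3 : 0 < n.+1%:R^-1 :> R by rewrite invr_gt0 ltr0n.
have h4 : n.+1%:R^-1 <= 1 :> R by rewrite invf_le1 ?ltr0n // ler1n.
move: h3 h4; rewrite harmS; move: (n.+1%:R^-1) => p h3 h4.
by rewrite -(natr1 n); apply/andP; split; lra.
Qed.

Lemma sums_harm v : 0 <= v < 1 -> sums (fun n => harm n.+1 * v ^+ n.+1) (- ln (1 - v) / (1 - v)).
Proof.
move=> hv; case/andP: (hv) => v0 v1; have w0 : 0 < 1 - v by rewrite subr_gt0.
have E N : (1 - v) * \sum_(n < N) harm n.+1 * v ^+ n.+1 =
   \sum_(n < N) v ^+ n.+1 / n.+1%:R - harm N * v ^+ N.+1.
  elim: N => [|N IH]; first by rewrite !big_ord0 /harm big_ord0; ring.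
  by rewrite !big_ord_recr mulrDr IH /= harmS !exprS; ring.
have nz : null (fun N => harm N * v ^+ N.+1).
  apply: (null_le0 (null_lin_expn hv)) => N; have /andP[h1 h2] := harm_le N.
  rewrite ger0_norm ?mulr_ge0 ?exprn_ge0 // exprS.
  apply: ler_pM => //; first by rewrite mulr_ge0 ?exprn_ge0.
    by rewrite -(natr1 N); lra.
  by rewrite ler_piMl ?exprn_ge0 // ltW.
have h := tendsZ (1 - v)^-1 (tends_null (sums_log hv) (v := fun N => (1 - v) * \sum_(n < N) harm n.+1 * v ^+ n.+1) _).
rewrite mulrC; apply: (eq_tends (h _)).
  by apply: (eq_null (nullN nz)) => N; rewrite E; ring.
by move=> N; rewrite mulKf // gt_eqF.
Qed.

Lemma sums_partial (g : nat -> R) (l : R) N : (forall n, 0 <= g n) -> sums g l -> \sum_(n < N) g n <= l.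
Proof.
move=> g0 h; apply: (tends_ge h); exists N => n Nn.
rewrite -(subnK Nn); elim: (n - N)%N => [|k IH]; first by rewrite add0n.
by rewrite addSn big_ord_recr /=; apply: le_trans IH _; rewrite lerDl.
Qed.

(** The logarithm is traded for harmonic numbers because their generating function is closed, -ln(1
    - v)/(1 - v). Euler's constant enters here, and the replacement costs O(1/n), the order of the
    error already present. *)
Lemma alpha_decomp (f : R -> R) (K : R) : (forall y, 0 <= y -> `|f y - osc y| <= K / pow4 y) ->
  forall n, `|alpha n.+1 - (harm n.+1 - euler_gamma R) / ln 4 - f (log4 n.+1%:R)| <= (K + (ln 4)^-1) / n.+1%:R.
Proof.
move=> fK n; have l4 := ln4_gt0 R.
have y0 : 0 <= log4 (n.+1%:R : R) by rewrite divr_ge0 ?(ltW l4) // ln_ge0 // ler1n.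
have := fK _ y0; rewrite pow4_log4 // /osc floor4_log4 // /log4 => h1.
have h2 := harm_gamma n.
set a := alpha _ in h1 *; set l := ln n.+1%:R in h1 h2 *; set g := euler_gamma R in h2 *.
set F := f _ in h1 *.
have -> : a - (harm n.+1 - g) / ln 4 - F = - (F - (a - l / ln 4)) - (harm n.+1 - l - g) / ln 4.
  by field; rewrite gt_eqF.
apply: le_trans (ler_normB _ _) _; rewrite normrN [leRHS]mulrDl; apply: lerD => //.
by rewrite normrM mulrC ler_pM // normfV gtr0_norm.
Qed.
End AbelEstimate.

(** * Behaviour of the weights near 0 *)

Section SmallParameter.
Variable R : realType.
Implicit Types (x q v e : R).

Lemma small_exp q : 0 < q -> [/\ 1 - q <= expR (- q), 1 - expR (- q) <= q &
  q * expR (- q) <= 1 - expR (- q)].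
Proof.
move=> q0; have h1 := expR_ge1Dx (- q); have h2 := expR_ge1Dx q; have e0 := expR_gt0 (- q).
have E : expR q * expR (- q) = 1 by rewrite -expRD subrr expR0.
split; [lra|lra|].
have := ler_wpM2r (ltW e0) h2; rewrite E; lra.
Qed.

Lemma small_sech x : 0 < x <= 1 / 2 -> [/\ 1 - x ^+ 2 <= sech2 x, 1 <= x ^+ 2 / (1 - sech2 x) &
  x ^+ 2 / (1 - sech2 x) <= 1 + 4 * x ^+ 2].
Proof.
case/andP=> x0 x1; have xx := ltW x0.
have q0 : 0 < x ^+ 2 by rewrite exprn_gt0.
have q4 : x ^+ 2 <= 1 / 4 by nra.
have [h1 _ _] := small_exp q0; have h2 := sech2_ge xx; have h3 := th_le xx; have h4 := th_ge xx.
have t0 := th_gt0 x0; have v0 := sech2_gt0 x.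
have vE : 1 - sech2 x = th x ^+ 2 by rewrite /sech2; ring.
have vq : 1 - x ^+ 2 <= sech2 x by lra.
split=> //; rewrite vE.
  by rewrite ler_pdivlMr ?exprn_gt0 // mul1r lerXn2r ?nnegrE // ltW.
rewrite ler_pdivrMr ?exprn_gt0 //.
have h5 : (x * (1 - x ^+ 2)) ^+ 2 <= th x ^+ 2.
  have p : 0 <= x * (1 - x ^+ 2) by rewrite mulr_ge0 //; lra.
  rewrite lerXn2r ?nnegrE // ?(ltW t0) //; apply: le_trans h4.
  by rewrite ler_wpM2l.
have q4' : 0 <= 1 + 4 * x ^+ 2 by lra.
apply: le_trans (ler_wpM2l q4' h5).
move: q0 q4; have -> : (x * (1 - x ^+ 2)) ^+ 2 = x ^+ 2 * (1 - x ^+ 2) ^+ 2 by ring.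
move: (x ^+ 2) => q q0 q4.
have -> : (1 + 4 * q) * (q * (1 - q) ^+ 2) = q + q ^+ 2 * (2 - 7 * q + 4 * q ^+ 2) by ring.
by rewrite lerDl mulr_ge0 ?sqr_ge0 //; nra.
Qed.

Lemma neglog_sech x : 0 < x <= 1 / 2 ->
  - ln (x ^+ 2) <= - ln (1 - sech2 x) <= - ln (x ^+ 2) + 4 * x ^+ 2.
Proof.
move=> hx; have [h1 h2 h3] := small_sech hx; case/andP: hx => x0 x1.
have q0 : 0 < x ^+ 2 by rewrite exprn_gt0.
have w0 : 0 < 1 - sech2 x by rewrite subr_gt0 sech2_lt1.
have l0 : 0 <= ln (x ^+ 2 / (1 - sech2 x)) by rewrite ln_ge0.
have l1 : ln (x ^+ 2 / (1 - sech2 x)) <= 4 * x ^+ 2.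
  apply: le_trans (le_ln1Dx (_ : -1 < 4 * x ^+ 2)); last by lra.
  by rewrite ler_ln ?posrE ?divr_gt0 //; lra.
move: l0 l1; rewrite ln_div ?posrE // => l0 l1; apply/andP; split; lra.
Qed.

Lemma neglog_exp x : 0 < x <= 1 / 2 -> - ln (1 - expR (- x ^+ 2)) <= - ln (x ^+ 2) + x ^+ 2.
Proof.
case/andP=> x0 x1; have q0 : 0 < x ^+ 2 by rewrite exprn_gt0.
have [_ _ h] := small_exp q0; have p0 : 0 < x ^+ 2 * expR (- x ^+ 2) by rewrite mulr_gt0 ?expR_gt0.
have : ln (x ^+ 2 * expR (- x ^+ 2)) <= ln (1 - expR (- x ^+ 2)).
  by rewrite ler_ln ?posrE //; exact: lt_le_trans h.
by rewrite lnM ?posrE ?expR_gt0 // expRK; lra.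
Qed.
End SmallParameter.

Section AbelKernel.
Variable R : realType.
Implicit Types (w x y q : R).

(* Since x^2 \sum_n e^{-n x^2} c(n) is a Riemann sum of \int c(t/x^2) e^{-t} dt, the substitution
   t = e^w convolves f with the density of w -> -e^{-e^w}. *)
Definition smooth (f : R -> R) y w : R := f (y + w / ln 4) * dexp 1 w.

Lemma smooth_ctn (f : R -> R) y : continuous f -> continuous (smooth f y).
Proof.
move=> cf; apply: ctnM; last exact: ctn_dexp.
apply: ctn_comp => //; apply: ctnD; first exact: ctn_cst.
by apply: ctnM; [apply: (@dv_ctn _ _ (fun=> 1)) => x; exact: dv_id|exact: ctn_cst].
Qed.

Lemma smooth_le (f : R -> R) (M : R) y a b : continuous f -> (forall x, `|f x| <= M) -> a <= b ->
  `|intg (smooth f y) a b| <= M * intg (dexp 1) a b.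
Proof.
move=> cf fM ab; rewrite -(intgZ _ _ _ (ctn_dexp (R := R) (c := 1))).
apply: norm_intg => // [||w _]; [exact: smooth_ctn|apply: ctnZ; exact: ctn_dexp|].
by rewrite normrM (ger0_norm (dexp_ge0 _ _)) ler_wpM2r // dexp_ge0.
Qed.

Lemma smooth_window (f : R -> R) (M : R) y J a b : continuous f -> 0 <= M -> (forall x, `|f x| <= M) ->
  a <= - J -> J <= b -> `|intg (smooth f y) a b - intg (smooth f y) (- J) J| <= 4 * M * expR (- J).
Proof.
move=> cf M0 fM aJ Jb.
rewrite -(intg_chasles _ a (- J) b) -(intg_chasles _ (- J) J b).
have -> : intg (smooth f y) a (- J) + (intg (smooth f y) (- J) J + intg (smooth f y) J b) - intg (smooth f y) (- J) J =
  intg (smooth f y) a (- J) + intg (smooth f y) J b by ring.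
have t a' b' : a' <= b' -> (b' <= - J \/ J <= a') -> `|intg (smooth f y) a' b'| <= 2 * M * expR (- J).
  move=> ab hJ; apply: le_trans (smooth_le y cf fM ab) _.
  have h := dexp_tail ltr01 ab hJ; apply: le_trans (ler_wpM2l M0 h) _.
  by rewrite expr1n invr1 le_eqVlt; apply/orP; left; apply/eqP; ring.
apply: le_trans (ler_normD _ _) _; have h1 := t _ _ aJ (or_introl (lexx _)).
have h2 := t _ _ Jb (or_intror (lexx _)).
by apply: le_trans (lerD h1 h2) _; rewrite le_eqVlt; apply/orP; left; apply/eqP; ring.
Qed.

Lemma log4D1 (n : nat) : 0 <= log4 (n.+2%:R : R) - log4 n.+1%:R <= (ln 4)^-1 / n.+1%:R.
Proof.
have l4 := ln4_gt0 R; have /andP[h1 h2] := ln_diff_bounds R n.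
rewrite /log4 -mulrBl; apply/andP; split.
  by rewrite divr_ge0 ?(ltW l4) //; apply: le_trans h1; rewrite invr_ge0.
by rewrite mulrC ler_wpM2l // invr_ge0 ltW.
Qed.

Section Cells.
Variables (f : R -> R) (L q : R).
Hypotheses (fL : forall x y, `|f x - f y| <= L * `|x - y|) (L0 : 0 <= L) (q_gt0 : 0 < q).
Let e := expR (- q).
Let z : R := - ln q / ln 4.
Let a (n : nat) : R := ln n.+1%:R + ln q.

Let a_exp n : expR (a n) = n.+1%:R * q.
Proof. by rewrite /a expRD !lnK ?posrE ?ltr0n. Qed.

Let a_le n : a n <= a n.+1.
Proof. by rewrite /a lerD2r ler_ln ?posrE ?ltr0n // ler_nat. Qed.

Let cf : continuous f. Proof. exact: (ctn_lipschitz fL). Qed.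

Let rho_cell n : intg (dexp 1) (a n) (a n.+1) = (1 - e) * e ^+ n.+1.
Proof.
rewrite intg_dexp // divr1 !mul1r !a_exp -!mulrN !expRM_natl -/e [in X in _ - X]exprS.
by ring.
Qed.

Let arg_log4 w : z + w / ln 4 = (w - ln q) / ln 4.
Proof. by rewrite /z -mulrDl addrC. Qed.

(* The n-th cell is n x^2 <= t <= (n + 1) x^2 in the variable t = e^w. *)
Lemma cell_est n : `|intg (smooth f z) (a n) (a n.+1) - f (log4 n.+1%:R) * ((1 - e) * e ^+ n.+1)|
  <= L * (ln 4)^-1 / n.+1%:R * ((1 - e) * e ^+ n.+1).
Proof.
have cd := ctn_dexp (R := R) (c := 1); have cs := smooth_ctn (y := z) cf.
rewrite -rho_cell -!(intgZ _ _ _ cd) -(intgB _ _ cs); last exact: ctnZ.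
apply: norm_intg => // [||w /andP[w1 w2]]; [by apply: ctnB => //; apply: ctnZ|exact: ctnZ|].
rewrite /smooth -mulrBl normrM (ger0_norm (dexp_ge0 _ _)) ler_wpM2r ?dexp_ge0 //.
apply: le_trans (fL _ _) _; rewrite -mulrA ler_wpM2l // arg_log4.
have l4 := ln4_gt0 R; have /andP[h1 h2] := log4D1 n.
have b1 : log4 n.+1%:R <= (w - ln q) / ln 4.
  by rewrite /log4 ler_pM2r ?invr_gt0 // lerBrDr.
have b2 : (w - ln q) / ln 4 <= log4 n.+2%:R.
  by rewrite /log4 ler_pM2r ?invr_gt0 // lerBlDr.
rewrite ger0_norm ?subr_ge0 //; apply: le_trans h2; exact: lerB.
Qed.

Lemma cells_est N : `|intg (smooth f z) (ln q) (ln N.+1%:R + ln q)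
    - \sum_(n < N) f (log4 n.+1%:R) * ((1 - e) * e ^+ n.+1)| <=
  L * (ln 4)^-1 * (1 - e) * \sum_(n < N) e ^+ n.+1 / n.+1%:R.
Proof.
have -> : intg (smooth f z) (ln q) (ln N.+1%:R + ln q) = \sum_(n < N) intg (smooth f z) (a n) (a n.+1).
  elim: N => [|N IH]; first by rewrite big_ord0 ln1 add0r intg_refl.
  by rewrite big_ord_recr -IH /= intg_chasles.
rewrite -sumrB mulr_sumr; apply: le_trans (ler_norm_sum _ _ _) _.
apply: ler_sum => n _; apply: le_trans (cell_est n) _.
by rewrite le_eqVlt; apply/orP; left; apply/eqP; ring.
Qed.
End Cells.

(** Since e <= v and 1 - e <= q, every difference of weights is nonnegative; the sum of absolute
    values is then a difference of two geometric series. *)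
Lemma sum_diff_est (v e q : R) N : 0 <= v < 1 -> 0 <= e <= v -> 1 - e <= q ->
  \sum_(n < N) `|q * v ^+ n.+1 - (1 - e) * e ^+ n.+1| <= q * v / (1 - v) - e.
Proof.
move=> hv /andP[e0 ev] eq; case/andP: (hv) => v0 v1.
have he : 0 <= e < 1 by rewrite e0 (le_lt_trans ev).
have q0 : 0 <= q by lra.
have pt n : `|q * v ^+ n.+1 - (1 - e) * e ^+ n.+1| = q * v * v ^+ n - (1 - e) * e * e ^+ n.
  rewrite ger0_norm ?exprS; first by ring.
  rewrite subr_ge0; apply: ler_pM; rewrite ?subr_ge0 ?exprn_ge0 //; first lra.
    by rewrite mulr_ge0 ?exprn_ge0.
  by rewrite -!exprS lerXn2r ?nnegrE.
have -> : q * v / (1 - v) - e = q * v * (1 - v)^-1 - (1 - e) * e * (1 - e)^-1.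
  by field; apply/andP; split; rewrite gt_eqF // subr_gt0 //; lra.
have hs := sumsB (sumsZ (q * v) (sums_geometric hv)) (sumsZ ((1 - e) * e) (sums_geometric he)).
exact: sums_partial (fun n => normr_ge0 (q * v ^+ n.+1 - (1 - e) * e ^+ n.+1)) (eq_sums hs (fun n => esym (pt n))).
Qed.
End AbelKernel.

(** * Comparison of the generating function with the smoothed periodic limit *)

Section Abel.
Variable R : realType.
Implicit Types (w x y q J : R).

Lemma sqr_half x : 0 < x <= 1 / 2 -> x ^+ 2 <= 1 / 4.
Proof. by case/andP=> *; nra. Qed.

Lemma quarter_le1 : 1 / 4 <= 1 :> R.
Proof. by lra. Qed.

Lemma abel_main_bound (q L0 Lam rho v g l4 : R) : 0 < l4 -> 0 <= q <= 1 / 4 -> 0 <= L0 ->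
  L0 <= Lam <= L0 + 4 * q -> 1 <= rho <= 1 + 4 * q -> 1 - q <= v <= 1 ->
  `|(rho * Lam - g * (rho * v)) / l4 - (L0 - g) / l4| <= (8 + 4 * `|g|) / l4 * (q * (L0 + 1)).
Proof.
move=> l40 /andP[q0 q1] L00 /andP[h1 h2] /andP[r1 r2] /andP[v1 v2].
rewrite -mulrBl normrM (gtr0_norm (_ : 0 < l4^-1)) ?invr_gt0 // mulrAC ler_pM2r ?invr_gt0 //.
have -> : rho * Lam - g * (rho * v) - (L0 - g) = (rho - 1) * Lam + (Lam - L0) + g * (1 - rho * v) by ring.
have b1 : `|(rho - 1) * Lam| <= 4 * q * (L0 + 1) by rewrite ger0_norm; [apply: ler_pM; lra|apply: mulr_ge0; lra].
have b2 : `|Lam - L0| <= 4 * q by rewrite ger0_norm; lra.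
have b3 : `|g * (1 - rho * v)| <= 4 * `|g| * q.
  have -> : 4 * `|g| * q = `|g| * (4 * q) by ring.
  rewrite normrM ler_wpM2l // ler_norml; apply/andP; split; nra.
apply: le_trans (ler_normD _ _) _; apply: le_trans (lerD (ler_normD _ _) (lexx _)) _.
have g0 := normr_ge0 g; have qL : 0 <= q * L0 by rewrite mulr_ge0.
have gqL : 0 <= `|g| * (q * L0) by rewrite mulr_ge0.
have -> : (8 + 4 * `|g|) * (q * (L0 + 1)) = 8 * (q * L0) + 8 * q + 4 * (`|g| * (q * L0)) + 4 * `|g| * q by ring.
have E : 4 * q * (L0 + 1) = 4 * (q * L0) + 4 * q by ring.
lra.
Qed.

Lemma abel_error_sum (A B C q S1 S2 S3 l1 l2 ell e v : R) : 0 <= A -> 0 <= B -> 0 <= C -> 0 <= q ->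
  S1 <= l1 -> S2 <= l2 -> S3 <= q * v / (1 - v) - e -> l1 <= ell + 4 * q -> l2 <= ell + q ->
  1 - q <= e -> 1 - e <= q -> q / (1 - v) <= 1 + 4 * q -> 0 < 1 - v -> 0 <= v -> q <= 1 / 4 -> 0 <= l2 -> 0 <= ell -> e <= 1 ->
  q * (A * S1) + B * S3 + C * (1 - e) * S2 <= (A + 5 * B + C) * (q * (ell + 1)).
Proof.
move=> A0 B0 C0 q0 s1 s2 s3 b1 b2 e1 e2 r w0 v0 q4 l20 ell0 e3.
have c1 : q * (A * S1) <= q * (A * (ell + 1)) by rewrite ler_wpM2l // ler_wpM2l //; lra.
have c2 : B * S3 <= B * (5 * q * (ell + 1)).
  rewrite ler_wpM2l //; apply: le_trans s3 _.
  have h : q * v / (1 - v) <= q / (1 - v).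
    by rewrite ler_pM2r ?invr_gt0 // ler_piMr //; lra.
  have : 5 * q <= 5 * q * (ell + 1) by rewrite ler_peMr ?mulr_ge0 //; lra.
  lra.
have c3 : C * (1 - e) * S2 <= C * (q * (ell + 1)).
  rewrite -mulrA ler_wpM2l //; have : (1 - e) * S2 <= (1 - e) * (ell + 1) by rewrite ler_wpM2l //; lra.
  by move=> h; apply: le_trans h _; rewrite ler_wpM2r //; lra.
have -> : (A + 5 * B + C) * (q * (ell + 1)) = q * (A * (ell + 1)) + B * (5 * q * (ell + 1)) + C * (q * (ell + 1)) by ring.
lra.
Qed.

Variables (f : R -> R) (K L M : R).
Hypotheses (fK : forall y, 0 <= y -> `|f y - osc y| <= K / pow4 y)
  (fL : forall x y, `|f x - f y| <= L * `|x - y|) (fM : forall x, `|f x| <= M).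
Hypotheses (K0 : 0 <= K) (L0 : 0 <= L) (M0 : 0 <= M).

(** Three errors arise: the residue of [alpha_decomp], the exchange of the weights q v^n for the
    exact cell masses (1 - e) e^n, and the oscillation of f within a cell. The residue and the
    oscillation meet \sum v^n/n or \sum e^n/n, hence the factor -ln q + 1. Finite N lets the bound
    pass to the limit. *)
Lemma abel_finite x N : 0 < x <= 1 / 2 ->
  `|x ^+ 2 * (\sum_(n < N) alpha R n.+1 * sech2 x ^+ n.+1)
    - x ^+ 2 / ln 4 * (\sum_(n < N) (harm R n.+1 - euler_gamma R) * sech2 x ^+ n.+1)
    - intg (smooth f (- ln (x ^+ 2) / ln 4)) (ln (x ^+ 2)) (ln N.+1%:R + ln (x ^+ 2))|
  <= (K + (ln 4)^-1 + 5 * M + L * (ln 4)^-1) * (x ^+ 2 * (- ln (x ^+ 2) + 1)).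
Proof.
move=> hx; have [v1 _ r2] := small_sech hx; have /andP[_ lv] := neglog_sech hx; have le1 := neglog_exp hx.
case/andP: (hx) => x0 x1; have q0 : 0 < x ^+ 2 by rewrite exprn_gt0.
have q4 := sqr_half hx.
have [e1 e2 e3] := small_exp q0; have ev := sech2_ge (ltW x0).
have hv : 0 <= sech2 x < 1 by rewrite (ltW (sech2_gt0 x)) sech2_lt1.
have [vpos _] := andP hv.
set v := sech2 x in v1 r2 lv ev hv vpos *.
set q := x ^+ 2 in v1 r2 lv le1 q0 q4 e1 e2 e3 ev *.
have l4 := ln4_gt0 R; have li : 0 <= (ln 4)^-1 :> R by rewrite invr_ge0 ltW.
have epos : 0 <= expR (- q) by exact: expR_ge0.
have he : 0 <= expR (- q) < 1 by rewrite epos -[ltRHS]expR0 ltr_expR oppr_lt0.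
have s1 : \sum_(n < N) v ^+ n.+1 / n.+1%:R <= - ln (1 - v).
  by apply: sums_partial (sums_log hv) => n; rewrite divr_ge0 ?exprn_ge0.
have s2 : \sum_(n < N) expR (- q) ^+ n.+1 / n.+1%:R <= - ln (1 - expR (- q)).
  by apply: sums_partial (sums_log he) => n; rewrite divr_ge0 ?exprn_ge0.
have hev : 0 <= expR (- q) <= v by rewrite epos.
have s3 := sum_diff_est N hv hev e2.
have s4 := cells_est fL L0 q0 N.
set G := intg _ _ _ in s4 *.
set S1 := \sum_(n < N) v ^+ n.+1 / _ in s1; set S2 := \sum_(n < N) expR _ ^+ _ / _ in s2 s4.
set S3 := \sum_(n < N) `|_| in s3; set S4 := \sum_(n < N) f _ * _ in s4.
pose r n := alpha R n.+1 - (harm R n.+1 - euler_gamma R) / ln 4 - f (log4 n.+1%:R).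
have -> : q * (\sum_(n < N) alpha R n.+1 * v ^+ n.+1)
    - q / ln 4 * (\sum_(n < N) (harm R n.+1 - euler_gamma R) * v ^+ n.+1) =
   q * (\sum_(n < N) r n * v ^+ n.+1) +
   \sum_(n < N) f (log4 n.+1%:R) * (q * v ^+ n.+1 - (1 - expR (- q)) * expR (- q) ^+ n.+1) + S4.
  rewrite /S4 !mulr_sumr -sumrB -!big_split /=.
  by apply: eq_bigr => n _; rewrite /r; field; rewrite gt_eqF.
rewrite -addrA -[S4 - G]opprB.
have b1 : `|q * (\sum_(n < N) r n * v ^+ n.+1)| <= q * ((K + (ln 4)^-1) * S1).
  rewrite normrM (gtr0_norm q0) ler_wpM2l ?(ltW q0) // /S1 mulr_sumr.
  apply: le_trans (ler_norm_sum _ _ _) _; apply: ler_sum => n _.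
  rewrite normrM (ger0_norm (exprn_ge0 n.+1 vpos)) [v ^+ _ / _]mulrC mulrA ler_wpM2r ?exprn_ge0 //.
  exact: alpha_decomp.
have b2 : `|\sum_(n < N) f (log4 n.+1%:R) * (q * v ^+ n.+1 - (1 - expR (- q)) * expR (- q) ^+ n.+1)| <= M * S3.
  rewrite /S3 mulr_sumr; apply: le_trans (ler_norm_sum _ _ _) _; apply: ler_sum => n _.
  by rewrite normrM ler_wpM2r.
apply: le_trans (ler_normB _ _) _; apply: le_trans (lerD (ler_normD _ _) s4) _.
apply: le_trans (lerD (lerD b1 b2) (lexx _)) _.
have w0 : 0 < 1 - v by rewrite subr_gt0; case/andP: hv.
have S20 : 0 <= - ln (1 - expR (- q)) by rewrite oppr_ge0; apply: ln_le0; rewrite gerBl.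
have ell0 : 0 <= - ln q by rewrite oppr_ge0; apply: ln_le0; exact: le_trans q4 quarter_le1.
have ee : expR (- q) <= 1 by case/andP: he => _ /ltW.
exact: abel_error_sum (addr_ge0 K0 li) M0 (mulr_ge0 L0 li) (ltW q0) s1 s2 s3 lv le1 e1 e2 r2 w0 vpos q4 S20 ell0 ee.
Qed.
End Abel.

Section AbelLimit.
Variable R : realType.
Implicit Types (w x y q : R).

Lemma ln4E : ln (4 : R) = 2 * ln 2.
Proof.
by have -> : (4 : R) = 2 * 2 by [ring]; rewrite lnM ?posrE //; ring.
Qed.

Lemma ln4_ge1 : 1 <= ln (4 : R).
Proof.
rewrite ln4E; have : ln (1 / 2 : R) <= - (1 / 2).
  have -> : (1 / 2 : R) = 1 + - (1 / 2) by field.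
  apply: le_trans (le_ln1Dx _) _; lra.
by rewrite div1r lnV ?posrE //; lra.
Qed.

Lemma norm_triangle3 (D G H a b : R) : `|D - G| <= a -> `|G - H| <= b -> `|D - H| <= a + b.
Proof. by move=> h1 h2; rewrite -(subrKA G); apply: le_trans (ler_normD _ _) (lerD h1 h2). Qed.

Lemma norm_triangle4 (D A A' H a b c : R) : `|D - A - H| <= a + c -> `|A - A'| <= b ->
  `|D - A' - H| <= a + b + c.
Proof.
move=> h1 h2; have -> : D - A' - H = (D - A - H) + (A - A') by ring.
by apply: le_trans (ler_normD _ _) _; rewrite [leRHS]addrAC; apply: lerD.
Qed.

Lemma norm_triangle5 (P D y g I a b c d e : R) : `|P + D - (y - g) - I| <= a + c -> `|D| <= d -> d <= e ->
  a <= b -> `|P - y + g - I| <= b + c + e.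
Proof.
move=> h1 h2 h3 h4; have -> : P - y + g - I = (P + D - (y - g) - I) - D by ring.
apply: le_trans (ler_normB _ _) _; lra.
Qed.

Lemma pow2_exp (k : nat) : expR (ln 2 * k%:R) = 2 ^+ k :> R.
Proof. by rewrite mulrC expRM_natl lnK ?posrE. Qed.

Lemma half_exp (k : nat) : expR (- (ln 2 * k%:R)) = (1 / 2) ^+ k :> R.
Proof. by rewrite expRN pow2_exp div1r exprVn. Qed.

Lemma tail_rate (C y : R) J : 0 <= C -> y <= 1 -> C / expR (ln 2 * (J%:R - y)) <= 2 * C * (1 / 2) ^+ J.
Proof.
move=> C0 y1; have l2 := ln2_gt0 R.
have e2 : expR (ln 2) = 2 :> R by rewrite lnK ?posrE.
have -> : 2 * C * (1 / 2) ^+ J = C * (expR (ln 2) * expR (- (ln 2 * J%:R))) by rewrite e2 half_exp; ring.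
rewrite -expRN -expRD ler_wpM2l // ler_expR.
have : ln 2 * y <= ln 2 * 1 by rewrite ler_wpM2l // ltW.
by rewrite mulrBr mulr1 => h; lra.
Qed.

Lemma prod_rate (B q s c n p : R) : 0 <= B -> 0 <= q -> 0 <= s -> q <= p -> s <= c * n ->
  B * (q * s) <= B * c * (n * p).
Proof.
move=> B0 q0 s0 qp sn; have -> : B * c * (n * p) = B * (p * (c * n)) by ring.
by rewrite ler_wpM2l // ler_pM.
Qed.

Lemma shift_ge0 J y : 0 <= y -> 0 <= ln 4 * (y + J%:R) + 1.
Proof. by move=> y0; rewrite addr_ge0 // mulr_ge0 ?(ltW (ln4_gt0 R)) // addr_ge0. Qed.

Lemma shift_rate J y : y <= 1 -> ln 4 * (y + J%:R) + 1 <= (ln 4 + 1) * J.+1%:R.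
Proof.
move=> y1; rewrite -(natr1 J); have l4 := ln4_gt0 R; have j0 : 0 <= J%:R :> R by [].
have h : ln 4 * y <= ln 4 * 1 by rewrite ler_wpM2l // ltW.
move: (ln 4) (J%:R) h j0 => a j h j0; lra.
Qed.

Lemma sqr_rate J y : 0 <= y -> expR (- (ln 2 * (y + J%:R))) ^+ 2 <= (1 / 4) ^+ J.
Proof.
move=> y0; have -> : (1 / 4) ^+ J = (1 / 2) ^+ J * (1 / 2) ^+ J :> R by rewrite -exprMn; congr (_ ^+ _); field.
rewrite -half_exp -expRD -expRM_natl ler_expR.
have h : 0 <= ln 2 * y by rewrite mulr_ge0 // ltW // ln2_gt0.
by move: h; rewrite mulrDr; move: (ln 2 * y) (ln 2 * _) => a b h; lra.
Qed.

Variables (f : R -> R) (K L M : R).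
Hypotheses (f1 : forall x, f (x + 1) = f x).
Hypotheses (fK : forall y, 0 <= y -> `|f y - osc y| <= K / pow4 y)
  (fL : forall x y, `|f x - f y| <= L * `|x - y|) (fM : forall x, `|f x| <= M).
Hypotheses (K0 : 0 <= K) (L0 : 0 <= L) (M0 : 0 <= M).

(** Let N tend to infinity in [abel_finite]: the harmonic part takes the closed form [sums_harm],
    and restriction to the window [[-J, J]] costs the tails of the density. *)
Lemma abel_est : exists2 B : R, 0 <= B & forall x J, 0 < x <= 1 / 2 -> J <= - ln (x ^+ 2) ->
  `|dser x - (- ln (x ^+ 2) - euler_gamma R) / ln 4 - intg (smooth f (- ln (x ^+ 2) / ln 4)) (- J) J|
  <= B * (x ^+ 2 * (- ln (x ^+ 2) + 1)) + 4 * M * expR (- J).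
Proof.
have l4 := ln4_gt0 R; have [C _ HC] := aserP R.
pose B1 : R := K + (ln 4)^-1 + 5 * M + L * (ln 4)^-1.
pose B2 : R := (8 + 4 * `|euler_gamma R|) / ln 4.
have li : 0 <= (ln 4)^-1 :> R by rewrite invr_ge0 ltW.
exists (B1 + B2).
  apply: addr_ge0; last by apply: mulr_ge0 li; apply: addr_ge0; [exact: ler0n|exact: mulr_ge0 (ler0n _ _) (normr_ge0 _)].
  apply: addr_ge0; last exact: mulr_ge0.
  by apply: addr_ge0; [exact: addr_ge0|exact: mulr_ge0 (ler0n _ _) M0].
move=> x J hx hJ; have cf : continuous f := ctn_lipschitz fL.
have [v1 r1 r2] := small_sech hx; have hl := neglog_sech hx.
have q4 := sqr_half hx; case/andP: (hx) => x0 x1.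
have q0 : 0 < x ^+ 2 by rewrite exprn_gt0.
have hv : 0 <= sech2 x < 1 by rewrite (ltW (sech2_gt0 x)) sech2_lt1.
have hv1 : 1 - x ^+ 2 <= sech2 x <= 1 by rewrite v1 /= ltW //; case/andP: hv.
have [ha _] := HC _ hv.
have hh := sumsB (sums_harm hv) (sumsZ (euler_gamma R * sech2 x) (sums_geometric hv)).
pose A : R := x ^+ 2 / ln 4 * (- ln (1 - sech2 x) / (1 - sech2 x) - euler_gamma R * sech2 x * (1 - sech2 x)^-1).
have w0 : 0 < 1 - sech2 x by rewrite subr_gt0; case/andP: hv.
have hD : tends (fun N => x ^+ 2 * (\sum_(n < N) alpha R n.+1 * sech2 x ^+ n.+1)
    - x ^+ 2 / ln 4 * (\sum_(n < N) (harm R n.+1 - euler_gamma R) * sech2 x ^+ n.+1)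
    - intg (smooth f (- ln (x ^+ 2) / ln 4)) (- J) J)
   (dser x - A - intg (smooth f (- ln (x ^+ 2) / ln 4)) (- J) J).
  apply: tendsB (tends_cst _); apply: tendsB; first exact: tendsZ ha.
  apply: tendsZ; apply: (eq_tends hh) => N; apply: eq_bigr => n _; rewrite exprS; ring.
have ell0 : 0 <= - ln (x ^+ 2) by rewrite oppr_ge0; apply: ln_le0; exact: le_trans q4 (quarter_le1 R).
have hfin : `|dser x - A - intg (smooth f (- ln (x ^+ 2) / ln 4)) (- J) J| <=
   B1 * (x ^+ 2 * (- ln (x ^+ 2) + 1)) + 4 * M * expR (- J).
  apply: (tends_norm_le hD).
  exists (Num.truncn (expR (J - ln (x ^+ 2)))) => N hN.
  have bN : J <= ln N.+1%:R + ln (x ^+ 2).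
    rewrite -lerBlDr -ler_expR lnK ?posrE ?ltr0n // ltW //.
    by apply: lt_le_trans (truncnS_gt _) _; rewrite ler_nat ltnS.
  have aJ : ln (x ^+ 2) <= - J by rewrite lerNr.
  have hw := smooth_window (- ln (x ^+ 2) / ln 4) cf M0 fM aJ bN.
  have hf := abel_finite fK fL fM K0 L0 M0 N hx.
  exact: norm_triangle3 hf hw.
have hmain := abel_main_bound (euler_gamma R) l4 (introT andP (conj (ltW q0) q4)) ell0 hl (introT andP (conj r1 r2)) hv1.
have AE : A = (x ^+ 2 / (1 - sech2 x) * - ln (1 - sech2 x) -
  euler_gamma R * (x ^+ 2 / (1 - sech2 x) * sech2 x)) / ln 4.
  by rewrite /A; field; rewrite !gt_eqF.
rewrite -AE in hmain; rewrite [(B1 + B2) * _]mulrDl.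
exact: norm_triangle4 hfin hmain.
Qed.

(** Take x = 2^-(y + J), so that -ln(x^2)/ln 4 = y + J and periodicity removes J from f. The
    dilation equation, iterated 2J times, carries x to 2^(J - y) >= 1, where [dser_decay] makes the
    last term O(2^-J). Uniformity in y permits integration over a period. *)
Lemma abel_uniform : exists2 err : nat -> R, null err & forall J y, (0 < J)%N -> 0 <= y <= 1 ->
  `|\sum_(r < J + J) profile (ln 2 * (r.+1%:R - y - J%:R)) - (y + J%:R) + euler_gamma R / ln 4
    - intg (smooth f y) (- J%:R) J%:R| <= err J.
Proof.
have [B B0 HB] := abel_est; have [C C0 HC] := dser_decay R.
have l4 := ln4_gt0 R; have l41 := ln4_ge1.
pose err J : R := B * (ln 4 + 1) * (J.+1%:R * (1 / 4) ^+ J) + 4 * M * (expR (-1)) ^+ J + 2 * C * (1 / 2) ^+ J.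
have h4 : 0 <= (1 / 4 : R) < 1 by apply/andP; split; lra.
have h2 : 0 <= (1 / 2 : R) < 1 by apply/andP; split; lra.
have he : 0 <= expR (-1 : R) < 1 by rewrite expR_ge0 -[ltRHS]expR0 ltr_expR; lra.
exists err.
  apply: nullD; [apply: nullD|]; apply: nullZ; [exact: null_lin_expn|exact: null_expn|exact: null_expn].
move=> J y J0 /andP[y0 y1].
have J1 : 1 <= J%:R :> R by rewrite ler1n.
pose x := expR (- (ln 2 * (y + J%:R))).
have lx : ln (x ^+ 2) = - (ln 4 * (y + J%:R)).
  rewrite /x -expRM_natl expRK ln4E; ring.
have E1 : - ln (x ^+ 2) = ln 4 * (y + J%:R) by rewrite lx opprK.
have E2 : - ln (x ^+ 2) / ln 4 = y + J%:R by rewrite E1; field; rewrite gt_eqF.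
have p2 := pow2_exp; have pm2 := half_exp.
have l2 : 0 < ln (2 : R) by exact: ln2_gt0.
have hx : 0 < x <= 1 / 2.
  rewrite expR_gt0 /=; have -> : 1 / 2 = expR (- (ln 2 * 1%:R)) :> R by rewrite pm2 expr1.
  by rewrite ler_expR lerN2 ler_pM2l //; lra.
have hJ : J%:R <= - ln (x ^+ 2).
  rewrite E1; apply: le_trans (_ : 1 * (y + J%:R) <= _); first by rewrite mul1r lerDr.
  by rewrite ler_wpM2r // addr_ge0.
have := HB _ _ hx hJ; rewrite E2 E1.
have -> : (ln 4 * (y + J%:R) - euler_gamma R) / ln 4 = y + J%:R - euler_gamma R / ln 4.
  by field; rewrite gt_eqF.
have -> : intg (smooth f (y + J%:R)) (- J%:R) J%:R = intg (smooth f y) (- J%:R) J%:R.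
  by apply: eq_intg => w; rewrite /smooth addrAC periodD.
have x0 : 0 < x by case/andP: hx.
rewrite (dser_iter (J + J) x0).
have big : \sum_(r < J + J) profile (ln (2 ^+ r.+1 * x)) = \sum_(r < J + J) profile (ln 2 * (r.+1%:R - y - J%:R)).
  by apply: eq_bigr => r _; congr profile; rewrite -p2 -expRD expRK; ring.
rewrite big; have xe : 2 ^+ (J + J) * x = expR (ln 2 * (J%:R - y)).
  by rewrite -p2 -expRD natrD; congr expR; ring.
have x2 : 1 <= 2 ^+ (J + J) * x.
  have h : 0 <= J%:R - y by lra.
  rewrite xe -[leLHS]expR0 ler_expR; exact: mulr_ge0 (ltW l2) h.
have hd := HC _ x2.
have hd2 : C / (2 ^+ (J + J) * x) <= 2 * C * (1 / 2) ^+ J by rewrite xe; exact: tail_rate.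
have hb := prod_rate (c := ln 4 + 1) (n := J.+1%:R) B0 (sqr_ge0 x) (shift_ge0 J y0) (sqr_rate J y0) (shift_rate J y1).
have hE : expR (- J%:R) = expR (-1) ^+ J :> R by rewrite -expRM_natl mulrN1.
rewrite hE => h; exact: norm_triangle5 h hd hd2 hb.
Qed.
End AbelLimit.

(** * Fourier coefficients *)

Section FourierCoefficient.
Variable R : realType.
Implicit Types (c z : R[i]) (w x y s : R).
Local Open Scope complex_scope.
Local Notation Re := (@complex.Re R).
Local Notation Im := (@complex.Im R).

(** Over N + 1 equal pieces the quadratic increments add up to O(1/N). *)
Lemma quad_const (g : R -> R[i]) (C a b : R) : a <= b ->
  (forall x y, a <= x -> x <= y -> y <= b -> n1 (g y - g x) <= C * (y - x) ^+ 2) -> g b = g a.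
Proof.
move=> ab H; apply/eqP; rewrite -subr_eq0; apply/eqP; apply: n1_eq0.
apply: (null_uniq (nullZ (C * (b - a) ^+ 2) (@null_inv R))) => N.
rewrite (ger0_norm (n1_ge0 _)).
have N0 : 0 < N.+1%:R :> R by rewrite ltr0n.
pose h := (b - a) / N.+1%:R; have h0 : 0 <= h by rewrite divr_ge0 ?subr_ge0 ?(ltW N0).
have xb (k : nat) : (k <= N.+1)%N -> a + h * k%:R <= b.
  move=> kN; have -> : b = a + h * N.+1%:R by rewrite /h divfK ?gt_eqF //; ring.
  by rewrite lerD2l ler_wpM2l // ler_nat.
have step k : (k <= N.+1)%N -> n1 (g (a + h * k%:R) - g a) <= k%:R * (C * h ^+ 2).
  elim: k => [|k IH] kN; first by rewrite mulr0 addr0 subrr n1_0 mul0r.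
  have -> : g (a + h * k.+1%:R) - g a = (g (a + h * k.+1%:R) - g (a + h * k%:R)) + (g (a + h * k%:R) - g a).
    by rewrite subrKA.
  have ak : a <= a + h * k%:R by rewrite lerDl mulr_ge0.
  have kk : a + h * k%:R <= a + h * k.+1%:R by rewrite lerD2l ler_wpM2l // ler_nat.
  apply: le_trans (n1D _ _) _; rewrite -[k.+1%:R in leRHS](natr1 k) mulrDl mul1r addrC.
  apply: lerD; first exact: IH (ltnW kN).
  have := H _ _ ak kk (xb _ kN).
  have -> : a + h * k.+1%:R - (a + h * k%:R) = h by rewrite -(natr1 k); ring.
  by [].
have := step N.+1 (leqnn _).
have -> : a + h * N.+1%:R = b by rewrite /h divfK ?gt_eqF //; ring.
have -> : N.+1%:R * (C * h ^+ 2) = C * (b - a) ^+ 2 * N.+1%:R^-1 by rewrite /h; field; rewrite gt_eqF.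
by [].
Qed.

Lemma cexp_lipschitz z x y : Re z = 0 -> n1 (cexp (z * x%:C) - cexp (z * y%:C)) <= 4 * n1 z * `|x - y|.
Proof.
move=> hz.
wlog yx : x y / y <= x => [H|].
  have [/H//|xy] := leP y x; rewrite n1_dist distrC; apply: H; exact: ltW.
have b w : n1 (z * cexp (z * w%:C)) <= 2 * n1 z.
  apply: le_trans (n1M _ _) _; rewrite mulrC ler_wpM2r ?n1_ge0 //.
  by apply: le_trans (n1_cexp _) _; rewrite ReM /= hz mul0r mulr0 subr0 expR0 mulr1.
have bR w : `|Re (z * cexp (z * w%:C))| <= 2 * n1 z by apply: le_trans (b w); rewrite lerDl.
have bI w : `|Im (z * cexp (z * w%:C))| <= 2 * n1 z by apply: le_trans (b w); rewrite lerDr.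
have [u _ hu] := MVT_dv yx (fun w _ => proj1 (cdv_cexp z w)).
have [v _ hv] := MVT_dv yx (fun w _ => proj2 (cdv_cexp z w)).
rewrite /n1 ReD ReN ImD ImN hu hv !normrM.
have -> : 4 * (`|Re z| + `|Im z|) * `|x - y| = 2 * n1 z * `|x - y| + 2 * n1 z * `|x - y| by rewrite /n1; ring.
by apply: lerD; apply: ler_wpM2r.
Qed.

Lemma periodic_cintg (P : R -> R[i]) s : ccn P -> (forall y, P (y + 1) = P y) ->
  cintg (fun y => P (y + s)) 0 1 = cintg P 0 1.
Proof.
move=> cP P1; rewrite cintg_shift // add0r.
have h : cintg P 0 s = cintg P 1 (1 + s).
  by rewrite -{1}(eq_cintg 0 s P1) cintg_shift // add0r [s + 1]addrC.
rewrite -(cintg_chasles P s 0 (1 + s)) -(cintg_chasles P 0 1 (1 + s)) -h.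
have := cintg_chasles P s 0 s; rewrite cintg_refl => e.
by rewrite addrCA e addr0.
Qed.

Lemma cexp_per1 c (m : nat) : cexp c = 1 -> cexp (c * m%:R) = 1.
Proof.
move=> h; elim: m => [|m IH]; first by rewrite mulr0 cexp0.
by rewrite -(natr1 m) mulrDr mulr1 cexpD IH h mulr1.
Qed.

Lemma cexpN1 c : cexp c = 1 -> cexp (- c) = 1.
Proof. by move=> h; have := cexpN c; rewrite h mul1r. Qed.

Definition wave c y : R[i] := cexp (- c * y%:C).
Definition coeff (f : R -> R) c : R[i] := cintg (fun y => (f y)%:C * wave c y) 0 1.

Lemma wave_ccn c : ccn (wave c).
Proof. exact: ccn_cexp. Qed.

Lemma waveD c y s : wave c (y + s) = wave c y * wave c s.
Proof. by rewrite /wave realCD mulrDr cexpD. Qed.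

Lemma n1_wave c y : Re c = 0 -> n1 (wave c y) <= 2.
Proof.
by move=> h; apply: le_trans (n1_cexp _) _; rewrite ReM ReN h /= oppr0 mul0r mulr0 subr0 expR0 mulr1.
Qed.

Lemma coeff_shift (f : R -> R) c s : continuous f -> (forall y, f (y + 1) = f y) -> cexp c = 1 ->
  cintg (fun y => (f (y + s))%:C * wave c y) 0 1 = cexp (c * s%:C) * coeff f c.
Proof.
move=> cf f1 hc; have cP : ccn (fun y => (f y)%:C * wave c y).
  by apply: ccnM; [exact: ccn_real|exact: wave_ccn].
have w1 : wave c 1 = 1 by rewrite /wave mulr1; exact: cexpN1.
rewrite /coeff -(periodic_cintg s cP); last by move=> y; rewrite f1 waveD w1 mulr1.
rewrite -cintgZ.
  apply: eq_cintg => y; rewrite waveD [wave c s]/wave mulNr.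
  by have := cexpN (c * s%:C); move: (cexp _) (cexp _) => a b ab; rewrite -[LHS]mul1r -ab; ring.
apply: (ccn_comp cP); apply: (@dv_ctn _ _ (fun=> 1 + 0)) => x; apply: dvD; [exact: dv_id|exact: dv_cst].
Qed.

Lemma dexp1_le1 x : dexp 1 x <= 1 :> R.
Proof.
rewrite /dexp mul1r expRN ler_pdivrMr ?expR_gt0 // mul1r.
by apply: le_trans (expR_ge1Dx _); rewrite lerDr.
Qed.

Section Smooth.
Variables (f : R -> R) (L M : R) (c : R[i]).
Hypotheses (f1 : forall x, f (x + 1) = f x) (fL : forall x y, `|f x - f y| <= L * `|x - y|) (L0 : 0 <= L).
Hypotheses (c_im : Re c = 0) (c_per : cexp c = 1).

Let cf : continuous f. Proof. exact: ctn_lipschitz fL. Qed.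
Let cs y : continuous (smooth f y). Proof. exact: smooth_ctn. Qed.

Lemma smooth_intg_lip a b y y' : a <= b ->
  `|intg (smooth f y) a b - intg (smooth f y') a b| <= L * `|y - y'|.
Proof.
move=> ab; rewrite -(intgB _ _ (@cs y) (@cs y')).
have h : `|intg (fun x => smooth f y x - smooth f y' x) a b| <= intg (fun x => L * `|y - y'| * dexp 1 x) a b.
  apply: norm_intg => // [||w _]; [exact: ctnB|by apply: ctnZ; exact: ctn_dexp|].
  rewrite /smooth -mulrBl normrM (ger0_norm (dexp_ge0 _ _)) ler_wpM2r ?dexp_ge0 //.
  by apply: le_trans (fL _ _) _; rewrite opprD addrACA subrr addr0.
apply: le_trans h _; rewrite (intgZ _ _ _ (ctn_dexp (c := 1))).
rewrite -[leRHS]mulr1; apply: ler_wpM2l; first by rewrite mulr_ge0.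
by have := @intg_dexp_le R 1 a b ltr01; rewrite invr1.
Qed.

Let z := c * ((ln 4)^-1)%:C.

Let z_im : Re z = 0.
Proof. by rewrite /z ReM c_im /=; ring. Qed.

Let ker w := (dexp 1 w)%:C * cexp (z * w%:C).

Let ker_ccn : ccn ker.
Proof. by apply: ccnM; [apply: ccn_real; exact: ctn_dexp|exact: ccn_cexp]. Qed.

Let inner a W y := (intg (smooth f y) a W)%:C * wave c y.

Let inner_ccn a W : a <= W -> ccn (inner a W).
Proof.
move=> aW; apply: ccnM; last exact: wave_ccn.
by apply: ccn_real; apply: (ctn_lipschitz (L := L)) => x y; exact: smooth_intg_lip.
Qed.

(** On a short interval the shift w/ln 4 is frozen at its left end W. Translating f multiplies its
    coefficient by e^(c W/ln 4), the phase of [ker] at W. The freezing error is Lipschitz in W' - W,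
    hence quadratic after integration over the interval. *)
Let inner_step W W' : W <= W' ->
  n1 (cintg (inner W W') 0 1 - coeff f c * cintg ker W W') <=
  (2 * L * (ln 4)^-1 + n1 (coeff f c) * (4 * n1 z)) * (W' - W) ^+ 2.
Proof.
move=> WW; have h0 : 0 <= W' - W by rewrite subr_ge0.
have cd := ctn_dexp (R := R) (c := 1).
have l4 := ln4_gt0 R; have li : 0 <= (ln 4)^-1 :> R by rewrite invr_ge0 ltW.
set I := intg (dexp 1) W W'.
have I1 : I <= W' - W.
  by rewrite -[leRHS]mul1r -intg_cst; apply: le_intg => // [|w _]; [exact: ctn_cst|exact: dexp1_le1].
have I0 : 0 <= I by apply: intg_ge0 => // w _; exact: dexp_ge0.
pose mid y := (I * f (y + W / ln 4))%:C * wave c y.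
have cm : ccn mid.
  apply: ccnM; last exact: wave_ccn; apply: ccn_real; apply: ctnZ; apply: ctn_comp => //.
  by apply: (@dv_ctn _ _ (fun=> 1 + 0)) => x; apply: dvD; [exact: dv_id|exact: dv_cst].
have midE : cintg mid 0 1 = I%:C * (cexp (z * W%:C) * coeff f c).
  have -> : z * W%:C = c * (W / ln 4)%:C by rewrite /z -mulrA -realCM mulrC [_ * W]mulrC mulrC.
  rewrite -(coeff_shift _ cf f1 c_per) -cintgZ.
    by apply: eq_cintg => y; rewrite /mid realCM mulrA.
  apply: ccnM; last exact: wave_ccn; apply: ccn_real; apply: ctn_comp => //.
  by apply: (@dv_ctn _ _ (fun=> 1 + 0)) => x; apply: dvD; [exact: dv_id|exact: dv_cst].
have b1 : n1 (cintg (inner W W') 0 1 - cintg mid 0 1) <= 2 * L * (ln 4)^-1 * (W' - W) ^+ 2.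
  have ci := inner_ccn WW; rewrite -(cintgB _ _ ci cm).
  have : n1 (cintg (fun y => inner W W' y - mid y) 0 1) <= 2 * L * (ln 4)^-1 * (W' - W) ^+ 2 * (1 - 0).
    apply: n1_cintg_le => // [|y _].
      by apply: (eq_ccn (ccnD ci (ccnZ (-1) cm))) => y; rewrite mulN1r.
    rewrite /inner /mid -mulrBl -rmorphB n1_realM.
    have hd : `|intg (smooth f y) W W' - I * f (y + W / ln 4)| <= L * (ln 4)^-1 * (W' - W) * I.
      rewrite [I * _]mulrC -(intgZ _ _ _ cd) -(intgB _ _ (@cs y) (ctnZ (c := f (y + W / ln 4)) cd)) /I -(intgZ _ _ _ cd).
      apply: norm_intg => // [||w /andP[w1 w2]]; [by apply: ctnB => //; exact: ctnZ|exact: ctnZ|].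
      rewrite /smooth -mulrBl normrM (ger0_norm (dexp_ge0 _ _)) ler_wpM2r ?dexp_ge0 //.
      apply: le_trans (fL _ _) _; rewrite -mulrA ler_wpM2l // opprD addrACA subrr add0r -mulrBl.
      by rewrite ger0_norm ?mulr_ge0 ?subr_ge0 // mulrC ler_wpM2l // lerD2r.
    apply: le_trans (ler_pM (normr_ge0 _) (n1_ge0 _) hd (n1_wave y c_im)) _.
    have p0 : 0 <= 2 * L * (ln 4)^-1 * (W' - W).
      by apply: mulr_ge0 h0; apply: mulr_ge0 li; exact: mulr_ge0 (ler0n _ 2) L0.
    have := ler_wpM2l p0 I1; rewrite expr2 mulrA; apply: le_trans.
    by rewrite le_eqVlt; apply/orP; left; apply/eqP; ring.
  by rewrite subr0 mulr1.
have b2 : n1 (I%:C * cexp (z * W%:C) - cintg ker W W') <= 4 * n1 z * (W' - W) ^+ 2.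
  have cD : ccn (fun w => (dexp 1 w)%:C) by apply: ccn_real.
  rewrite -(cintg_real (dexp 1)) mulrC -(cintgZ _ _ _ cD) -(cintgB _ _ (ccnZ _ cD) ker_ccn).
  have : n1 (cintg (fun w => cexp (z * W%:C) * (dexp 1 w)%:C - ker w) W W') <= 4 * n1 z * (W' - W) * (W' - W).
    apply: n1_cintg_le => // [|w /andP[w1 w2]].
      by apply: (eq_ccn (ccnD (ccnZ _ cD) (ccnZ (-1) ker_ccn))) => y; rewrite mulN1r.
    rewrite /ker mulrC -mulrBr n1_realM (ger0_norm (dexp_ge0 _ _)) -[leRHS]mul1r.
    apply: ler_pM; rewrite ?dexp_ge0 ?n1_ge0 ?dexp1_le1 //.
    apply: le_trans (cexp_lipschitz _ _ z_im) _; rewrite ler_wpM2l ?mulr_ge0 ?n1_ge0 //.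
    by rewrite distrC ger0_norm ?subr_ge0 // lerD2r.
  by rewrite -mulrA -expr2.
have -> : cintg (inner W W') 0 1 - coeff f c * cintg ker W W' =
   (cintg (inner W W') 0 1 - cintg mid 0 1) + coeff f c * (I%:C * cexp (z * W%:C) - cintg ker W W').
  by rewrite midE; ring.
apply: le_trans (n1D _ _) _; rewrite mulrDl; apply: lerD => //.
by apply: le_trans (n1M _ _) _; rewrite -mulrA ler_wpM2l // n1_ge0.
Qed.

(* An exchange of two integrals: both sides have the same increments in b up to a quadratic error. *)
Lemma coeff_smooth a b : a <= b ->
  cintg (fun y => (intg (smooth f y) a b)%:C * wave c y) 0 1 = coeff f c * cintg ker a b.
Proof.
move=> ab; apply/eqP; rewrite -subr_eq0; apply/eqP.
pose g W := cintg (inner a W) 0 1 - coeff f c * cintg ker a W.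
have ga : g a = 0.
  rewrite /g cintg_refl mulr0 subr0 (eq_cintg (g := fun=> 0)); first by rewrite cintg_cst mul0r.
  by move=> y; rewrite /inner intg_refl mul0r.
rewrite -/(inner a b) -/(g b) -ga; apply: (quad_const ab (C := 2 * L * (ln 4)^-1 + n1 (coeff f c) * (4 * n1 z))).
move=> x y ax xy yb; have h := inner_step xy.
suff -> : g y - g x = cintg (inner x y) 0 1 - coeff f c * cintg ker x y by [].
have e1 : cintg (inner a y) 0 1 = cintg (inner a x) 0 1 + cintg (inner x y) 0 1.
  rewrite -cintgD; [|exact: inner_ccn|exact: inner_ccn].
  by apply: eq_cintg => t; rewrite /inner -mulrDl -realCD intg_chasles.
by rewrite /g e1 -(cintg_chasles ker a x y); ring.
Qed.
End Smooth.
End FourierCoefficient.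

(** * Fourier coefficients as Mellin transforms *)

Section CoefficientFormula.
Variable R : realType.
Implicit Types (c z : R[i]) (w x y s : R) (J N : nat).
Local Open Scope complex_scope.
Local Notation Re := (@complex.Re R).
Local Notation Im := (@complex.Im R).

Lemma cintg_swap (P : R -> R[i]) (a b : R) : cintg P a b = - cintg P b a.
Proof. by apply/eqP; rewrite -addr_eq0 cintg_chasles cintg_refl. Qed.

Lemma cintg_sum N (F : nat -> R -> R[i]) (a b : R) : (forall n, ccn (F n)) ->
  cintg (fun y => \sum_(n < N) F n y) a b = \sum_(n < N) cintg (F n) a b.
Proof.
move=> cF; elim: N => [|N IH].
  rewrite big_ord0 (eq_cintg (g := fun=> 0)) ?cintg_cst ?mul0r // => y.
  by rewrite big_ord0.
rewrite big_ord_recr /= -IH -(cintgD _ _ (ccn_sum N cF) (cF N)).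
by apply: eq_cintg => y; rewrite big_ord_recr.
Qed.

Lemma affine_ctn (a b : R) : continuous (fun y : R => a * y + b).
Proof.
apply: (@dv_ctn _ _ (fun=> a * 1 + 0)) => x; apply: dvD; last exact: dv_cst.
by apply: dvZ; exact: dv_id.
Qed.

Lemma cintg_unit_chain (G : R -> R[i]) (F : nat -> R -> R[i]) (a : R) N : ccn G ->
  (forall r y, F r y = G (y + (a - r%:R))) ->
  \sum_(r < N) cintg (F r) 0 1 = cintg G (a - N%:R + 1) (a + 1).
Proof.
move=> cG FG; have FE r : cintg (F r) 0 1 = cintg G (a - r%:R) (a - r%:R + 1).
  have := cintg_shift (a - r%:R) 0 1 cG; rewrite add0r [1 + _]addrC => <-.
  exact: eq_cintg (FG r).
elim: N => [|N IH]; first by rewrite big_ord0 subr0 cintg_refl.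
have e : a - N.+1%:R + 1 = a - N%:R by rewrite -(natr1 N); ring.
by rewrite e -(cintg_chasles G _ (a - N%:R + 1)) big_ord_recr /= IH FE addrC.
Qed.

Lemma lin3_realC (a b s g : R) : (a * b - s + g)%:C = a%:C * b%:C - s%:C + g%:C * 1.
Proof. by rewrite (realCD (a * b - s)) (realCD (a * b)) (realCM a) rmorphN /= mulr1. Qed.

Lemma lin4_realC (s a g t : R) (w : R[i]) :
  (s - a + g - t)%:C * w = s%:C * w - a%:C * w + g%:C * w - t%:C * w.
Proof. by rewrite (realCD (s - a + g)) (realCD (s - a)) (realCD s) !rmorphN /=; ring. Qed.

Variables (c : R[i]).
Hypotheses (c_im : Re c = 0) (c_per : cexp c = 1).

Let unit_profile y : R[i] := (profile (ln 2 * (1 - y)))%:C * wave c y.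

Let unit_profile_ccn : ccn unit_profile.
Proof.
apply: ccnM; last exact: wave_ccn; apply: ccn_real.
apply: (ctn_comp (@profile_ctn R)); apply: (eq_ctn (@affine_ctn (- ln 2) (ln 2))) => y; ring.
Qed.

Lemma wave_nat (m : nat) : wave c m%:R = 1.
Proof. by rewrite /wave realC_nat mulNr; apply: cexpN1; exact: cexp_per1. Qed.

(** The summands are integer translates of one function and [wave c] has period 1, so the unit
    integrals chain into one over [1 - J, 1 + J]; the substitution x = ln 2 (1 - y) makes the ends
    symmetric multiples of ln 2. *)
Lemma profile_sum_intg J : cintg (fun y => (\sum_(r < J + J) profile (ln 2 * (r.+1%:R - y - J%:R)))%:C * wave c y) 0 1 =
  ((ln 2)^-1)%:C * cintg (fun x => cexp (c * ((ln 2)^-1)%:C * x%:C) * (profile x)%:C) (- (ln 2 * J%:R)) (ln 2 * J%:R).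
Proof.
have l0 := ln2_gt0 R.
pose F (r : nat) y := (profile (ln 2 * (r.+1%:R - y - J%:R)))%:C * wave c y.
have cF r : ccn (F r).
  apply: ccnM; last exact: wave_ccn; apply: ccn_real; apply: (ctn_comp (@profile_ctn R)).
  apply: (eq_ctn (@affine_ctn (- ln 2) (ln 2 * (r.+1%:R - J%:R)))) => y; ring.
transitivity (\sum_(r < J + J) cintg (F r) 0 1).
  rewrite -(cintg_sum _ _ _ cF); apply: eq_cintg => y.
  by rewrite rmorph_sum /= mulr_suml.
have FE r y : F r y = unit_profile (y + (J%:R - r%:R)).
  rewrite /F /unit_profile.
  have -> : 1 - (y + (J%:R - r%:R)) = r.+1%:R - y - J%:R :> R by rewrite -(natr1 r); ring.
  congr (_ * _); rewrite !waveD wave_nat mul1r.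
  have : wave c (- r%:R) * wave c r%:R = 1 by rewrite -waveD addNr /wave mulr0 cexp0.
  by rewrite wave_nat mulr1 => ->; rewrite mulr1.
rewrite (cintg_unit_chain _ unit_profile_ccn FE).
pose d : R := - (ln 2)^-1.
have E1 : J%:R - (J + J)%:R + 1 = d * (ln 2 * J%:R) + 1 by rewrite /d natrD; field; rewrite gt_eqF.
have E2 : J%:R + 1 = d * (- (ln 2 * J%:R)) + 1 by rewrite /d; field; rewrite gt_eqF.
rewrite E1 E2 -(cintg_scale _ _ _ _ unit_profile_ccn) cintg_swap.
rewrite -cintgZ; last by apply: ccnM; [exact: ccn_cexp|apply: ccn_real; exact: profile_ctn].
rewrite -cintgN.
  apply: eq_cintg => x; rewrite /unit_profile.
  have -> : ln 2 * (1 - (d * x + 1)) = x by rewrite /d; field; rewrite gt_eqF.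
  rewrite waveD (wave_nat 1) mulr1 /wave.
  have -> : - c * (d * x)%:C = c * ((ln 2)^-1)%:C * x%:C by rewrite /d realCM rmorphN; ring.
  by rewrite /d rmorphN; ring.
apply: ccnZ; apply: (ccn_comp unit_profile_ccn); exact: affine_ctn.
Qed.

Variables (f : R -> R) (K L M : R).
Hypotheses (f1 : forall x, f (x + 1) = f x).
Hypotheses (fK : forall y, 0 <= y -> `|f y - osc y| <= K / pow4 y)
  (fL : forall x y, `|f x - f y| <= L * `|x - y|) (fM : forall x, `|f x| <= M).
Hypotheses (K0 : 0 <= K) (L0 : 0 <= L) (M0 : 0 <= M).

(** Integrate [abel_uniform] against [wave c]. By [coeff_smooth] the convolution becomes a product,
    and the transform of the density is Euler's integral at 1 + c/ln 4. *)
Lemma coeff_limit : ctends (fun J =>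
  ((ln 2)^-1)%:C * cintg (fun x => cexp (c * ((ln 2)^-1)%:C * x%:C) * (profile x)%:C) (- (ln 2 * J%:R)) (ln 2 * J%:R)
  - cintg (fun y => (y + J%:R)%:C * wave c y) 0 1 + (euler_gamma R / ln 4)%:C * cintg (wave c) 0 1)
  (coeff f c * Gint (1 + c * ((ln 4)^-1)%:C)).
Proof.
have [err herr Herr] := abel_uniform f1 fK fL fM K0 L0 M0.
set z := c * ((ln 4)^-1)%:C.
have hz : Re (1 + z) = 1 by rewrite ReD /z ReM c_im /=; ring.
have hG := impr_ctends ltr01 (Gint_impr (k := 0) hz).
have kE w : gker (1 + z) w = (dexp 1 w)%:C * cexp (z * w%:C).
  by rewrite /gker /dexp mulrDl mul1r cexpD cexp_real mul1r realCM; ring.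
have hK := ctendsZ (coeff f c) hG.
apply: (ctends_null hK); apply/(null_shift _ 1).
apply: (null_le0 (nullZ 2 ((null_shift _ 1).2 herr))) => J0.
rewrite addn1; set J := J0.+1; rewrite (ger0_norm (n1_ge0 _)).
have JJ : - J%:R <= J%:R :> R by rewrite ge0_cp // oppr_le0.
rewrite -profile_sum_intg !mul1r (eq_cintg _ _ kE) -(coeff_smooth f1 fL L0 c_im c_per JJ).
pose P y : R[i] := (\sum_(r < J + J) profile (ln 2 * (r.+1%:R - y - J%:R)))%:C * wave c y.
have cP : ccn P.
  apply: ccnM; last exact: wave_ccn; apply: ccn_real.
  have cr (r : nat) : continuous (fun y : R => profile (ln 2 * (r.+1%:R - y - J%:R))).
    apply: (ctn_comp (@profile_ctn R)).
    by apply: (eq_ctn (@affine_ctn (- ln 2) (ln 2 * (r.+1%:R - J%:R)))) => y; ring.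
  elim: (J + J)%N => [|N IH]; first by apply: (eq_ctn (@ctn_cst R 0)) => y; rewrite big_ord0.
  by apply: (eq_ctn (ctnD IH (cr N))) => y; rewrite big_ord_recr.
have cY : ccn (fun y => (y + J%:R)%:C * wave c y).
  apply: ccnM; last exact: wave_ccn; apply: ccn_real.
  by apply: (eq_ctn (@affine_ctn 1 J%:R)) => y; rewrite mul1r.
have cS : ccn (fun y => (intg (smooth f y) (- J%:R) J%:R)%:C * wave c y).
  apply: ccnM; last exact: wave_ccn; apply: ccn_real.
  by apply: (ctn_lipschitz (L := L)) => x y; exact: smooth_intg_lip.
have cW := wave_ccn c.
rewrite -(cintgB _ _ cP cY).
have cPY : ccn (fun y => P y - (y + J%:R)%:C * wave c y).
  by apply: (eq_ccn (ccnD cP (ccnZ (-1) cY))) => y; rewrite mulN1r.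
have cG := ccnZ (euler_gamma R / ln 4)%:C cW.
rewrite -(cintgZ _ _ _ cW) -(cintgD _ _ cPY cG) -(cintgB _ _ (ccnD cPY cG) cS).
set H := (X in cintg X 0 1); suff hb : n1 (cintg H 0 1) <= 2 * err J * (1 - 0) by move: hb; rewrite subr0 mulr1.
apply: n1_cintg_le => // [|y hy]; rewrite /H.
  by apply: (eq_ccn (ccnD (ccnD cPY cG) (ccnZ (-1) cS))) => y; rewrite mulN1r.
have hJ : (0 < J)%N by [].
have := ler_pM (normr_ge0 _) (n1_ge0 _) (Herr _ _ hJ hy) (n1_wave y c_im).
rewrite -n1_realM [err J * 2]mulrC; apply: le_trans.
rewrite /P; set s := \sum_(r < _) _; set t := intg _ _ _.
rewrite le_eqVlt; apply/orP; left; apply/eqP; congr n1.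
exact: esym (lin4_realC _ _ _ _ _).
Qed.

(** For every J the integral of (y + J) e^(-c y) over a period is -1/c, so the drift contributes
    1/c, exactly the term z^-1 of [profile_mellin] for z = c/ln 2. Euler's constant multiplies the
    zero mean of [wave c]. *)
Lemma coeff_mellin : c != 0 -> exists l2 l4, [/\ ctends (hasse_sum (- (c * ((ln 2)^-1)%:C))) l2,
  ctends (hasse_sum (2 - c * ((ln 2)^-1)%:C)) l4 &
  coeff f c * Gint (1 + c * ((ln 4)^-1)%:C) =
  ((ln 2)^-1)%:C * ((l2 / (c * ((ln 2)^-1)%:C) + 2 * l4 / (c * ((ln 2)^-1)%:C - 2)) * Gint (2 + c * ((ln 2)^-1)%:C))].
Proof.
move=> c0; have l0 := ln2_gt0 R; set z := c * ((ln 2)^-1)%:C.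
have lc : ((ln 2)^-1)%:C * (ln 2)%:C = 1 :> R[i].
  by rewrite -realCM mulVf ?gt_eqF // -[RHS](realC_nat R 1).
have lc0 : ((ln 2)^-1)%:C != 0 :> R[i].
  by apply/eqP => h; move: lc; rewrite h mul0r => /eqP; rewrite eq_sym oner_eq0.
have hz : Re z = 0 by rewrite /z ReM c_im /=; ring.
have z0 : z != 0 by rewrite mulf_neq0.
have zp : cexp (z * (ln 2)%:C) = 1 by rewrite /z -mulrA lc mulr1.
have [l2 [l4 [h2 h4 h]]] := profile_mellin hz z0 zp.
exists l2, l4; split=> //; apply: (ctends_uniq coeff_limit).
apply: (eq_ctends (ctendsZ ((ln 2)^-1)%:C h)) => J.
have dW x : cdv (fun y => - c^-1 * wave c y) x (wave c x).
  by apply: (cdv_eq (cdvZ (- c^-1) (cdv_cexp (- c) x))); rewrite mulrA mulrNN mulVf // mul1r.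
have w0 : wave c 0 = 1 by rewrite /wave mulr0 cexp0.
have w1 := wave_nat 1.
have -> : cintg (wave c) 0 1 = 0.
  by rewrite (cintg_FTC _ _ (wave_ccn c) dW) w0 w1 subrr.
have cY : ccn (fun y => (y + J%:R)%:C * wave c y).
  apply: ccnM; last exact: wave_ccn; apply: ccn_real.
  by apply: (eq_ctn (@affine_ctn 1 J%:R)) => y; rewrite mul1r.
have dY x : cdv (fun y => - c^-1 * ((y + J%:R)%:C * wave c y) - c^-1 * (c^-1 * wave c y)) x
    ((x + J%:R)%:C * wave c x).
  have h1 := cdv_real (dvD (dv_id x) (dv_cst J%:R x)).
  apply: (cdv_eq (cdvB (cdvZ (- c^-1) (cdvM h1 (cdv_cexp (- c) x))) (cdvZ c^-1 (cdvZ c^-1 (cdv_cexp (- c) x))))).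
  by rewrite /wave addr0 [1%:C](realC_nat R 1); field.
rewrite (cintg_FTC _ _ cY dY) w0 w1 mulr0 addr0 add0r.
have -> : z^-1 = (ln 2)%:C * c^-1.
  by rewrite /z invfM -[((ln 2)^-1)%:C^-1]mul1r -lc mulrAC mulfV // mul1r mulrC.
rewrite [RHS]mulrDr [X in _ = _ + X]mulrA lc realCD [1%:C](realC_nat R 1); ring.
Qed.
End CoefficientFormula.

(** * The mean value of the periodic limit *)

Section MeanValue.
Variable R : realType.
Variables (f : R -> R) (K L M : R).
Hypotheses (f1 : forall x, f (x + 1) = f x).
Hypotheses (fK : forall y, 0 <= y -> `|f y - osc y| <= K / pow4 y)
  (fL : forall x y, `|f x - f y| <= L * `|x - y|) (fM : forall x, `|f x| <= M).
Hypotheses (K0 : 0 <= K) (L0 : 0 <= L) (M0 : 0 <= M).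
Local Open Scope complex_scope.

(** At frequency 0 the phase is 1 and [Gint 1] is 1. The divergent J cancels between the drift, with
    mean J + 1/2, and [profile_intg] divided by ln 2; then -1/3 - 1/2 = -5/6. *)
Lemma coeff0 : intg f 0 1 = 5 / (6 * ln 2) - 5 / 6 + euler_gamma R / ln 4.
Proof.
have l0 := ln2_gt0 R.
have h := coeff_limit (c := 0) (erefl _) (cexp0 R) f1 fK fL fM K0 L0 M0.
have e : 1 + 0 * ((ln 4)^-1)%:C = 1 :> R[i] by rewrite mul0r addr0.
rewrite e Gint1 mulr1 in h.
have w y : wave 0 y = 1 :> R[i] by rewrite /wave oppr0 mul0r cexp0.
have c0 : coeff f 0 = (intg f 0 1)%:C.
  by rewrite -cintg_real; apply: eq_cintg => y; rewrite w mulr1.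
rewrite c0 in h.
suff h2 : tends (fun J : nat => (ln 2)^-1 * intg (@profile R) (- (ln 2 * J%:R)) (ln 2 * J%:R)
    - (J%:R + 1 / 2) + euler_gamma R / ln 4) (5 / (6 * ln 2) - 5 / 6 + euler_gamma R / ln 4).
  have := ctends_real h2 => h3.
  suff E : (intg f 0 1)%:C = (5 / (6 * ln 2) - 5 / 6 + euler_gamma R / ln 4)%:C by have := congr1 (@complex.Re R) E.
  apply: (ctends_uniq h); apply: (eq_ctends h3) => J.
  rewrite lin3_realC; congr (_ * _ - _ + _ * _).
  - rewrite -cintg_real; apply: eq_cintg => x.
    by rewrite mul0r mul0r cexp0 mul1r.
  - rewrite (eq_cintg (g := fun y => (y + J%:R)%:C)); last by move=> y; rewrite w mulr1.
    rewrite cintg_real; congr (_%:C).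
    have d (x : R) : dv (fun y => y * y / 2 + y * J%:R) x (x + J%:R).
      apply: (dv_eq (dvD (dvM (dvM (dv_id x) (dv_id x)) (dv_cst 2^-1 x)) (dvM (dv_id x) (dv_cst J%:R x)))).
      by field.
    have cy : continuous (fun y : R => y + J%:R).
      by apply: (eq_ctn (@affine_ctn R 1 J%:R)) => y; rewrite mul1r.
    by rewrite (intg_FTC _ _ cy d); field.
  - by rewrite (eq_cintg (g := fun=> 1)) // cintg_cst mul1r subr0 [1%:C](realC_nat R 1).
have h1 := tendsZ (ln 2)^-1 (@profile_intg R).
have := tendsD h1 (tends_cst (euler_gamma R / ln 4 - 1 / 2)).
have -> : (ln 2)^-1 * (5 / 6 - ln 2 / 3) + (euler_gamma R / ln 4 - 1 / 2) =
   5 / (6 * ln 2) - 5 / 6 + euler_gamma R / ln 4.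
  by rewrite ln4E; field; rewrite gt_eqF.
by move=> h2; apply: (eq_tends h2) => J; rewrite ln4E; field; rewrite gt_eqF.
Qed.
End MeanValue.

(** * Fourier inversion *)

Section Fejer.
Variable R : realType.
Implicit Types (x y a s : R) (k n K : nat).

Definition cosk k y : R := cos (2 * pi * k%:R * y).
Definition dirichlet n y : R := 1 + \sum_(k < n) 2 * cosk k.+1 y.
(** K times the usual Fejer kernel, so that sums rather than means of partial sums are compared. *)
Definition fejer K y : R := \sum_(n < K) dirichlet n y.

Lemma cosk_ctn k : continuous (cosk k).
Proof.
apply: (@dv_ctn _ _ (fun y => - sin (2 * pi * k%:R * y) * (2 * pi * k%:R * 1))) => y.
by apply: dv_cos; apply: dvZ; exact: dv_id.
Qed.

Lemma cosk_per k y : cosk k (y + 1) = cosk k y.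
Proof.
rewrite /cosk; elim: k => [|k IH]; first by rewrite mulr0 !mul0r.
have e (t : R) : 2 * pi * k.+1%:R * t = 2 * pi * k%:R * t + 2 * pi * t by rewrite -(natr1 k); ring.
have c2 t : cos (t + 2 * pi) = cos t :> R.
  by have -> : t + 2 * pi = t + pi + pi by [ring]; rewrite !cosDpi opprK.
have s2 t : sin (t + 2 * pi) = sin t :> R.
  by have -> : t + 2 * pi = t + pi + pi by [ring]; rewrite !sinDpi opprK.
rewrite (e (y + 1)).
have -> : 2 * pi * k%:R * (y + 1) + 2 * pi * (y + 1) = (2 * pi * k%:R * (y + 1) + 2 * pi * y) + 2 * pi by ring.
rewrite c2 cosD IH (e y) cosD; congr (_ - _ * _).
have : forall m : nat, sin (2 * pi * m%:R * (y + 1)) = sin (2 * pi * m%:R * y) :> R.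
  elim=> [|m IHm]; first by rewrite mulr0 !mul0r.
  have -> : 2 * pi * m.+1%:R * (y + 1) = 2 * pi * m.+1%:R * y + 2 * pi * m%:R + 2 * pi by rewrite -(natr1 m); ring.
  rewrite s2; elim: {IHm} m (2 * pi * m.+1%:R * y) => [|m IHm] t; first by rewrite mulr0 addr0.
  have -> : t + 2 * pi * m.+1%:R = t + 2 * pi * m%:R + 2 * pi by rewrite -(natr1 m); ring.
  by rewrite s2 IHm.
by move=> ->.
Qed.

Lemma cosk_half k y : cosk k.+1 (y + (2 * k.+1%:R)^-1) = - cosk k.+1 y.
Proof.
rewrite /cosk -cosDpi; congr cos.
by field; rewrite gt_eqF // ltr0n.
Qed.

Lemma coskN k y : cosk k (- y) = cosk k y.
Proof. by rewrite /cosk mulrN cosN. Qed.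

Lemma sin_dirichlet n y : sin (pi * y) * dirichlet n y = sin ((2 * n%:R + 1) * (pi * y)).
Proof.
elim: n => [|n IH]; first by rewrite /dirichlet big_ord0 mulr0 add0r mul1r addr0 mulr1.
rewrite /dirichlet big_ord_recr /= addrA mulrDr -/(dirichlet n y) IH /cosk.
have -> : (2 * n%:R + 1) * (pi * y) = 2 * pi * n.+1%:R * y + - (pi * y) by rewrite -(natr1 n); ring.
have -> : (2 * n.+1%:R + 1) * (pi * y) = 2 * pi * n.+1%:R * y + pi * y by ring.
by rewrite !sinD sinN cosN; ring.
Qed.

Lemma sin_fejer K y : sin (pi * y) ^+ 2 * fejer K y = sin (K%:R * (pi * y)) ^+ 2.
Proof.
elim: K => [|K IH]; first by rewrite /fejer big_ord0 !mul0r sin0 expr0n /= mulr0.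
rewrite /fejer big_ord_recr /= mulrDr -/(fejer K y) IH expr2 -mulrA sin_dirichlet.
move: (pi * y) => a.
have -> : (2 * K%:R + 1) * a = K%:R * a + (K%:R * a + a) by ring.
have -> : K.+1%:R * a = K%:R * a + a by rewrite -(natr1 K); ring.
rewrite !sinD !cosD.
have h := cos2Dsin2 a; have e : cos a ^+ 2 = 1 - sin a ^+ 2 by rewrite -h; ring.
move: (sin (K%:R * a)) (cos (K%:R * a)) (sin a) (cos a) e => p q u v e.
have -> : (p * v + q * u) ^+ 2 = p ^+ 2 * v ^+ 2 + 2 * p * q * u * v + q ^+ 2 * u ^+ 2 by ring.
by rewrite e; ring.
Qed.

Lemma sin_ge_half a : 0 <= a <= pi / 2 -> a / 2 <= sin a.
Proof.
case/andP=> a0 a1; have p0 := pi_gt0 R.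
have b0 : 0 <= a / 2 by rewrite divr_ge0.
have h y : dv (fun t => sin t - t * cos t) y (y * sin y).
  by apply: (dv_eq (dvB (dv_sin (dv_id y)) (dvM (dv_id y) (dv_cos (dv_id y))))); ring.
have p y : 0 <= y <= a / 2 -> 0 <= y * sin y.
  by case/andP=> y0 y1; rewrite mulr_ge0 // sin_ge0_pi //; apply/andP; split; lra.
have := dv_ge0_le b0 (fun y _ => h y) p; rewrite sin0 mul0r subrr => hs.
have hc : 0 <= cos a by apply: cos_ge0_pihalf; apply/andP; split; lra.
have hh : 0 <= cos (a / 2) by apply: cos_ge0_pihalf; apply/andP; split; lra.
have E : a = a / 2 + a / 2 by field.
have Es : sin a = 2 * (sin (a / 2) * cos (a / 2)) by rewrite {1}E sinD; ring.
have Ec : cos a = 2 * (cos (a / 2) * cos (a / 2)) - 1.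
  by rewrite {1}E cosD; have := cos2Dsin2 (a / 2); move: (cos _) (sin _) => u v; lra.
have h2 : a / 2 * cos (a / 2) * cos (a / 2) <= sin (a / 2) * cos (a / 2).
  by apply: ler_wpM2r => //; lra.
have h3 : a / 2 * (1 / 2) <= a / 2 * (cos (a / 2) * cos (a / 2)) by apply: ler_wpM2l => //; lra.
rewrite Es; lra.
Qed.

(** By [sin_fejer] the kernel times sin^2(pi y) is a squared sine, and sin(pi t) >= t on [0, 1/2]
    follows from [sin_ge_half] and pi >= 2. *)
Lemma fejer_bound K y : - (1 / 2) <= y <= 1 / 2 -> 0 <= y ^+ 2 * fejer K y <= 1.
Proof.
have p2 := pi_ge2 R => hy.
have [->|y0] := eqVneq y 0; first by rewrite expr0n /= mul0r lexx ler01.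
have key (t : R) : 0 < t <= 1 / 2 -> t <= sin (pi * t).
  case/andP=> t0 t1; have := @sin_ge_half (pi * t).
  have -> : 0 <= pi * t <= pi / 2 by apply/andP; split; nra.
  by move=> /(_ isT); nra.
have sy : y ^+ 2 <= sin (pi * y) ^+ 2.
  rewrite -(real_normK (num_real y)) -(real_normK (num_real (sin _))) lerXn2r ?nnegrE //.
  apply: le_trans (key `|y| _) _; first by rewrite normr_gt0 y0 ler_norml.
  by case: (ger0P y) => _; rewrite ?mulrN ?sinN ?ler_norm // -normrN ler_norm.
have q0 : 0 < y ^+ 2 by rewrite exprn_even_gt0.
have s0 : 0 < sin (pi * y) ^+ 2 by exact: lt_le_trans sy.
have F0 : 0 <= fejer K y by rewrite -(pmulr_rge0 _ s0) sin_fejer sqr_ge0.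
rewrite mulr_ge0 ?(ltW q0) //=; apply: le_trans (ler_wpM2r F0 sy) _.
rewrite sin_fejer; have := cos2Dsin2 (K%:R * (pi * y)); have := sqr_ge0 (cos (K%:R * (pi * y))); lra.
Qed.

Lemma dirichlet_ctn n : continuous (dirichlet n).
Proof.
apply: ctnD; first exact: ctn_cst.
elim: n => [|n IH]; first by apply: (eq_ctn (@ctn_cst R 0)) => y; rewrite big_ord0.
apply: (eq_ctn (ctnD IH (ctnZ (c := 2) (@cosk_ctn n.+1)))) => y; by rewrite big_ord_recr.
Qed.

Lemma fejer_ctn K : continuous (fejer K).
Proof.
elim: K => [|K IH]; first by apply: (eq_ctn (@ctn_cst R 0)) => y; rewrite /fejer big_ord0.
by apply: (eq_ctn (ctnD IH (@dirichlet_ctn K))) => y; rewrite /fejer big_ord_recr.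
Qed.

Lemma fejer_per K y : fejer K (y + 1) = fejer K y.
Proof.
apply: eq_bigr => n _; congr (_ + _); apply: eq_bigr => k _; by rewrite cosk_per.
Qed.

Lemma fejerN K y : fejer K (- y) = fejer K y.
Proof.
apply: eq_bigr => n _; congr (_ + _); apply: eq_bigr => k _; by rewrite coskN.
Qed.

Lemma ctn_shift (P : R -> R) s : continuous P -> continuous (fun y => P (y + s)).
Proof.
move=> cP; apply: ctn_comp => //.
by apply: (@dv_ctn _ _ (fun=> 1 + 0)) => x; apply: dvD; [exact: dv_id|exact: dv_cst].
Qed.

Lemma periodic_intg (P : R -> R) s : continuous P -> (forall y, P (y + 1) = P y) ->
  intg (fun y => P (y + s)) 0 1 = intg P 0 1.
Proof.
move=> cP P1; rewrite intg_shift // add0r.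
have h : intg P 0 s = intg P 1 (1 + s).
  by rewrite -{1}(eq_intg 0 s P1) intg_shift // add0r [s + 1]addrC.
rewrite -(intg_chasles P s 0 (1 + s)) -(intg_chasles P 0 1 (1 + s)) -h.
have := intg_chasles P s 0 s; rewrite intg_refl => e.
by rewrite addrCA e addr0.
Qed.

Lemma symmetric_intg (P : R -> R) : continuous P -> (forall y, P (y + 1) = P y) ->
  2 * intg P 0 1 = intg (fun y => P y + P (- y)) (- (1 / 2)) (1 / 2).
Proof.
move=> cP P1.
have cN : continuous (fun y => P (- y)).
  apply: ctn_comp => //; apply: (@dv_ctn _ _ (fun=> -1)) => x; apply: dvN; exact: dv_id.
rewrite intgD //.
have e1 : intg P 0 1 = intg P (- (1 / 2)) (1 / 2).
  rewrite -(periodic_intg (- (1 / 2)) cP P1) intg_shift // add0r; congr intg; by field.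
have e2 : intg (fun y => P (- y)) (- (1 / 2)) (1 / 2) = intg P (- (1 / 2)) (1 / 2).
  have := intg_scale (-1) 0 (- (1 / 2)) (1 / 2) cP.
  have -> : -1 * - (1 / 2) + 0 = 1 / 2 :> R by ring.
  have -> : -1 * (1 / 2) + 0 = - (1 / 2) :> R by ring.
  have h := intg_chasles P (1 / 2) (- (1 / 2)) (1 / 2); rewrite intg_refl in h.
  rewrite (eq_intg (g := fun y => - P (- y))) ?intgN // => [e|y]; first lra.
  by rewrite mulN1r mulN1r addr0.
by rewrite e2 -e1; ring.
Qed.

Lemma intg_cosk k : intg (cosk k.+1) 0 1 = 0.
Proof.
have h := periodic_intg ((2 * k.+1%:R)^-1) (@cosk_ctn k.+1) (cosk_per k.+1).
have e : intg (fun y => cosk k.+1 (y + (2 * k.+1%:R)^-1)) 0 1 = - intg (cosk k.+1) 0 1.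
  by rewrite -(intgN _ _ (@cosk_ctn k.+1)); apply: eq_intg => y; rewrite cosk_half.
rewrite e in h; lra.
Qed.

Section Series.
Variables (F : R -> R) (S : R).
Hypotheses (cF : continuous F) (F1 : forall x, F (x + 1) = F x) (S0 : 0 <= S)
  (F2 : forall x h, `|F (x + h) - 2 * F x + F (x - h)| <= S * h ^+ 2).

Definition fourier k x : R := 2 * intg (fun y => F (y + x) * cosk k y) 0 1.
Definition fourier_sum K x : R := intg F 0 1 + \sum_(k < K) fourier k.+1 x.

Let cFx x : continuous (fun y => F (y + x)). Proof. exact: ctn_shift. Qed.

(* Shifting by half a period changes the sign of cosk, so second differences of F control the
   coefficient. *)
Lemma fourier_bound k x : `|fourier k.+1 x| <= S / (8 * k.+1%:R ^+ 2).
Proof.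
set h : R := (2 * k.+1%:R)^-1.
pose G s y := F (y + (x + s)) * cosk k.+1 y.
have cG s : continuous (G s) by apply: ctnM; [exact: cFx|exact: cosk_ctn].
have per s y : G s (y + 1) = G s y by rewrite /G cosk_per addrAC F1.
have e1 : intg (G h) 0 1 = - intg (G 0) 0 1.
  rewrite -(periodic_intg h (@cG 0) (per 0)) -(intgN _ _ (@ctn_shift _ h (@cG 0))).
  apply: eq_intg => y; rewrite /G cosk_half mulrN opprK.
  by congr (F _ * _); ring.
have e2 : intg (G (- h)) 0 1 = - intg (G 0) 0 1.
  rewrite -(periodic_intg h (@cG (- h)) (per (- h))) -(intgN _ _ (@cG 0)).
  apply: eq_intg => y; rewrite /G cosk_half mulrN.
  by congr (- (F _ * _)); ring.
have E : intg (fun y => G h y - 2 * G 0 y + G (- h) y) 0 1 = - 4 * intg (G 0) 0 1.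
  have c2 := ctnZ (c := 2) (@cG 0).
  rewrite (intgD _ _ (ctnB (@cG h) c2) (@cG (- h))) (intgB _ _ (@cG h) c2) (intgZ _ _ _ (@cG 0)) e1 e2; ring.
have B : `|intg (fun y => G h y - 2 * G 0 y + G (- h) y) 0 1| <= S * h ^+ 2 * (1 - 0).
  rewrite -intg_cst; apply: norm_intg => // [||y _].
  - by apply: ctnD; [apply: ctnB; [|apply: ctnZ]|]; exact: cG.
  - exact: ctn_cst.
  rewrite /G addr0.
  have -> : F (y + (x + h)) * cosk k.+1 y - 2 * (F (y + x) * cosk k.+1 y) + F (y + (x - h)) * cosk k.+1 y =
    (F (y + x + h) - 2 * F (y + x) + F (y + x - h)) * cosk k.+1 y by rewrite !addrA; ring.
  rewrite normrM -[leRHS]mulr1; apply: ler_pM => //.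
  by rewrite ler_norml cos_geN1 cos_le1.
rewrite E subr0 mulr1 normrM normrN normr_nat in B.
have -> : fourier k.+1 x = 2 * intg (G 0) 0 1 by congr (_ * _); apply: eq_intg => y; rewrite /G addr0.
rewrite normrM normr_nat; have -> : S / (8 * k.+1%:R ^+ 2) = S * h ^+ 2 / 2.
  by rewrite /h; field; rewrite gt_eqF // ltr0n.
move: B; move: (`|intg _ _ _|) (S * h ^+ 2) => p q B; lra.
Qed.

Lemma intg_fejer (P : R -> R) K : continuous P ->
  intg (fun y => P y * fejer K y) 0 1 = \sum_(n < K) (intg P 0 1 + \sum_(k < n) 2 * intg (fun y => P y * cosk k.+1 y) 0 1).
Proof.
move=> cP.
have hD n : intg (fun y => P y * dirichlet n y) 0 1 = intg P 0 1 + \sum_(k < n) 2 * intg (fun y => P y * cosk k.+1 y) 0 1.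
  elim: n => [|n IH].
    by rewrite big_ord0 addr0; apply: eq_intg => y; rewrite /dirichlet big_ord0 addr0 mulr1.
  rewrite big_ord_recr addrA -IH /=.
  have c1 : continuous (fun y => P y * dirichlet n y) by apply: ctnM => //; exact: dirichlet_ctn.
  have c2 : continuous (fun y => P y * cosk n.+1 y) by apply: ctnM => //; exact: cosk_ctn.
  rewrite -(intgZ _ _ _ c2) -(intgD _ _ c1 (ctnZ (c := 2) c2)).
  by apply: eq_intg => y; rewrite /dirichlet big_ord_recr /=; ring.
elim: K => [|K IH].
  by rewrite big_ord0 (eq_intg (g := fun=> 0)) ?intg_cst ?mul0r // => y; rewrite /fejer big_ord0 mulr0.
rewrite big_ord_recr -IH -hD /=.
have c1 : continuous (fun y => P y * fejer K y) by apply: ctnM => //; exact: fejer_ctn.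
have c2 : continuous (fun y => P y * dirichlet K y) by apply: ctnM => //; exact: dirichlet_ctn.
rewrite -(intgD _ _ c1 c2).
by apply: eq_intg => y; rewrite /fejer big_ord_recr mulrDr.
Qed.

(** The kernel is even, so only second differences of F enter; their bound S y^2 compensates the
    y^-2 of the kernel, and the total error stays bounded in K. *)
Lemma fejer_mean K x : `|\sum_(n < K) fourier_sum n x - K%:R * F x| <= S / 2.
Proof.
have e1 : \sum_(n < K) fourier_sum n x = intg (fun y => F (y + x) * fejer K y) 0 1.
  by rewrite intg_fejer //; apply: eq_bigr => n _; rewrite (periodic_intg x cF F1).
have e2 : K%:R * F x = intg (fun y => F x * fejer K y) 0 1.
  rewrite (intgZ _ _ _ (@fejer_ctn K)) mulrC; congr (_ * _).
  have := @intg_fejer (fun=> 1) K (@ctn_cst R 1).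
  rewrite (eq_intg (g := fejer K)) => [->|y]; last by rewrite mul1r.
  rewrite (eq_bigr (fun=> 1)) ?sumr_const ?card_ord // => n _.
  rewrite intg_cst big1 ?addr0 => [|k _]; first by ring.
  by rewrite (eq_intg (g := cosk k.+1)) ?intg_cosk ?mulr0 // => y; rewrite mul1r.
have c1 : continuous (fun y => F (y + x) * fejer K y) by apply: ctnM; [exact: cFx|exact: fejer_ctn].
have c2 : continuous (fun y => F x * fejer K y) by apply: ctnZ; exact: fejer_ctn.
rewrite e1 e2 -(intgB _ _ c1 c2).
have cP : continuous (fun y => F (y + x) * fejer K y - F x * fejer K y) by exact: ctnB.
have := symmetric_intg cP _ => H.
have {}H := H (fun y => _); move: H.
set P := (fun y : R => _ - _).
move=> H; have {}H : 2 * intg P 0 1 = intg (fun y => P y + P (- y)) (- (1 / 2)) (1 / 2).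
  by apply: H => y; rewrite /P fejer_per addrAC F1.
have h12 : - (1 / 2) <= 1 / 2 :> R by lra.
have B : `|intg (fun y => P y + P (- y)) (- (1 / 2)) (1 / 2)| <= S * (1 / 2 - - (1 / 2)).
  rewrite -intg_cst; apply: norm_intg => // [||y hy].
  - apply: ctnD => //; apply: ctn_comp => //; apply: (@dv_ctn _ _ (fun=> -1)) => t; apply: dvN; exact: dv_id.
  - exact: ctn_cst.
  have /andP[b0 b1] := fejer_bound K hy.
  have -> : P y + P (- y) = (F (x + y) - 2 * F x + F (x - y)) * fejer K y.
    by rewrite /P fejerN [y + x]addrC [- y + x]addrC; ring.
  have [y0|y0] := eqVneq y 0.
    have -> : F (x + y) - 2 * F x + F (x - y) = 0 by rewrite y0 subr0 addr0; ring.
    by rewrite mul0r normr0.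
  have q0 : 0 < y ^+ 2 by rewrite exprn_even_gt0.
  have f0 : 0 <= fejer K y by rewrite -(pmulr_rge0 _ q0).
  rewrite normrM (ger0_norm f0); apply: le_trans (ler_wpM2r f0 (F2 x y)) _.
  by rewrite -mulrA -[leRHS]mulr1 ler_wpM2l.
move: B; rewrite -H normrM normr_nat; move: (`|intg P 0 1|) => p B; lra.
Qed.

Lemma fourier_cesaro K x : K%:R * fourier_sum K x - \sum_(n < K) fourier_sum n x =
  \sum_(k < K) k.+1%:R * fourier k.+1 x.
Proof.
elim: K => [|K IH]; first by rewrite !big_ord0; ring.
rewrite !big_ord_recr /= -IH /fourier_sum big_ord_recr /= -(natr1 K); ring.
Qed.

Lemma harm_sqrt K : \sum_(k < K) (k.+1%:R : R)^-1 <= 2 * Num.sqrt K%:R.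
Proof.
elim: K => [|K IH]; first by rewrite big_ord0 mulr_ge0 // sqrtr_ge0.
rewrite big_ord_recr /=; apply: le_trans (lerD IH (lexx _)) _.
have t0 : 0 < Num.sqrt (K.+1%:R : R) by rewrite sqrtr_gt0 ltr0n.
have s0 := sqrtr_ge0 (K%:R : R).
have sE : Num.sqrt (K%:R : R) ^+ 2 = K%:R by rewrite sqr_sqrtr.
have tE : Num.sqrt (K.+1%:R : R) ^+ 2 = K.+1%:R by rewrite sqr_sqrtr.
have tE' : Num.sqrt (K.+1%:R : R) ^+ 2 = Num.sqrt (K%:R : R) ^+ 2 + 1 by rewrite tE sE -(natr1 K).
have -> : (K.+1%:R : R)^-1 = (Num.sqrt (K.+1%:R : R) ^+ 2)^-1 by rewrite tE.
move: (Num.sqrt _) (Num.sqrt _) s0 t0 tE' => t s s0 t0 e.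
have t1 : 1 <= t by rewrite -(@ler_pXn2r _ 2) ?nnegrE ?(ltW t0) // e expr1n lerDr sqr_ge0.
have ts : s <= t by rewrite -(@ler_pXn2r _ 2) ?nnegrE ?(ltW t0) // e lerDl.
rewrite -lerBrDl -div1r ler_pdivrMr ?exprn_gt0 //.
have h1 : (t - s) * (t + s) = 1 by rewrite -subr_sqr e; ring.
have d0 : 0 <= t - s by rewrite subr_ge0.
have h2 : (t - s) * (t + s) <= (t - s) * (2 * t) by rewrite ler_wpM2l //; lra.
rewrite h1 in h2; have h3 := ler_pM ler01 ler01 h2 t1; rewrite mul1r in h3.
apply: le_trans h3 _; rewrite le_eqVlt; apply/orP; left; apply/eqP; ring.
Qed.

(** A Tauberian step: by [fourier_cesaro], K times a partial sum differs from the sum of the first K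
    partial sums by \sum k c_k. With c_k = O(k^-2) this is O(\sum 1/k), and the crude bound of
    [harm_sqrt] already gives o(K). *)
Lemma fourier_inversion x : tends (fun K => fourier_sum K x) (F x).
Proof.
apply/(tends_shift _ _ 1).
apply: (null_le0 (null_inv_sqrt (S * (1 / 4 + 1 / 2)))) => K; rewrite addn1.
have N0 : 0 < K.+1%:R :> R by rewrite ltr0n.
have s0 : 0 < Num.sqrt (K.+1%:R : R) by rewrite sqrtr_gt0 ltr0n.
have s1 : 1 <= Num.sqrt (K.+1%:R : R) by rewrite -[leLHS]sqrtr1 ler_wsqrtr // ler1n.
have sE : Num.sqrt (K.+1%:R : R) ^+ 2 = K.+1%:R by rewrite sqr_sqrtr.
have h1 := fejer_mean K.+1 x.
have h2 : `|\sum_(k < K.+1) k.+1%:R * fourier k.+1 x| <= S / 8 * (2 * Num.sqrt (K.+1%:R : R)).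
  apply: le_trans (ler_norm_sum _ _ _) _.
  have p8 : 0 <= S / 8 by apply: divr_ge0 S0 (ler0n _ 8).
  apply: le_trans (ler_wpM2l p8 (harm_sqrt K.+1)); rewrite mulr_sumr; apply: ler_sum => k _.
  rewrite normrM normr_nat; apply: le_trans (ler_wpM2l (ler0n _ _) (fourier_bound k x)) _.
  by rewrite le_eqVlt; apply/orP; left; apply/eqP; field; rewrite gt_eqF // ltr0n.
have E : K.+1%:R * (fourier_sum K.+1 x - F x) = \sum_(k < K.+1) k.+1%:R * fourier k.+1 x +
    (\sum_(n < K.+1) fourier_sum n x - K.+1%:R * F x).
  by rewrite -fourier_cesaro; ring.
have h3 : K.+1%:R * `|fourier_sum K.+1 x - F x| <= S / 8 * (2 * Num.sqrt (K.+1%:R : R)) + S / 2.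
  have -> : K.+1%:R * `|fourier_sum K.+1 x - F x| = `|K.+1%:R * (fourier_sum K.+1 x - F x)|.
    by rewrite normrM normr_nat.
  by rewrite E; apply: le_trans (ler_normD _ _) (lerD h2 h1).
have h4 : K.+1%:R * (S * (1 / 4 + 1 / 2) / Num.sqrt K.+1%:R) = S * (1 / 4 + 1 / 2) * Num.sqrt (K.+1%:R : R).
  by rewrite -{1}sE; field; rewrite gt_eqF.
have h5 : K.+1%:R * `|fourier_sum K.+1 x - F x| <= K.+1%:R * (S * (1 / 4 + 1 / 2) / Num.sqrt K.+1%:R).
  by rewrite h4; apply: le_trans h3 _; have := ler_wpM2l S0 s1; lra.
by move: h5; rewrite ler_pM2l.
Qed.
End Series.
End Fejer.

(** * The asymptotic expansion *)

Section FourierSeries.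
Variable R : realType.
Local Open Scope complex_scope.
Local Notation Re := (@complex.Re R).
Local Notation Im := (@complex.Im R).

Definition freq (k : int) : R[i] := 0 +i* (2 * pi * k%:~R).

Lemma freq_chi k : freq k * ((ln 2)^-1)%:C = chi R k.
Proof. by apply: complexP; rewrite ?ReM ?ImM /=; ring. Qed.

Lemma freq_chi2 k : freq k * ((ln 4)^-1)%:C = chi R k / 2.
Proof.
have l0 := ln2_gt0 R.
have -> : (2 : R[i])^-1 = (2^-1 : R)%:C by rewrite rmorphV ?unitfE ?pnatr_eq0 //= realC_nat.
rewrite ln4E; apply: complexP; rewrite !(ReM, ImM) /= ?mul0r ?mulr0 //.
by field; rewrite gt_eqF.
Qed.

Lemma cexp_freq k : cexp (freq k) = 1.
Proof.
have e1 : cexp (freq 1) = 1.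
  rewrite /cexp /freq /= expR0 mulr1 [2 * pi]mulrC mulr_natr cos2pi sin2pi mul1r.
  by [].
have e n : cexp (freq n%:Z) = 1.
  have -> : freq n%:Z = freq 1 * n%:R.
    by rewrite -(realC_nat R n); apply: complexP; rewrite !(ReM, ImM) /=; ring.
  exact: cexp_per1.
case: (intP k) => [|n|n]; rewrite ?e //.
have -> : freq (- n.+1%:Z) = - freq n.+1 by apply: complexP; rewrite ?ReN ?ImN /= ?oppr0 // rmorphN /= mulrN.
exact: cexpN1.
Qed.

Lemma freq_neq0 k : k != 0 -> freq k != 0.
Proof.
move=> k0; apply/eqP => /(congr1 Im) /= /eqP; apply/negP.
by rewrite mulf_neq0 ?intr_eq0 // mulf_neq0 ?gt_eqF ?pi_gt0.
Qed.

Lemma wave_pair (k : nat) (y : R) : wave (freq k%:Z) y + wave (freq (- k%:Z)) y = (2 * cosk k y)%:C.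
Proof.
rewrite /wave /cexp /cosk; apply: complexP; rewrite !(ReD, ImD, ReM, ImM, ReN, ImN) /=.
  have -> : - 0 * y - - (2 * pi * k%:R) * 0 = 0 by ring.
  have -> : - 0 * y - - (2 * pi * (- k%:Z)%:~R) * 0 = 0 by ring.
  have -> : - 0 * 0 + - (2 * pi * k%:R) * y = - (2 * pi * k%:R * y) by ring.
  have -> : - 0 * 0 + - (2 * pi * (- k%:Z)%:~R) * y = 2 * pi * k%:R * y by rewrite rmorphN /=; ring.
  by rewrite expR0 cosN; ring.
have -> : - 0 * y - - (2 * pi * k%:R) * 0 = 0 by ring.
have -> : - 0 * y - - (2 * pi * (- k%:Z)%:~R) * 0 = 0 by ring.
have -> : - 0 * 0 + - (2 * pi * k%:R) * y = - (2 * pi * k%:R * y) by ring.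
have -> : - 0 * 0 + - (2 * pi * (- k%:Z)%:~R) * y = 2 * pi * k%:R * y by rewrite rmorphN /=; ring.
by rewrite expR0 sinN; ring.
Qed.

Lemma zetaE (s : R[i]) l : ctends (hasse_sum (1 - s)) l -> zeta s = l / (s - 1).
Proof. by move=> h; rewrite /zeta (climnE h) mulrC. Qed.

Variables (f : R -> R) (K L M S : R).
Hypotheses (f1 : forall x, f (x + 1) = f x).
Hypotheses (fK : forall y, 0 <= y -> `|f y - osc y| <= K / pow4 y)
  (fL : forall x y, `|f x - f y| <= L * `|x - y|) (fM : forall x, `|f x| <= M)
  (fS : forall x h, `|f (x + h) - 2 * f x + f (x - h)| <= S * h ^+ 2).
Hypotheses (K0 : 0 <= K) (L0 : 0 <= L) (M0 : 0 <= M) (S0 : 0 <= S).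

Let cf : continuous f. Proof. exact: ctn_lipschitz fL. Qed.

(** Since 2^chi = 1, duplication at w = 1 + chi/2 reads Gamma((3 + chi)/2) Gamma(1 + chi/2) =
    (sqrt(pi)/2) Gamma(2 + chi). It turns the quotient Gamma(2 + chi)/Gamma(1 + chi/2) of
    [coeff_mellin] into the single Gamma factor of delta; the 1/3 undoes the normalisation of
    [alpha]. *)
Lemma delta_termE k (x : R) : k != 0 -> delta_term k x = (1 / 3)%:C * (cexp (freq k * x%:C) * coeff f (freq k)).
Proof.
move=> k0; have l0 := ln2_gt0 R; have p0 := pi_gt0 R.
have [l2 [l4 [h2 h4 H]]] := coeff_mellin (c := freq k) (erefl _) (cexp_freq k) f1 fK fL fM K0 L0 M0 (freq_neq0 k0).
rewrite freq_chi in h2 h4 H; rewrite freq_chi2 in H.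
set X := chi R k in h2 h4 H *.
have Xw : Re (1 + X / 2) = 1.
  have -> : X / 2 = freq k * ((ln 4)^-1)%:C by rewrite freq_chi2.
  by rewrite ReD ReM /=; ring.
have [G hG GE] := gauss_prod_duplication Xw.
have [_ G0] := gauss_prod_tends (k := 0) Xw isT.
have E3 : 1 + X / 2 + 1 / 2 = (3 + X) / 2 by field.
have E2 : 2 * (1 + X / 2) = 2 + X by field.
rewrite E3 in hG; rewrite E2 in GE.
have Xl : cexp (X * (ln 2)%:C) = 1.
  have -> : X * (ln 2)%:C = freq k.
    by rewrite /X -freq_chi -mulrA -realCM mulVf ?gt_eqF // mulr1.
  exact: cexp_freq.
have q4 : cexp (- ((2 + X) * (ln 2)%:C)) = 1 / 4.
  have -> : - ((2 + X) * (ln 2)%:C) = (- (2 * ln 2))%:C + - (X * (ln 2)%:C).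
    by rewrite mulrDl opprD -(realC_nat R 2) -realCM -rmorphN.
  rewrite cexpD (cexpN1 Xl) mulr1 cexp_real expRN expRM_natl lnK ?posrE // rmorphV ?unitfE ?expf_neq0 //=.
  by rewrite rmorphXn /= (realC_nat R 2) div1r; congr (_^-1); ring.
rewrite q4 in GE.
have gE : Gamma ((3 + X) / 2) = G by exact: climnE hG.
have z1 : zeta (X + 1) = l2 / X.
  rewrite (@zetaE _ l2); first by rewrite addrK.
  by have -> : 1 - (X + 1) = - X by ring.
have z2 : zeta (X - 1) = l4 / (X - 2).
  rewrite (@zetaE _ l4); first by congr (_ / _); ring.
  by have -> : 1 - (X - 1) = 2 - X by ring.
rewrite /delta_term -/X gE z1 z2.
have -> : cexp (0 +i* (2 * k%:~R * pi * x)) = cexp (freq k * x%:C).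
  by congr cexp; apply: complexP; rewrite !(ReM, ImM) /=; ring.
have s0 : 0 < Num.sqrt (pi : R) by rewrite sqrtr_gt0.
have -> : (2 / (3 * Num.sqrt pi * ln 2))%:C = (1 / 3)%:C * ((ln 2)^-1)%:C * (2%:C * ((Num.sqrt pi)^-1)%:C) :> R[i].
  by rewrite -!realCM; congr (_%:C); field; rewrite !gt_eqF.
have si : (Num.sqrt pi)%:C * ((Num.sqrt pi)^-1)%:C = 1 :> R[i].
  by rewrite -realCM mulfV ?gt_eqF // -[RHS](realC_nat R 1).
rewrite -[X in X * _ = _]mulrA -[LHS]mulrA.
rewrite (realC_nat R 2); rewrite -[2 * l4 / _]mulrA in H.
move: (cexp _) (coeff f _) ((1/3)%:C) ((ln 2)^-1)%:C ((Num.sqrt pi)%:C) (((Num.sqrt pi)^-1)%:C) (l2 / X) (l4 / (X - 2)) (Gint _) (Gint _) G0 GE H si.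
move=> e a t u s si z1' z4' g2 g g0 GE H ss.
apply: (mulIf g0).
transitivity (t * u * (2 * si) * (2 * z4' + z1') * e * (G * g)); first by ring.
rewrite GE; transitivity (t * u * (2 * z4' + z1') * e * g2 * (s * si)); first by field.
rewrite ss; transitivity (t * e * (a * g)); last by ring.
by rewrite H; ring.
Qed.

Lemma fourier_pair (k : nat) (x : R) :
  cexp (freq k%:Z * x%:C) * coeff f (freq k%:Z) + cexp (freq (- k%:Z) * x%:C) * coeff f (freq (- k%:Z)) =
  (fourier f k x)%:C.
Proof.
rewrite -!(coeff_shift x cf f1 (cexp_freq _)).
have cfx : continuous (fun y => f (y + x)) by exact: ctn_shift.
have cw c : ccn (fun y => (f (y + x))%:C * wave c y) by apply: ccnM; [exact: ccn_real|exact: wave_ccn].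
rewrite -cintgD // /fourier.
have cc : continuous (fun y => f (y + x) * cosk k y) by apply: ctnM => //; exact: cosk_ctn.
rewrite -(intgZ _ _ _ cc) -cintg_real; apply: eq_cintg => y.
by rewrite -mulrDr wave_pair -realCM; congr (_%:C); ring.
Qed.

Lemma deltaE (x : R) : delta x = ((f x - intg f 0 1) / 3)%:C.
Proof.
have h := fourier_inversion cf f1 S0 fS x.
apply: climnE; apply: (eq_ctends (u := fun N => ((fourier_sum f N x - intg f 0 1) / 3)%:C)).
  apply: ctends_real; have := tendsZ 3^-1 (tendsB h (tends_cst (intg f 0 1))).
  by rewrite mulrC => h3; apply: (eq_tends h3) => N; rewrite mulrC.
move=> N; rewrite big_add1 big_mkord /= /fourier_sum addrC addKr.
rewrite mulr_suml rmorph_sum /=; apply: eq_bigr => k _.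
rewrite !delta_termE // -mulrDr fourier_pair -realCM; congr (_%:C); by field.
Qed.
End FourierSeries.

Lemma EL_alpha (R : realType) n : EL R n = (4 / 3) * n%:R + (alpha R n - 1) / 3.
Proof. by rewrite /alpha; field. Qed.

Local Open Scope complex_scope.

Theorem theorem5 (R : realType) :
  exists (C : R) (N : nat), forall n : nat, (N <= n)%N ->
    `| (EL R n)%:C
       - ((4 / 3) * n%:R + (1 / 3) * log4 (n%:R : R)
          + (5 + 3 * euler_gamma R - 11 * ln (2 : R)) / (18 * ln (2 : R)))%:C
       - delta (log4 (n%:R : R)) |
    <= (C * ln (n%:R : R) / n%:R)%:C.
Proof.
have [f [f1 [K K0 fK]]] := periodic_limit R.
have [L L0 fL] := period_lipschitz f1 K0 fK.
have [M M0 fM] := period_bdd f1 K0 fK.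
have [S S0 fS] := period_second f1 K0 fK.
have l2 := ln2_gt0 R.
(* The error is in fact at most K/(3 n); since ln 2 <= ln n for n >= 2, dividing the constant by ln
   2 gives the stated form. *)
exists (K / (3 * ln 2)), 2%N => n n2.
have n0 : (0 < n)%N by exact: leq_trans n2.
have nR : 0 < n%:R :> R by rewrite ltr0n.
rewrite (deltaE f1 fK fL fM fS K0 L0 M0 S0) (coeff0 f1 fK fL fM K0 L0 M0) -!rmorphB /=.
apply: le_trans (norm_le_n1 _) _; rewrite n1_real lecR.
have y0 : 0 <= log4 (n%:R : R) by rewrite divr_ge0 ?(ltW (ln4_gt0 R)) // ln_ge0 // ler1n.
have := fK _ y0; rewrite pow4_log4 // /osc floor4_log4 // => h.
have E : EL R n - (4 / 3 * n%:R + 1 / 3 * log4 n%:R + (5 + 3 * euler_gamma R - 11 * ln 2) / (18 * ln 2))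
   - (f (log4 n%:R) - (5 / (6 * ln 2) - 5 / 6 + euler_gamma R / ln 4)) / 3 =
   - ((f (log4 n%:R) - (alpha R n - log4 n%:R)) / 3).
  by rewrite EL_alpha ln4E; field; rewrite gt_eqF.
rewrite E normrN normrM (ger0_norm (_ : 0 <= 3^-1)) ?invr_ge0 //.
have ln2n : ln 2 <= ln (n%:R : R) by rewrite ler_ln ?posrE // (ler_nat R 2 n).
apply: le_trans (ler_wpM2r (_ : 0 <= 3^-1) h) _; first by rewrite invr_ge0.
have -> : K / n%:R / 3 = K / (3 * ln 2) * ln 2 / n%:R by field; rewrite !gt_eqF.
rewrite ler_pM2r ?invr_gt0 // ler_wpM2l //.
by rewrite divr_ge0 // mulr_ge0 // ltW.
Qed.
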